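(* (i) Suppose there exists a $\mathbb{Q}$-algebra isomorphism $\varphi:\mathcal{Z}_{\mathcal{A}}\to\overline{\mathcal{Z}}$ with $\varphi(\zeta_{\mathcal{A}}({\boldsymbol{k}}))=\zeta_{\mathcal{S}}({\boldsymbol{k}})$ for every positive index ${\boldsymbol{k}}$. Then for every index ${\boldsymbol{k}}\in\mathbb{Z}^r$ ($r\ge0$, entries arbitrary integers), $\zeta_{\mathcal{A}}({\boldsymbol{k}})\in\mathcal{Z}_{\mathcal{A}}$ and $\varphi(\zeta_{\mathcal{A}}({\boldsymbol{k}}))=\zeta_{\mathcal{S}}({\boldsymbol{k}})$. In particular, $\mathcal{A}$-MZVs and $\mathcal{S}$-MZVs of general indices satisfy the same $\mathbb{Q}$-linear relations. (ii) Suppose there exists a topological $\mathbb{Q}$-algebra isomorphism $\psi:\mathcal{Z}_{\widehat{\mathcal{A}}}\to\overline{\mathcal{Z}}[[t]]$ with $\psi({\boldsymbol{p}})=t$ and $\psi(\zeta_{\widehat{\mathcal{A}}}({\boldsymbol{k}}))=\zeta_{\widehat{\mathcal{S}}}({\boldsymbol{k}})$ for every positive index ${\boldsymbol{k}}$. Then for every index ${\boldsymbol{k}}\in\mathbb{Z}^r$, $\zeta_{\widehat{\mathcal{A}}}({\boldsymbol{k}})\in\mathcal{Z}_{\widehat{\mathcal{A}}}$ and $\psi(\zeta_{\widehat{\mathcal{A}}}({\boldsymbol{k}}))=\zeta_{\widehat{\mathcal{S}}}({\boldsymbol{k}})$. In particular, $\widehat{\mathcal{A}}$-MZVs and $\widehat{\mathcal{S}}$-MZVs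 of general indices satisfy the same $\mathbb{Q}$-linear relations.
   Context: An index is a tuple of integers ${\boldsymbol{k}}=(k_1,\dots,k_r)$, $r\ge0$; it is positive if all $k_i>0$ (the empty index is positive). For primes $p$, $\zeta_p({\boldsymbol{k}})=\sum_{0<n_1<\cdots<n_r<p}n_1^{-k_1}\cdots n_r^{-k_r}\in\mathbb{Z}_{(p)}$ (equal to $1$ for the empty index). $\mathcal{A}=(\prod_p\mathbb{Z}/p\mathbb{Z})/(\bigoplus_p\mathbb{Z}/p\mathbb{Z})$ and $\zeta_{\mathcal{A}}({\boldsymbol{k}})=(\zeta_p({\boldsymbol{k}})\bmod p)_p$; $\mathcal{Z}_{\mathcal{A}}$ is the $\mathbb{Q}$-subalgebra of $\mathcal{A}$ generated by $\zeta_{\mathcal{A}}({\boldsymbol{k}})$ for positive ${\boldsymbol{k}}$. $\widehat{\mathcal{A}}=\varprojlim_n[(\prod_p\mathbb{Z}/p^n\mathbb{Z})/(\bigoplus_p\mathbb{Z}/p^n\mathbb{Z})]$, $\zeta_{\widehat{\mathcal{A}}}({\boldsymbol{k}})=((\zeta_p({\boldsymbol{k}})\bmod p^n)_p)_n$, ${\boldsymbol{p}}=((p\bmod p^n)_p)_n$; $\widehat{\mathcal{A}}$ carries the ${\boldsymbol{p}}$-adic topology, and $\mathcal{Z}_{\widehat{\mathcal{A}}}$ is the closed $\mathbb{Q}$-subalgebra generated by ${\boldsymbol{p}}$ and $\zeta_{\widehat{\mathcal{A}}}({\boldsymbol{k}})$ for positive ${\boldsymbol{k}}$ (elements $\sum_{i\ge1}a_i\zeta_{\widehat{\mathcal{A}}}({\boldsymbol{k}}_i){\boldsymbol{p}}^{n_i}$,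 $a_i\in\mathbb{Q}$, ${\boldsymbol{k}}_i$ positive, $n_i\ge0$, $n_i\to\infty$). $\mathcal{Z}\subset\mathbb{R}$ is the $\mathbb{Q}$-algebra generated by multiple zeta values $\zeta(k_1,\dots,k_r)=\sum_{0<n_1<\cdots<n_r}n_1^{-k_1}\cdots n_r^{-k_r}$ ($k_i\ge1$, $k_r\ge2$); $\overline{\mathcal{Z}}=\mathcal{Z}/\pi^2\mathcal{Z}\cong\mathcal{Z}[\pi i]/\pi i\mathcal{Z}[\pi i]$; $\overline{\mathcal{Z}}[[t]]$ carries the $t$-adic topology. For $t\in\mathbb{C}\setminus[1,\infty)$, $\zeta(s_1,\dots,s_r;t)=\sum_{0<n_1<\cdots<n_r}\prod_j(n_j-t)^{-s_j}$ (principal branch), meromorphically continued from its region of absolute convergence to $\mathbb{C}^r$, $\zeta(\varnothing;t)=1$; for $t_+\in\mathbb{C}\setminus(-\infty,-1]$, $t_-\in\mathbb{C}\setminus[1,\infty)$, $\zeta_{\widehat{\mathcal{U}}}(s_1,\dots,s_r;t_+,t_-)=\sum_{i=0}^r e^{\pi i(s_{i+1}+\cdots+s_r)}\zeta(s_1,\dots,s_i;-t_+)\zeta(s_r,\dots,s_{i+1};t_-)$, known (Komori) to extend holomorphically, entire in ${\boldsymbol{s}}$. For an integer index ${\boldsymbol{k}}$: $\zeta_{\mathcal{S}}({\boldsymbol{k}})=\zeta_{\widehat{\mathcal{U}}}({\boldsymbol{k}};0,0)\bmod\pi i\mathcal{Z}[\pi i]\in\overline{\mathcal{Z}}$, and $\zeta_{\widehat{\mathcal{S}}}({\boldsymbol{k}})$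 is the Taylor expansion at $t=0$ of $\zeta_{\widehat{\mathcal{U}}}({\boldsymbol{k}};0,t)$ modulo $\pi i\mathcal{Z}[\pi i][[t]]$, an element of $\overline{\mathcal{Z}}[[t]]$ (these values lie in $\mathcal{Z}[\pi i]$, resp.\ $\mathcal{Z}[\pi i][[t]]$). *)

(* Defs.v *)
From Stdlib Require Import Reals.
From Coquelicot Require Import Coquelicot.
From mathcomp Require Import all_boot all_algebra.

Set Implicit Arguments.
Unset Strict Implicit.
Unset Printing Implicit Defensive.

Definition int2Z (z : int) : Z :=
  match z with Posz n => Z.of_nat n | Negz n => Z.opp (Z.of_nat n.+1) end.
Definition Q2R (q : rat) : R := Rdiv (IZR (int2Z (numq q))) (IZR (int2Z (denq q))).
Definition Q2C (q : rat) : C := RtoC (Q2R q).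
Definition int2C (z : int) : C := RtoC (IZR (int2Z z)).

Definition positive_index (k : seq int) : bool := all (fun x => (0 < x)%R) k.

(* truncated multiple harmonic sum over 0 < n_1 < ... < n_r < N of
   n_1^{-k_1} ... n_r^{-k_r}, written on the reversed index [k_r; ...; k_1] *)
Fixpoint trunc_rev (rk : seq int) (N : nat) : rat :=
  match rk with
  | [::] => 1%R
  | kr :: rest =>
      (\sum_(1 <= n < N) ((n%:R : rat) ^ (- kr)) * trunc_rev rest n)%R
  end.
Definition zeta_trunc (k : seq int) (N : nat) : rat := trunc_rev (rev k) N.

Definition zeta_p (k : seq int) (p : nat) : rat := zeta_trunc k p.

(* Elements of prod_p Z/p^nZ are represented by sequences (a_p)_p of    *)
(* rationals which are p-integral for almost all p (Z_(p)/p^n = Z/p^n); *)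
(* two sequences are equal in (prod_p Z/p^n)/(bigoplus_p Z/p^n) iff     *)
(* v_p(a_p - b_p) >= n for all but finitely many primes p.              *)
Definition pval_ge (p n : nat) (x : rat) : bool :=
  (p ^ n %| `|numq x|)%N && ~~ (p %| `|denq x|)%N.

Definition admissible (a : nat -> rat) : Prop :=
  exists N : nat, forall p : nat, prime p -> (N <= p)%N -> pval_ge p 0 (a p).

Definition eqAn (n : nat) (a b : nat -> rat) : Prop :=
  exists N : nat, forall p : nat, prime p -> (N <= p)%N -> pval_ge p n (a p - b p)%R.

Definition eqA (a b : nat -> rat) : Prop := eqAn 1 a b.
Definition addA (a b : nat -> rat) : nat -> rat := fun p => (a p + b p)%R.
Definition mulA (a b : nat -> rat) : nat -> rat := fun p => (a p * b p)%R.
Definition constA (q : rat) : nat -> rat := fun _ => q.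
Definition zetaA (k : seq int) : nat -> rat := fun p => zeta_p k p.

Inductive ZA : (nat -> rat) -> Prop :=
| ZA_gen k : positive_index k -> ZA (zetaA k)
| ZA_const q : ZA (constA q)
| ZA_add a b : ZA a -> ZA b -> ZA (addA a b)
| ZA_mul a b : ZA a -> ZA b -> ZA (mulA a b)
| ZA_eq a b : ZA a -> admissible b -> eqA a b -> ZA b.

(* ---- A-hat = lim_n A_n : compatible families (x_n)_n, x_n in A_n ---- *)
Definition Ahat := nat -> nat -> rat.  (* level n, prime p *)
Definition isAh (x : Ahat) : Prop :=
  (forall n, admissible (x n)) /\ (forall n, eqAn n (x n.+1) (x n)).
Definition eqAh (x y : Ahat) : Prop := forall n, eqAn n (x n) (y n).
Definition addAh (x y : Ahat) : Ahat := fun n p => (x n p + y n p)%R.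
Definition subAh (x y : Ahat) : Ahat := fun n p => (x n p - y n p)%R.
Definition mulAh (x y : Ahat) : Ahat := fun n p => (x n p * y n p)%R.
Definition constAh (q : rat) : Ahat := fun _ _ => q.
Definition pAh : Ahat := fun _ p => (p%:R)%R.
Definition pAh_pow (m : nat) : Ahat := fun _ p => ((p%:R) ^+ m)%R.
Definition zetaAh (k : seq int) : Ahat := fun _ p => zeta_p k p.

Definition in_pm (m : nat) (x : Ahat) : Prop :=
  exists w, isAh w /\ eqAh x (mulAh (pAh_pow m) w).
Definition convAh (y : nat -> Ahat) (x : Ahat) : Prop :=
  forall m, exists I, forall i, (I <= i)%N -> in_pm m (subAh (y i) x).

Inductive ZAh0 : Ahat -> Prop :=
| ZAh0_gen k : positive_index k -> ZAh0 (zetaAh k)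
| ZAh0_p : ZAh0 pAh
| ZAh0_const q : ZAh0 (constAh q)
| ZAh0_add x y : ZAh0 x -> ZAh0 y -> ZAh0 (addAh x y)
| ZAh0_mul x y : ZAh0 x -> ZAh0 y -> ZAh0 (mulAh x y)
| ZAh0_eq x y : ZAh0 x -> isAh y -> eqAh x y -> ZAh0 y.

Definition ZAh (x : Ahat) : Prop :=
  isAh x /\ exists y : nat -> Ahat, (forall i, ZAh0 (y i)) /\ convAh y x.

Definition Cexp (z : C) : C :=
  (Rmult (exp (fst z)) (cos (snd z)), Rmult (exp (fst z)) (sin (snd z))).
(* principal argument, valid off (-oo,0] *)
Definition Carg (z : C) : R := Rmult 2 (atan (Rdiv (snd z) (Rplus (Cmod z) (fst z)))).
Definition Clog (z : C) : C := (ln (Cmod z), Carg z).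
Definition Cpow_neg (w s : C) : C := Cexp (Copp (Cmult s (Clog w))).
Definition piI : C := (R0, PI).

Fixpoint csum (f : nat -> C) (n : nat) : C :=
  match n with O => RtoC 0 | S m => Cplus (csum f m) (f m) end.
Fixpoint Cpown (z : C) (n : nat) : C :=
  match n with O => RtoC 1 | S m => Cmult (Cpown z m) z end.

(* sum over 0 < n_1 < ... < n_r < N of prod_j (n_j - t)^{-s_j},
   on the reversed list [s_r; ...; s_1] *)
Fixpoint ctrunc_rev (rs : seq C) (t : C) (N : nat) : C :=
  match rs with
  | [::] => RtoC 1
  | sr :: rest =>
      csum (fun n => if n == 0%N then RtoC 0 else
              Cmult (Cpow_neg (Cminus (RtoC (INR n)) t) sr) (ctrunc_rev rest t n)) N
  end.
Definition ctrunc (s : seq C) (t : C) (N : nat) : C := ctrunc_rev (rev s) t N.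

Definition csumlist (l : seq C) : C := foldr Cplus (RtoC 0) l.

Definition zetaU_trunc (s : seq C) (tp tm : C) (N : nat) : C :=
  csum (fun i =>
    Cmult (Cexp (Cmult piI (csumlist (drop i s))))
          (Cmult (ctrunc (take i s) (Copp tp) N) (ctrunc (rev (drop i s)) tm N)))
    (size s).+1.

(* region Re s_j > 1 for all j: all series converge absolutely there *)
Definition conv_region (r : nat) (s : seq C) : Prop :=
  size s = r /\ forall j, (j < r)%N -> Rlt 1 (fst (nth (RtoC 0) s j)).

(* holomorphic on C^r (separately holomorphic; = holomorphic by Hartogs) *)
Definition entire_r (r : nat) (F : seq C -> C) : Prop :=
  forall s, size s = r -> forall j, (j < r)%N -> forall z : C,
    @ex_derive C_AbsRing C_NormedModule
      (fun w : C => F (set_nth (RtoC 0) s j w)) z.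

Definition zetaU_extension (r : nat) (tp tm : C) (F : seq C -> C) : Prop :=
  entire_r r F /\
  forall s, conv_region r s ->
    filterlim (fun N => zetaU_trunc s tp tm N) eventually (locally (F s)).

(* v = zeta_Uhat(k; 0, 0) (an element of Z[pi i]) *)
Definition zetaU00_is (k : seq int) (v : C) : Prop :=
  exists F, zetaU_extension (size k) (RtoC 0) (RtoC 0) F /\ F (map int2C k) = v.

Definition zetaU0t_taylor (k : seq int) (c : nat -> C) : Prop :=
  exists G : C -> seq C -> C,
    (forall t : C, ~ (snd t = R0 /\ Rle 1 (fst t)) ->
        zetaU_extension (size k) (RtoC 0) t (G t)) /\
    exists rho : R, Rlt 0 rho /\
      forall t : C, Rlt (Cmod t) rho ->
        is_series (fun n => Cmult (c n) (Cpown t n)) (G t (map int2C k)).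

Definition mzv_is (k : seq nat) (x : R) : Prop :=
  k <> [::] /\ all (fun a => (0 < a)%N) k /\ (2 <= last 0%N k)%N /\
  is_lim_seq (fun N => Q2R (zeta_trunc (map (fun a : nat => Posz a) k) N)) x.

Inductive Zpi : C -> Prop :=
| Zpi_mzv k x : mzv_is k x -> Zpi (RtoC x)
| Zpi_pii : Zpi piI
| Zpi_const q : Zpi (Q2C q)
| Zpi_add z w : Zpi z -> Zpi w -> Zpi (Cplus z w)
| Zpi_mul z w : Zpi z -> Zpi w -> Zpi (Cmult z w).

Definition in_piZpi (z : C) : Prop := exists w, Zpi w /\ z = Cmult piI w.
Definition eqZbar (z w : C) : Prop := in_piZpi (Cminus z w).

(* Zbar[[t]] : coefficient sequences in Z[pi i] mod pi i Z[pi i] *)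
Definition PS := nat -> C.
Definition isPS (c : PS) : Prop := forall n, Zpi (c n).
Definition eqPS (c d : PS) : Prop := forall n, eqZbar (c n) (d n).
Definition addPS (c d : PS) : PS := fun n => Cplus (c n) (d n).
Definition mulPS (c d : PS) : PS :=
  fun n => csum (fun i => Cmult (c i) (d (n - i)%N)) n.+1.
Definition constPS (q : rat) : PS := fun n => if n == 0%N then Q2C q else RtoC 0.
Definition tPS : PS := fun n => if n == 1%N then RtoC 1 else RtoC 0.
Definition convPS (y : nat -> PS) (c : PS) : Prop :=
  forall m, exists I, forall i, (I <= i)%N -> forall n, (n < m)%N -> eqZbar (y i n) (c n).

(* Isomorphisms (maps given on representatives)                        *)
Definition QalgIso_A (phi : (nat -> rat) -> C) : Prop :=
  (forall a, ZA a -> Zpi (phi a)) /\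
  (forall a b, ZA a -> ZA b -> (eqA a b <-> eqZbar (phi a) (phi b))) /\
  (forall z, Zpi z -> exists a, ZA a /\ eqZbar (phi a) z) /\
  (forall a b, ZA a -> ZA b -> eqZbar (phi (addA a b)) (Cplus (phi a) (phi b))) /\
  (forall a b, ZA a -> ZA b -> eqZbar (phi (mulA a b)) (Cmult (phi a) (phi b))) /\
  (forall q, eqZbar (phi (constA q)) (Q2C q)).

Definition topQalgIso_Ah (psi : Ahat -> PS) : Prop :=
  (forall x, ZAh x -> isPS (psi x)) /\
  (forall x y, ZAh x -> ZAh y -> (eqAh x y <-> eqPS (psi x) (psi y))) /\
  (forall c, isPS c -> exists x, ZAh x /\ eqPS (psi x) c) /\
  (forall x y, ZAh x -> ZAh y -> eqPS (psi (addAh x y)) (addPS (psi x) (psi y))) /\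
  (forall x y, ZAh x -> ZAh y -> eqPS (psi (mulAh x y)) (mulPS (psi x) (psi y))) /\
  (forall q, eqPS (psi (constAh q)) (constPS q)) /\
  (forall (y : nat -> Ahat) x, (forall i, ZAh (y i)) -> ZAh x ->
     (convAh y x <-> convPS (fun i => psi (y i)) (psi x))).

(* Main.v *)
(** For a nonpositive entry [-m], telescoping [(n+1)^(m+1) - n^(m+1)] in the
    corresponding summation variable writes a truncated sum as a rational
    combination of truncated sums in which [-m] is replaced by [-m'] with [m' < m],
    and of sums of lower depth, one of them multiplied by [p^(m+1)].

    The function [zeta_U(s; 0, t)] is a sum over chains in the ordered set
    [1 < 2 < ... < t - 2 < t - 1] running through infinity, where [t - n] carries the
    branch [log (n - t) - pi i] of its logarithm, so the same telescoping yields the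
    same relation with [p] replaced by [t].  It is first obtained when the other
    exponents are large: the two-sided partial sums, corrected by an error block that
    stands for the part of the chain through infinity, have summable increments on a
    whole circle of exponents and converge on an arc inside the region of convergence,
    hence converge at the centre.  Separate analyticity carries the relation to all
    exponents, and its case [m = 0] supplies the extension in depth [r] from the one in
    depth [r + 1].  Induction on depth and on [m] then reduces every index to positive
    ones.

    Over [A-hat] one also needs Taylor expansions in [t] at positive indices; for
    exponents 1 the correcting blocks are explicit, and the increments of the corrected
    sums are power series in [t] with summable l^1 norms. *)

Require Import Defs.
From Stdlib Require Import ZArith Reals Lra ClassicalEpsilon FunctionalExtensionality.
From Coquelicot Require Import Coquelicot.
From mathcomp Require Import all_boot all_algebra zify.

Set Implicit Arguments.
Unset Strict Implicit.
Unset Printing Implicit Defensive.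

Local Open Scope R_scope.

(** * Complex differentiability *)

Definition Cdiff (f : C -> C) (z : C) : Prop :=
  exists l : C, forall eps : R, 0 < eps -> exists d : R, 0 < d /\
    forall h : C, Cmod h < d -> Cmod (f (z + h) - f z - l * h)%C <= eps * Cmod h.

Definition Centire (f : C -> C) : Prop := forall z, Cdiff f z.

Lemma Cmod_triangle_sub (x y : C) : Cmod x <= Cmod y + Cmod (x - y)%C.
Proof.
have -> : x = (y + (x - y))%C by ring.
have -> : (y + (x - y) - y = x - y)%C by ring.
exact: Cmod_triangle.
Qed.

Lemma Cmod_sub_sym (x y : C) : Cmod (x - y)%C = Cmod (y - x)%C.
Proof. by rewrite -Cmod_opp; congr Cmod; ring. Qed.

Lemma ball_C_Cmod (x y : C) (e : R) : Cmod (y - x)%C < e -> ball x e y.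
Proof. exact: (@C_NormedModule_mixin_compat1 x y e). Qed.

(** The balls of C are squares, hence a factor [sqrt 2], rounded up to 2. *)
Lemma Cmod_ball_C (x y : C) (e : posreal) : ball x e y -> Cmod (y - x)%C < 2 * e.
Proof.
move=> H; have := @C_NormedModule_mixin_compat2 x y e H => H1.
apply: Rlt_le_trans H1 _; apply: Rmult_le_compat_r; first by have := cond_pos e; lra.
have H2 : sqrt 2 <= sqrt (2 * 2) by apply: sqrt_le_1_alt; lra.
by rewrite sqrt_square in H2; lra.
Qed.

(** The form with an explicit remainder is what estimates consume and what limits of sequences
    produce; this equivalence links it to the derivative in [entire_r]. *)
Lemma Cdiff_ex_derive (f : C -> C) (z : C) :
  Cdiff f z <-> @ex_derive C_AbsRing C_NormedModule f z.
Proof.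
split.
- case=> l Hl; exists l; split; first exact: is_linear_scal_l.
  move=> x /= Hx eps.
  have Exz : x = z by symmetry; apply (@is_filter_lim_locally_unique C_AbsRing (AbsRing_NormedModule C_AbsRing)); exact: Hx.
  subst x.
  have [d [dpos Hd]] := Hl eps (cond_pos eps).
  exists (mkposreal d dpos) => y Hy.
  have Hyz : Cmod (y - z)%C < d by exact: Hy.
  have := Hd _ Hyz.
  rewrite /norm /= /minus /plus /opp /scal /= /mult /=.
  have -> : (z + (y - z))%C = y by ring.
  have -> : (f y - f z - l * (y - z))%C = (f y + - f z + - ((y + - z) * l))%C by ring.
  by [].
- case=> l [_ Hl]; exists l => eps Heps.
  have Hz : @is_filter_lim (AbsRing_UniformSpace C_AbsRing) (@locally (AbsRing_UniformSpace C_AbsRing) z) z.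
    by move=> P HP; exact: HP.
  have := Hl z Hz (mkposreal eps Heps); rewrite /= => -[d Hd].
  exists d; split; first exact: cond_pos.
  move=> h Hh.
  have Hb : Cmod (z + h - z)%C < d by have -> : (z + h - z = h)%C by ring.
  have := Hd (z + h)%C Hb.
  rewrite /norm /= /minus /plus /opp /scal /= /mult /=.
  have -> : (z + h + - z = h)%C by ring.
  have -> : (f (z + h) - f z - l * h)%C = (f (z + h) + - f z + - (h * l))%C by ring.
  by [].
Qed.

Lemma Cdiff_ext (f g : C -> C) (z : C) :
  (forall w, f w = g w) -> Cdiff f z -> Cdiff g z.
Proof.
move=> H [l Hl]; exists l => eps He; have [d [dp Hd]] := Hl _ He.
by exists d; split=> // h Hh; rewrite -!H; apply: Hd.
Qed.

Lemma Cdiff_ext_loc (f g : C -> C) (z : C) (r : R) : 0 < r ->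
  (forall w, Cmod (w - z)%C < r -> f w = g w) -> Cdiff f z -> Cdiff g z.
Proof.
move=> rp H [l Hl]; exists l => eps He; have [d [dp Hd]] := Hl _ He.
exists (Rmin d r); split; first by apply: Rmin_glb_lt.
move=> h Hh; rewrite -!H.
- by apply: Hd; apply: Rlt_le_trans Hh (Rmin_l _ _).
- have -> : (z - z = 0)%C by ring.
  by rewrite Cmod_0.
- have -> : (z + h - z = h)%C by ring.
  by apply: Rlt_le_trans Hh (Rmin_r _ _).
Qed.

Lemma Cdiff_const (c z : C) : Cdiff (fun _ => c) z.
Proof.
exists (RtoC 0) => eps He; exists 1; split; first lra.
move=> h _; have -> : (c - c - 0 * h = 0)%C by ring.
rewrite Cmod_0; apply: Rmult_le_pos; [lra | exact: Cmod_ge_0].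
Qed.

Lemma Cdiff_id (z : C) : Cdiff (fun w => w) z.
Proof.
exists (RtoC 1) => eps He; exists 1; split; first lra.
move=> h _; have -> : (z + h - z - 1 * h = 0)%C by ring.
rewrite Cmod_0; apply: Rmult_le_pos; [lra | exact: Cmod_ge_0].
Qed.

Lemma Cdiff_cont (f : C -> C) (z : C) : Cdiff f z ->
  forall eps, 0 < eps -> exists d, 0 < d /\
    forall h, Cmod h < d -> Cmod (f (z + h) - f z)%C <= eps.
Proof.
case=> l Hl eps He; have [d [dp Hd]] := Hl 1 Rlt_0_1.
have Hk : 0 < 1 + Cmod l by have := Cmod_ge_0 l; lra.
exists (Rmin d (eps / (1 + Cmod l))); split.
  by apply: Rmin_glb_lt => //; apply: Rdiv_lt_0_compat.
move=> h Hh.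
have H1 := Hd h (Rlt_le_trans _ _ _ Hh (Rmin_l _ _)).
have H2 := Rlt_le_trans _ _ _ Hh (Rmin_r _ _).
have -> : (f (z + h) - f z = (f (z + h) - f z - l * h) + l * h)%C by ring.
apply: Rle_trans (Cmod_triangle _ _) _; rewrite Cmod_mult.
have H3 : (1 + Cmod l) * Cmod h <= eps.
  have -> : eps = (1 + Cmod l) * (eps / (1 + Cmod l)) by field; lra.
  apply: Rmult_le_compat_l; lra.
lra.
Qed.

Lemma Cdiff_plus (f g : C -> C) (z : C) :
  Cdiff f z -> Cdiff g z -> Cdiff (fun w => f w + g w)%C z.
Proof.
move=> /Cdiff_ex_derive Hf /Cdiff_ex_derive Hg; apply/Cdiff_ex_derive.
exact: (@ex_derive_plus C_AbsRing C_NormedModule f g).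
Qed.

Lemma Cdiff_mult (f g : C -> C) (z : C) :
  Cdiff f z -> Cdiff g z -> Cdiff (fun w => f w * g w)%C z.
Proof.
move=> [a Ha] [b Hb].
have [dg [dgp Hdg]] := Cdiff_cont (ex_intro _ b Hb) (eps := 1) Rlt_0_1.
exists (a * g z + f z * b)%C => eps He.
set K := 1 + Cmod (g z) + Cmod (f z) + Cmod a.
have Kp : 0 < K by rewrite /K; have := Cmod_ge_0 (g z); have := Cmod_ge_0 (f z);
  have := Cmod_ge_0 a; lra.
have ep : 0 < eps / (3 * K) by apply: Rdiv_lt_0_compat; lra.
have [d1 [d1p H1]] := Ha _ ep.
have [d2 [d2p H2]] := Hb _ ep.
have [d3 [d3p H3]] := Cdiff_cont (ex_intro _ b Hb) (eps := eps / (3 * K)) ep.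
exists (Rmin (Rmin d1 d2) (Rmin d3 dg)); split; first by repeat apply: Rmin_glb_lt.
move=> h Hh.
have h1 := H1 h (Rlt_le_trans _ _ _ Hh (Rle_trans _ _ _ (Rmin_l _ _) (Rmin_l _ _))).
have h2 := H2 h (Rlt_le_trans _ _ _ Hh (Rle_trans _ _ _ (Rmin_l _ _) (Rmin_r _ _))).
have h3 := H3 h (Rlt_le_trans _ _ _ Hh (Rle_trans _ _ _ (Rmin_r _ _) (Rmin_l _ _))).
have h4 := Hdg h (Rlt_le_trans _ _ _ Hh (Rle_trans _ _ _ (Rmin_r _ _) (Rmin_r _ _))).
have -> : (f (z + h) * g (z + h) - f z * g z - (a * g z + f z * b) * h
  = (f (z+h) - f z - a * h) * g (z + h) + (f z * (g (z+h) - g z - b * h)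
     + a * h * (g (z + h) - g z)))%C by ring.
have hg : Cmod (g (z + h)%C) <= 1 + Cmod (g z) by have := Cmod_triangle_sub (g (z+h)%C) (g z); lra.
have P := Cmod_ge_0.
have e1 : Cmod ((f (z+h) - f z - a * h) * g (z + h))%C <= eps / (3 * K) * Cmod h * K.
  by rewrite Cmod_mult; apply: Rmult_le_compat => //; rewrite /K;
     have := P (f z); have := P a; lra.
have e2 : Cmod (f z * (g (z+h) - g z - b * h))%C <= K * (eps / (3 * K) * Cmod h).
  rewrite Cmod_mult; apply: Rmult_le_compat => //; rewrite /K;
     have := P (g z); have := P a; lra.
have e3 : Cmod (a * h * (g (z+h) - g z))%C <= K * Cmod h * (eps / (3 * K)).
  rewrite !Cmod_mult; apply: Rmult_le_compat => //; first by apply: Rmult_le_pos.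
  by apply: Rmult_le_compat => //; rewrite /K; have := P (g z); have := P (f z); have := P a; lra.
apply: Rle_trans (Cmod_triangle _ _) _.
apply: Rle_trans (Rplus_le_compat _ _ _ _ e1 (Rle_trans _ _ _ (Cmod_triangle _ _)
  (Rplus_le_compat _ _ _ _ e2 e3))) _.
by apply: Req_le; field; lra.
Qed.

Lemma Cdiff_comp (f g : C -> C) (z : C) :
  Cdiff f (g z) -> Cdiff g z -> Cdiff (fun w => f (g w)) z.
Proof.
move=> [a Ha] [b Hb].
exists (a * b)%C => eps He.
set K := 1 + Cmod b + Cmod a.
have P := Cmod_ge_0.
have Kp : 0 < K by rewrite /K; have := P b; have := P a; lra.
have ep : 0 < eps / (2 * K) by apply: Rdiv_lt_0_compat; lra.
have [d1 [d1p H1]] := Ha _ ep.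
have [d2 [d2p H2]] := Hb _ ep.
have [d3 [d3p H3]] := Hb 1 Rlt_0_1.
exists (Rmin (Rmin d2 d3) (d1 / K)); split.
  by repeat apply: Rmin_glb_lt => //; apply: Rdiv_lt_0_compat.
move=> h Hh.
have h2 := H2 h (Rlt_le_trans _ _ _ Hh (Rle_trans _ _ _ (Rmin_l _ _) (Rmin_l _ _))).
have h3 := H3 h (Rlt_le_trans _ _ _ Hh (Rle_trans _ _ _ (Rmin_l _ _) (Rmin_r _ _))).
have h4 := Rlt_le_trans _ _ _ Hh (Rmin_r _ _).
set k := (g (z + h) - g z)%C.
have kb : Cmod k <= K * Cmod h.
  have -> : k = ((g (z + h) - g z - b * h) + b * h)%C by rewrite /k; ring.
  apply: Rle_trans (Cmod_triangle _ _) _; rewrite Cmod_mult.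
  by have := Rmult_le_pos _ _ (P a) (P h); rewrite /K; lra.
have kd : Cmod k < d1.
  apply: Rle_lt_trans kb _; have -> : d1 = K * (d1 / K) by field; lra.
  by apply: Rmult_lt_compat_l.
have h1 := H1 k kd.
have -> : (g (z + h) = g z + k)%C by rewrite /k; ring.
have -> : (f (g z + k) - f (g z) - a * b * h =
  (f (g z + k) - f (g z) - a * k) + a * (g (z + h) - g z - b * h))%C by rewrite /k; ring.
apply: Rle_trans (Cmod_triangle _ _) _; rewrite Cmod_mult.
have e1 : eps / (2 * K) * Cmod k <= eps / (2 * K) * (K * Cmod h).
  by apply: Rmult_le_compat_l => //; lra.
have e2 : Cmod a * Cmod (g (z + h) - g z - b * h)%C <= K * (eps / (2 * K) * Cmod h).
  by apply: Rmult_le_compat => //; rewrite /K; have := P b; lra.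
apply: Rle_trans (Rplus_le_compat _ _ _ _ (Rle_trans _ _ _ h1 e1) e2) _.
by apply: Req_le; field; lra.
Qed.

Lemma Cdiff_opp (f : C -> C) (z : C) : Cdiff f z -> Cdiff (fun w => - f w)%C z.
Proof.
move=> H; apply: (@Cdiff_ext (fun w => (- (1)) * f w)%C); first by move=> w; ring.
by apply: Cdiff_mult => //; exact: Cdiff_const.
Qed.

Lemma Cdiff_minus (f g : C -> C) (z : C) :
  Cdiff f z -> Cdiff g z -> Cdiff (fun w => f w - g w)%C z.
Proof. by move=> Hf Hg; apply: Cdiff_plus => //; apply: Cdiff_opp. Qed.

Lemma Cdiff_csum (f : nat -> C -> C) (z : C) n :
  (forall i, (i < n)%coq_nat -> Cdiff (f i) z) -> Cdiff (fun w => csum (fun i => f i w) n) z.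
Proof.
elim: n => [|n IH] H /=; first exact: Cdiff_const.
by apply: Cdiff_plus; [apply: IH => i Hi; apply: H; lia | apply: H; lia].
Qed.

(** * Goursat's theorem on rectangles *)

Definition Cint (f : R -> C) (a b : R) : C :=
  (RInt (fun x => fst (f x)) a b, RInt (fun x => snd (f x)) a b).

Definition Rcont (f : R -> C) : Prop := forall x,
  continuous (fun s => fst (f s)) x /\ continuous (fun s => snd (f s)) x.

Lemma Rcont_intro (f : R -> C) :
  (forall x eps, 0 < eps -> exists d, 0 < d /\
     forall y, Rabs (y - x) < d -> Cmod (f y - f x)%C <= eps) -> Rcont f.
Proof.
move=> H x.
have P : forall p : C -> R, (forall u v : C, Rabs (p u - p v) <= Cmod (u - v)%C) ->
    continuous (fun s => p (f s)) x.
  move=> p Hp; apply/filterlim_locally => eps.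
  have [d [dp Hd]] := H x (eps / 2) ltac:(have := cond_pos eps; lra).
  exists (mkposreal d dp) => y Hy.
  apply: Rle_lt_trans (Hp _ _) _.
  by apply: Rle_lt_trans (Hd _ Hy) _; have := cond_pos eps; lra.
split; apply: P => u v; have := Rmax_Cmod (u - v)%C; rewrite /=.
- by apply: Rle_trans; apply: Rmax_l.
- by apply: Rle_trans; apply: Rmax_r.
Qed.

Lemma Centire_Rcont (f : C -> C) (g : R -> C) : Centire f ->
  (forall x eps, 0 < eps -> exists d, 0 < d /\
     forall y, Rabs (y - x) < d -> Cmod (g y - g x)%C < eps) -> Rcont (fun s => f (g s)).
Proof.
move=> Hf Hg; apply: Rcont_intro => x eps He.
have [d [dp Hd]] := Cdiff_cont (Hf (g x)) He.
have [e [ep He']] := Hg x d dp; exists e; split=> // y Hy.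
have := Hd _ (He' y Hy).
by have -> : (g x + (g y - g x) = g y)%C by ring.
Qed.

Lemma Cmod_fst_snd (z : C) : Cmod z <= Rabs (fst z) + Rabs (snd z).
Proof.
have -> : z = ((fst z, 0) + (0, snd z))%C by case: z => x y; rewrite /Cplus /=; congr pair; ring.
apply: Rle_trans (Cmod_triangle _ _) _; apply: Req_le.
have e1 : Cmod (fst z, 0) = Rabs (fst z) by exact: Cmod_R.
have e2 : Cmod (0, snd z) = Rabs (snd z).
  have -> : (0, snd z) = (Ci * RtoC (snd z))%C by rewrite /Cmult /=; congr pair; ring.
  by rewrite Cmod_mult Cmod_R Cmod_Ci; ring.
by rewrite e1 e2 /= Rplus_0_r Rplus_0_l.
Qed.

Lemma Centire_horiz (f : C -> C) y : Centire f -> Rcont (fun s => f (s, y)).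
Proof.
move=> H; apply: (@Centire_Rcont f (fun s => (s, y))) => // x eps He; exists eps; split=> // s Hs.
have -> : ((s, y) - (x, y))%C = RtoC (s - x) by rewrite /Cminus /Cplus /Copp /RtoC /=; congr pair; ring.
by rewrite Cmod_R.
Qed.

Lemma Centire_vert (f : C -> C) x : Centire f -> Rcont (fun s => f (x, s)).
Proof.
move=> H; apply: (@Centire_Rcont f (fun s => (x, s))) => // y eps He; exists eps; split=> // s Hs.
have -> : ((x, s) - (x, y))%C = (Ci * RtoC (s - y))%C by rewrite /Cminus /Cplus /Copp /Cmult /RtoC /=; congr pair; ring.
by rewrite Cmod_mult Cmod_Ci Cmod_R Rmult_1_l.
Qed.

Lemma Rcont_int (f : R -> C) a b : Rcont f ->
  ex_RInt (fun s => fst (f s)) a b /\ ex_RInt (fun s => snd (f s)) a b.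
Proof. by move=> H; split; apply: ex_RInt_continuous => z _; apply H. Qed.

Lemma Cint_Chasles (f : R -> C) a b c : Rcont f -> (Cint f a b + Cint f b c)%C = Cint f a c.
Proof.
move=> H; rewrite /Cint /Cplus /=.
have [h1 h2] := Rcont_int a b H; have [h3 h4] := Rcont_int b c H.
by congr pair; apply: RInt_Chasles.
Qed.

Lemma Cint_plus (f g : R -> C) a b : Rcont f -> Rcont g ->
  Cint (fun s => f s + g s)%C a b = (Cint f a b + Cint g a b)%C.
Proof.
move=> Hf Hg; have [h1 h2] := Rcont_int a b Hf; have [h3 h4] := Rcont_int a b Hg.
rewrite /Cint /Cplus /=; congr pair.
- exact: (@RInt_plus R_CompleteNormedModule (fun s => fst (f s)) (fun s => fst (g s)) a b).
- exact: (@RInt_plus R_CompleteNormedModule (fun s => snd (f s)) (fun s => snd (g s)) a b).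
Qed.

(** The factor 2 comes from bounding real and imaginary part separately; only constants are
    affected. *)
Lemma Cint_bound (f : R -> C) a b M : a <= b -> Rcont f ->
  (forall s, a <= s <= b -> Cmod (f s) <= M) -> Cmod (Cint f a b) <= 2 * (M * (b - a)).
Proof.
move=> ab H HM; apply: Rle_trans (Cmod_fst_snd _) _; rewrite /Cint /=.
have [h1 h2] := Rcont_int a b H.
have Q : forall p : C -> R, (forall u : C, Rabs (p u) <= Cmod u) ->
   ex_RInt (fun s => p (f s)) a b -> Rabs (RInt (fun s => p (f s)) a b) <= M * (b - a).
  move=> p Hp Hi; rewrite Rmult_comm; apply: abs_RInt_le_const => // s Hs.
  by apply: Rle_trans (Hp _) _; apply: HM.
have q1 := Q fst (fun u => Rle_trans _ _ _ (Rmax_l _ _) (Rmax_Cmod u)) h1.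
have q2 := Q snd (fun u => Rle_trans _ _ _ (Rmax_r _ _) (Rmax_Cmod u)) h2.
lra.
Qed.

(** The boundary of the rectangle with corner (x, y) and sides a, b, run counterclockwise; [Ci] is
    the direction of dz on the vertical sides. *)
Definition rect_int (f : C -> C) (x y a b : R) : C :=
  (Cint (fun s => f (s, y)) x (Rplus x a) + Ci * Cint (fun s => f (Rplus x a, s)) y (Rplus y b)
   - Cint (fun s => f (s, Rplus y b)) x (Rplus x a) - Ci * Cint (fun s => f (x, s)) y (Rplus y b))%C.

Lemma rect_int_split_x (f : C -> C) x y a1 a2 b : Centire f ->
  rect_int f x y (a1 + a2) b = (rect_int f x y a1 b + rect_int f (x + a1) y a2 b)%C.
Proof.
move=> H; rewrite /rect_int.
have <- := @Cint_Chasles (fun s => f (s, y)) x (x + a1) (x + (a1 + a2)) (Centire_horiz _ H).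
have <- := @Cint_Chasles (fun s => f (s, y + b)) x (x + a1) (x + (a1 + a2)) (Centire_horiz _ H).
by have -> : x + (a1 + a2) = x + a1 + a2 by [ring]; ring.
Qed.

Lemma rect_int_split_y (f : C -> C) x y a b1 b2 : Centire f ->
  rect_int f x y a (b1 + b2) = (rect_int f x y a b1 + rect_int f x (y + b1) a b2)%C.
Proof.
move=> H; rewrite /rect_int.
have <- := @Cint_Chasles (fun s => f (x + a, s)) y (y + b1) (y + (b1 + b2)) (Centire_vert _ H).
have <- := @Cint_Chasles (fun s => f (x, s)) y (y + b1) (y + (b1 + b2)) (Centire_vert _ H).
by have -> : y + (b1 + b2) = y + b1 + b2 by [ring]; ring.
Qed.

Lemma RInt_affine (p q a b : R) :
  RInt (fun s => p + q * s) a b = p * (b - a) + q * (b * b - a * a) / 2.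
Proof.
apply: is_RInt_unique.
have -> : p * (b - a) + q * (b * b - a * a) / 2 =
  minus (p * b + q * (b * b) / 2) (p * a + q * (a * a) / 2).
  by rewrite /minus /plus /Hierarchy.opp /=; field.
apply: (@is_RInt_derive _ (fun s => p * s + q * (s * s) / 2)) => s _.
- by auto_derive => //; field.
- apply: ex_derive_continuous; by auto_derive.
Qed.

Lemma Cint_horiz_affine (u v : C) y a b :
  Cint (fun s => u + v * (s, y))%C a b =
  ((fst u - snd v * y) * (b - a) + fst v * (b * b - a * a) / 2,
   (snd u + fst v * y) * (b - a) + snd v * (b * b - a * a) / 2).
Proof.
rewrite /Cint -!RInt_affine; congr pair; apply: RInt_ext => s _ /=; ring.
Qed.

Lemma Cint_vert_affine (u v : C) x a b :
  Cint (fun s => u + v * (x, s))%C a b =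
  ((fst u + fst v * x) * (b - a) + - snd v * (b * b - a * a) / 2,
   (snd u + snd v * x) * (b - a) + fst v * (b * b - a * a) / 2).
Proof.
rewrite /Cint -!RInt_affine; congr pair; apply: RInt_ext => s _ /=; ring.
Qed.

Lemma rect_int_affine (u v : C) x y a b : rect_int (fun z => u + v * z)%C x y a b = 0.
Proof.
rewrite /rect_int !Cint_horiz_affine !Cint_vert_affine.
by rewrite /Cminus /Cplus /Cmult /Copp /RtoC /=; congr pair; field.
Qed.

Lemma rect_int_plus (f g : C -> C) x y a b : Centire f -> Centire g ->
  rect_int (fun z => f z + g z)%C x y a b = (rect_int f x y a b + rect_int g x y a b)%C.
Proof.
move=> Hf Hg; rewrite /rect_int.
rewrite !(@Cint_plus (fun s => f (s, _)) (fun s => g (s, _))); try exact: Centire_horiz.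
rewrite !(@Cint_plus (fun s => f (_, s)) (fun s => g (_, s))); try exact: Centire_vert.
by ring.
Qed.

Lemma rect_int_bound (f : C -> C) x y a b L M : Centire f ->
  0 <= a <= L -> 0 <= b <= L -> 0 <= M ->
  (forall s s', x <= s <= x + a -> y <= s' <= y + b -> Cmod (f (s, s')) <= M) ->
  Cmod (rect_int f x y a b) <= 8 * (M * L).
Proof.
move=> H Ha Hb HM Hf; rewrite /rect_int.
have hor : forall s', y <= s' <= y + b ->
    Cmod (Cint (fun s => f (s, s')) x (x + a)) <= 2 * (M * L).
  move=> s' Hs'; apply: Rle_trans (@Cint_bound _ x (x + a) M ltac:(lra) (Centire_horiz _ H) _) _.
    by move=> s Hs; apply: Hf.
  by apply: Rmult_le_compat_l; [lra | apply: Rmult_le_compat_l; lra].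
have ver : forall s, x <= s <= x + a ->
    Cmod (Ci * Cint (fun s' => f (s, s')) y (y + b))%C <= 2 * (M * L).
  move=> s Hs; rewrite Cmod_mult Cmod_Ci Rmult_1_l.
  apply: Rle_trans (@Cint_bound _ y (y + b) M ltac:(lra) (Centire_vert _ H) _) _.
    by move=> s' Hs'; apply: Hf.
  by apply: Rmult_le_compat_l; [lra | apply: Rmult_le_compat_l; lra].
have h1 := hor y ltac:(lra); have h2 := hor (y + b) ltac:(lra).
have h3 := ver x ltac:(lra); have h4 := ver (x + a) ltac:(lra).
rewrite /Cminus.
apply: Rle_trans (Cmod_triangle _ _) _; rewrite Cmod_opp.
apply: Rle_trans (Rplus_le_compat_r _ _ _ (Cmod_triangle _ _)) _; rewrite Cmod_opp.
apply: Rle_trans (Rplus_le_compat_r _ _ _ (Rplus_le_compat_r _ _ _ (Cmod_triangle _ _))) _.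
lra.
Qed.

(** Four quarters, each of modulus below K, could not add up to 4 K. The corner of the good quarter
    is named so that the corners of nested rectangles form monotone sequences. *)
Lemma rect_int_bisect (f : C -> C) x y a b K : Centire f -> 4 * K <= Cmod (rect_int f x y a b) ->
  exists x' y', (x' = x \/ x' = x + a / 2) /\ (y' = y \/ y' = y + b / 2) /\
    K <= Cmod (rect_int f x' y' (a / 2) (b / 2)).
Proof.
move=> H HK.
have E : rect_int f x y a b =
  ((rect_int f x y (a/2) (b/2) + rect_int f x (y + b/2) (a/2) (b/2)) +
   (rect_int f (x + a/2) y (a/2) (b/2) + rect_int f (x + a/2) (y + b/2) (a/2) (b/2)))%C.
  have -> : rect_int f x y a b = rect_int f x y (a/2 + a/2) (b/2+b/2) by congr rect_int; field.
  by rewrite rect_int_split_x // !rect_int_split_y.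
case: (Rle_dec K (Cmod (rect_int f x y (a/2) (b/2)))) => h1; first by exists x, y; auto.
case: (Rle_dec K (Cmod (rect_int f x (y+b/2) (a/2) (b/2)))) => h2; first by exists x, (y + b/2); auto.
case: (Rle_dec K (Cmod (rect_int f (x+a/2) y (a/2) (b/2)))) => h3; first by exists (x+a/2), y; auto.
case: (Rle_dec K (Cmod (rect_int f (x+a/2) (y+b/2) (a/2) (b/2)))) => h4;
  first by exists (x+a/2), (y+b/2); auto.
exfalso; rewrite E in HK.
have := Rle_trans _ _ _ HK (Rle_trans _ _ _ (Cmod_triangle _ _)
  (Rplus_le_compat _ _ _ _ (Cmod_triangle _ _) (Cmod_triangle _ _))).
lra.
Qed.

(** The supremum of the left ends lies in all the nested intervals. It is applied to each coordinate
    of the shrinking rectangles. *)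
Lemma nested_point (u : nat -> R) (d : R) : 0 <= d ->
  (forall n, u n <= u (S n) /\ u (S n) + d / 2 ^ (S n) <= u n + d / 2 ^ n) ->
  exists l, forall n, u n <= l <= u n + d / 2 ^ n.
Proof.
move=> dp H.
have pw n : 0 <= d / 2 ^ n by apply: Rdiv_le_0_compat => //; apply: pow_lt; lra.
have mono n k : u n <= u (n + k)%coq_nat.
  elim: k => [|k IH]; first by rewrite Nat.add_0_r; lra.
  by rewrite Nat.add_succ_r; apply: Rle_trans IH _; apply H.
have dec n k : u (n + k)%coq_nat + d / 2 ^ (n + k)%coq_nat <= u n + d / 2 ^ n.
  elim: k => [|k IH]; first by rewrite Nat.add_0_r; lra.
  by rewrite Nat.add_succ_r; apply: Rle_trans IH; apply H.
have ub n k : u k <= u n + d / 2 ^ n.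
  case: (Nat.le_ge_cases n k) => nk.
    have := dec n (k - n)%coq_nat; have -> : (n + (k - n))%coq_nat = k by lia.
    by have := pw k; lra.
  have := mono k (n - k)%coq_nat; have -> : (k + (n - k))%coq_nat = n by lia.
  by have := pw n; lra.
have hb : bound (fun r => exists n, r = u n) by exists (u O + d / 2 ^ O) => r [k ->]; exact: ub.
have [l [l1 l2]] := completeness _ hb (ex_intro _ (u O) (ex_intro _ O erefl)).
exists l => n; split; first by apply: l1; exists n.
by apply: l2 => r [k ->]; apply: ub.
Qed.

(** Bisection concentrates a nonzero integral at a point, where f is affine up to a remainder
    o(|h|). Affine functions integrate to 0 exactly, and the remainder is too small for the lower
    bound K / 4^n. *)
Lemma goursat (f : C -> C) x y a b : Centire f -> 0 <= a -> 0 <= b -> rect_int f x y a b = 0.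
Proof.
move=> H Ha Hb; apply: Cmod_eq_0; apply: Rle_antisym; last exact: Cmod_ge_0.
apply: Rnot_lt_le => HK; set K := Cmod _ in HK.
pose bad n (p : R * R) := K / 4 ^ n <= Cmod (rect_int f (fst p) (snd p) (a / 2 ^ n) (b / 2 ^ n)).
have step n p : bad n p -> exists p', bad (S n) p' /\
    (fst p' = fst p \/ fst p' = fst p + a / 2 ^ (S n)) /\
    (snd p' = snd p \/ snd p' = snd p + b / 2 ^ (S n)).
  have e2 c : c / 2 ^ (S n) = c / 2 ^ n / 2 by rewrite /=; field; apply: pow_nonzero; lra.
  move=> Hbad; have Hb4 : 4 * (K / 4 ^ (S n)) <= Cmod (rect_int f (fst p) (snd p) (a / 2 ^ n) (b / 2 ^ n)).
    by have <- : K / 4 ^ n = 4 * (K / 4 ^ S n) by rewrite /=; field; apply: pow_nonzero; lra.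
  have [x' [y' [h1 [h2 h3]]]] := rect_int_bisect H Hb4.
  by exists (x', y'); rewrite /bad !e2.
have [F HF] : exists F : nat -> R * R, forall n, bad n (F n) /\
    (fst (F (S n)) = fst (F n) \/ fst (F (S n)) = fst (F n) + a / 2 ^ (S n)) /\
    (snd (F (S n)) = snd (F n) \/ snd (F (S n)) = snd (F n) + b / 2 ^ (S n)).
  have b0 : bad O (x, y) by rewrite /bad /= !Rdiv_1_r; exact: Rle_refl.
  (* Dependent choice: the rectangles are built by recursion on corners packed with their proof of
     [bad]. *)
  pose nxt n (q : {p | bad n p}) : {p | bad (S n) p} :=
    let s := constructive_indefinite_description _ (step n _ (proj2_sig q)) in
    exist _ (proj1_sig s) (proj1 (proj2_sig s)).
  pose G := nat_rect (fun n => {p | bad n p}) (exist _ _ b0) nxt.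
  exists (fun n => proj1_sig (G n)) => n; split; first exact: (proj2_sig (G n)).
  rewrite /= /nxt /=.
  by case: (constructive_indefinite_description _ _) => p' [h1 h2] /=.
have e2 c n : c / 2 ^ n = c / 2 ^ (S n) + c / 2 ^ (S n) by rewrite /=; field; apply: pow_nonzero; lra.
have pw c n : 0 <= c -> 0 <= c / 2 ^ n.
  by move=> c0; apply: Rdiv_le_0_compat => //; apply: pow_lt; lra.
have [X HX] : exists l, forall n, fst (F n) <= l <= fst (F n) + a / 2 ^ n.
  apply: (@nested_point (fun n => fst (F n)) a Ha) => n.
  by have [_ [h _]] := HF n; have := e2 a n; have := pw a (S n) Ha; case: h => ->; lra.
have [Y HY] : exists l, forall n, snd (F n) <= l <= snd (F n) + b / 2 ^ n.
  apply: (@nested_point (fun n => snd (F n)) b Hb) => n.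
  by have [_ [_ h]] := HF n; have := e2 b n; have := pw b (S n) Hb; case: h => ->; lra.
set D := a + b + 1.
have Dp : 0 < D by rewrite /D; lra.
have [l Hl] := H (X, Y).
(* Calibrated so that the remainder contributes 8 (K / (32 D^2)) (2 L) L = (K / 2) / 4^n, half of
   what [bad] requires. *)
have ep : 0 < K / (32 * (D * D)) by apply: Rdiv_lt_0_compat => //; nra.
have [d [dp Hd]] := Hl _ ep.
have [n Hn] : exists n, 2 * (D / 2 ^ n) < d.
  have hl : Rabs (/ 2) < 1 by rewrite Rabs_pos_eq; lra.
  have [n Hn] := pow_lt_1_zero (/2) hl (d / (2 * D)) ltac:(apply: Rdiv_lt_0_compat; lra).
  exists n; have := Hn n (Nat.le_refl n); rewrite pow_inv Rabs_pos_eq; last first.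
    by left; apply: Rinv_0_lt_compat; apply: pow_lt; lra.
  move=> h; have -> : d = 2 * (D * (d / (2 * D))) by field; lra.
  by apply: Rmult_lt_compat_l; [lra | apply: Rmult_lt_compat_l].
have p2 : 0 < 2 ^ n by apply: pow_lt; lra.
have [Hbad _] := HF n; have {}HX := HX n; have {}HY := HY n.
rewrite /bad in Hbad.
set x' := fst (F n) in Hbad HX; set y' := snd (F n) in Hbad HY.
set A := a / 2 ^ n in Hbad HX; set B := b / 2 ^ n in Hbad HY.
set L := D / 2 ^ n in Hn.
have AL : 0 <= A <= L.
  by split; [exact: pw | apply: Rmult_le_compat_r; [left; exact: Rinv_0_lt_compat | rewrite /D; lra]].
have BL : 0 <= B <= L.
  by split; [exact: pw | apply: Rmult_le_compat_r; [left; exact: Rinv_0_lt_compat | rewrite /D; lra]].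
pose aff z := (f (X, Y) - l * (X, Y) + l * z)%C.
have Eaff : Centire aff.
  move=> z; apply: Cdiff_plus; first exact: Cdiff_const.
  by apply: Cdiff_mult; [exact: Cdiff_const | exact: Cdiff_id].
pose g z := (f z - aff z)%C.
have Eg : Centire g by move=> z; apply: Cdiff_minus.
have Ef : rect_int f x' y' A B = rect_int g x' y' A B.
  have -> : f = (fun z => g z + aff z)%C by apply: functional_extensionality => z; rewrite /g; ring.
  by rewrite rect_int_plus // rect_int_affine; ring.
rewrite Ef in Hbad.
have Lp : 0 <= L by lra.
have Mp : 0 <= K / (32 * (D * D)) * (2 * L) by apply: Rmult_le_pos; lra.
have bound : Cmod (rect_int g x' y' A B) <= 8 * (K / (32 * (D * D)) * (2 * L) * L).
  apply: rect_int_bound => // s s' Hs Hs'.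
  have hd : Cmod ((s, s') - (X, Y))%C <= 2 * L.
    apply: Rle_trans (Cmod_fst_snd _) _; rewrite /=.
    have : Rabs (s + - X) <= L by apply: Rabs_le; lra.
    have : Rabs (s' + - Y) <= L by apply: Rabs_le; lra.
    lra.
  have := Hd ((s, s') - (X, Y))%C ltac:(lra).
  have -> : ((X, Y) + ((s, s') - (X, Y)))%C = (s, s').
    by rewrite /Cplus /Cminus /Cplus /Copp /=; congr pair; ring.
  have -> : (f (s, s') - f (X, Y) - l * ((s, s') - (X, Y)))%C = g (s, s') by rewrite /g /aff; ring.
  move=> h; apply: Rle_trans h _; apply: Rmult_le_compat_l; lra.
have e4 : 8 * (K / (32 * (D * D)) * (2 * L) * L) = K / 2 / 4 ^ n.
  have -> : 4 ^ n = 2 ^ n * 2 ^ n by rewrite -Rpow_mult_distr; congr pow; ring.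
  by rewrite /L; field; split; lra.
have : 0 < K / 4 ^ n by apply: Rdiv_lt_0_compat => //; apply: pow_lt; lra.
have e5 : K / 2 / 4 ^ n = (K / 4 ^ n) / 2 by field; apply: pow_nonzero; lra.
lra.
Qed.

(** * The exponential and convergence of complex sequences *)

Definition Rder (f : R -> C) (x : R) (l : C) : Prop :=
  is_derive (fun s => fst (f s)) x (fst l) /\ is_derive (fun s => snd (f s)) x (snd l).

Lemma Rder_ext (f g : R -> C) x l l' : (forall s, f s = g s) -> l = l' -> Rder f x l -> Rder g x l'.
Proof.
by move=> E <- [h1 h2]; split; [apply: is_derive_ext h1 | apply: is_derive_ext h2] => s; rewrite E.
Qed.

Lemma Rder_const c x : Rder (fun _ => c) x 0.
Proof. by split; apply: is_derive_const. Qed.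

Lemma Rder_scal_id z x : Rder (fun s => RtoC s * z)%C x z.
Proof. by case: z => a b; split; rewrite /=; auto_derive => //; ring. Qed.

Lemma Rder_plus f g x a b : Rder f x a -> Rder g x b -> Rder (fun s => f s + g s)%C x (a + b)%C.
Proof.
move=> [h1 h2] [h3 h4]; split.
- exact: (@is_derive_plus R_AbsRing R_NormedModule (fun s => fst (f s)) (fun s => fst (g s))).
- exact: (@is_derive_plus R_AbsRing R_NormedModule (fun s => snd (f s)) (fun s => snd (g s))).
Qed.

Lemma Rder_mult f g x a b : Rder f x a -> Rder g x b ->
  Rder (fun s => f s * g s)%C x (a * g x + f x * b)%C.
Proof.
move=> [h1 h2] [h3 h4]; split; rewrite /=.
- evar_last.
    apply: (@is_derive_minus R_AbsRing R_NormedModule (fun s => fst (f s) * fst (g s)) (fun s => snd (f s) * snd (g s))).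
      apply: (@is_derive_mult R_AbsRing (fun s => fst (f s)) (fun s => fst (g s)) x _ _ h1 h3 Rmult_comm).
    apply: (@is_derive_mult R_AbsRing (fun s => snd (f s)) (fun s => snd (g s)) x _ _ h2 h4 Rmult_comm).
  by rewrite /minus /plus /mult /Hierarchy.opp /=; ring.
- evar_last.
    apply: (@is_derive_plus R_AbsRing R_NormedModule (fun s => fst (f s) * snd (g s)) (fun s => snd (f s) * fst (g s))).
      apply: (@is_derive_mult R_AbsRing (fun s => fst (f s)) (fun s => snd (g s)) x _ _ h1 h4 Rmult_comm).
    apply: (@is_derive_mult R_AbsRing (fun s => snd (f s)) (fun s => fst (g s)) x _ _ h2 h3 Rmult_comm).
  by rewrite /plus /mult /=; ring.
Qed.

Lemma Rder_scal f x a c : Rder f x a -> Rder (fun s => c * f s)%C x (c * a)%C.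
Proof.
move=> h; apply: (Rder_ext _ _ (Rder_mult (Rder_const c x) h)) => //; ring.
Qed.

Lemma Rder_opp f x a : Rder f x a -> Rder (fun s => - f s)%C x (- a)%C.
Proof.
by move=> h; apply: (Rder_ext _ _ (Rder_scal (- (1))%C h)) => [s|]; ring.
Qed.

Lemma Rder_pow f x a n : Rder f x a ->
  Rder (fun s => Cpow (f s) (S n)) x (RtoC (INR (S n)) * Cpow (f x) n * a)%C.
Proof.
move=> h; elim: n => [|n IH].
  by apply: (Rder_ext _ _ h) => [s|]; cbn [Cpow INR]; ring.
apply: (Rder_ext _ _ (Rder_mult h IH)) => // .
by rewrite (S_INR (S n)) RtoC_plus; cbn [Cpow]; ring.
Qed.

Lemma Rder_csum (f : nat -> R -> C) x (a : nat -> C) n :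
  (forall i, Rder (f i) x (a i)) -> Rder (fun s => csum (fun i => f i s) n) x (csum a n).
Proof.
move=> H; elim: n => [|n IH] /=; first exact: Rder_const.
exact: Rder_plus.
Qed.

Lemma Rder_Cexp f x a : Rder f x a -> Rder (fun s => Cexp (f s)) x (Cexp (f x) * a)%C.
Proof.
move=> [h1 h2]; split; rewrite /Cexp /=.
- evar_last.
    apply: (@is_derive_mult R_AbsRing (fun s => exp (fst (f s))) (fun s => cos (snd (f s))) x _ _ _ _ Rmult_comm).
      apply: (@is_derive_comp R_AbsRing R_NormedModule exp (fun s => fst (f s))) h1.
      exact: is_derive_exp.
    apply: (@is_derive_comp R_AbsRing R_NormedModule cos (fun s => snd (f s))) h2.
    exact: is_derive_cos.
  by rewrite /plus /mult /scal /= /mult /=; ring.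
- evar_last.
    apply: (@is_derive_mult R_AbsRing (fun s => exp (fst (f s))) (fun s => sin (snd (f s))) x _ _ _ _ Rmult_comm).
      apply: (@is_derive_comp R_AbsRing R_NormedModule exp (fun s => fst (f s))) h1.
      exact: is_derive_exp.
    apply: (@is_derive_comp R_AbsRing R_NormedModule sin (fun s => snd (f s))) h2.
    exact: is_derive_sin.
  by rewrite /plus /mult /scal /= /mult /=; ring.
Qed.

(** Paths in C have no exact mean value theorem; using the real one for each component costs the
    factor 2. *)
Lemma Cmean_value (f f' : R -> C) D :
  (forall s, 0 <= s <= 1 -> Rder f s (f' s) /\ Cmod (f' s) <= D) -> Cmod (f 1 - f 0)%C <= 2 * D.
Proof.
move=> H.
have Q : forall p : C -> R, (forall u : C, Rabs (p u) <= Cmod u) ->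
    (forall s, 0 <= s <= 1 -> is_derive (fun s => p (f s)) s (p (f' s))) ->
    Rabs (p (f 1) - p (f 0)) <= D.
  move=> p Hp Hd.
  have [c [Hc ->]] : exists c, (0 <= c <= 1) /\ p (f 1) - p (f 0) = p (f' c) * (1 - 0).
    have m1 : Rmin 0 1 = 0 by rewrite Rmin_left; lra.
    have m2 : Rmax 0 1 = 1 by rewrite Rmax_right; lra.
    have h1 : forall s, Rmin 0 1 < s < Rmax 0 1 -> is_derive (fun s => p (f s)) s (p (f' s)).
      by rewrite m1 m2 => s hs; apply: Hd; lra.
    have h2 : forall s, Rmin 0 1 <= s <= Rmax 0 1 -> continuity_pt (fun s => p (f s)) s.
      rewrite m1 m2 => s hs; apply/continuity_pt_filterlim.
      by apply: (@ex_derive_continuous R_AbsRing R_NormedModule); exists (p (f' s)); apply: Hd.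
    have [c [e h]] := @MVT_gen (fun s => p (f s)) 0 1 (fun s => p (f' s)) h1 h2.
    by exists c; rewrite m1 m2 in e.
  rewrite Rminus_0_r Rmult_1_r; apply: Rle_trans (Hp _) _.
  by have [_ ] := H c Hc.
have q1 := Q fst (fun u => Rle_trans _ _ _ (Rmax_l _ _) (Rmax_Cmod u)) (fun s hs => (H s hs).1.1).
have q2 := Q snd (fun u => Rle_trans _ _ _ (Rmax_r _ _) (Rmax_Cmod u)) (fun s hs => (H s hs).1.2).
by apply: Rle_trans (Cmod_fst_snd _) _; rewrite /=; rewrite /Rminus in q1 q2; lra.
Qed.

Lemma Cexp_plus z w : Cexp (z + w)%C = (Cexp z * Cexp w)%C.
Proof. by rewrite /Cexp /Cmult /= exp_plus cos_plus sin_plus; congr pair; ring. Qed.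

Lemma Cexp_0 : Cexp 0 = 1.
Proof. by rewrite /Cexp /RtoC /= exp_0 cos_0 sin_0; congr pair; ring. Qed.

Lemma Cmod_Cexp z : Cmod (Cexp z) = exp (fst z).
Proof.
rewrite /Cexp /Cmod /=.
have -> : exp z.1 * cos z.2 * (exp z.1 * cos z.2 * 1) + exp z.1 * sin z.2 * (exp z.1 * sin z.2 * 1)
  = exp z.1 * exp z.1 * (Rsqr (sin z.2) + Rsqr (cos z.2)) by rewrite /Rsqr; ring.
by rewrite sin2_cos2 Rmult_1_r sqrt_square //; left; apply: exp_pos.
Qed.

Lemma fst_le_Cmod z : fst z <= Cmod z.
Proof. by apply: Rle_trans (Rle_abs _) _; apply: re_le_Cmod. Qed.

Lemma Cmod_Cexp_le z : Cmod (Cexp z) <= exp (Cmod z).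
Proof.
rewrite Cmod_Cexp; case: (Rle_lt_or_eq_dec _ _ (fst_le_Cmod z)) => [h|->]; last exact: Rle_refl.
by left; apply: exp_increasing.
Qed.

Definition exp_poly (N : nat) (z : C) : C := csum (fun n => Cpow z n / RtoC (INR (fact n)))%C N.

Lemma csum_S_l (f : nat -> C) n : csum f (S n) = (f O + csum (fun i => f (S i)) n)%C.
Proof.
elim: n => [|n IH]; first by cbn [csum]; ring.
have -> : csum f (S (S n)) = (csum f (S n) + f (S n))%C by [].
by rewrite IH; cbn [csum]; ring.
Qed.

Lemma csum_ext (f g : nat -> C) n : (forall i, (i < n)%N -> f i = g i) -> csum f n = csum g n.
Proof.
elim: n => [//|n IH] H /=; rewrite IH ?H // => i hi; apply: H; lia.
Qed.

Lemma csum_mull c (f : nat -> C) n : csum (fun i => c * f i)%C n = (c * csum f n)%C.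
Proof. by elim: n => [|n IH] /=; [ring | rewrite IH; ring]. Qed.

(** Induction along the segment from 0 to z: the derivative of the remainder of order N + 1 is z
    times the remainder of order N, and each use of [Cmean_value] contributes one factor 2 to (2
    |z|)^N. *)
Lemma Cexp_poly_rem N z : Cmod (Cexp z - exp_poly N z)%C <= (2 * Cmod z) ^ N * exp (Cmod z).
Proof.
elim: N z => [|N IH] z.
  rewrite /exp_poly /= Rmult_1_l; have -> : (Cexp z - 0 = Cexp z)%C by ring.
  exact: Cmod_Cexp_le.
pose f s := (Cexp (RtoC s * z) - exp_poly (S N) (RtoC s * z))%C.
pose f' s := ((Cexp (RtoC s * z) - exp_poly N (RtoC s * z)) * z)%C.
have -> : (Cexp z - exp_poly (S N) z)%C = (f 1 - f 0)%C.
  have z1 : (RtoC 1 * z = z)%C by ring.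
  have z0 : (RtoC 0 * z = 0)%C by ring.
  rewrite /f z1 z0 Cexp_0.
  have -> : exp_poly (S N) 0 = 1.
    rewrite /exp_poly csum_S_l (@csum_ext _ (fun _ => 0 * 0)%C); last first.
      by move=> i _ /=; rewrite /Cdiv; ring.
    by rewrite csum_mull /=; field.
  by ring.
have -> : (2 * Cmod z) ^ S N * exp (Cmod z) = 2 * ((2 * Cmod z) ^ N * exp (Cmod z) * Cmod z) by rewrite /=; ring.
apply: (@Cmean_value f f') => s hs; split.
  apply: (Rder_ext (f := fun s => (Cexp (RtoC s * z) + - csum (fun n => / RtoC (INR (fact n)) * Cpow (RtoC s * z) n) (S N))%C)
     (l := (Cexp (RtoC s * z) * z + - (0 + csum (fun n => / RtoC (INR (fact (S n))) * (RtoC (INR (S n)) * Cpow (RtoC s * z) n * z)) N))%C)).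
  - move=> s'; rewrite /f /exp_poly; congr Cplus; congr Copp; apply: csum_ext => i _; rewrite /Cdiv; ring.
  - rewrite /f' /exp_poly (@csum_ext _ (fun n => z * (Cpow (RtoC s * z) n / RtoC (INR (fact n))))%C); last first.
      move=> i _; rewrite fact_simpl mult_INR RtoC_mult.
      have h1 := INR_fact_neq_0 i; have h2 : INR (S i) <> 0 by apply: not_0_INR.
      have {}h1 : RtoC (INR (fact i)) <> 0 by move=> /RtoC_inj.
      have {}h2 : RtoC (INR (S i)) <> 0 by move=> /RtoC_inj.
      by field; split.
    by rewrite csum_mull; ring.
  - apply: Rder_plus; first exact: (Rder_Cexp (Rder_scal_id z s)).
    apply: Rder_opp.
    apply: (Rder_ext (f := fun s => (RtoC 1 + csum (fun n => / RtoC (INR (fact (S n))) * Cpow (RtoC s * z) (S n)) N)%C)) => [s'||].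
    + by rewrite csum_S_l /=; congr Cplus; field.
    + reflexivity.
    + apply: Rder_plus; first exact: Rder_const.
      by apply: Rder_csum => i; apply: Rder_scal; apply: Rder_pow; exact: Rder_scal_id.
rewrite /f' Cmod_mult; apply: Rmult_le_compat_r; first exact: Cmod_ge_0.
have hle : Cmod (RtoC s * z)%C <= Cmod z.
  rewrite Cmod_mult Cmod_R Rabs_pos_eq; last lra.
  by have := Cmod_ge_0 z; nra.
apply: Rle_trans (IH _) _; apply: Rmult_le_compat.
- by apply: pow_le; have := Cmod_ge_0 (RtoC s * z)%C; lra.
- by left; apply: exp_pos.
- by apply: pow_incr; have := Cmod_ge_0 (RtoC s * z)%C; lra.
- by case: (Rle_lt_or_eq_dec _ _ hle) => [h|->]; [left; apply: exp_increasing | exact: Rle_refl].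
Qed.

Lemma Cexp_second_order h : Cmod (Cexp h - 1 - h)%C <= 4 * (Cmod h * Cmod h) * exp (Cmod h).
Proof.
have := Cexp_poly_rem 2 h.
have -> : (Cexp h - exp_poly 2 h = Cexp h - 1 - h)%C by rewrite /exp_poly /= /Cdiv; field.
by move=> h1; apply: Rle_trans h1 _; apply: Req_le; rewrite /=; ring.
Qed.

Lemma Centire_Cexp : Centire Cexp.
Proof.
move=> z; exists (Cexp z) => eps He.
set K := Cmod (Cexp z) * 4 * exp 1 + 1.
have Kp : 0 < K.
  have h1 := Cmod_ge_0 (Cexp z); have h2 := exp_pos 1.
  by rewrite /K; have := Rmult_le_pos _ _ h1 (Rlt_le _ _ h2); lra.
exists (Rmin 1 (eps / K)); split.
  by apply: Rmin_glb_lt; [lra | apply: Rdiv_lt_0_compat].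
move=> h Hh.
have h1 := Rlt_le_trans _ _ _ Hh (Rmin_l _ _); have h2 := Rlt_le_trans _ _ _ Hh (Rmin_r _ _).
rewrite Cexp_plus; have -> : (Cexp z * Cexp h - Cexp z - Cexp z * h = Cexp z * (Cexp h - 1 - h))%C by ring.
rewrite Cmod_mult.
have hp := Cmod_ge_0 h.
have e1 : exp (Cmod h) <= exp 1 by left; apply: exp_increasing.
have e2 : Cmod (Cexp h - 1 - h)%C <= 4 * (Cmod h * Cmod h) * exp 1.
  by apply: Rle_trans (Cexp_second_order h) _; apply: Rmult_le_compat_l => //; nra.
have e3 : K * Cmod h <= eps.
  have -> : eps = K * (eps / K) by field; lra.
  by apply: Rmult_le_compat_l; lra.
apply: Rle_trans (Rmult_le_compat_l _ _ _ (Cmod_ge_0 _) e2) _.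
have -> : Cmod (Cexp z) * (4 * (Cmod h * Cmod h) * exp 1) = (K - 1) * Cmod h * Cmod h by rewrite /K; ring.
by apply: Rmult_le_compat_r => //; nra.
Qed.

Lemma Cexp_2PI z : Cexp (Cplus z (0, 2 * PI)) = Cexp z.
Proof.
rewrite Cexp_plus; have -> : Cexp (0, 2 * PI) = 1.
  by rewrite /Cexp /= exp_0 cos_2PI sin_2PI /RtoC; congr pair; ring.
by ring.
Qed.

Definition Ccv (x : nat -> C) (l : C) : Prop :=
  forall eps, 0 < eps -> exists N, forall n, (N <= n)%N -> Cmod (x n - l)%C <= eps.

Fixpoint rsum (u : nat -> R) (n : nat) : R :=
  match n with O => 0 | S m => rsum u m + u m end.

Definition summable (u : nat -> R) : Prop :=
  (forall n, 0 <= u n) /\ exists S, forall n, rsum u n <= S.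

Lemma rsum_mono u n m : (forall k, 0 <= u k) -> (n <= m)%N -> rsum u n <= rsum u m.
Proof.
move=> h; elim: m => [|m IH] nm; first by have -> : n = O by [lia]; apply: Rle_refl.
case: (leqP n m) => h1; first by have := IH h1; have := h m; rewrite /=; lra.
by have -> : n = S m by [lia]; apply: Rle_refl.
Qed.

Lemma summable_Cauchy u : summable u -> forall eps, 0 < eps ->
  exists N, forall n m, (N <= n)%N -> (n <= m)%N -> rsum u m - rsum u n <= eps.
Proof.
move=> [h0 [S HS]] eps He.
have hb : bound (fun r => exists n, r = rsum u n).
  exists S. move=> r [n ->]. exact: HS.
have [l [l1 l2]] := completeness _ hb (ex_intro _ (rsum u O) (ex_intro _ O erefl)).
have [N HN] : exists N, l - eps < rsum u N.
  apply: NNPP => hn; have : l <= l - eps; last lra.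
  apply: l2 => r [n ->]; apply: Rnot_lt_le => h; apply: hn; by exists n.
exists N => n m hn nm.
have := rsum_mono h0 hn; have : rsum u m <= l by apply: l1; exists m.
lra.
Qed.

Lemma rsum_telescope (x : nat -> C) u n m : (forall k, Cmod (x (S k) - x k)%C <= u k) ->
  (n <= m)%N -> Cmod (x m - x n)%C <= rsum u m - rsum u n.
Proof.
move=> h; elim: m => [|m IH] nm.
  have -> : n = O by lia.
  by rewrite Rminus_diag; have -> : (x O - x O = 0)%C by [ring]; rewrite Cmod_0; lra.
case: (leqP n m) => h1; last first.
  have -> : n = S m by lia.
  by rewrite Rminus_diag; have -> : (x (S m) - x (S m) = 0)%C by [ring]; rewrite Cmod_0; lra.
have -> : (x (S m) - x n = (x (S m) - x m) + (x m - x n))%C by ring.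
apply: Rle_trans (Cmod_triangle _ _) _.
by have := IH h1; have := h m; rewrite /=; lra.
Qed.

Lemma Ccv_of_Cauchy (x : nat -> C) :
  (forall eps, 0 < eps -> exists N, forall n m, (N <= n)%N -> (N <= m)%N -> Cmod (x m - x n)%C <= eps) ->
  exists l, Ccv x l.
Proof.
move=> H.
have Q : forall p : C -> R, (forall u v : C, Rabs (p u - p v) <= Cmod (u - v)%C) ->
    exists l, Un_cv (fun n => p (x n)) l.
  move=> p Hp; suff : Cauchy_crit (fun n => p (x n)) by move=> /Rcomplete.R_complete [l Hl]; exists l.
  move=> eps He; have [N HN] := H (eps / 2) ltac:(lra).
  exists N => n m hn hm; apply: Rle_lt_trans (Hp _ _) _.
  by apply: Rle_lt_trans (HN m n _ _) _; try lia; lra.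
have [a Ha] := Q fst (fun u v => Rle_trans _ _ _ (Rmax_l _ _) (Rmax_Cmod (u - v)%C)).
have [b Hb] := Q snd (fun u v => Rle_trans _ _ _ (Rmax_r _ _) (Rmax_Cmod (u - v)%C)).
exists (a, b) => eps He.
have [N1 H1] := Ha (eps / 2) ltac:(lra); have [N2 H2] := Hb (eps / 2) ltac:(lra).
exists (N1 + N2)%N => n hn; apply: Rle_trans (Cmod_fst_snd _) _.
have := H1 n ltac:(lia); have := H2 n ltac:(lia).
rewrite /Rdist /Rminus /=; lra.
Qed.

Lemma Ccv_summable (x : nat -> C) u : summable u ->
  (forall k, Cmod (x (S k) - x k)%C <= u k) -> exists l, Ccv x l.
Proof.
move=> Hu H; apply: Ccv_of_Cauchy => eps He.
have [N HN] := summable_Cauchy Hu He; exists N => n m hn hm.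
case: (leqP n m) => nm; first by apply: Rle_trans (rsum_telescope H nm) _; apply: HN.
rewrite Cmod_sub_sym; apply: Rle_trans (rsum_telescope H (ltnW nm)) _; apply: HN => //.
exact: ltnW.
Qed.

Lemma Ccv_unique x l l' : Ccv x l -> Ccv x l' -> l = l'.
Proof.
move=> H1 H2; have : Cmod (l - l')%C <= 0.
  apply: Rnot_lt_le => h.
  have [N1 h1] := H1 (Cmod (l - l')%C / 3) ltac:(lra).
  have [N2 h2] := H2 (Cmod (l - l')%C / 3) ltac:(lra).
  have := h1 (N1 + N2)%N ltac:(lia); have := h2 (N1 + N2)%N ltac:(lia).
  have := Cmod_triangle (l - x (N1 + N2)%N)%C (x (N1 + N2)%N - l')%C.
  have -> : (l - x (N1 + N2)%N + (x (N1 + N2)%N - l') = l - l')%C by ring.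
  have := Cmod_sub_sym l (x (N1 + N2)%N); lra.
move=> h; have e : (l - l' = 0)%C by apply: Cmod_eq_0; have := Cmod_ge_0 (l - l')%C; lra.
have -> : l = ((l - l') + l')%C by ring.
by rewrite e; ring.
Qed.

Lemma Ccv_ext x y l : (forall n, x n = y n) -> Ccv x l -> Ccv y l.
Proof. by move=> e H eps He; have [N HN] := H eps He; exists N => n hn; rewrite -e; apply: HN. Qed.

Lemma Ccv_const c : Ccv (fun _ => c) c.
Proof. by move=> eps He; exists O => n _; have -> : (c - c = 0)%C by [ring]; rewrite Cmod_0; lra. Qed.

Lemma Ccv_bounded x l : Ccv x l -> exists B, forall n, Cmod (x n) <= B.
Proof.
move=> H; have [N HN] := H 1 Rlt_0_1.
have [B HB] : exists B, forall n, (n < N)%N -> Cmod (x n) <= B.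
  elim: {HN}N => [|N [B HB]]; first by exists 0.
  exists (Rmax B (Cmod (x N))) => n hn; case: (ltnP n N) => h.
    by apply: Rle_trans (HB n h) (Rmax_l _ _).
  by have -> : n = N by [lia]; apply: Rmax_r.
exists (Rmax B (1 + Cmod l)) => n; case: (ltnP n N) => h.
  by apply: Rle_trans (HB n h) (Rmax_l _ _).
apply: Rle_trans (Rmax_r _ _); have := Cmod_triangle_sub (x n) l; have := HN n h; lra.
Qed.

Lemma Ccv_plus x y l m : Ccv x l -> Ccv y m -> Ccv (fun n => x n + y n)%C (l + m)%C.
Proof.
move=> H1 H2 eps He; have [N1 h1] := H1 (eps / 2) ltac:(lra); have [N2 h2] := H2 (eps / 2) ltac:(lra).
exists (N1 + N2)%N => n hn.
have -> : (x n + y n - (l + m) = (x n - l) + (y n - m))%C by ring.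
apply: Rle_trans (Cmod_triangle _ _) _.
have := h1 n ltac:(lia); have := h2 n ltac:(lia); lra.
Qed.

Lemma Ccv_mult x y l m : Ccv x l -> Ccv y m -> Ccv (fun n => x n * y n)%C (l * m)%C.
Proof.
move=> H1 H2 eps He; have [B HB] := Ccv_bounded H1.
have B0 : 0 <= B by apply: Rle_trans (HB O); exact: Cmod_ge_0.
set K := B + Cmod m + 1; have Kp : 0 < K by rewrite /K; have := Cmod_ge_0 m; lra.
have ep : 0 < eps / (2 * K) by apply: Rdiv_lt_0_compat; lra.
have [N1 h1] := H1 _ ep; have [N2 h2] := H2 _ ep.
exists (N1 + N2)%N => n hn.
have -> : (x n * y n - l * m = x n * (y n - m) + (x n - l) * m)%C by ring.
apply: Rle_trans (Cmod_triangle _ _) _; rewrite !Cmod_mult.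
have := h1 n ltac:(lia); have := h2 n ltac:(lia) => q2 q1.
have P := Cmod_ge_0.
have e1 : Cmod (x n) * Cmod (y n - m)%C <= K * (eps / (2 * K)).
  by apply: Rmult_le_compat => //; rewrite /K; have := HB n; have := P m; lra.
have e2 : Cmod (x n - l)%C * Cmod m <= (eps / (2 * K)) * K.
  by apply: Rmult_le_compat => //; rewrite /K; lra.
have -> : eps = K * (eps / (2 * K)) + (eps / (2 * K)) * K by field; lra.
lra.
Qed.

Lemma Ccv_scal c x l : Ccv x l -> Ccv (fun n => c * x n)%C (c * l)%C.
Proof. by apply: Ccv_mult; apply: Ccv_const. Qed.

Lemma Ccv_opp x l : Ccv x l -> Ccv (fun n => - x n)%C (- l)%C.
Proof.
move=> /(Ccv_scal (- (1))%C) H.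
have -> : (- l = - (1) * l)%C by ring.
by apply: Ccv_ext H => n; ring.
Qed.

Lemma Ccv_csum (f : nat -> nat -> C) (l : nat -> C) r :
  (forall i, (i < r)%N -> Ccv (fun n => f i n) (l i)) -> Ccv (fun n => csum (fun i => f i n) r) (csum l r).
Proof.
elim: r => [|r IH] H /=; first exact: Ccv_const.
by apply: Ccv_plus; [apply: IH => i hi; apply: H; lia | apply: H].
Qed.

Lemma Ccv_shift x l k : Ccv (fun n => x (n + k)%N) l -> Ccv x l.
Proof.
move=> H eps He; have [N HN] := H eps He; exists (N + k)%N => n hn.
by have -> : n = (n - k + k)%N by [lia]; apply: HN; lia.
Qed.

Lemma Ccv_unshift x l k : Ccv x l -> Ccv (fun n => x (n + k)%N) l.
Proof. by move=> H eps He; have [N HN] := H eps He; exists N => n hn; apply: HN; lia. Qed.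

Lemma filterlim_Ccv (x : nat -> C) l : filterlim x eventually (locally l) <-> Ccv x l.
Proof.
split.
- move=> /filterlim_locally H eps He.
  have [N HN] := H (mkposreal (eps / 2) ltac:(lra)).
  exists N => n hn; have /= := Cmod_ball_C (HN n ltac:(lia)); lra.
- move=> H; apply/filterlim_locally => eps.
  have [N HN] := H (eps / 2) ltac:(have := cond_pos eps; lra).
  exists N => n hn; apply: ball_C_Cmod.
  by apply: Rle_lt_trans (HN n ltac:(lia)) _; have := cond_pos eps; lra.
Qed.

(** * Convergence at the centre of a circle *)

Definition circle_pt (c : C) (r th : R) : C := (c + RtoC r * Cexp (0, th))%C.

Lemma Cexp_polar x y : Cexp (x, y) = (RtoC (exp x) * Cexp (0, y))%C.
Proof. by rewrite /Cexp /Cmult /RtoC /= exp_0; congr pair; ring. Qed.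

Lemma Cmod_circle c r th : 0 <= r -> Cmod (circle_pt c r th - c)%C = r.
Proof.
move=> h; have -> : (circle_pt c r th - c = RtoC r * Cexp (0, th))%C by rewrite /circle_pt; ring.
by rewrite Cmod_mult Cmod_R Cmod_Cexp /= exp_0 Rabs_pos_eq //; ring.
Qed.

(* In logarithmic coordinates [w -> c + exp w] the circles about [c] become the
   vertical segments of a 2 pi i-periodic entire function, so Goursat's theorem on
   rectangles makes the circular mean independent of the radius. *)
Lemma max_center (g : C -> C) c r B : Centire g -> 0 < r ->
  (forall th, Cmod (g (circle_pt c r th)) <= B) -> Cmod (g c) <= 2 * B.
Proof.
move=> H rp HB.
pose h w := g (c + Cexp w)%C.
have Eh : Centire h.
  move=> w; apply: (@Cdiff_comp g (fun w => c + Cexp w)%C); first exact: H.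
  by apply: Cdiff_plus; [exact: Cdiff_const | exact: Centire_Cexp].
have pp := PI_RGT_0.
(* A quarter of the supposed excess over 2 B, so that |g c| <= 2 B + 2 eps is already absurd. *)
apply: Rnot_lt_le => hlt; set eps := (Cmod (g c) - 2 * B) / 4.
have ep : 0 < eps by rewrite /eps; lra.
have [d [dp Hd]] := Cdiff_cont (H c) ep.
(* Below ln r, and with exp x0 < d, so that on the left edge [h] stays within eps of g c. *)
pose x0 := Rmin (ln r - 1) (ln d - 1).
have x0r : x0 <= ln r - 1 by exact: Rmin_l.
have x0d : exp x0 < d.
  apply: Rlt_le_trans (exp_increasing _ (ln d) _) _; last by rewrite exp_ln //; apply: Rle_refl.
  by have := Rmin_r (ln r - 1) (ln d - 1); rewrite -/x0; lra.
have G := @goursat h x0 0 (ln r - x0) (2 * PI) Eh ltac:(lra) ltac:(lra).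
rewrite /rect_int in G.
have e1 : x0 + (ln r - x0) = ln r by ring.
rewrite e1 !Rplus_0_l in G.
have e2 : Cint (fun s => h (s, 2 * PI)) x0 (ln r) = Cint (fun s => h (s, 0)) x0 (ln r).
  congr Cint; apply: functional_extensionality => s; rewrite /h -(Cexp_2PI (s, 0)).
  by congr (g (c + Cexp _))%C; rewrite /Cplus /=; congr pair; ring.
rewrite e2 in G.
set I1 := Cint (fun s => h (ln r, s)) 0 (2 * PI) in G.
set I0 := Cint (fun s => h (x0, s)) 0 (2 * PI) in G.
have e3 : I1 = I0.
  have -> : I1 = (I0 + (- Ci) * (Cint (fun s => h (s, 0)) x0 (ln r) + Ci * I1 - Cint (fun s => h (s, 0)) x0 (ln r) - Ci * I0))%C.
    have i2 : (Ci * Ci = - (1))%C by rewrite /Cmult /Copp /RtoC /=; congr pair; ring.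
    have -> : (- Ci * (Cint (fun s => h (s, 0)) x0 (ln r) + Ci * I1 - Cint (fun s => h (s, 0)) x0 (ln r) - Ci * I0) = (Ci * Ci) * (I0 - I1))%C by ring.
    by rewrite i2; ring.
  by rewrite G; ring.
have b1 : Cmod I1 <= 2 * (B * (2 * PI - 0)).
  apply: Cint_bound; [lra | exact: Centire_vert | move=> s _].
  by have := HB s; rewrite /h Cexp_polar exp_ln.
have b0 : Cmod (I0 - RtoC (2 * PI) * g c)%C <= 2 * (eps * (2 * PI - 0)).
  pose k s := (h (x0, s) + - g c)%C.
  have Hk : Rcont k.
    apply: (@Centire_Rcont (fun w => h w + - g c)%C (fun s => (x0, s))).
      by move=> w; apply: Cdiff_plus; [exact: Eh | exact: Cdiff_const].
    move=> y e he; exists e; split=> // s hs.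
    have -> : ((x0, s) - (x0, y))%C = (Ci * RtoC (s - y))%C by rewrite /Cminus /Cplus /Copp /Cmult /RtoC /=; congr pair; ring.
    by rewrite Cmod_mult Cmod_Ci Cmod_R Rmult_1_l.
  have -> : (I0 - RtoC (2 * PI) * g c)%C = Cint k 0 (2 * PI).
    have Hc : Rcont (fun _ => - g c)%C by move=> s; split; apply: continuous_const.
    rewrite /k (@Cint_plus (fun s => h (x0, s)) (fun _ => - g c)%C) //; last exact: Centire_vert.
    congr Cplus; rewrite /Cint /Copp /Cmult /RtoC /= !RInt_const /scal /= /mult /=; congr pair; ring.
  apply: Cint_bound => //; first lra.
  move=> s _; rewrite /k /h Cexp_polar; apply: Hd.
  by rewrite Cmod_mult Cmod_R Cmod_Cexp /= exp_0 Rmult_1_r Rabs_pos_eq //; left; apply: exp_pos.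
have b2 : Cmod (RtoC (2 * PI) * g c)%C = 2 * PI * Cmod (g c).
  by rewrite Cmod_mult Cmod_R Rabs_pos_eq //; lra.
have b3 : 2 * PI * Cmod (g c) <= 2 * (B * (2 * PI)) + 2 * (eps * (2 * PI)).
  rewrite -b2; have -> : (RtoC (2 * PI) * g c)%C = (I1 + - (I0 - RtoC (2 * PI) * g c))%C by rewrite e3; ring.
  apply: Rle_trans (Cmod_triangle _ _) _; rewrite Cmod_opp.
  by rewrite Rminus_0_r in b1, b0; lra.
have b4 : Cmod (g c) <= 2 * B + 2 * eps.
  by apply: (Rmult_le_reg_l (2 * PI)); [lra | apply: Rle_trans b3 _; apply: Req_le; ring].
by rewrite /eps in b4; lra.
Qed.

(** Continuity on a compact interval of angles. [vitali_center] takes T = 4 pi because angles in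
    [0, 2 pi] are turned there by up to 3 pi / 2. *)
Lemma Centire_circle_bounded (f : C -> C) c r T : Centire f -> 0 <= T -> 0 <= r ->
  exists B, forall th, 0 <= th <= T -> Cmod (f (circle_pt c r th)) <= B.
Proof.
move=> H T0 r0.
have Hc : forall th, 0 <= th <= T -> continuity_pt (fun th => Cmod (f (circle_pt c r th))) th.
  move=> th _ eps He.
  have [d [dp Hd]] := Cdiff_cont (H (circle_pt c r th)) (eps := eps / 2) ltac:(lra).
  have [d2 [d2p Hd2]] := Cdiff_cont (Centire_Cexp (0, th)) (eps := d / (2 * (r + 1)))
    ltac:(apply: Rdiv_lt_0_compat; lra).
  suff Hs : forall s : R, Rabs (s - th) < d2 ->
      Rabs (Cmod (f (circle_pt c r s)) - Cmod (f (circle_pt c r th))) < eps.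
    by exists d2; split=> // s [_ hs]; apply: Hs.
  move=> s hs.
  have hq : Cmod (circle_pt c r s - circle_pt c r th)%C < d.
    have -> : (circle_pt c r s - circle_pt c r th)%C = (RtoC r * (Cexp ((0, th) + (0, Rminus s th)) - Cexp (0, th)))%C.
      have -> : Cexp ((0, th) + (0, Rminus s th))%C = Cexp (0, s).
        by congr Cexp; rewrite /Cplus /=; congr pair; ring.
      by rewrite /circle_pt; ring.
    rewrite Cmod_mult Cmod_R Rabs_pos_eq //.
    have := Hd2 (0, Rminus s th) _.
    have -> : Cmod (0, Rminus s th) = Rabs (s - th).
      have -> : (0, Rminus s th) = (Ci * RtoC (s - th))%C by rewrite /Cmult /=; congr pair; ring.
      by rewrite Cmod_mult Cmod_R Cmod_Ci; ring.
    move=> /(_ hs) h1.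
    have h2 : (r + 1) * (d / (2 * (r + 1))) = d / 2 by field; lra.
    have h3 := Rmult_le_compat_l _ _ _ r0 h1.
    have h4 : 0 < d / (2 * (r + 1)) by apply: Rdiv_lt_0_compat; lra.
    lra.
  have := Hd _ hq; have -> : (circle_pt c r th + (circle_pt c r s - circle_pt c r th) = circle_pt c r s)%C by ring.
  have := Cmod_triangle_sub (f (circle_pt c r s)) (f (circle_pt c r th)).
  have := Cmod_triangle_sub (f (circle_pt c r th)) (f (circle_pt c r s)).
  rewrite (Cmod_sub_sym (f (circle_pt c r th))) => h1 h2 h3.
  by apply: Rle_lt_trans (_ : _ <= eps / 2) _; [apply: Rabs_le; lra | lra].
have [M [HM _]] := continuity_ab_maj _ _ _ T0 Hc.
by exists (Cmod (f (circle_pt c r M))) => th hth; apply: HM.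
Qed.

Lemma Cexp_rot k th : Cexp (0, th + INR k * (PI / 2)) = (Cpow Ci k * Cexp (0, th))%C.
Proof.
elim: k => [|k IH]; first by rewrite /= Rmult_0_l Rplus_0_r; ring.
rewrite S_INR; have -> : (0, th + (INR k + 1) * (PI / 2)) = Cplus (0, th + INR k * (PI / 2)) (0, PI / 2).
  by rewrite /Cplus /=; congr pair; ring.
rewrite Cexp_plus IH; have -> : Cexp (0, PI / 2) = Ci by rewrite /Cexp /= exp_0 cos_PI2 sin_PI2 /Ci; congr pair; ring.
by cbn [Cpow]; ring.
Qed.

(** The four cosines are cos, -sin, -cos and sin of th, and one of them is at least 1 / sqrt 2. The
    weaker threshold 1/2 matches the arc Re (z - c) >= r / 2 of [vitali_center]. *)
Lemma some_rotation_in_arc (th : R) : exists k, (k < 4)%N /\ / 2 <= cos (th + INR k * (PI / 2)).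
Proof.
have c1 : cos (th + INR 1 * (PI / 2)) = - sin th.
  by rewrite /= Rmult_1_l cos_plus cos_PI2 sin_PI2; ring.
have c2 : cos (th + INR 2 * (PI / 2)) = - cos th.
  have -> : INR 2 * (PI / 2) = PI by rewrite /=; field.
  by rewrite cos_plus cos_PI sin_PI; ring.
have c3 : cos (th + INR 3 * (PI / 2)) = sin th.
  have -> : INR 3 * (PI / 2) = PI + PI / 2 by rewrite /=; field.
  by rewrite -Rplus_assoc cos_plus cos_PI2 sin_PI2 sin_plus cos_PI sin_PI; ring.
have s := sin2_cos2 th; rewrite /Rsqr in s.
case: (Rle_dec (/2) (cos th)) => h0; first by exists O; rewrite /= Rmult_0_l Rplus_0_r.
case: (Rle_dec (/2) (- sin th)) => h1; first by exists 1%N; rewrite c1.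
case: (Rle_dec (/2) (- cos th)) => h2; first by exists 2%N; rewrite c2.
case: (Rle_dec (/2) (sin th)) => h3; first by exists 3%N; rewrite c3.
exfalso; nra.
Qed.

Lemma rsum_ge0 u n : (forall k, 0 <= u k) -> 0 <= rsum u n.
Proof. by move=> h; elim: n => [|n IH] /=; [lra | have := h n; lra]. Qed.

(* A two-constants argument: the product of the four quarter-turn rotates of
   [F - E n] about [c] is small on the whole circle because one factor always
   lies on the arc, hence it is small at [c], where it equals [(F c - E n c)^4]. *)
Lemma vitali_center (F : C -> C) (E : nat -> C -> C) c r u :
  Centire F -> (forall n, Centire (E n)) -> 0 < r -> summable u ->
  (forall n z, Cmod (z - c)%C = r -> Cmod (E (S n) z - E n z)%C <= u n) ->
  (forall z, Cmod (z - c)%C = r -> r / 2 <= fst (z - c)%C -> Ccv (fun n => E n z) (F z)) ->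
  Ccv (fun n => E n c) (F c).
Proof.
move=> HF HE rp Hu Hinc Harc.
have pp := PI_RGT_0.
have [u0 [US HUS]] := Hu.
have [BF HBF] := @Centire_circle_bounded F c r (4 * PI) HF ltac:(lra) ltac:(lra).
have [BE HBE] := @Centire_circle_bounded (E O) c r (4 * PI) (HE O) ltac:(lra) ltac:(lra).
have US0 : 0 <= US by apply: Rle_trans (HUS O); apply: Rle_refl.
have onc th : Cmod (circle_pt c r th - c)%C = r by apply: Cmod_circle; lra.
(* K bounds |F - E n| on the whole circle for every n: bounds of F and of E 0 plus the total
   increment. *)
set K := 1 + Rabs BF + Rabs BE + US.
have Kp : 1 <= K by rewrite /K; have := Rabs_pos BF; have := Rabs_pos BE; lra.
have HD n th : 0 <= th <= 4 * PI -> Cmod (F (circle_pt c r th) - E n (circle_pt c r th))%C <= K.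
  move=> hth; set z := circle_pt c r th.
  have h1 := rsum_telescope (x := fun n => E n z) (u := u) (fun k => Hinc k z (onc th)) (leq0n n).
  have -> : (F z - E n z = F z + - (E n z - E O z) + - E O z)%C by ring.
  apply: Rle_trans (Cmod_triangle _ _) _.
  apply: Rle_trans (Rplus_le_compat_r _ _ _ (Cmod_triangle _ _)) _; rewrite !Cmod_opp.
  have := HBF th hth; have := HBE th hth; have := HUS n; have := Rle_abs BF; have := Rle_abs BE.
  by rewrite /= in h1; rewrite /K -/z; lra.
move=> eps He.
(* Of the four factors three are at most K and one at most e4; with the factor 2 of [max_center]
   this gives 2 e4 K^3 = eps^4. *)
set e4 := eps ^ 4 / (2 * K ^ 3).
have K3 : 0 < K ^ 3 by apply: pow_lt; lra.
have e4p : 0 < e4 by apply: Rdiv_lt_0_compat; [apply: pow_lt | lra].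
have [N HN] := summable_Cauchy Hu e4p.
exists N => n hn.
have small th : / 2 <= cos th -> Cmod (F (circle_pt c r th) - E n (circle_pt c r th))%C <= e4.
  move=> hc; set z := circle_pt c r th.
  have ha : r / 2 <= fst (z - c)%C.
    have -> : fst (z - c)%C = r * cos th by rewrite /z /circle_pt /Cexp /= exp_0; ring.
    by nra.
  apply: Rle_plus_epsilon => d dp.
  have [M HM] := Harc z (onc th) ha d dp.
  have -> : (F z - E n z = - (E (n + M)%N z - F z) + (E (n + M)%N z - E n z))%C by ring.
  apply: Rle_trans (Cmod_triangle _ _) _; rewrite Cmod_opp.
  have h1 := rsum_telescope (x := fun n => E n z) (u := u) (fun k => Hinc k z (onc th)) (leq_addr M n).
  have h2 := HN n (n + M)%N hn (leq_addr _ _).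
  by have := HM (n + M)%N ltac:(lia); lra.
pose rot k z := (c + Cpow Ci k * (z - c))%C.
pose g z := (((F (rot 0%N z) - E n (rot 0%N z)) * (F (rot 1%N z) - E n (rot 1%N z))) *
  ((F (rot 2%N z) - E n (rot 2%N z)) * (F (rot 3%N z) - E n (rot 3%N z))))%C.
have Eg : Centire g.
  have Er k : Centire (fun z => F (rot k z) - E n (rot k z))%C.
    have Erot : Centire (rot k).
      move=> z; apply: Cdiff_plus; first exact: Cdiff_const.
      apply: Cdiff_mult; first exact: Cdiff_const.
      by apply: Cdiff_minus; [exact: Cdiff_id | exact: Cdiff_const].
    move=> z; apply: Cdiff_minus.
      by apply: (@Cdiff_comp F (rot k)); [exact: HF | exact: Erot].
    by apply: (@Cdiff_comp (E n) (rot k)); [exact: HE | exact: Erot].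
  by move=> z; apply: Cdiff_mult; apply: Cdiff_mult; apply: Er.
have rotc k th : rot k (circle_pt c r th) = circle_pt c r (th + INR k * (PI / 2)).
  by rewrite /rot /circle_pt Cexp_rot; ring.
(* The bound by K is known for angles up to 4 pi, so the angle is first reduced to [0, 2 pi]. *)
have per th : exists th', (0 <= th' <= 2 * PI) /\ Cexp (0, th') = Cexp (0, th).
  pose m := Int_part (th / (2 * PI)).
  exists (th - IZR m * (2 * PI)); split.
    have [h1 h2] := base_Int_part (th / (2 * PI)); rewrite -/m in h1 h2.
    have e : th = th / (2 * PI) * (2 * PI) by field; lra.
    by rewrite e; nra.
  have per1 x k : Cexp (0, x + INR k * (2 * PI)) = Cexp (0, x).
    elim: k => [|k IH]; first by rewrite /= Rmult_0_l Rplus_0_r.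
    rewrite -IH -(Cexp_2PI (0, x + INR k * (2 * PI))) S_INR; congr Cexp.
    by rewrite /Cplus /=; congr pair; ring.
  case: (Z.le_gt_cases 0 m) => hm.
    rewrite -(per1 (th - IZR m * (2 * PI)) (Z.to_nat m)) INR_IZR_INZ Z2Nat.id //.
    by congr (Cexp (_, _)); ring.
  rewrite -(per1 th (Z.to_nat (- m))) INR_IZR_INZ Z2Nat.id; last lia.
  by rewrite opp_IZR; congr (Cexp (_, _)); ring.
have Hg : Cmod (g c) <= 2 * (e4 * K ^ 3).
  apply: (@max_center g c r) => // th0.
  have [th [hth eth]] := per th0.
  have -> : circle_pt c r th0 = circle_pt c r th by rewrite /circle_pt eth.
  rewrite /g !Cmod_mult !rotc.
  set D := fun k => Cmod (F (circle_pt c r (th + INR k * (PI / 2))) - E n (circle_pt c r (th + INR k * (PI / 2))))%C.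
  have Dk k : (k < 4)%N -> 0 <= D k <= K.
    move=> hk; split; first exact: Cmod_ge_0.
    apply: HD; have hk3 : INR k <= 3.
      by have -> : 3 = INR 3 by [rewrite /=; ring]; apply: le_INR; lia.
    have := pos_INR k; nra.
  change (D 0%N * D 1%N * (D 2%N * D 3%N) <= e4 * K ^ 3).
  have d0 := Dk 0%N isT; have d1 := Dk 1%N isT; have d2 := Dk 2%N isT; have d3 := Dk 3%N isT.
  have three a b c0 d : 0 <= a <= e4 -> 0 <= b <= K -> 0 <= c0 <= K -> 0 <= d <= K ->
      a * (b * (c0 * d)) <= e4 * K ^ 3.
    move=> [a0 a1] [b0 b1] [c1 c2] [q0 q1].
    apply: Rmult_le_compat => //; first by apply: Rmult_le_pos => //; apply: Rmult_le_pos.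
    have -> : K ^ 3 = K * (K * K) by ring.
    apply: Rmult_le_compat => //; first by apply: Rmult_le_pos.
    by apply: Rmult_le_compat.
  have [k [hk hc]] := some_rotation_in_arc th.
  have sk := small _ hc; rewrite -/(D k) in sk.
  move: hk sk; case: k hc => [|[|[|[|k]]]] hc hk sk; last by lia.
  - have := three (D 0%N) (D 1%N) (D 2%N) (D 3%N) ltac:(lra) d1 d2 d3; lra.
  - have := three (D 1%N) (D 0%N) (D 2%N) (D 3%N) ltac:(lra) d0 d2 d3; lra.
  - have := three (D 2%N) (D 0%N) (D 1%N) (D 3%N) ltac:(lra) d0 d1 d3; lra.
  - have := three (D 3%N) (D 0%N) (D 1%N) (D 2%N) ltac:(lra) d0 d1 d2; lra.
have rc k : rot k c = c by rewrite /rot; ring.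
have e5 : Cmod (g c) = Cmod (E n c - F c)%C ^ 4.
  by rewrite /g !rc !Cmod_mult (Cmod_sub_sym (E n c)); ring.
rewrite e5 in Hg.
apply: Rnot_lt_le => hlt.
have : eps ^ 4 < Cmod (E n c - F c)%C ^ 4.
  apply: Rlt_le_trans (_ : eps ^ 3 * Cmod (E n c - F c)%C <= _).
    have -> : eps ^ 4 = eps ^ 3 * eps by ring.
    by apply: Rmult_lt_compat_l => //; apply: pow_lt.
  have -> : Cmod (E n c - F c)%C ^ 4 = Cmod (E n c - F c)%C ^ 3 * Cmod (E n c - F c)%C by ring.
  by apply: Rmult_le_compat_r; [exact: Cmod_ge_0 | apply: pow_incr; lra].
have : 2 * (e4 * K ^ 3) = eps ^ 4 by rewrite /e4; field; lra.
lra.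
Qed.

(** The identity theorem for a half-plane, from [vitali_center] with the zero sequence: the radius
    is so large that the right arc of the circle about c lies in Re z >= A. *)
Lemma Centire_identity (F : C -> C) A : Centire F -> (forall z, A <= fst z -> F z = 0) -> forall c, F c = 0.
Proof.
move=> HF H c; apply: esym.
set r := 2 * (Rabs A + Rabs (fst c) + 1).
have rp : 0 < r by rewrite /r; have := Rabs_pos A; have := Rabs_pos (fst c); lra.
have Hu : summable (fun _ => 0).
  by split=> [_|]; [lra | exists 0; elim=> [|n IH] /=; lra].
have := @vitali_center F (fun _ _ => 0) c r (fun _ => 0) HF (fun _ _ => Cdiff_const _ _) rp Hu.
move=> H1; apply: (Ccv_unique (x := fun _ => RtoC 0)); first exact: Ccv_const.
apply: H1.
- by move=> n z _; have -> : (0 - 0 = 0)%C by [ring]; rewrite Cmod_0; lra.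
- move=> z _ hz; rewrite H; first exact: Ccv_const.
  rewrite /= in hz; rewrite /r in hz.
  by have := Rle_abs A; have := Rle_abs (- fst c); rewrite Rabs_Ropp; lra.
Qed.

(** * Two-sided nested sums *)

Lemma csumS (f : nat -> C) n : csum f n.+1 = (csum f n + f n)%C.
Proof. by []. Qed.

Definition wt := nat -> C.
(** One entry of an index, as its two weight sequences: at the chain element n before infinity and
    at t - n after it. *)
Definition node := (wt * wt)%type.

(** The outermost, hence largest, n comes first. Before infinity this is the last variable, so left
    halves enter reversed; after infinity it is the first one, as t - n increases when n
    decreases. *)
Fixpoint nest (l : seq wt) (N : nat) : C :=
  match l with
  | [::] => RtoC 1
  | f :: l' => csum (fun n => f n * nest l' n)%C N
  end.

(** All ways to cut an index into a part before and a part after infinity; [L] is the left part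
    already passed, in reversed order. *)
Fixpoint zs (L R : seq node) (N : nat) : C :=
  (nest (map fst L) N * nest (map snd R) N +
   match R with [::] => 0 | x :: R' => zs (x :: L) R' N end)%C.

(** The cuts of [zs] that leave at least one entry of [X], and all of [R], on the right. *)
Fixpoint zp (L X R : seq node) (N : nat) : C :=
  match X with
  | [::] => 0
  | x :: X' => (nest (map fst L) N * nest (map snd (X ++ R)) N + zp (x :: L) X' R N)%C
  end.

Lemma zs_cat L X R N : zs L (X ++ R) N = (zp L X R N + zs (rev X ++ L) R N)%C.
Proof.
elim: X L => [|x X IH] L; first by rewrite /=; ring.
by rewrite rev_cons cat_rcons cat_cons; cbn [zs zp]; rewrite IH cat_cons; ring.
Qed.

Lemma zs_csum L R N : zs L R N =
  csum (fun i => nest (map fst (rev (take i R) ++ L)) N * nest (map snd (drop i R)) N)%C (size R).+1.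
Proof.
elim: R L => [|x R IH] L; first by rewrite /= /rev /=; ring.
rewrite csum_S_l; cbn [zs]; rewrite IH; congr Cplus.
apply: csum_ext => i _; congr Cmult; congr nest; congr map.
by rewrite [take i.+1 _]/= rev_cons cat_rcons.
Qed.

(** The loops start at n = 0, which is no chain element. Weights vanish there, so identities
    involving n - 1 are needed for n > 0 only. *)
Definition z0 (f : wt) : Prop := f O = 0.

Lemma csum_lin3 (x y z : nat -> C) c N :
  (forall n, (n < N)%N -> x n = (y n - c * z n)%C) ->
  csum x N = (csum y N - c * csum z N)%C.
Proof.
elim: N => [|N IH] H /=; first by ring.
rewrite IH ?H //; first by ring.
by move=> n hn; apply: H; lia.
Qed.

Lemma nest_cat_lin (Y l l' l'' : seq wt) c :
  (forall N, nest l N = (nest l' N - c * nest l'' N)%C) ->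
  forall N, nest (Y ++ l) N = (nest (Y ++ l') N - c * nest (Y ++ l'') N)%C.
Proof.
move=> H; elim: Y => [|f Y IH] N; first exact: H.
by rewrite /=; apply: csum_lin3 => n _; rewrite IH; ring.
Qed.

Lemma nest_cat_lin' (Y : seq wt) y l l' l'' c : z0 y ->
  (forall N, (0 < N)%N -> nest l N = (nest l' N - c * nest l'' N)%C) ->
  forall N, nest (Y ++ y :: l) N = (nest (Y ++ y :: l') N - c * nest (Y ++ y :: l'') N)%C.
Proof.
move=> y0 H; apply: nest_cat_lin => N /=; apply: csum_lin3 => -[|n] _.
  by rewrite y0; ring.
by rewrite H //; ring.
Qed.

Section Telescope.

Variables (gp gm : wt).

(** [gp n] and [gm n] are the values of one function g at n and at t - n. The successor of t - n is
    t - (n - 1), so both weights are g(successor) - g(element). *)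
Definition om_p : wt := fun n => if n == O then RtoC 0 else (gp n.+1 - gp n)%C.
Definition om_m : wt := fun n => if n == O then RtoC 0 else (gm n.-1 - gm n)%C.
Definition om : node := (om_p, om_m).

(** Upper end of the telescoped sum: g at the next variable or, after the last one, g at the end t
    of the chain. *)
Definition mul_right (l2 : seq node) : C * seq node :=
  match l2 with
  | [::] => (gm O, [::])
  | y :: R => (RtoC 1, (fun n => y.1 n * gp n, fun n => y.2 n * gm n)%C :: R)
  end.

Definition shifted (f : node) : node := (fun n => f.1 n * gp n.+1, fun n => f.2 n * gm n.-1)%C.

(** Lower end of the telescoped sum: g at the successor of the preceding variable ([shifted]) or, if
    there is none, g at the first element 1. *)
Definition mul_left (l1 : seq node) : C * seq node :=
  match rev l1 with
  | [::] => (gp 1%N, [::])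
  | f :: L => (RtoC 1, rcons (rev L) (shifted f))
  end.

Lemma mul_left_nil : mul_left [::] = (gp 1%N, [::]).
Proof. by []. Qed.

Lemma mul_left_rcons l f : mul_left (rcons l f) = (RtoC 1, rcons l (shifted f)).
Proof. by rewrite /mul_left rev_rcons revK. Qed.

(** A telescoped variable that comes last before the cut stops at N instead of a next variable. Its
    boundary value [gp N] is compensated in [zs_telescope]. *)
Lemma nest_om_p (l1 : seq node) N : (0 < N)%N ->
  nest (om_p :: map fst (rev l1)) N =
  (gp N * nest (map fst (rev l1)) N - (mul_left l1).1 * nest (map fst (rev (mul_left l1).2)) N)%C.
Proof.
case/lastP: l1 => [|l f] hN.
  rewrite mul_left_nil /=; elim: N hN => [//|[|N] IH] _; first by rewrite /om_p /=; ring.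
  by rewrite csumS IH // /om_p /=; ring.
rewrite mul_left_rcons !rev_rcons /=.
elim: N {hN} => [|N IH]; first by cbn [csum]; ring.
rewrite !csumS IH /om_p; case: N {IH} => [|N] /=; ring.
Qed.

Lemma nest_om_m (l2 : seq node) N : (0 < N)%N ->
  nest (om_m :: map snd l2) N =
  ((mul_right l2).1 * nest (map snd (mul_right l2).2) N - gm N.-1 * nest (map snd l2) N)%C.
Proof.
case: l2 => [|y R] hN.
  rewrite /=; elim: N hN => [//|[|N] IH] _; first by rewrite /om_m /=; ring.
  by rewrite csumS IH // /om_m /=; ring.
rewrite /=; elim: N {hN} => [|N IH]; first by cbn [csum]; ring.
rewrite !csumS IH /om_m; case: N {IH} => [|N] /=; ring.
Qed.

(** When the cut lies beyond the variable y following the telescoped one, both ends are interior and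
    no boundary value arises. *)
Lemma zs_om_left (y : node) l1 : z0 y.1 -> forall R Y N,
  zs (Y ++ y :: om :: rev l1) R N =
  (zs (Y ++ (fun n => y.1 n * gp n, fun n => y.2 n * gm n)%C :: rev l1) R N
   - (mul_left l1).1 * zs (Y ++ y :: rev (mul_left l1).2) R N)%C.
Proof.
move=> hy; elim=> [|x R IH] Y N; cbn [zs]; last first.
  rewrite -!cat_cons IH.
  set Q := nest (map fst (Y ++ y :: om :: rev l1)) N.
  have -> : Q = (nest (map fst (Y ++ (fun n => y.1 n * gp n, fun n => y.2 n * gm n)%C :: rev l1)) N
      - (mul_left l1).1 * nest (map fst (Y ++ y :: rev (mul_left l1).2)) N)%C; last by ring.
  rewrite /Q !map_cat; apply: nest_cat_lin => M /=; apply: csum_lin3 => -[|n] _.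
    by rewrite hy; ring.
  by have := nest_om_p l1 (ltn0Sn n); cbn [nest] => ->; ring.
rewrite !Cplus_0_r !Cmult_1_r !map_cat; apply: nest_cat_lin => M /=; apply: csum_lin3 => -[|n] _.
  by rewrite hy; ring.
by have := nest_om_p l1 (ltn0Sn n); cbn [nest] => ->; ring.
Qed.

(** The mirror case: the preceding variable f is already on the right of the cut. *)
Lemma zp_om_right l2 X f : z0 f.2 -> forall M N,
  zp M (rcons X f) (om :: l2) N =
  ((mul_right l2).1 * zp M (rcons X f) (mul_right l2).2 N - zp M (rcons X (shifted f)) l2 N)%C.
Proof.
move=> hf M N.
have key X0 : nest (map snd (rcons X0 f ++ om :: l2)) N =
  ((mul_right l2).1 * nest (map snd (rcons X0 f ++ (mul_right l2).2)) N
    - nest (map snd (rcons X0 (shifted f) ++ l2)) N)%C.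
  rewrite !cat_rcons !map_cat.
  have H n : nest (f.2 :: om_m :: map snd l2) n =
      ((mul_right l2).1 * nest (f.2 :: map snd (mul_right l2).2) n - nest ((shifted f).2 :: map snd l2) n)%C.
    rewrite -[nest ((shifted f).2 :: _) n]Cmult_1_l; cbn [nest].
    rewrite -csum_mull; apply: csum_lin3 => -[|k] _.
      by rewrite /shifted /= hf; ring.
    have := nest_om_m l2 (ltn0Sn k); cbn [nest] => ->.
    change ((shifted f).2 k.+1) with (f.2 k.+1 * gm k)%C; change (k.+1.-1) with k.
    ring.
  have {H} : forall n, nest (map snd (f :: om :: l2)) n =
    ((mul_right l2).1 * nest (map snd (f :: (mul_right l2).2)) n - nest (map snd (shifted f :: l2)) n)%C := H.
  move: (map snd (f :: om :: l2)) (map snd (f :: _)) (map snd (shifted f :: l2)) => A B D H.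
  elim: (map snd X0) N => [|g Y IH] N; first exact: H.
  rewrite -[nest ((g :: Y) ++ D) N]Cmult_1_l !cat_cons; cbn [nest].
  by rewrite -csum_mull; apply: csum_lin3 => n _; rewrite IH; ring.
have alg (A B D c z1 z2 : C) :
  (A * (c * B - D) + (c * z1 - z2) = c * (A * B + z1) - (A * D + z2))%C by ring.
have alg0 (A B D c : C) : (A * (c * B - D) + 0 = c * (A * B + 0) - (A * D + 0))%C by ring.
elim: X M => [|x X IH] M.
  have k0 := key [::]; cbn [rcons] in k0 |- *; cbn [zp]; rewrite k0; exact: alg0.
have kx := key (x :: X); cbn [rcons] in kx |- *; cbn [zp]; rewrite kx IH; exact: alg.
Qed.

Definition z0n (x : node) : Prop := z0 x.1 /\ z0 x.2.

(** Only the two cuts adjacent to [om] leave boundary values, [gp N] and - [gm N.-1], with the same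
    pair of nested sums. The added term cancels them; it is the increment of g over the step from N
    across infinity to t - (N - 1). *)
Lemma zs_telescope l1 l2 N : List.Forall z0n l1 -> List.Forall z0n l2 -> (0 < N)%N ->
  (zs [::] (l1 ++ om :: l2) N +
    (gm N.-1 - gp N) * (nest (map fst (rev l1)) N * nest (map snd l2) N))%C =
  ((mul_right l2).1 * zs [::] (l1 ++ (mul_right l2).2) N
   - (mul_left l1).1 * zs [::] ((mul_left l1).2 ++ l2) N)%C.
Proof.
move=> h1 h2 hN; rewrite !zs_cat !cats0.
have e1 : zp [::] l1 (om :: l2) N =
   ((mul_right l2).1 * zp [::] l1 (mul_right l2).2 N - (mul_left l1).1 * zp [::] (mul_left l1).2 l2 N)%C.
  case/lastP: l1 h1 => [|l f] h1; first by rewrite mul_left_nil; cbn [fst snd zp]; ring.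
  rewrite mul_left_rcons zp_om_right; first by cbn [fst snd]; rewrite Cmult_1_l.
  by move: h1; rewrite -cats1 => /List.Forall_app [_ h]; inversion h; case: H1.
have e2 := nest_om_p l1 hN; have e3 := nest_om_m l2 hN.
cbn [zs]; rewrite e1 [map snd (om :: l2)]/= [nest (om.2 :: _) _]e3.
case: l2 h2 {e1} e3 => [|y R] h2 e3.
  by cbn [zs]; rewrite [map fst (om :: rev l1)]/= e2 /=; ring.
have hy : z0 y.1 by inversion h2; case: H1.
cbn [zs mul_right fst snd].
rewrite [map fst (om :: rev l1)]/= e2.
have alg (u1 u2 c A A' B D g m s1 s2 : C) :
  (1 * u1 - c * u2 + (A * (1 * B - m * D) + ((g * A - c * A') * D + (s1 - c * s2))) + (m - g) * (A * D)
   = 1 * (u1 + (A * B + s1)) - c * (u2 + (A' * D + s2)))%C by ring.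
have := zs_om_left l1 hy R [::] N; rewrite /= => ->; exact: alg.
Qed.

End Telescope.

Definition opt (b : bool) (z : C) : C := if b then z else 0.

Lemma csum_plus (f g : nat -> C) n : csum (fun i => f i + g i)%C n = (csum f n + csum g n)%C.
Proof. by elim: n => [|n IH] /=; [ring | rewrite IH; ring]. Qed.

(** Summation by parts: instead of advancing the vector [a] by one chain element, the transposed
    step acts on [X]. [abel_right] is the same for the other side. *)
Lemma abel_left (a a' al X : nat -> C) r : a' O = a O ->
  (forall i, (i < r)%N -> a' i.+1 = a i.+1 + al i * a i)%C ->
  csum (fun i => a' i * X i)%C r.+1 =
  csum (fun i => a i * (X i + opt (i < r)%N (al i * X i.+1)))%C r.+1.
Proof.
move=> h0 h.
have key k : (k <= r)%N -> csum (fun i => a' i * X i)%C k.+1 =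
    (csum (fun i => a i * (X i + opt (i < r)%N (al i * X i.+1))) k + a k * X k)%C.
  elim: k => [|k IH] hk; first by cbn [csum]; rewrite h0; ring.
  have e : csum (fun i => a' i * X i)%C k.+2 = (csum (fun i => a' i * X i) k.+1 + a' k.+1 * X k.+1)%C by [].
  by rewrite e IH ?h; try lia; cbn [csum]; rewrite hk /=; ring.
by rewrite key //; cbn [csum]; rewrite ltnn /=; ring.
Qed.

Lemma abel_right (b b' nu X : nat -> C) r : b' r = b r ->
  (forall i, (i < r)%N -> b' i = b i + nu i * b i.+1)%C ->
  csum (fun i => b' i * X i)%C r.+1 =
  csum (fun i => b i * (X i + match i with O => 0 | S q => nu q * X q end))%C r.+1.
Proof.
move=> h0 h.
have key k : (k <= r)%N -> csum (fun i => b' i * X i)%C k =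
    (csum (fun i => b i * (X i + match i with O => 0 | S q => nu q * X q end)) k
     + match k with O => 0 | S q => nu q * X q * b k end)%C.
  elim: k => [|k IH] hk; first by cbn [csum]; ring.
  by cbn [csum]; rewrite IH ?h; try lia; case: k {IH} hk => [|k] hk; ring.
by cbn [csum]; rewrite key // h0; case: r {h h0 key} => [|r]; ring.
Qed.

Lemma Cmod_csum_le (f : nat -> C) (B : R) n : (forall i, (i < n)%N -> Cmod (f i) <= B) ->
  Cmod (csum f n) <= INR n * B.
Proof.
elim: n => [|n IH] H; first by rewrite /= Cmod_0; lra.
rewrite S_INR; cbn [csum]; apply: Rle_trans (Cmod_triangle _ _) _.
have := H n (ltnSn n); have := IH (fun i hi => H i (ltnW hi)); lra.
Qed.

(* [E] glues the left sums [a] to the right sums [b] by a block [J] standing for the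
   part of the chain through infinity; adding one element on each side multiplies [J]
   by bidiagonal matrices, so only the defect of that relation enters [E (N+1) - E N]. *)
Definition glue (a b : nat -> C) (J : nat -> nat -> C) (r : nat) : C :=
  csum (fun i => a i * csum (fun j => b j * J i j) r.+1)%C r.+1.

Definition advance (al nu : nat -> C) (J : nat -> nat -> C) (r i j : nat) : C :=
  let K := fun i => (J i j + match j with O => 0 | S q => nu q * J i q end)%C in
  (K i + opt (i < r)%N (al i * K i.+1))%C.

Lemma glue_advance a a' b b' al nu J r : a' O = a O -> b' r = b r ->
  (forall i, (i < r)%N -> a' i.+1 = a i.+1 + al i * a i)%C ->
  (forall i, (i < r)%N -> b' i = b i + nu i * b i.+1)%C ->
  glue a' b' J r = glue a b (advance al nu J r) r.
Proof.
move=> a0 b0 ha hb; rewrite /glue (abel_left _ a0 ha); apply: csum_ext => i hi; congr Cmult.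
rewrite (abel_right (J i) b0 hb) /advance; case: (i < r)%N; rewrite /opt; last first.
  by rewrite Cplus_0_r; apply: csum_ext => j _; rewrite Cplus_0_r.
rewrite (abel_right (J i.+1) b0 hb) -csum_mull -csum_plus.
by apply: csum_ext => j _; ring.
Qed.

Lemma glue_sub a b J J' r : (glue a b J r - glue a b J' r)%C = glue a b (fun i j => J i j - J' i j)%C r.
Proof.
have e (f g : nat -> C) n : (csum f n - csum g n)%C = csum (fun i => f i - g i)%C n.
  by elim: n => [|n IH] /=; [ring | rewrite -IH; ring].
rewrite /glue e; apply: csum_ext => i _.
have -> : csum (fun j => b j * (J i j - J' i j))%C r.+1 =
   (csum (fun j => b j * J i j) r.+1 - csum (fun j => b j * J' i j) r.+1)%C.
  by rewrite e; apply: csum_ext => j _; ring.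
by ring.
Qed.

Lemma glue_bound a b J r A e : 0 <= A -> 0 <= e ->
  (forall i, (i <= r)%N -> Cmod (a i) <= A) -> (forall i, (i <= r)%N -> Cmod (b i) <= A) ->
  (forall i j, (i <= r)%N -> (j <= r)%N -> Cmod (J i j) <= e) ->
  Cmod (glue a b J r) <= INR r.+1 * (A * (INR r.+1 * (A * e))).
Proof.
move=> A0 e0 ha hb hJ; apply: Cmod_csum_le => i hi; rewrite Cmod_mult.
apply: Rmult_le_compat; [exact: Cmod_ge_0 | exact: Cmod_ge_0 | by apply: ha; lia |].
apply: Cmod_csum_le => j hj; rewrite Cmod_mult.
by apply: Rmult_le_compat; [exact: Cmod_ge_0 | exact: Cmod_ge_0 | apply: hb; lia | apply: hJ; lia].
Qed.

(** The order constraint between the variables is dropped, except for the common bound N. *)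
Lemma nest_bound (l : seq wt) (m : nat -> R) N : (forall n, 0 <= m n) ->
  List.Forall (fun f : wt => forall n, Cmod (f n) <= m n) l ->
  Cmod (nest l N) <= rsum m N ^ size l.
Proof.
move=> m0; elim: l N => [|f l IH] N H; first by rewrite /= Cmod_1; lra.
have hf : forall n, Cmod (f n) <= m n by inversion H.
have hl : List.Forall (fun f : wt => forall n, Cmod (f n) <= m n) l by inversion H.
cbn [nest size]; have -> : rsum m N ^ (size l).+1 = rsum m N * rsum m N ^ size l by [].
have key M : (M <= N)%N -> Cmod (csum (fun n => f n * nest l n)%C M) <= rsum m M * rsum m N ^ size l.
  elim: M => [|M IHM] hM; first by rewrite /= Cmod_0; lra.
  cbn [csum rsum]; apply: Rle_trans (Cmod_triangle _ _) _; rewrite Cmod_mult Rmult_plus_distr_r.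
  apply: Rplus_le_compat; first by apply: IHM; lia.
  apply: Rmult_le_compat => //; try exact: Cmod_ge_0.
  apply: Rle_trans (IH M hl) _; apply: pow_incr; split; first exact: rsum_ge0.
  by apply: rsum_mono => //; lia.
exact: key.
Qed.

(** * Complex powers along a chain *)

Definition npow (n : nat) (x : R) : R := if n == O then 0 else exp (x * ln (INR n)).

Lemma npow_S n x : npow n.+1 x = exp (x * ln (INR n.+1)).
Proof. by []. Qed.

Lemma npow_ge0 n x : 0 <= npow n x.
Proof. by case: n => [|n]; [rewrite /npow /=; lra | left; apply: exp_pos]. Qed.

Lemma npow_gt0 n x : 0 < npow n.+1 x.
Proof. exact: exp_pos. Qed.

Lemma npow_plus n x y : npow n (x + y) = npow n x * npow n y.
Proof.
by case: n => [|n]; [rewrite /npow /=; ring | rewrite !npow_S Rmult_plus_distr_r exp_plus].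
Qed.

Lemma ln_INR_ge0 n : 0 <= ln (INR n.+1).
Proof.
rewrite -ln_1; case: n => [|n]; first by rewrite /=; lra.
left; apply: ln_increasing; first lra.
by have -> : 1 = INR 1 by []; apply: lt_INR; lia.
Qed.

Lemma exp_le_compat x y : x <= y -> exp x <= exp y.
Proof. by case=> [h|->]; [left; apply: exp_increasing | lra]. Qed.

Lemma npow_le n x y : x <= y -> npow n x <= npow n y.
Proof.
case: n => [|n] h; first by rewrite /npow /=; lra.
by rewrite !npow_S; apply: exp_le_compat; apply: Rmult_le_compat_r => //; exact: ln_INR_ge0.
Qed.

Lemma npow_0 n : npow n.+1 0 = 1.
Proof. by rewrite npow_S Rmult_0_l exp_0. Qed.

Lemma npow_1 n : npow n.+1 1 = INR n.+1.
Proof. by rewrite npow_S Rmult_1_l exp_ln //; apply: lt_0_INR; lia. Qed.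

Lemma npow_pow n x k : npow n.+1 x ^ k = npow n.+1 (INR k * x).
Proof.
elim: k => [|k IH]; first by rewrite /= Rmult_0_l npow_0.
have -> : INR k.+1 * x = x + INR k * x by rewrite S_INR; ring.
by rewrite npow_plus -IH.
Qed.

Lemma ln_succ_lower n : / INR n.+2 <= ln (INR n.+2) - ln (INR n.+1).
Proof.
have h1 : 0 < INR n.+1 by apply: lt_0_INR; lia.
have h2 : 0 < INR n.+2 by apply: lt_0_INR; lia.
have e : ln (INR n.+1) - ln (INR n.+2) = ln (INR n.+1 / INR n.+2) by rewrite ln_div.
have q : 0 < INR n.+1 / INR n.+2 by apply: Rdiv_lt_0_compat.
have := exp_ineq1_le (ln (INR n.+1 / INR n.+2)); rewrite exp_ln //.
have -> : INR n.+1 / INR n.+2 = 1 - / INR n.+2 by rewrite (S_INR n.+1); field; rewrite -S_INR; lra.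
have e' : ln (1 - / INR n.+2) = ln (INR n.+1 / INR n.+2).
  by congr ln; rewrite (S_INR n.+1); field; rewrite -S_INR; lra.
rewrite e' -e; lra.
Qed.

(** Induction through (N+2)^kap >= (N+1)^kap + (kap/2) (N+1)^(kap-1), which follows from exp y >= 1
    + y and ln((N+2)/(N+1)) >= 1/(N+2) >= 1/(2 (N+1)); hence the constant 2/kap. *)
Lemma npow_growth kap : 0 < kap -> exists D, 0 < D /\
  forall N, rsum (fun n => npow n (kap - 1)) N.+1 <= D * npow N.+1 kap.
Proof.
move=> kp; exists (2 / kap); split; first by apply: Rdiv_lt_0_compat; lra.
elim=> [|N IH].
  by rewrite /= /npow /= Rplus_0_l; apply: Rmult_le_pos; [apply: Rdiv_le_0_compat; lra | left; apply: exp_pos].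
have -> : rsum (fun n => npow n (kap - 1)) N.+2 = rsum (fun n => npow n (kap - 1)) N.+1 + npow N.+1 (kap - 1) by [].
have step : npow N.+1 kap + kap / 2 * npow N.+1 (kap - 1) <= npow N.+2 kap.
  have e1 : npow N.+2 kap = npow N.+1 kap * exp (kap * (ln (INR N.+2) - ln (INR N.+1))).
    by rewrite !npow_S -exp_plus; congr exp; ring.
  have e2 : npow N.+1 (kap - 1) = npow N.+1 kap * / INR N.+1.
    have p1 := npow_1 N; have i0 : 0 < INR N.+1 by apply: lt_0_INR; lia.
    have : npow N.+1 (kap - 1) * npow N.+1 1 = npow N.+1 kap by rewrite -npow_plus; congr npow; ring.
    by rewrite p1 => <-; field; lra.
  have i1 : / INR N.+1 / 2 <= ln (INR N.+2) - ln (INR N.+1).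
    apply: Rle_trans (ln_succ_lower N).
    have i0 : 0 < INR N.+1 by apply: lt_0_INR; lia.
    have -> : / INR N.+1 / 2 = / (2 * INR N.+1) by field; lra.
    apply: Rinv_le_contravar; first by apply: lt_0_INR; lia.
    by have := pos_INR N; rewrite (S_INR N.+1) S_INR; lra.
  have e3 := exp_ineq1_le (kap * (ln (INR N.+2) - ln (INR N.+1))).
  rewrite e1 e2; have p := npow_gt0 N kap.
  have : npow N.+1 kap * (1 + kap * (/ INR N.+1 / 2)) <= npow N.+1 kap * exp (kap * (ln (INR N.+2) - ln (INR N.+1))).
    apply: Rmult_le_compat_l; first lra.
    by apply: Rle_trans e3; apply: Rplus_le_compat_l; apply: Rmult_le_compat_l; lra.
  by lra.
have : 2 / kap * (npow N.+1 kap + kap / 2 * npow N.+1 (kap - 1)) <= 2 / kap * npow N.+2 kap.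
  by apply: Rmult_le_compat_l => //; apply: Rdiv_le_0_compat; lra.
have -> : 2 / kap * (npow N.+1 kap + kap / 2 * npow N.+1 (kap - 1)) = 2 / kap * npow N.+1 kap + npow N.+1 (kap - 1) by field; lra.
lra.
Qed.

(** Telescoping kap n^(-1-kap) <= (n-1)^(-kap) - n^(-kap) keeps the partial sums below 1 + 1/kap. *)
Lemma npow_summable kap : 0 < kap -> summable (fun n => npow n (- 1 - kap)).
Proof.
move=> kp; split; first by move=> n; apply: npow_ge0.
exists (1 + / kap).
have key N : rsum (fun n => npow n (- 1 - kap)) N.+2 + / kap * npow N.+1 (- kap) <= 1 + / kap.
  elim: N => [|N IH].
    rewrite /= /npow /= ln_1 !Rmult_0_r exp_0; lra.
  apply: Rle_trans IH.
  have -> : rsum (fun n => npow n (- 1 - kap)) N.+3 = rsum (fun n => npow n (- 1 - kap)) N.+2 + npow N.+2 (- 1 - kap) by [].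
  have step : npow N.+2 (- kap) + kap * npow N.+2 (- 1 - kap) <= npow N.+1 (- kap).
    have e1 : npow N.+1 (- kap) = npow N.+2 (- kap) * exp (kap * (ln (INR N.+2) - ln (INR N.+1))).
      by rewrite !npow_S -exp_plus; congr exp; ring.
    have i0 : 0 < INR N.+2 by apply: lt_0_INR; lia.
    have e2 : npow N.+2 (- 1 - kap) = npow N.+2 (- kap) * / INR N.+2.
      have p1 := npow_1 N.+1.
      have : npow N.+2 (- 1 - kap) * npow N.+2 1 = npow N.+2 (- kap) by rewrite -npow_plus; congr npow; ring.
      by rewrite p1 => <-; field; lra.
    have e3 := exp_ineq1_le (kap * (ln (INR N.+2) - ln (INR N.+1))).
    rewrite e1 e2; have p := npow_gt0 N.+1 (- kap).
    have : npow N.+2 (- kap) * (1 + kap * / INR N.+2) <= npow N.+2 (- kap) * exp (kap * (ln (INR N.+2) - ln (INR N.+1))).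
      apply: Rmult_le_compat_l; first lra.
      apply: Rle_trans e3; apply: Rplus_le_compat_l; apply: Rmult_le_compat_l; first lra.
      exact: ln_succ_lower.
    by lra.
  have : / kap * (npow N.+2 (- kap) + kap * npow N.+2 (- 1 - kap)) <= / kap * npow N.+1 (- kap).
    by apply: Rmult_le_compat_l => //; left; apply: Rinv_0_lt_compat.
  have -> : / kap * (npow N.+2 (- kap) + kap * npow N.+2 (- 1 - kap)) = / kap * npow N.+2 (- kap) + npow N.+2 (- 1 - kap) by field; lra.
  lra.
have ik : 0 < / kap by apply: Rinv_0_lt_compat.
case=> [|[|N]]; [rewrite /=; lra | rewrite /= /npow /=; lra |].
have := key N; have := Rmult_le_pos _ _ (Rlt_le _ _ ik) (npow_ge0 N.+1 (- kap)); lra.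
Qed.

Lemma summable_scal u c : 0 <= c -> summable u -> summable (fun n => c * u n).
Proof.
move=> c0 [h0 [B HB]]; split; first by move=> n; apply: Rmult_le_pos.
exists (c * B); elim=> [|n IH]; first by rewrite /=; apply: Rmult_le_pos => //; apply: (HB O).
have e k : rsum (fun n => c * u n) k = c * rsum u k by elim: k => [|k IHk] /=; [ring | rewrite IHk; ring].
by rewrite e; apply: Rmult_le_compat_l.
Qed.

Lemma summable_shift u : summable u -> summable (fun n => u n.+1).
Proof.
move=> [h0 [B HB]]; split=> //; exists B => n.
have e : u O + rsum (fun n => u n.+1) n = rsum u n.+1.
  by elim: n => [|n IH]; [rewrite /=; ring | have : u O + rsum (fun n => u n.+1) n = rsum u n.+1 := IH; cbn [rsum]; lra].
by have := HB n.+1; have := h0 O; lra.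
Qed.

(** The plane cut along the negative axis, where the half-angle formula of [Carg] makes sense. *)
Definition slit (z : C) : Prop := 0 < Cmod z + fst z.

Lemma slit_Cmod z : slit z -> 0 < Cmod z.
Proof. by rewrite /slit => h; have := fst_le_Cmod z; lra. Qed.

Lemma Cmod_sqr z : Cmod z * Cmod z = fst z * fst z + snd z * snd z.
Proof. by rewrite /Cmod sqrt_sqrt; [ring | nra]. Qed.

Lemma slit_pos z : 0 < fst z -> slit z.
Proof. by move=> h; rewrite /slit; have := Cmod_ge_0 z; lra. Qed.

Lemma slit_im z : snd z <> 0 -> slit z.
Proof.
move=> h; rewrite /slit; have := Cmod_sqr z; have := Cmod_ge_0 z => h1 h2.
have : 0 < snd z * snd z by nra.
by move=> h3; apply: Rnot_le_lt => h4; nra.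
Qed.

(** With q = Im z / (|z| + Re z), the tangent of half the argument, the double-angle formulas and 1
    + q^2 = 2 |z| / (|z| + Re z) give back Re z and Im z. *)
Lemma Cexp_Clog z : slit z -> Cexp (Clog z) = z.
Proof.
move=> hs; have mp := slit_Cmod hs; rewrite /Cexp /Clog /= exp_ln // /Carg.
pose q := snd z / (Cmod z + fst z); rewrite -/q.
have e := Cmod_sqr z; rewrite /slit in hs.
have qq : 0 < 1 + q * q by nra.
have e2 : 2 * atan q = atan q + atan q by ring.
have ss : sqrt (1 + q²) * sqrt (1 + q²) = 1 + q * q by rewrite sqrt_sqrt /Rsqr //; lra.
have sp : 0 < sqrt (1 + q²) by apply: sqrt_lt_R0; rewrite /Rsqr.
have [S [Sp [SS [cS sS]]]] : exists S, 0 < S /\ S * S = 1 + q * q /\ cos (atan q) = / S /\ sin (atan q) = q / S.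
  exists (sqrt (1 + q²)); split=> //; split=> //.
  by rewrite cos_atan sin_atan; split; rewrite // /Rdiv Rmult_1_l.
have c2 : cos (2 * atan q) = (1 - q * q) / (1 + q * q).
  by rewrite e2 cos_plus cS sS -SS; field; lra.
have s2 : sin (2 * atan q) = 2 * q / (1 + q * q).
  by rewrite e2 sin_plus cS sS -SS; field; lra.
have hq : 1 + q * q = 2 * Cmod z / (Cmod z + fst z).
  rewrite /q; apply: (Rmult_eq_reg_r ((Cmod z + fst z) * (Cmod z + fst z))); last by nra.
  by field_simplify; nra.
have e3 : Cmod z * ((1 - q * q) / (1 + q * q)) = fst z.
  have -> : 1 - q * q = 2 - (1 + q * q) by ring.
  by rewrite hq; field; lra.
have e4 : Cmod z * (2 * q / (1 + q * q)) = snd z by rewrite hq /q; field; lra.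
by rewrite c2 s2 e3 e4; case: (z).
Qed.

Lemma atan_bound_2 q : Rabs (2 * atan q) <= PI.
Proof. by have [h1 h2] := atan_bound q; apply: Rabs_le; lra. Qed.

Lemma Cdiv_components (l z : C) : fst z * fst z + snd z * snd z <> 0 ->
  (l / z)%C = ((fst z * fst l + snd z * snd l) / (fst z * fst z + snd z * snd z),
               (fst z * snd l - snd z * fst l) / (fst z * fst z + snd z * snd z)).
Proof.
case: z => u v; case: l => u' v' /= nz; rewrite /Cdiv /Cmult /Cinv /=.
by congr pair; field; move=> h; apply: nz; rewrite -h; ring.
Qed.

Lemma Rder_Clog (f : R -> C) x l : slit (f x) -> Rder f x l ->
  Rder (fun s => Clog (f s)) x (l / f x)%C.
Proof.
move=> hs [h1 h2]; have mp := slit_Cmod hs; have e := Cmod_sqr (f x); rewrite /slit in hs.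
pose a := fst (f x); pose b := snd (f x); pose da := fst l; pose db := snd l.
have ha : is_derive (fun s => fst (f s)) x da by [].
have hb : is_derive (fun s => snd (f s)) x db by [].
have e' : Cmod (f x) * Cmod (f x) = a * a + b * b by [].
have hsq : is_derive (fun s => fst (f s) * fst (f s) + snd (f s) * snd (f s)) x (2 * (a * da + b * db)).
  evar_last.
    apply: (@is_derive_plus R_AbsRing R_NormedModule).
      exact: (@is_derive_mult R_AbsRing (fun s => fst (f s)) (fun s => fst (f s)) x _ _ ha ha Rmult_comm).
    exact: (@is_derive_mult R_AbsRing (fun s => snd (f s)) (fun s => snd (f s)) x _ _ hb hb Rmult_comm).
  by rewrite /plus /mult /= -/a -/b; ring.
have hm : is_derive (fun s => Cmod (f s)) x ((a * da + b * db) / Cmod (f x)).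
  apply: (is_derive_ext (fun s => sqrt (fst (f s) * fst (f s) + snd (f s) * snd (f s)))).
    by move=> s; rewrite /Cmod; congr sqrt; rewrite /=; ring.
  evar_last.
    apply: (@is_derive_comp R_AbsRing R_NormedModule sqrt) hsq.
    by apply/is_derive_Reals; apply: derivable_pt_lim_sqrt; rewrite -/a -/b -e'; nra.
  have -> : sqrt (fst (f x) * fst (f x) + snd (f x) * snd (f x)) = Cmod (f x).
    by rewrite /Cmod; congr sqrt; rewrite /=; ring.
  by rewrite /scal /= /mult /=; field; lra.
have iv : (l / f x)%C = ((a * da + b * db) / (Cmod (f x) * Cmod (f x)), (a * db - b * da) / (Cmod (f x) * Cmod (f x))).
  by rewrite e' Cdiv_components // -e; nra.
rewrite iv; split; rewrite /Clog /=.
- evar_last.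
    apply: (@is_derive_comp R_AbsRing R_NormedModule ln) hm.
    exact: is_derive_ln.
  by rewrite /scal /= /mult /=; field; lra.
- have hq : is_derive (fun s => snd (f s) / (Cmod (f s) + fst (f s))) x
     ((db * (Cmod (f x) + a) - ((a * da + b * db) / Cmod (f x) + da) * b) / (Cmod (f x) + a) ^ 2).
    have hden : is_derive (fun s => Cmod (f s) + fst (f s)) x ((a * da + b * db) / Cmod (f x) + da).
      exact: (@is_derive_plus R_AbsRing R_NormedModule (fun s => Cmod (f s)) (fun s => fst (f s))).
    evar_last; first by apply: is_derive_div; [exact: hb | exact: hden | rewrite /=; lra].
    have -> : fst (f x) = a by []. have -> : snd (f x) = b by []. by rewrite (Rmult_comm b).
  rewrite /Carg; evar_last.
    apply: is_derive_scal; apply: (@is_derive_comp R_AbsRing R_NormedModule atan) hq.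
    exact: is_derive_atan.
  rewrite /scal /= /mult /= -/a -/b.
  set m := Cmod (f x) in mp hs e e' |- *.
  have hma : 0 < m + a by [].
  have den : 1 + (b / (m + a))² = 2 * m / (m + a).
    rewrite /Rsqr; apply: (Rmult_eq_reg_r ((m + a) * (m + a))); last by nra.
    by field_simplify; nra.
  pose X := db * (m + a) - ((a * da + b * db) / m + da) * b.
  have hX : X * m = (a * db - b * da) * (m + a).
    have -> : X * m = db * (m * m) + db * a * m - (a * da + b * db + da * m) * b by rewrite /X; field; lra.
    by rewrite e'; ring.
  rewrite -/X den; have -> : X = (a * db - b * da) * (m + a) / m by rewrite -hX; field; lra.
  by field; split; lra.
Qed.

Lemma Clog_INR n : Clog (RtoC (INR n.+1)) = RtoC (ln (INR n.+1)).
Proof.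
rewrite /Clog /Carg Cmod_R Rabs_pos_eq; last exact: pos_INR.
by rewrite /= /Rdiv Rmult_0_l atan_0 Rmult_0_r.
Qed.

(* A half-chain is given by branches of the logarithm [la n] of its elements. *)
Definition near_log (la : nat -> C) (K : R) : Prop :=
  forall n, Cmod (la n.+1 - RtoC (ln (INR n.+1)))%C <= K.

Definition wpow (la : nat -> C) (s : C) : wt :=
  fun n => if n == O then RtoC 0 else Cexp (- (s * la n))%C.

Lemma Cmod_Cexp_near l x K s : Cmod (l - RtoC x)%C <= K ->
  Cmod (Cexp (- (s * l)))%C <= exp (Cmod s * K) * exp (- fst s * x).
Proof.
move=> h; rewrite Cmod_Cexp -exp_plus; apply: exp_le_compat.
have -> : (- (s * l) = - (s * (l - RtoC x)) + - (s * RtoC x))%C by ring.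
have e : fst (- (s * RtoC x))%C = - fst s * x by rewrite /=; ring.
have -> (z w : C) : fst (z + w)%C = fst z + fst w by [].
rewrite e; apply: Rplus_le_compat_r; apply: Rle_trans (fst_le_Cmod _) _.
rewrite Cmod_opp Cmod_mult; apply: Rmult_le_compat_l => //; exact: Cmod_ge_0.
Qed.

Lemma wpow_bound la K s n : near_log la K ->
  Cmod (wpow la s n) <= exp (Cmod s * K) * npow n (- fst s).
Proof.
case: n => [|n] H; first by rewrite /wpow /npow /= Cmod_0; lra.
exact: (Cmod_Cexp_near s (H n)).
Qed.

Lemma wpow_plus la s s' n : wpow la (s + s')%C n = (wpow la s n * wpow la s' n)%C.
Proof.
case: n => [|n]; first by rewrite /wpow /=; ring.
by rewrite /wpow /= -Cexp_plus; congr Cexp; ring.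
Qed.

Lemma Centire_wpow la n : Centire (fun s => wpow la s n).
Proof.
move=> s; case: n => [|n]; rewrite /wpow /=; first exact: Cdiff_const.
apply: (@Cdiff_comp Cexp (fun s => - (s * la n.+1))%C); first exact: Centire_Cexp.
by apply: Cdiff_opp; apply: Cdiff_mult; [exact: Cdiff_id | exact: Cdiff_const].
Qed.

(** The polynomial w (w-1) ... (w-l+1) / l!, for complex w because the telescoped exponent runs
    along a circle. *)
Fixpoint cbinom (w : C) (l : nat) : C :=
  match l with O => RtoC 1 | S l' => (cbinom w l' * (w - RtoC (INR l')) / RtoC (INR l))%C end.

Lemma RtoC_INR_neq0 n : RtoC (INR n.+1) <> 0.
Proof. by move=> /RtoC_inj; apply: not_0_INR. Qed.

Lemma cbinom_pred w l : (RtoC (INR l.+1) * cbinom w l.+1 = w * cbinom (w - 1) l)%C.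
Proof.
elim: l => [|l IH]; first by rewrite /=; field; move=> /RtoC_inj; lra.
have h := @RtoC_INR_neq0 l.+1; have h' := @RtoC_INR_neq0 l.
have -> : cbinom w l.+2 = (cbinom w l.+1 * (w - RtoC (INR l.+1)) / RtoC (INR l.+2))%C by [].
have -> : cbinom (w - 1) l.+1 = (cbinom (w - 1) l * (w - 1 - RtoC (INR l)) / RtoC (INR l.+1))%C by [].
have -> : (RtoC (INR l.+2) * (cbinom w l.+1 * (w - RtoC (INR l.+1)) / RtoC (INR l.+2)) =
   (RtoC (INR l.+1) * cbinom w l.+1) * (w - RtoC (INR l.+1)) / RtoC (INR l.+1))%C by field.
rewrite IH; have -> : RtoC (INR l.+1) = (RtoC (INR l) + 1)%C by rewrite S_INR RtoC_plus.
have h2 : (RtoC (INR l) + 1)%C <> 0 by rewrite -RtoC_plus -S_INR.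
by field.
Qed.

Lemma Centire_cbinom l : Centire (fun w => cbinom w l).
Proof.
elim: l => [|l IH] w /=; first exact: Cdiff_const.
apply: Cdiff_mult; last exact: Cdiff_const.
by apply: Cdiff_mult; [exact: IH | apply: Cdiff_minus; [exact: Cdiff_id | exact: Cdiff_const]].
Qed.

Definition taylor_poly (M : nat) (w l0 : C) (tau : R) : C :=
  csum (fun l => cbinom (- w) l * RtoC (tau ^ l) * Cexp (- ((w + RtoC (INR l)) * l0)))%C M.

(** The product of the factors 2 |w + i|, i < M: the modulus comes from differentiating a power with
    exponent -(w+i), the 2 from a mean-value step. *)
Fixpoint wprod (w : C) (M : nat) : R :=
  match M with O => 1 | S M' => 2 * Cmod w * wprod (w + 1)%C M' end.

Lemma wprod_ge0 w M : 0 <= wprod w M.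
Proof.
elim: M w => [|M IH] w /=; first lra.
by apply: Rmult_le_pos => //; have := Cmod_ge_0 w; lra.
Qed.

Lemma Rder_comp_scal f s tau l : Rder f (s * tau) l -> Rder (fun s => f (s * tau)) s (RtoC tau * l)%C.
Proof.
have hd : is_derive (fun s => s * tau) s tau by auto_derive => //; ring.
move=> [h1 h2]; split.
- evar_last; first exact: (@is_derive_comp R_AbsRing R_NormedModule (fun s => fst (f s)) (fun s => s * tau) s _ _ h1 hd).
  by rewrite /scal /= /mult /=; ring.
- evar_last; first exact: (@is_derive_comp R_AbsRing R_NormedModule (fun s => snd (f s)) (fun s => s * tau) s _ _ h2 hd).
  by rewrite /scal /= /mult /=; ring.
Qed.

Lemma Cmean_value_le (f f' : R -> C) D tau : 0 <= tau <= 1 ->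
  (forall s, 0 <= s <= 1 -> Rder f s (f' s) /\ Cmod (f' s) <= D) -> Cmod (f tau - f 0)%C <= 2 * D.
Proof.
move=> ht H; have := @Cmean_value (fun s => f (s * tau)) (fun s => RtoC tau * f' (Rmult s tau))%C D.
rewrite Rmult_1_l Rmult_0_l; apply => s hs.
have hst : 0 <= s * tau <= 1 by nra.
have [h1 h2] := H _ hst; split; first exact: Rder_comp_scal.
rewrite Cmod_mult Cmod_R Rabs_pos_eq; last lra.
by have := Cmod_ge_0 (f' (s * tau)); nra.
Qed.

(* [x(tau) = exp(lp tau)] moves with unit speed, so [lp' = 1/x = exp(- lp)]. *)
Lemma taylor_power (lp : R -> C) (x K : R) M w :
  (forall s, 0 <= s <= 1 -> Rder lp s (Cexp (- lp s)%C) /\ Cmod (lp s - RtoC x)%C <= K) ->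
  0 <= K ->
  forall tau, 0 <= tau <= 1 ->
  Cmod (Cexp (- (w * lp tau)) - taylor_poly M w (lp 0) tau)%C <=
    wprod w M * (exp ((Cmod w + INR M) * K) * exp (- (fst w + INR M) * x)).
Proof.
move=> H K0; elim: M w => [|M IH] w tau ht.
  rewrite /taylor_poly /= !Rplus_0_r Rmult_1_l.
  have -> (z : C) : (z - 0 = z)%C by ring.
  by apply: Cmod_Cexp_near; apply H.
pose f s := (Cexp (- (w * lp s)) - taylor_poly M.+1 w (lp 0) s)%C.
pose f' s := (- w * (Cexp (- ((w + 1) * lp s)) - taylor_poly M (w + 1) (lp 0) s))%C.
have f0 : f 0 = 0.
  rewrite /f /taylor_poly csum_S_l (@csum_ext _ (fun _ => 0 * 0)%C); last first.
    by move=> i _; rewrite pow_i; [ring | lia].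
  by rewrite csum_mull /= Cplus_0_r; ring.
have -> : (Cexp (- (w * lp tau)) - taylor_poly M.+1 w (lp 0) tau = f tau - f 0)%C by rewrite f0 /f; ring.
pose D := wprod (w + 1) M * (exp ((Cmod w + INR M.+1) * K) * exp (- (fst w + INR M.+1) * x)).
have -> : wprod w M.+1 * (exp ((Cmod w + INR M.+1) * K) * exp (- (fst w + INR M.+1) * x)) = 2 * (Cmod w * D).
  by rewrite /D /=; ring.
apply: (@Cmean_value_le f f') => // s hs; have [hd hk] := H s hs; split; last first.
  rewrite /f' Cmod_mult Cmod_opp; apply: Rmult_le_compat_l; first exact: Cmod_ge_0.
  apply: Rle_trans (IH _ _ hs) _; rewrite /D; apply: Rmult_le_compat_l; first exact: wprod_ge0.
  have e : fst (w + 1)%C + INR M = fst w + INR M.+1 by rewrite S_INR /=; ring.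
  rewrite e; apply: Rmult_le_compat_r; first by left; apply: exp_pos.
  apply: exp_le_compat; apply: Rmult_le_compat_r => //; rewrite S_INR.
  by have := Cmod_triangle w 1; rewrite Cmod_1; lra.
apply: (Rder_ext (f := fun s => (Cexp (- w * lp s) + - (RtoC 1 * Cexp (- ((w + RtoC (INR 0)) * lp (IZR Z0))) +
   csum (fun l => (cbinom (- w) l.+1 * Cexp (- ((w + RtoC (INR l.+1)) * lp (IZR Z0)))) * Cpow (RtoC s * 1) l.+1) M))%C)
  (l := (Cexp (- w * lp s) * (- w * Cexp (- lp s)) + - (0 + csum (fun l => (cbinom (- w) l.+1 * Cexp (- ((w + RtoC (INR l.+1)) * lp (IZR Z0)))) * (RtoC (INR l.+1) * Cpow (RtoC s * 1) l * 1)) M))%C)).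
- move=> s'; rewrite /f /taylor_poly csum_S_l; congr Cplus; first by congr Cexp; ring.
  congr Copp; congr Cplus; first by rewrite /=; ring.
  apply: csum_ext => l _; rewrite Cmult_1_r -RtoC_pow; ring.
- rewrite /f'; have -> : (Cexp (- w * lp s) * (- w * Cexp (- lp s)) = - w * Cexp (- ((w + 1) * lp s)))%C.
    have -> : (- ((w + 1) * lp s) = - w * lp s + - lp s)%C by ring.
    by rewrite Cexp_plus; ring.
  have -> : (- w * (Cexp (- ((w + 1) * lp s)) - taylor_poly M (w + 1) (lp 0) s) =
    - w * Cexp (- ((w + 1) * lp s)) + - ((- w) * taylor_poly M (w + 1) (lp 0) s))%C by ring.
  congr Cplus; congr Copp; rewrite Cplus_0_l /taylor_poly -csum_mull; apply: csum_ext => l _.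
  rewrite Cmult_1_r Cmult_1_r -RtoC_pow.
  have -> : ((w + 1 + RtoC (INR l)) = w + RtoC (INR l.+1))%C by rewrite S_INR RtoC_plus; ring.
  have := cbinom_pred (- w) l; have -> : (- (w + 1) = - w - 1)%C by ring.
  move=> e; rewrite !Cmult_assoc -e; ring.
- apply: Rder_plus; first by apply: Rder_Cexp; apply: Rder_scal.
  apply: Rder_opp; apply: Rder_plus; first exact: Rder_const.
  by apply: Rder_csum => l; apply: Rder_scal; apply: Rder_pow; exact: Rder_scal_id.
Qed.

(** * The two half-chains for a parameter t off [1, oo) *)

Definition tdom (t : C) : Prop := ~ (snd t = 0 /\ 1 <= fst t).

Lemma tdom_0 : tdom 0.
Proof. by rewrite /tdom /=; lra. Qed.

Lemma tdom_slit t x : tdom t -> 1 <= x -> slit (RtoC x - t)%C.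
Proof.
move=> ht hx; case: (Req_dec (snd t) 0) => h; last by apply: slit_im; rewrite /=; lra.
by apply: slit_pos; rewrite /=; apply: Rnot_le_lt => h2; apply: ht; lra.
Qed.

Lemma tdom_dist t : tdom t -> exists d, 0 < d /\ forall x, 1 <= x -> d <= Cmod (RtoC x - t)%C.
Proof.
move=> ht; case: (Req_dec (snd t) 0) => h.
  exists (1 - fst t); split.
    by apply: Rnot_le_lt => h2; apply: ht; lra.
  by move=> x hx; have := fst_le_Cmod (RtoC x - t)%C; rewrite /=; lra.
exists (Rabs (snd t)); split; first exact: Rabs_pos_lt.
move=> x hx; apply: Rle_trans (_ : Rabs (snd (RtoC x - t)%C) <= _).
  by rewrite /= Rplus_0_l Rabs_Ropp; lra.
exact: Rle_trans (Rmax_r _ _) (Rmax_Cmod _).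
Qed.

(** For x >= 1 the moduli of x and x - t are comparable up to the factor c, d being a lower bound
    for |x - t|; the argument contributes at most pi. *)
Lemma tdom_log t : tdom t -> exists K, 0 <= K /\
  forall x, 1 <= x -> Cmod (Clog (RtoC x - t) - RtoC (ln x))%C <= K.
Proof.
move=> ht; have [d [dp Hd]] := tdom_dist ht.
have tp := Cmod_ge_0 t.
pose c := 1 + Cmod t + Cmod t / d.
have cd : 0 <= Cmod t / d by apply: Rdiv_le_0_compat.
have c1 : 1 <= c by rewrite /c; lra.
have lc : 0 <= ln c.
  by rewrite -ln_1; case: (Rle_lt_or_eq_dec _ _ c1) => [h|<-]; [left; apply: ln_increasing; lra | lra].
exists (ln c + PI); split; first by have := PI_RGT_0; lra.
move=> x hx; have hs := tdom_slit ht hx; have mp := slit_Cmod hs.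
apply: Rle_trans (Cmod_fst_snd _) _; rewrite /= Rplus_comm.
have -> : Carg (RtoC x - t) + - 0 = Carg (RtoC x - t) by ring.
have := atan_bound_2 (snd (RtoC x - t)%C / (Cmod (RtoC x - t)%C + fst (RtoC x - t)%C)); rewrite -/(Carg _) => ha.
suff : Rabs (ln (Cmod (RtoC x - t)%C) + - ln x) <= ln c by lra.
have up : Cmod (RtoC x - t)%C <= c * x.
  have := Cmod_triangle (RtoC x) (- t)%C; rewrite Cmod_opp Cmod_R Rabs_pos_eq; last lra.
  rewrite /Cminus /c => h; nra.
have lo : x <= c * Cmod (RtoC x - t)%C.
  have := Cmod_triangle (RtoC x - t)%C t; have -> : (RtoC x - t + t = RtoC x)%C by ring.
  rewrite Cmod_R Rabs_pos_eq; last lra.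
  have h2 : Cmod t <= Cmod t / d * Cmod (RtoC x - t)%C.
    have {1}-> : Cmod t = Cmod t / d * d by field; lra.
    by apply: Rmult_le_compat_l => //; apply: Hd.
  rewrite /c => h; nra.
have l1 : ln (Cmod (RtoC x - t)%C) <= ln c + ln x by rewrite -ln_mult; try lra; apply: ln_le.
have l2 : ln x <= ln c + ln (Cmod (RtoC x - t)%C) by rewrite -ln_mult; try lra; apply: ln_le; lra.
by apply: Rabs_le; lra.
Qed.

Definition lap (n : nat) : C := RtoC (ln (INR n)).
(* [exp (- s * lam t n)] is [e^(pi i s) (n - t)^(- s)], so the phase factors of
   [zeta_U] disappear into the branch of [log (t - n)]. *)
Definition lam (t : C) (n : nat) : C := (Clog (RtoC (INR n) - t) - piI)%C.
Definition nd (t s : C) : node := (wpow lap s, wpow (lam t) s).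

Lemma nd_z0 t s : z0n (nd t s).
Proof. by []. Qed.

(* For every [s], [tau -> exp (lp tau)] runs from one chain element to the next one. *)
Definition unit_step (l l' : C) (x K : R) : Prop :=
  exists lp : R -> C, lp 0 = l /\ lp 1 = l' /\
    forall s, 0 <= s <= 1 -> Rder lp s (Cexp (- lp s)%C) /\ Cmod (lp s - RtoC x)%C <= K.

Lemma Cexp_neg z : (Cexp (- z) * Cexp z = 1)%C.
Proof. by rewrite -Cexp_plus; have -> : (- z + z = 0)%C by [ring]; rewrite Cexp_0. Qed.

Lemma Cexp_neg_Clog z : slit z -> Cexp (- Clog z)%C = (/ z)%C.
Proof.
move=> h; have := Cexp_neg (Clog z); rewrite Cexp_Clog // => e.
have nz : z <> 0 by apply/Cmod_gt_0; exact: slit_Cmod.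
by rewrite -[Cexp _]Cmult_1_r -(Cinv_r z) // Cmult_assoc e; ring.
Qed.

Lemma Cexp_piI : Cexp piI = (- (1))%C.
Proof. by rewrite /Cexp /piI /= exp_0 cos_PI sin_PI /Copp /RtoC /=; congr pair; ring. Qed.

Lemma ln_ratio_le x y : 1 <= y -> y / 2 <= x <= 2 * y -> Rabs (ln x - ln y) <= 1.
Proof.
move=> hy [h1 h2].
have l2 : ln 2 <= 1.
  have := exp_ineq1_le (ln 2); rewrite exp_ln; lra.
have a1 : ln x <= ln 2 + ln y by rewrite -ln_mult; try lra; apply: ln_le; lra.
have a2 : ln y <= ln 2 + ln x by rewrite -ln_mult; try lra; apply: ln_le; lra.
by apply: Rabs_le; lra.
Qed.

Lemma INR_S_ge1 n : 1 <= INR n.+1.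
Proof. by rewrite S_INR; have := pos_INR n; lra. Qed.

Lemma unit_step_p n : unit_step (lap n.+1) (lap n.+2) (ln (INR n.+1)) 1.
Proof.
have hn := INR_S_ge1 n.
exists (fun s => Clog (RtoC (INR n.+1) + RtoC s * 1)%C); split.
  by rewrite ?/lap -Clog_INR; congr Clog; ring.
split; first by rewrite /lap -Clog_INR (S_INR n.+1) RtoC_plus; congr Clog; ring.
move=> s hs; have e : (RtoC (INR n.+1) + RtoC s * 1)%C = RtoC (INR n.+1 + s) by rewrite RtoC_plus; ring.
have sl : slit (RtoC (INR n.+1) + RtoC s * 1)%C by rewrite e; apply: slit_pos; rewrite /RtoC; cbn [fst]; lra.
split.
  rewrite Cexp_neg_Clog //.
  apply: (Rder_ext _ _ (Rder_Clog sl (Rder_plus (Rder_const _ s) (Rder_scal_id 1 s)))) => //.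
  by rewrite /Cdiv; ring.
rewrite e /Clog /Carg Cmod_R Rabs_pos_eq; last lra.
cbn [fst snd RtoC]; rewrite /Rdiv Rmult_0_l atan_0 Rmult_0_r.
have -> : ((ln (INR n.+1 + s), 0) - RtoC (ln (INR n.+1)))%C = RtoC (ln (INR n.+1 + s) - ln (INR n.+1)).
  by rewrite /Cminus /Cplus /Copp /RtoC /=; congr pair; ring.
by rewrite Cmod_R; apply: ln_ratio_le; lra.
Qed.

(** Along n + 2 - s the derivative of Clog (n + 2 - s - t) is 1 / (t - (n + 2 - s)), and the branch
    shifted by -pi i has exactly this as exp (- lp). In the constant, PI pays for the shift and 1
    for moving the real point by at most one unit. *)
Lemma unit_step_m t : tdom t -> exists K, 0 <= K /\ near_log (lam t) K /\
  forall n, unit_step (lam t n.+2) (lam t n.+1) (ln (INR n.+2)) K.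
Proof.
move=> ht; have [K [K0 HK]] := tdom_log ht.
have mpi : Cmod piI = PI.
  have -> : piI = (Ci * RtoC PI)%C by rewrite /piI /Cmult /=; congr pair; ring.
  by rewrite Cmod_mult Cmod_R Cmod_Ci Rabs_pos_eq; [ring | have := PI_RGT_0; lra].
have pp := PI_RGT_0.
exists (K + PI + 1); split; first lra; split.
  move=> n; rewrite /lam.
  have -> : (Clog (RtoC (INR n.+1) - t) - piI - RtoC (ln (INR n.+1)) = (Clog (RtoC (INR n.+1) - t) - RtoC (ln (INR n.+1))) + - piI)%C by ring.
  apply: Rle_trans (Cmod_triangle _ _) _; rewrite Cmod_opp mpi.
  by have := HK _ (INR_S_ge1 n); lra.
move=> n; exists (fun s => Clog ((RtoC (INR n.+2) - t) + RtoC s * (- (1))) - piI)%C; split.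
  by rewrite /lam; congr (Clog _ - _)%C; ring.
split; first by rewrite /lam (S_INR n.+1) RtoC_plus; congr (Clog _ - _)%C; ring.
move=> s hs; have e : (RtoC (INR n.+2) - t + RtoC s * (- (1)))%C = (RtoC (INR n.+2 - s) - t)%C by rewrite RtoC_minus; ring.
have hn := INR_S_ge1 n; have hx : 1 <= INR n.+2 - s by rewrite S_INR; lra.
have sl : slit (RtoC (INR n.+2) - t + RtoC s * (- (1)))%C by rewrite e; apply: tdom_slit.
split.
  have -> : (- (Clog (RtoC (INR n.+2) - t + RtoC s * (- (1))) - piI) = - Clog (RtoC (INR n.+2) - t + RtoC s * (- (1))) + piI)%C by ring.
  rewrite Cexp_plus Cexp_piI Cexp_neg_Clog //.
  apply: (Rder_ext _ _ (Rder_plus (Rder_Clog sl (Rder_plus (Rder_const _ s) (Rder_scal_id (- (1))%C s))) (Rder_const (- piI)%C s))) => //.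
  by rewrite /Cdiv; ring.
rewrite e.
have -> : (Clog (RtoC (INR n.+2 - s) - t) - piI - RtoC (ln (INR n.+2)) = (Clog (RtoC (INR n.+2 - s) - t) - RtoC (ln (INR n.+2 - s)))
   + (- piI + RtoC (ln (INR n.+2 - s) - ln (INR n.+2))))%C by rewrite (RtoC_minus (ln _)); ring.
apply: Rle_trans (Cmod_triangle _ _) _.
apply: Rle_trans (Rplus_le_compat_l _ _ _ (Cmod_triangle _ _)) _; rewrite Cmod_opp mpi Cmod_R.
have h1 := HK _ hx.
have h2 := @ln_ratio_le (INR n.+2 - s) (INR n.+2) (INR_S_ge1 _) ltac:(rewrite (S_INR n.+1); lra).
lra.
Qed.

Lemma near_log_lap : near_log lap 0.
Proof.
by move=> n; rewrite /lap; have -> : (RtoC (ln (INR n.+1)) - RtoC (ln (INR n.+1)) = 0)%C by [ring]; rewrite Cmod_0; lra.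
Qed.

Lemma near_log_le la K K' : K <= K' -> near_log la K -> near_log la K'.
Proof. by move=> h H n; apply: Rle_trans (H n) h. Qed.

Definition chain_const (t : C) (K : R) : Prop :=
  0 <= K /\ near_log lap K /\ near_log (lam t) K /\
  (forall n, unit_step (lap n.+1) (lap n.+2) (ln (INR n.+1)) K) /\
  (forall n, unit_step (lam t n.+2) (lam t n.+1) (ln (INR n.+2)) K).

Lemma chain_const_ex t : tdom t -> exists K, chain_const t K.
Proof.
move=> ht; have [K [K0 [h1 h2]]] := unit_step_m ht.
have us l l' x a b : a <= b -> unit_step l l' x a -> unit_step l l' x b.
  move=> hab [lp [e1 [e2 h]]]; exists lp; split=> //; split=> // s hs.
  by have [q1 q2] := h s hs; split=> //; lra.
exists (K + 1); split; [lra | split; last split; last split].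
- apply: near_log_le near_log_lap; lra.
- apply: near_log_le h1; lra.
- move=> n; apply: us (unit_step_p n); lra.
- move=> n; apply: us (h2 n); lra.
Qed.

Lemma ctrunc_rev_nest rs t N :
  ctrunc_rev rs t N = nest (map (fun s n => if n == O then RtoC 0 else Cpow_neg (RtoC (INR n) - t) s) rs) N.
Proof.
elim: rs N => [//|s rs IH] N /=; apply: csum_ext => -[|n] _ /=; first by ring.
by rewrite IH.
Qed.

Lemma zetaU_trunc_zs s t N : zetaU_trunc s 0 t N = zs [::] (map (nd t) s) N.
Proof.
rewrite zs_csum size_map /zetaU_trunc; apply: csum_ext => i _.
rewrite cats0 -map_take -map_drop -map_rev /ctrunc revK !ctrunc_rev_nest -!map_comp.
have nz n : (n.+1 == O) = false by [].
have alg1 (x y z w : C) : (x * y * (z * w) = x * z * (y * w))%C by ring.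
have alg2 (x y z : C) : (z * (x * y) = x * (z * y))%C by ring.
have -> : nest [seq (fun n => if n == O then RtoC 0 else Cpow_neg (RtoC (INR n) - (- 0)) s0) | s0 <- rev (take i s)] N =
   nest [seq (fst \o nd t) i | i <- rev (take i s)] N.
  elim: (rev (take i s)) N => [//|a l IH] N /=; apply: csum_ext => -[|n] _; first by rewrite /wpow /=; ring.
  rewrite IH /wpow nz /Cpow_neg /lap -Clog_INR; congr (Cexp (- (_ * Clog _)) * _)%C; ring.
have -> : nest [seq (snd \o nd t) i | i <- drop i s] N = (Cexp (piI * csumlist (drop i s)) *
  nest [seq (fun n => if n == O then RtoC 0 else Cpow_neg (RtoC (INR n) - t) s0) | s0 <- drop i s] N)%C.
  elim: (drop i s) N => [|a l IH] N.
    by rewrite /csumlist /=; have -> : (piI * 0 = 0)%C by [ring]; rewrite Cexp_0; ring.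
  have -> : csumlist (a :: l) = (a + csumlist l)%C by [].
  have -> : (piI * (a + csumlist l) = piI * a + piI * csumlist l)%C by ring.
  rewrite Cexp_plus; cbn [map nest]; rewrite -csum_mull; apply: csum_ext => -[|n] _; first by rewrite /comp /nd /wpow /=; ring.
  rewrite IH /comp /nd; cbn [snd]; rewrite /wpow nz /Cpow_neg /lam.
  have -> : (- (a * (Clog (RtoC (INR n.+1) - t) - piI)) = piI * a + - (a * Clog (RtoC (INR n.+1) - t)))%C by ring.
  rewrite Cexp_plus; exact: alg1.
exact: alg2.
Qed.

(** * Partial sums glued by a block *)

(** Entry i uses the first i nodes before infinity, entry j of [rights] the nodes from j on after
    it. A block entry (i, j) therefore stands for the nodes i, ..., j - 1 sitting at infinity. *)
Definition lefts (l : seq node) (N i : nat) : C := nest (map fst (rev (take i l))) N.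
Definition rights (l : seq node) (N i : nat) : C := nest (map snd (drop i l)) N.
Definition node0 : node := (fun _ => RtoC 0, fun _ => RtoC 0).
Definition glued (l : seq node) (N : nat) (J : nat -> nat -> C) : C :=
  glue (lefts l N) (rights l N) J (size l).

Definition nodes_le (m : nat -> R) (l : seq node) : Prop :=
  List.Forall (fun x : node => forall n, Cmod (x.1 n) <= m n /\ Cmod (x.2 n) <= m n) l.

Lemma Forall_take_rev m (l : seq node) i : nodes_le m l ->
  List.Forall (fun f : wt => forall n, Cmod (f n) <= m n) (map fst (rev (take i l))).
Proof.
move=> H; have {H} H : nodes_le m (take i l).
  elim: l i H => [|x l IH] [|i] H //=; try exact: List.Forall_nil.
  by inversion H; apply: List.Forall_cons => //; apply: IH.
elim: (take i l) H => [|x l' IH] H; first exact: List.Forall_nil.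
inversion H; rewrite rev_cons map_rcons -cats1; apply/List.Forall_app; split; first exact: IH.
by apply: List.Forall_cons; [move=> n; apply H2 | exact: List.Forall_nil].
Qed.

Lemma Forall_drop m (l : seq node) i : nodes_le m l ->
  List.Forall (fun f : wt => forall n, Cmod (f n) <= m n) (map snd (drop i l)).
Proof.
move=> H; have {H} H : nodes_le m (drop i l).
  by elim: l i H => [|x l IH] [|i] H //=; inversion H; apply: IH.
elim: (drop i l) H => [|x l' IH] H; first exact: List.Forall_nil.
by inversion H; apply: List.Forall_cons; [move=> n; apply H2 | exact: IH].
Qed.

Lemma pow_le_max B i r : 1 <= B -> (i <= r)%N -> B ^ i <= B ^ r.
Proof. by move=> h hi; apply: Rle_pow => //; apply/leP. Qed.

Lemma lefts_bound m l N B i : (forall n, 0 <= m n) -> nodes_le m l -> 1 <= B -> rsum m N <= B ->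
  (i <= size l)%N -> Cmod (lefts l N i) <= B ^ size l.
Proof.
move=> m0 H B1 hB hi; apply: Rle_trans (nest_bound N m0 (Forall_take_rev i H)) _.
rewrite size_map size_rev size_take_min; apply: Rle_trans (_ : B ^ minn i (size l) <= _).
  by apply: pow_incr; split => //; exact: rsum_ge0.
by apply: pow_le_max => //; exact: geq_minr.
Qed.

Lemma rights_bound m l N B i : (forall n, 0 <= m n) -> nodes_le m l -> 1 <= B -> rsum m N <= B ->
  Cmod (rights l N i) <= B ^ size l.
Proof.
move=> m0 H B1 hB; apply: Rle_trans (nest_bound N m0 (Forall_drop i H)) _.
rewrite size_map size_drop; apply: Rle_trans (_ : B ^ (size l - i) <= _).
  by apply: pow_incr; split => //; exact: rsum_ge0.
by apply: pow_le_max => //; exact: leq_subr.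
Qed.

Lemma lefts_S l N i : (i < size l)%N ->
  lefts l N.+1 i.+1 = (lefts l N i.+1 + (nth node0 l i).1 N * lefts l N i)%C.
Proof. by move=> h; rewrite /lefts (take_nth node0) // rev_rcons. Qed.

Lemma rights_S l N i : (i < size l)%N ->
  rights l N.+1 i = (rights l N i + (nth node0 l i).2 N * rights l N i.+1)%C.
Proof. by move=> h; rewrite /rights (drop_nth node0). Qed.

Definition advanced (l : seq node) (N : nat) (J : nat -> nat -> C) : nat -> nat -> C :=
  advance (fun i => (nth node0 l i).1 N) (fun i => (nth node0 l i).2 N) J (size l).

Lemma glued_S l N J : glued l N.+1 J = glued l N (advanced l N J).
Proof.
rewrite /glued; apply: glue_advance.
- by rewrite /lefts take0.
- by rewrite /rights drop_size.
- by move=> i hi; apply: lefts_S.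
- by move=> i hi; apply: rights_S.
Qed.

Lemma glued_incr m l N J J' B e : (forall n, 0 <= m n) -> nodes_le m l -> 1 <= B -> rsum m N <= B -> 0 <= e ->
  (forall i j, (i <= size l)%N -> (j <= size l)%N -> Cmod (J i j - advanced l N J' i j)%C <= e) ->
  Cmod (glued l N.+1 J' - glued l N J)%C <=
    INR (size l).+1 * (B ^ size l * (INR (size l).+1 * (B ^ size l * e))).
Proof.
move=> m0 H B1 hB e0 he; rewrite glued_S Cmod_sub_sym /glued glue_sub; apply: glue_bound => //.
- by apply: pow_le; lra.
- by move=> i hi; apply: lefts_bound.
- by move=> i hi; apply: rights_bound.
Qed.

Definition delta (i j : nat) : C := if i == j then RtoC 1 else RtoC 0.

Lemma csum_delta (f : nat -> C) i n : (i < n)%N -> csum (fun j => f j * delta i j)%C n = f i.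
Proof.
elim: n => [//|n IH] hi; cbn [csum]; case: (ltnP i n) => h.
  rewrite IH // /delta; have -> : (i == n) = false by apply/eqP; lia.
  by ring.
have -> : i = n by lia.
rewrite /delta eqxx (@csum_ext _ (fun _ => 0 * 0)%C) ?csum_mull; first by ring.
by move=> j hj; have -> : (n == j) = false by [apply/eqP; lia]; ring.
Qed.

Lemma glued_delta l N : glued l N delta = zs [::] l N.
Proof.
rewrite zs_csum /glued /glue; apply: csum_ext => i hi.
by rewrite csum_delta // /lefts /rights cats0.
Qed.

(** Only the node i0 may sit at infinity, with total weight c there. *)
Definition block1 (i0 : nat) (c : C) (i j : nat) : C :=
  if (i == i0) && (j == i0.+1) then c else delta i j.

Lemma glue_plus a b J J' r : glue a b (fun i j => J i j + J' i j)%C r = (glue a b J r + glue a b J' r)%C.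
Proof.
rewrite /glue -csum_plus; apply: csum_ext => i _; rewrite -Cmult_plus_distr_l -csum_plus; congr Cmult.
by apply: csum_ext => j _; ring.
Qed.

Lemma glue_single a b c i0 j0 r : (i0 <= r)%N -> (j0 <= r)%N ->
  glue a b (fun i j => delta i0 i * (delta j0 j * c))%C r = (c * (a i0 * b j0))%C.
Proof.
move=> hi hj; rewrite /glue (@csum_ext _ (fun i => (a i * csum (fun j => (b j * c) * delta j0 j) r.+1) * delta i0 i)%C).
  by rewrite csum_delta // csum_delta //; ring.
move=> i _; have -> : csum (fun j => b j * (delta i0 i * (delta j0 j * c)))%C r.+1 =
   (delta i0 i * csum (fun j => (b j * c) * delta j0 j) r.+1)%C; last by ring.
by rewrite -csum_mull; apply: csum_ext => j _; ring.
Qed.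

Lemma glue_ext a b J J' r : (forall i j, (i <= r)%N -> (j <= r)%N -> J i j = J' i j) ->
  glue a b J r = glue a b J' r.
Proof.
move=> H; apply: csum_ext => i hi; congr Cmult; apply: csum_ext => j hj; congr Cmult.
by apply: H; lia.
Qed.

Lemma glued_block1 l N c i0 : (i0 < size l)%N ->
  glued l N (block1 i0 c) = (zs [::] l N + c * (lefts l N i0 * rights l N i0.+1))%C.
Proof.
move=> h; rewrite -glued_delta /glued.
rewrite (@glue_ext _ _ _ (fun i j => (delta i j + delta i0 i * (delta i0.+1 j * c))%C)).
  by rewrite glue_plus glue_single //; lia.
move=> i j _ _; rewrite /block1 /delta ![_ == i]eq_sym ![_ == j]eq_sym.
case: (eqVneq i i0) => [->|hi] /=; last by case: (eqVneq j i) => _; ring.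
case: (eqVneq j i0.+1) => [->|hj] /=; last by case: (eqVneq j i0) => _; ring.
by have -> : (i0.+1 == i0) = false by [apply/eqP; lia]; ring.
Qed.

Lemma Centire_nest (fam : seq (C -> wt)) N :
  List.Forall (fun f => forall n, Centire (fun w => f w n)) fam ->
  Centire (fun w => nest (map (fun f => f w) fam) N).
Proof.
elim: fam N => [|f fam IH] N H w; first exact: Cdiff_const.
inversion H; apply: (@Cdiff_csum (fun n w => f w n * nest (map (fun f => f w) fam) n)%C) => n _.
by apply: Cdiff_mult; [exact: H2 | exact: IH].
Qed.

Definition node_entire (f : C -> node) : Prop :=
  forall n, Centire (fun w => (f w).1 n) /\ Centire (fun w => (f w).2 n).

Lemma Centire_glued (fam : seq (C -> node)) (J : C -> nat -> nat -> C) N :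
  List.Forall node_entire fam -> (forall i j, Centire (fun w => J w i j)) ->
  Centire (fun w => glued (map (fun f => f w) fam) N (J w)).
Proof.
move=> H HJ w; rewrite /glued /glue.
apply: (@Cdiff_ext (fun w => csum (fun i => lefts (map (fun f => f w) fam) N i *
   csum (fun j => rights (map (fun f => f w) fam) N j * J w i j) (size fam).+1) (size fam).+1)%C).
  by move=> z; rewrite size_map.
have Ht i : List.Forall node_entire (take i fam).
  by elim: fam i H => [|x l IH] [|i] H //=; try exact: List.Forall_nil; inversion H; apply: List.Forall_cons => //; apply: IH.
have Hd i : List.Forall node_entire (drop i fam).
  by elim: fam i H {Ht} => [|x l IH] [|i] H //=; inversion H; apply: IH.
apply: (@Cdiff_csum (fun i w => _)) => i _; apply: Cdiff_mult.
  apply: (@Cdiff_ext (fun w => nest (map (fun f => f w) (map (fun f w => (f w).1) (rev (take i fam)))) N)).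
    by move=> z; rewrite /lefts -map_take -map_rev -!map_comp.
  apply: Centire_nest; elim: (take i fam) (Ht i) => [|x l IH] h; first exact: List.Forall_nil.
  inversion h; rewrite rev_cons map_rcons -cats1; apply/List.Forall_app; split; first exact: IH.
  by apply: List.Forall_cons; [move=> n; apply H2 | exact: List.Forall_nil].
apply: (@Cdiff_csum (fun j w => _)) => j _; apply: Cdiff_mult; last exact: HJ.
apply: (@Cdiff_ext (fun w => nest (map (fun f => f w) (map (fun f w => (f w).2) (drop j fam))) N)).
  by move=> z; rewrite /rights -map_drop -!map_comp.
apply: Centire_nest; elim: (drop j fam) (Hd j) => [|x l IH] h; first exact: List.Forall_nil.
by inversion h; apply: List.Forall_cons; [move=> n; apply H2 | exact: IH].
Qed.

Lemma nest_lin (Y l : seq wt) (x y z : wt) c : (forall n, x n = (c * y n + z n)%C) ->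
  forall N, nest (Y ++ x :: l) N = (c * nest (Y ++ y :: l) N + nest (Y ++ z :: l) N)%C.
Proof.
move=> H; elim: Y => [|f Y IH] N; cbn [cat nest].
  by rewrite -csum_mull -csum_plus; apply: csum_ext => n _; rewrite H; ring.
by rewrite -csum_mull -csum_plus; apply: csum_ext => n _; rewrite IH; ring.
Qed.

Lemma zs_lin_left (x y z : node) c L :
  (forall n, x.1 n = (c * y.1 n + z.1 n)%C) ->
  forall R Y N, zs (Y ++ x :: L) R N = (c * zs (Y ++ y :: L) R N + zs (Y ++ z :: L) R N)%C.
Proof.
move=> H; elim=> [|r R IH] Y N; cbn [zs]; rewrite !map_cat; cbn [map]; rewrite (nest_lin _ _ H).
  by ring.
by rewrite -!cat_cons IH; ring.
Qed.

Lemma zs_lin (x y z : node) c R :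
  (forall n, x.1 n = (c * y.1 n + z.1 n)%C) -> (forall n, x.2 n = (c * y.2 n + z.2 n)%C) ->
  forall X L N, zs L (X ++ x :: R) N = (c * zs L (X ++ y :: R) N + zs L (X ++ z :: R) N)%C.
Proof.
have alg (a d b b' s s' : C) : (a * (d * b + b') + (d * s + s') = d * (a * b + s) + (a * b' + s'))%C by ring.
move=> H1 H2; elim=> [|r X IH] L N; cbn [cat zs].
  have e := @nest_lin [::] (map snd R) x.2 y.2 z.2 c H2 N; cbn [cat map] in e |- *; rewrite e.
  by have e' := zs_lin_left L H1 R [::] N; cbn [cat] in e'; rewrite e'; exact: alg.
have e := @nest_lin (map snd (r :: X)) (map snd R) x.2 y.2 z.2 c H2 N.
by rewrite IH -!cat_cons !map_cat; cbn [map] in e |- *; rewrite e; exact: alg.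
Qed.

Lemma zs_csum_node (a : nat -> C) (y : nat -> node) (X R : seq node) N M :
  zs [::] (X ++ (fun n => csum (fun l => a l * (y l).1 n) M, fun n => csum (fun l => a l * (y l).2 n) M)%C :: R) N
  = csum (fun l => a l * zs [::] (X ++ y l :: R) N)%C M.
Proof.
have alg (z : C) : (- (1) * z + z = 0)%C by ring.
elim: M => [|M IH].
  (* The zero node is -1 times itself plus itself, so linearity alone yields the value 0 of an empty
     combination. *)
  by rewrite (@zs_lin _ node0 node0 (- (1))%C); [exact: alg | move=> n /=; ring | move=> n /=; ring].
rewrite csumS -IH Cplus_comm.
by apply: zs_lin => n; cbn [csum fst snd]; apply: Cplus_comm.
Qed.

(** * The telescoping relation for large exponents *)

(* The weight [(x+1)^(-w) - x^(-w)], with its binomial expansion cut off at order [M];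
   at [w = -(m+1)] the expansion is finite and exact. *)
Definition om_node (t : C) (M : nat) (w : C) : node :=
  (fun n => csum (fun l => cbinom (- w) l.+1 * (nd t (w + RtoC (INR l.+1))).1 n)%C M,
   fun n => csum (fun l => cbinom (- w) l.+1 * (nd t (w + RtoC (INR l.+1))).2 n)%C M).

Lemma cbinom_bounded l W : exists B, 0 <= B /\ forall w, Cmod w <= W -> Cmod (cbinom w l) <= B.
Proof.
elim: l => [|l [B [B0 HB]]]; first by exists 1; split; [lra | move=> w _; rewrite /= Cmod_1; lra].
have il : 0 < INR l.+1 by apply: lt_0_INR; lia.
exists (B * (Rabs W + INR l) / INR l.+1); split.
  by apply: Rdiv_le_0_compat => //; apply: Rmult_le_pos => //; have := Rabs_pos W; have := pos_INR l; lra.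
move=> w hw; have -> : cbinom w l.+1 = (cbinom w l * (w - RtoC (INR l)) / RtoC (INR l.+1))%C by [].
rewrite Cmod_div; last exact: RtoC_INR_neq0.
rewrite Cmod_mult Cmod_R (Rabs_pos_eq (INR l.+1)); last lra.
apply: Rmult_le_compat_r; first by left; apply: Rinv_0_lt_compat.
apply: Rmult_le_compat; try exact: Cmod_ge_0; first exact: HB.
apply: Rle_trans (Cmod_triangle _ _) _; rewrite Cmod_opp Cmod_R (Rabs_pos_eq (INR l)); last exact: pos_INR.
by have := Rle_abs W; lra.
Qed.

Lemma wprod_bounded M W : exists B, 0 <= B /\ forall w, Cmod w <= W -> wprod w M <= B.
Proof.
elim: M W => [|M IH] W; first by exists 1; split; [lra | move=> w _ /=; lra].
have [B [B0 HB]] := IH (W + 1).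
exists (2 * Rabs W * B); split; first by apply: Rmult_le_pos => //; have := Rabs_pos W; lra.
move=> w hw /=; have h1 : Cmod w <= Rabs W by have := Rle_abs W; lra.
apply: Rmult_le_compat => //.
- by have := Cmod_ge_0 w; lra.
- exact: wprod_ge0.
- lra.
- by apply: HB; have := Cmod_triangle w 1; rewrite Cmod_1; lra.
Qed.

Lemma fst_ge_Cmod z : - Cmod z <= fst z.
Proof. by have := fst_le_Cmod (- z)%C; rewrite Cmod_opp /=; lra. Qed.

Lemma csum_bounded_uniform (P : C -> Prop) (f : nat -> C -> nat -> C) (g : nat -> R) M :
  (forall n, 0 <= g n) ->
  (forall l, exists B, 0 <= B /\ forall w, P w -> forall n, Cmod (f l w n) <= B * g n) ->
  exists B, 0 <= B /\ forall w, P w -> forall n, Cmod (csum (fun l => f l w n) M) <= B * g n.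
Proof.
move=> g0 H; elim: M => [|M [B [B0 HB]]].
  by exists 0; split; [lra | move=> w _ n /=; rewrite Cmod_0; lra].
have [B' [B0' HB']] := H M.
exists (B + B'); split; first lra.
move=> w hw n; cbn [csum]; apply: Rle_trans (Cmod_triangle _ _) _.
by have := HB w hw n; have := HB' w hw n; lra.
Qed.

(** Since Re w >= -W, each of the powers in the cut-off expansion is at most a constant times
    n^W. *)
Lemma om_node_le t K M W : chain_const t K -> exists B, 0 <= B /\ forall w, Cmod w <= W ->
  forall n, Cmod ((om_node t M w).1 n) <= B * npow n W /\ Cmod ((om_node t M w).2 n) <= B * npow n W.
Proof.
move=> [K0 [H1 [H2 _]]].
have Q la : near_log la K -> exists B, 0 <= B /\ forall w, Cmod w <= W -> forall n,
    Cmod (csum (fun l => cbinom (- w) l.+1 * wpow la (w + RtoC (INR l.+1)) n)%C M) <= B * npow n W.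
  move=> H; apply: (@csum_bounded_uniform (fun w => Cmod w <= W) (fun l w n => (cbinom (- w) l.+1 * wpow la (w + RtoC (INR l.+1)) n)%C)) => [n|l].
    exact: npow_ge0.
  have [B [B0 HB]] := cbinom_bounded l.+1 W.
  exists (B * exp ((W + INR l.+1) * K)); split; first by apply: Rmult_le_pos => //; left; apply: exp_pos.
  move=> w hw n; rewrite Cmod_mult Rmult_assoc; apply: Rmult_le_compat; try exact: Cmod_ge_0.
    by apply: HB; rewrite Cmod_opp.
  apply: Rle_trans (wpow_bound _ n H) _; have hl := pos_INR l.+1.
  apply: Rmult_le_compat.
  - by left; apply: exp_pos.
  - exact: npow_ge0.
  - apply: exp_le_compat; apply: Rmult_le_compat_r => //.
    by apply: Rle_trans (Cmod_triangle _ _) _; rewrite Cmod_R Rabs_pos_eq //; lra.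
  - apply: npow_le; have -> : fst (w + RtoC (INR l.+1))%C = fst w + INR l.+1 by [].
    by have := fst_ge_Cmod w; lra.
have [B1 [b1 h1]] := Q _ H1; have [B2 [b2 h2]] := Q _ H2.
exists (B1 + B2); split; first lra.
move=> w hw n; have := h1 w hw n; have := h2 w hw n; have := npow_ge0 n W.
by rewrite /om_node /nd; cbn [fst snd]; nra.
Qed.

(** [taylor_power] at tau = 1 with the term of order 0 moved to the left: after M further terms the
    increment of a power over one step is known up to O(n^(W-M-1)). *)
Lemma unit_step_taylor l l' n K M W : 0 <= K -> unit_step l l' (ln (INR n.+1)) K ->
  forall w, Cmod w <= W ->
  Cmod ((Cexp (- (w * l')) - Cexp (- (w * l))) -
     csum (fun i => cbinom (- w) i.+1 * Cexp (- ((w + RtoC (INR i.+1)) * l))) M)%C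
  <= wprod w M.+1 * (exp ((W + INR M.+1) * K) * npow n.+1 (W - INR M.+1)).
Proof.
move=> K0 [lp [e0 [e1 H]]] w hw.
have h1 : 0 <= 1 <= 1 by lra.
have := taylor_power M.+1 w H K0 h1; rewrite /taylor_poly csum_S_l e0 e1.
have -> : (cbinom (- w) 0 * RtoC (1 ^ 0) * Cexp (- ((w + RtoC (INR 0)) * l)))%C = Cexp (- (w * l))%C.
  by rewrite /= !Cmult_1_l Cplus_0_r.
rewrite (@csum_ext _ (fun i => cbinom (- w) i.+1 * Cexp (- ((w + RtoC (INR i.+1)) * l)))%C); last first.
  by move=> i _; rewrite pow1 Cmult_1_r.
set S := csum _ M => h.
have -> : (Cexp (- (w * l')) - Cexp (- (w * l)) - S = Cexp (- (w * l')) - (Cexp (- (w * l)) + S))%C by ring.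
apply: Rle_trans h _; apply: Rmult_le_compat_l; first exact: wprod_ge0.
apply: Rmult_le_compat; try (by left; apply: exp_pos).
- by apply: exp_le_compat; apply: Rmult_le_compat_r => //; lra.
- rewrite npow_S; apply: exp_le_compat; apply: Rmult_le_compat_r; first exact: ln_INR_ge0.
  by have := fst_ge_Cmod w; lra.
Qed.

Lemma om_node_step t K M W : chain_const t K -> forall w, Cmod w <= W -> forall n,
  Cmod ((wpow lap w n.+2 - wpow lap w n.+1) - (om_node t M w).1 n.+1)%C
    <= wprod w M.+1 * (exp ((W + INR M.+1) * K) * npow n.+1 (W - INR M.+1)) /\
  Cmod ((wpow (lam t) w n.+1 - wpow (lam t) w n.+2) - (om_node t M w).2 n.+2)%C
    <= wprod w M.+1 * (exp ((W + INR M.+1) * K) * npow n.+2 (W - INR M.+1)).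
Proof.
move=> [K0 [_ [_ [H1 H2]]]] w hw n; split.
- exact: (@unit_step_taylor _ _ _ K M W K0 (H1 n) w hw).
- exact: (@unit_step_taylor _ _ _ K M W K0 (H2 n) w hw).
Qed.

Lemma nodes_le_weaken m m' l : (forall n, m n <= m' n) -> nodes_le m l -> nodes_le m' l.
Proof.
move=> h; apply: List.Forall_impl => x H n; have [h1 h2] := H n.
by split; [apply: Rle_trans h1 (h n) | apply: Rle_trans h2 (h n)].
Qed.

Lemma nd_le t K A (l : seq C) : chain_const t K -> List.Forall (fun s => A <= fst s) l ->
  exists B, 0 <= B /\ nodes_le (fun n => B * npow n (- A)) (map (nd t) l).
Proof.
move=> [K0 [H1 [H2 _]]]; elim: l => [|s l IH] H.
  by exists 0; split; [lra | exact: List.Forall_nil].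
have hs : A <= fst s by inversion H.
have [B [B0 HB]] : exists B, 0 <= B /\ nodes_le (fun n => B * npow n (- A)) (map (nd t) l) by apply: IH; inversion H.
exists (B + exp (Cmod s * K)); have ep := exp_pos (Cmod s * K); split; first lra.
apply: List.Forall_cons.
  have Q la : near_log la K -> forall n, Cmod (wpow la s n) <= (B + exp (Cmod s * K)) * npow n (- A).
    move=> Hla n; apply: Rle_trans (wpow_bound s n Hla) _.
    apply: Rmult_le_compat; [lra | exact: npow_ge0 | lra | apply: npow_le; lra].
  by move=> n; split; [exact: (Q _ H1) | exact: (Q _ H2)].
apply: nodes_le_weaken HB => n; apply: Rmult_le_compat_r; [exact: npow_ge0 | lra].
Qed.

Lemma block1_le i0 c i j b : 1 <= b -> Cmod c <= b -> Cmod (block1 i0 c i j) <= b.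
Proof.
move=> b1 hc; rewrite /block1 /delta; case: (_ && _) => //.
by case: (_ == _); rewrite ?Cmod_1 ?Cmod_0; lra.
Qed.

Lemma delta_neq i j : i <> j -> delta i j = 0.
Proof. by rewrite /delta => /eqP/negbTE ->. Qed.

Lemma block1_diff i0 c i j : (i <> i0 \/ j <> i0.+1) -> block1 i0 c i j = delta i j.
Proof. by rewrite /block1 => -[/eqP/negbTE ->|/eqP/negbTE ->] //; rewrite andbF. Qed.

(** The entry (i0, i0+1) carries the telescoping error e0. Every other entry of the defect is a sum
    of at most three products, each of which contains a weight of a node other than i0, of size a,
    or vanishes; the remaining factors are at most b. *)
Lemma block1_defect l N c c' i0 a b e0 : (i0 < size l)%N -> 0 <= a -> a <= b -> 1 <= b -> 0 <= e0 ->
  (forall q, (q < size l)%N -> q <> i0 -> Cmod ((nth node0 l q).1 N) <= a /\ Cmod ((nth node0 l q).2 N) <= a) ->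
  Cmod ((nth node0 l i0).1 N) <= b -> Cmod ((nth node0 l i0).2 N) <= b -> Cmod c' <= b ->
  Cmod (c - c' - ((nth node0 l i0).1 N + (nth node0 l i0).2 N))%C <= e0 ->
  forall i j, (i <= size l)%N -> (j <= size l)%N ->
    Cmod (block1 i0 c i j - advanced l N (block1 i0 c') i j)%C <= e0 + 3 * (a * (b * b)).
Proof.
move=> hi0 a0 ab b1 e00 hq h1 h2 hc he i j hi hj.
have abb : 0 <= a * b <= a * (b * b).
  split; first by apply: Rmult_le_pos; lra.
  by apply: Rmult_le_compat_l => //; nra.
have hal q : (q < size l)%N -> Cmod ((nth node0 l q).1 N) <= b.
  by move=> h; case: (eqVneq q i0) => [->//|/eqP n]; have [] := hq q h n; lra.
have hnu q : (q < size l)%N -> Cmod ((nth node0 l q).2 N) <= b.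
  by move=> h; case: (eqVneq q i0) => [->//|/eqP n]; have [] := hq q h n; lra.
have P := Cmod_ge_0.
rewrite /advanced /advance; case: j hj => [|q] hj.
  rewrite !block1_diff; try (by right); rewrite (@delta_neq i.+1 O) // /opt.
  case: (i < size l)%N; last by have -> : (delta i 0 - (delta i 0 + 0 + 0) = 0)%C by [ring]; rewrite Cmod_0; lra.
  by have -> : (delta i 0 - (delta i 0 + 0 + (nth node0 l i).1 N * (0 + 0)) = 0)%C by [ring]; rewrite Cmod_0; lra.
case: (classic (i = i0 /\ q = i0)) => [[ei eq]|hn].
  subst i q; rewrite {1 2}/block1 !eqxx /= /opt hi0.
  rewrite !block1_diff; try lia.
  rewrite (@delta_neq i0.+1 i0) /delta ?eqxx; last lia.
  have -> : (c - (c' + (nth node0 l i0).2 N * 1 + (nth node0 l i0).1 N * (1 + (nth node0 l i0).2 N * 0)) =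
    c - c' - ((nth node0 l i0).1 N + (nth node0 l i0).2 N))%C by ring.
  lra.
have hd : i <> i0 \/ q.+1 <> i0.+1 by case: (eqVneq i i0) => [e|/eqP n]; [right => e'; apply: hn; split; lia | left].
rewrite !(@block1_diff i0 _ i q.+1 hd).
have T1 : Cmod ((nth node0 l q).2 N * block1 i0 c' i q)%C <= a * b.
  rewrite Cmod_mult; case: (eqVneq q i0) => [e|/eqP n].
    rewrite block1_diff; last by right; lia.
    by rewrite delta_neq ?Cmod_0; [lra | move=> e'; apply: hn; split; lia].
  by apply: Rmult_le_compat => //; [have [] := hq q hj n | apply: block1_le].
have T2 : Cmod (opt (i < size l)%N ((nth node0 l i).1 N * block1 i0 c' i.+1 q.+1))%C <= a * b.
  rewrite /opt; case: (ltnP i (size l)) => h; last by rewrite Cmod_0; lra.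
  rewrite Cmod_mult; case: (eqVneq i i0) => [e|/eqP n].
    rewrite block1_diff; last by left; lia.
    by rewrite delta_neq ?Cmod_0; [lra | move=> e'; apply: hn; split; lia].
  by apply: Rmult_le_compat => //; [have [] := hq i h n | apply: block1_le].
have T3 : Cmod (opt (i < size l)%N ((nth node0 l i).1 N * ((nth node0 l q).2 N * block1 i0 c' i.+1 q)))%C <= a * (b * b).
  rewrite /opt; case: (ltnP i (size l)) => h; last by rewrite Cmod_0; lra.
  rewrite !Cmod_mult; case: (eqVneq i i0) => [e|/eqP n]; last first.
    apply: Rmult_le_compat => //; first by apply: Rmult_le_pos.
      by have [] := hq i h n.
    by apply: Rmult_le_compat => //; [exact: hnu | apply: block1_le].
  rewrite block1_diff; last by left; lia.
  (* The left weight belongs to i0 and may be large, but the entry of the block is nonzero only for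
     q = i0 + 1, so the right weight is small. *)
  case: (eqVneq q i0.+1) => [e'|/eqP n'].
    have nq : q <> i0 by lia.
    have -> : delta i.+1 q = 1 by rewrite e e' /delta eqxx.
    rewrite Cmod_1 Rmult_1_r; have [_ h3] := hq q hj nq.
    apply: Rle_trans (_ : b * a <= _); last by lra.
    by apply: Rmult_le_compat => //; exact: hal.
  by rewrite delta_neq ?Cmod_0; [lra | lia].
set t1 := (_ * block1 i0 c' i q)%C in T1 *.
have -> : (delta i q.+1 - (delta i q.+1 + t1 + opt (i < size l)%N ((nth node0 l i).1 N *
    (block1 i0 c' i.+1 q.+1 + (nth node0 l q).2 N * block1 i0 c' i.+1 q))) =
  - (t1 + (opt (i < size l)%N ((nth node0 l i).1 N * block1 i0 c' i.+1 q.+1) +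
     opt (i < size l)%N ((nth node0 l i).1 N * ((nth node0 l q).2 N * block1 i0 c' i.+1 q)))))%C.
  by rewrite /opt; case: (i < size l)%N; ring.
rewrite Cmod_opp; apply: Rle_trans (Cmod_triangle _ _) _.
apply: Rle_trans (Rplus_le_compat_l _ _ _ (Cmod_triangle _ _)) _; lra.
Qed.

Lemma size_cat_cons (T : Type) (l1 l2 : seq T) x : size (l1 ++ x :: l2) = (size l1 + (size l2).+1)%N.
Proof. by rewrite size_cat. Qed.

Lemma nodes_le_cat m l1 l2 : nodes_le m (l1 ++ l2) <-> nodes_le m l1 /\ nodes_le m l2.
Proof. exact: List.Forall_app. Qed.

Lemma nodes_le_nth m l q N : nodes_le m l -> (q < size l)%N ->
  Cmod ((nth node0 l q).1 N) <= m N /\ Cmod ((nth node0 l q).2 N) <= m N.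
Proof.
elim: l q => [//|x l IH] [|q] H hq; inversion H; first exact: H2.
exact: IH.
Qed.

Lemma summable_to_0 u : summable u -> forall eps, 0 < eps -> exists N, forall n, (N <= n)%N -> u n <= eps.
Proof.
move=> Hu eps He; have [N HN] := summable_Cauchy Hu He; exists N => n hn.
by have := HN n n.+1 hn (leqnSn n); rewrite /=; lra.
Qed.

Lemma Ccv_squeeze x l (v : nat -> R) : (forall n, Cmod (x n - l)%C <= v n) ->
  (forall eps, 0 < eps -> exists N, forall n, (N <= n)%N -> v n <= eps) -> Ccv x l.
Proof.
move=> H Hv eps He; have [N HN] := Hv eps He; exists N => n hn.
exact: Rle_trans (H n) (HN n hn).
Qed.

Lemma cpow_step_wpow la k n : (wpow la (- RtoC (INR k)) n.+1 = Cpow (Cexp (la n.+1)) k)%C.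
Proof.
rewrite /wpow; have -> : (n.+1 == O) = false by [].
elim: k => [|k IH]; first by rewrite /=; have -> : (- (- 0 * la n.+1) = 0)%C by [ring]; rewrite Cexp_0.
cbn [Cpow]; rewrite -IH -Cexp_plus; congr Cexp; rewrite S_INR RtoC_plus; ring.
Qed.

Lemma Cexp_lap n : Cexp (lap n.+1) = RtoC (INR n.+1).
Proof. by rewrite /lap -Clog_INR Cexp_Clog //; apply: slit_pos; rewrite /RtoC; cbn [fst]; apply: lt_0_INR; lia. Qed.

Lemma Cexp_lam t n : tdom t -> Cexp (lam t n.+1) = (t - RtoC (INR n.+1))%C.
Proof.
move=> ht; rewrite /lam /Cminus Cexp_plus Cexp_Clog; last by apply: tdom_slit => //; exact: INR_S_ge1.
have e := Cexp_neg piI; rewrite Cexp_piI in e.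
have -> : Cexp (- piI) = (- (1))%C.
  have -> : Cexp (- piI) = (- (Cexp (- piI) * - (1)))%C by ring.
  by rewrite e.
by ring.
Qed.

Lemma ext_entire r tp t F l1 l2 : zetaU_extension r tp t F -> (size l1 + (size l2).+1)%N = r ->
  Centire (fun w => F (l1 ++ w :: l2)).
Proof.
move=> [He _] hs z; apply/Cdiff_ex_derive.
have h := He (l1 ++ z :: l2) ltac:(rewrite size_cat_cons; exact: hs) (size l1) ltac:(lia) z.
apply: ex_derive_ext h => w /=; congr F.
by elim: l1 {hs} => [|x l1 IH] //=; rewrite IH.
Qed.

Lemma conv_region_Forall r s : size s = r -> List.Forall (fun z => 1 < fst z) s -> conv_region r s.
Proof.
move=> hs H; split=> // j hj; rewrite -hs in hj; elim: s j H hj {hs} => [//|x s IH] [|j] H hj; inversion H => //.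
exact: IH.
Qed.

Lemma ext_Ccv r t F s : zetaU_extension r 0 t F -> size s = r -> List.Forall (fun z => 1 < fst z) s ->
  Ccv (fun N => zs [::] (map (nd t) s) N) (F s).
Proof.
move=> [_ H] hs h; have := H s (conv_region_Forall hs h) => /filterlim_Ccv.
by apply: Ccv_ext => N; rewrite zetaU_trunc_zs.
Qed.

(** The increment of the power x^(-w) over the step from N across infinity to t - (N - 1). *)
Definition Jn (t w : C) (N : nat) : C := (wpow (lam t) w N.-1 - wpow lap w N)%C.

Definition shift_nodes (t : C) (M : nat) (l1 l2 : seq C) (w : C) : seq node :=
  map (nd t) l1 ++ om_node t M w :: map (nd t) l2.

(** The cut is at k + 2, so that N and N - 1 are both chain elements. *)
Definition shift_sum (t : C) (M : nat) (l1 l2 : seq C) (k : nat) (w : C) : C :=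
  glued (shift_nodes t M l1 l2 w) k.+2 (block1 (size l1) (Jn t w k.+2)).

Lemma size_shift_nodes t M l1 l2 w : size (shift_nodes t M l1 l2 w) = (size l1 + (size l2).+1)%N.
Proof. by rewrite /shift_nodes size_cat_cons !size_map. Qed.

Lemma nth_shift_nodes t M l1 l2 w : nth node0 (shift_nodes t M l1 l2 w) (size l1) = om_node t M w.
Proof. by rewrite /shift_nodes nth_cat size_map ltnn subnn. Qed.

Lemma nodes_le_shift_nodes m t M l1 l2 w : nodes_le m (map (nd t) l1) -> nodes_le m (map (nd t) l2) ->
  (forall n, Cmod ((om_node t M w).1 n) <= m n /\ Cmod ((om_node t M w).2 n) <= m n) ->
  nodes_le m (shift_nodes t M l1 l2 w).
Proof. by move=> h1 h2 h; apply/nodes_le_cat; split=> //; apply: List.Forall_cons. Qed.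

Lemma Centire_om t M : node_entire (om_node t M).
Proof.
have Q la n : Centire (fun w => csum (fun l => cbinom (- w) l.+1 * wpow la (w + RtoC (INR l.+1)) n)%C M).
  move=> w; apply: (@Cdiff_csum (fun l w => cbinom (- w) l.+1 * wpow la (w + RtoC (INR l.+1)) n)%C) => l _.
  apply: Cdiff_mult.
    apply: (@Cdiff_comp (fun w => cbinom w l.+1) (fun w => - w)%C); first exact: Centire_cbinom.
    by apply: Cdiff_opp; exact: Cdiff_id.
  apply: (@Cdiff_comp (fun w => wpow la w n) (fun w => w + RtoC (INR l.+1))%C); first exact: Centire_wpow.
  by apply: Cdiff_plus; [exact: Cdiff_id | exact: Cdiff_const].
by move=> n; split; [exact: (Q lap) | exact: (Q (lam t))].
Qed.

Lemma Forall_map_const (t : C) l : List.Forall node_entire (map (fun s _ => nd t s) l).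
Proof.
elim: l => [|s l IH]; first exact: List.Forall_nil.
by apply: List.Forall_cons => // n; split=> w; exact: Cdiff_const.
Qed.

Lemma Centire_shift_sum t M l1 l2 k : Centire (shift_sum t M l1 l2 k).
Proof.
move=> w; apply: (@Cdiff_ext (fun w => glued (map (fun f => f w)
   (map (fun s _ => nd t s) l1 ++ om_node t M :: map (fun s _ => nd t s) l2)) k.+2 (block1 (size l1) (Jn t w k.+2)))).
  by move=> z; rewrite /shift_sum /shift_nodes map_cat /= -!map_comp.
apply: (Centire_glued (J := fun w => block1 (size l1) (Jn t w k.+2))).
  apply/List.Forall_app; split; first exact: Forall_map_const.
  by apply: List.Forall_cons; [exact: Centire_om | exact: Forall_map_const].
move=> i j z; rewrite /block1; case: (_ && _); last exact: Cdiff_const.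
by apply: Cdiff_minus; exact: Centire_wpow.
Qed.

Lemma nodes_le_summable_bounded t K A (l : seq C) : chain_const t K -> 2 <= A ->
  List.Forall (fun s => A <= fst s) l ->
  exists B, forall N, Cmod (nest (map fst (rev (map (nd t) l))) N) <= B /\ Cmod (nest (map snd (map (nd t) l)) N) <= B.
Proof.
move=> HK hA H; have [B [B0 HB]] := nd_le HK H.
have [u0 [S HS]] : summable (fun n => B * npow n (- A)).
  have [_ [S HS]] := summable_scal B0 (npow_summable (kap := 1) Rlt_0_1).
  split; first by move=> n; apply: Rmult_le_pos => //; exact: npow_ge0.
  exists S => n; apply: Rle_trans (HS n).
  elim: n => [|n IH]; first by rewrite /=; lra.
  by cbn [rsum]; apply: Rplus_le_compat => //; apply: Rmult_le_compat_l => //; apply: npow_le; lra.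
exists (S ^ size l) => N; split.
- apply: Rle_trans (nest_bound N u0 _) _.
    by have := Forall_take_rev (size (map (nd t) l)) HB; rewrite take_size.
  by rewrite size_map size_rev size_map; apply: pow_incr; split => //; exact: rsum_ge0.
- apply: Rle_trans (nest_bound N u0 _) _.
    by have := Forall_drop 0 HB; rewrite drop0.
  by rewrite !size_map; apply: pow_incr; split => //; exact: rsum_ge0.
Qed.

Lemma lefts_shift_nodes t M l1 l2 w N : lefts (shift_nodes t M l1 l2 w) N (size l1) = nest (map fst (rev (map (nd t) l1))) N.
Proof. by rewrite /lefts /shift_nodes take_size_cat // size_map. Qed.

Lemma rights_shift_nodes t M l1 l2 w N : rights (shift_nodes t M l1 l2 w) N (size l1).+1 = nest (map snd (map (nd t) l2)) N.
Proof. by rewrite /rights /shift_nodes -cat_rcons drop_size_cat // size_rcons size_map. Qed.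

Lemma shift_sum_zs t M l1 l2 k w : shift_sum t M l1 l2 k w =
  (zs [::] (shift_nodes t M l1 l2 w) k.+2 + Jn t w k.+2 *
    (nest (map fst (rev (map (nd t) l1))) k.+2 * nest (map snd (map (nd t) l2)) k.+2))%C.
Proof. by rewrite /shift_sum glued_block1 ?size_shift_nodes ?lefts_shift_nodes ?rights_shift_nodes //; lia. Qed.

Lemma Forall_lt_of_le (A : R) (l : seq C) : 2 <= A -> List.Forall (fun s => A <= fst s) l ->
  List.Forall (fun z => 1 < fst z) l.
Proof. by move=> h; apply: List.Forall_impl => z; lra. Qed.

(** For Re z >= 2 the entry [Jn] is O(n^(-2)) and the sums beside it are bounded, so the correction
    disappears and the limit is a finite combination of convergent zeta sums. *)
Lemma shift_sum_arc r t F M l1 l2 A z : tdom t -> zetaU_extension r 0 t F -> (size l1 + (size l2).+1)%N = r ->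
  2 <= A -> List.Forall (fun s => A <= fst s) l1 -> List.Forall (fun s => A <= fst s) l2 -> 2 <= fst z ->
  Ccv (fun k => shift_sum t M l1 l2 k z) (csum (fun l => cbinom (- z) l.+1 * F (l1 ++ (z + RtoC (INR l.+1))%C :: l2))%C M).
Proof.
move=> ht HF hs hA h1 h2 hz; have [K HK] := chain_const_ex ht.
have [K0 [N1 [N2 _]]] := HK.
rewrite -[csum _ M]Cplus_0_r.
apply: (Ccv_ext (x := fun k => (zs [::] (shift_nodes t M l1 l2 z) (k + 2)%N + Jn t z k.+2 *
    (nest (map fst (rev (map (nd t) l1))) k.+2 * nest (map snd (map (nd t) l2)) k.+2))%C)).
  by move=> k; rewrite shift_sum_zs addn2.
apply: Ccv_plus.
  apply: Ccv_unshift.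
  apply: (Ccv_ext (x := fun N => csum (fun l => cbinom (- z) l.+1 * zs [::] (map (nd t) l1 ++ nd t (z + RtoC (INR l.+1))%C :: map (nd t) l2) N)%C M)).
    by move=> N; rewrite /shift_nodes /om_node zs_csum_node.
  apply: Ccv_csum => l _; apply: Ccv_scal.
  apply: (Ccv_ext (x := fun N => zs [::] (map (nd t) (l1 ++ (z + RtoC (INR l.+1))%C :: l2)) N)).
    by move=> N; rewrite map_cat.
  apply: (ext_Ccv HF); first by rewrite size_cat_cons.
  apply/List.Forall_app; split; first exact: Forall_lt_of_le h1.
  apply: List.Forall_cons; last exact: Forall_lt_of_le h2.
  by have -> : fst (z + RtoC (INR l.+1))%C = fst z + INR l.+1 by []; have := pos_INR l.+1; lra.
have [B1 H1] := nodes_le_summable_bounded HK hA h1.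
have [B2 H2] := nodes_le_summable_bounded HK hA h2.
have b1 : 0 <= B1 by have [q _] := H1 O; have := Cmod_ge_0 (nest (map fst (rev (map (nd t) l1))) 0); lra.
have b2 : 0 <= B2 by have [_ q] := H2 O; have := Cmod_ge_0 (nest (map snd (map (nd t) l2)) 0); lra.
have [B Bp] : exists B, 0 <= B /\ forall k, Cmod (Jn t z k.+2) <= B * npow k.+1 (- 1 - 1).
  exists (2 * exp (Cmod z * K)); have ep := exp_pos (Cmod z * K); split; first lra.
  move=> k; apply: Rle_trans (Cmod_triangle _ _) _; rewrite Cmod_opp.
  have q1 := wpow_bound z k.+1 N2; have q2 := wpow_bound z k.+2 N1.
  have q3 : npow k.+1 (- fst z) <= npow k.+1 (-1 - 1) by apply: npow_le; lra.
  have q4 : npow k.+2 (- fst z) <= npow k.+1 (-1 - 1).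
    apply: Rle_trans q3; rewrite !npow_S; apply: exp_le_compat.
    have : ln (INR k.+1) <= ln (INR k.+2) by apply: ln_le; [apply: lt_0_INR; lia | apply: le_INR; lia].
    by nra.
  have := Rmult_le_compat_l _ _ _ (Rlt_le _ _ ep) q3.
  have := Rmult_le_compat_l _ _ _ (Rlt_le _ _ ep) q4.
  by rewrite [k.+2.-1]/=; lra.
apply: (Ccv_squeeze (v := fun k => B * (B1 * B2) * npow k.+1 (- 1 - 1))).
  move=> k; have -> (x : C) : (x - 0 = x)%C by ring.
  rewrite !Cmod_mult; have := H1 k.+2; have := H2 k.+2; have := Bp.2 k => q1 [_ q2] [q3 _].
  have -> : B * (B1 * B2) * npow k.+1 (-1 - 1) = B * npow k.+1 (-1 - 1) * (B1 * B2) by ring.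
  apply: Rmult_le_compat => //; try exact: Cmod_ge_0; first by apply: Rmult_le_pos; exact: Cmod_ge_0.
  by apply: Rmult_le_compat => //; exact: Cmod_ge_0.
apply: summable_to_0; apply: (summable_shift (u := fun n => B * (B1 * B2) * npow n (-1 - 1))).
apply: summable_scal; first by apply: Rmult_le_pos; [exact: Bp.1 | exact: Rmult_le_pos].
exact: npow_summable Rlt_0_1.
Qed.

Lemma npow_S_ge1 n x : 0 <= x -> 1 <= npow n.+1 x.
Proof. by move=> h; rewrite -(npow_0 n); apply: npow_le. Qed.

(* The common increment estimate: with weights O(n^(kap-1)) the one-sided sums are
   O(n^(r kap)), so a defect O(n^(-1-kap'-2 r kap)) gives summable increments. *)
Lemma glued_incr_npow r kap C0 Ce kap' : 0 < kap -> 0 <= C0 -> 0 <= Ce -> exists B, 0 <= B /\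
  forall l N J J', size l = r -> nodes_le (fun n => C0 * npow n (kap - 1)) l ->
  (forall i j, (i <= r)%N -> (j <= r)%N ->
     Cmod (J i j - advanced l N.+1 J' i j)%C <= Ce * npow N.+1 (- 1 - kap' - INR r * (2 * kap))) ->
  Cmod (glued l N.+2 J' - glued l N.+1 J)%C <= B * npow N.+1 (- 1 - kap').
Proof.
move=> kp C00 Ce0; have [D [D0 HD]] := npow_growth kp.
have c1 : 1 <= 1 + C0 * D by have := Rmult_le_pos _ _ C00 (Rlt_le _ _ D0); lra.
have r0 := pos_INR r.+1.
have rr : 0 <= (1 + C0 * D) ^ r by apply: pow_le; lra.
exists (INR r.+1 * ((1 + C0 * D) ^ r * (INR r.+1 * ((1 + C0 * D) ^ r * Ce)))); split.
  by repeat (apply: Rmult_le_pos => //).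
move=> l N J J' hs Hl He.
have n1 := @npow_S_ge1 N kap (Rlt_le _ _ kp).
pose B := (1 + C0 * D) * npow N.+1 kap.
have B1 : 1 <= B by rewrite /B; nra.
have m0 n : 0 <= C0 * npow n (kap - 1) by apply: Rmult_le_pos => //; exact: npow_ge0.
have hB : rsum (fun n => C0 * npow n (kap - 1)) N.+1 <= B.
  have e k : rsum (fun n => C0 * npow n (kap - 1)) k = C0 * rsum (fun n => npow n (kap - 1)) k.
    by elim: k => [|k IHk]; [rewrite /=; ring | cbn [rsum]; rewrite IHk; ring].
  rewrite e /B; have := Rmult_le_compat_l _ _ _ C00 (HD N); lra.
have e0 : 0 <= Ce * npow N.+1 (- 1 - kap' - INR r * (2 * kap)) by apply: Rmult_le_pos => //; exact: npow_ge0.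
have He' i j : (i <= size l)%N -> (j <= size l)%N -> _ := fun h1 h2 =>
  He i j (etrans (congr1 (leq i) (esym hs)) h1) (etrans (congr1 (leq j) (esym hs)) h2).
apply: Rle_trans (glued_incr m0 Hl B1 hB e0 He') _.
apply: Req_le; rewrite /B Rpow_mult_distr npow_pow.
have -> : npow N.+1 (- 1 - kap') = npow N.+1 (INR r * kap) * (npow N.+1 (INR r * kap) * npow N.+1 (- 1 - kap' - INR r * (2 * kap))).
  by rewrite -!npow_plus; congr npow; ring.
by rewrite hs; ring.
Qed.

Lemma unit_step_end l l' x K : unit_step l l' x K -> Cmod (l' - RtoC x)%C <= K.
Proof. by move=> [lp [_ [<- H]]]; apply H; lra. Qed.

Lemma wpow_end l' n K w W : 0 <= K -> Cmod (l' - RtoC (ln (INR n.+1)))%C <= K -> Cmod w <= W ->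
  Cmod (Cexp (- (w * l')))%C <= exp (W * K) * npow n.+1 W.
Proof.
move=> K0 h hw; apply: Rle_trans (Cmod_Cexp_near w h) _.
apply: Rmult_le_compat; try (by left; apply: exp_pos).
- by apply: exp_le_compat; apply: Rmult_le_compat_r.
- rewrite npow_S; apply: exp_le_compat; apply: Rmult_le_compat_r; first exact: ln_INR_ge0.
  by have := fst_ge_Cmod w; lra.
Qed.

(** The weights of [om_node] are only O(n^W), so [glued_incr_npow] is used with kap = W + 1. One
    small and two large weights give a defect n^(2W-A), cutting the expansion gives n^(W-M-1); both
    must beat the growth n^(2 r kap), which fixes the bounds on A and M. *)
Lemma shift_sum_incr r t M l1 l2 W A : tdom t -> (size l1 + (size l2).+1)%N = r -> 0 <= W ->
  2 * W + 2 + INR r * (2 * (W + 1)) <= A -> A <= INR M.+1 ->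
  List.Forall (fun s => A <= fst s) l1 -> List.Forall (fun s => A <= fst s) l2 ->
  exists u, summable u /\ forall k w, Cmod w <= W ->
    Cmod (shift_sum t M l1 l2 k.+1 w - shift_sum t M l1 l2 k w)%C <= u k.
Proof.
move=> ht hs W0 hA hM h1 h2; have [K HK] := chain_const_ex ht.
have [K0 [N1 [N2 [U1 U2]]]] := HK.
have rp := pos_INR r.
have A0 : 2 * W + 2 <= A by have : 0 <= INR r * (2 * (W + 1)) by [apply: Rmult_le_pos => //; lra]; lra.
have [Ca1 [ca1 Ha1]] := nd_le HK h1; have [Ca2 [ca2 Ha2]] := nd_le HK h2.
have [Co [co Ho]] := om_node_le M W HK.
have [Bw [bw HBw]] := wprod_bounded M.+1 W.
have eW := exp_pos (W * K).
pose Ca := Ca1 + Ca2.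
pose Cb := 1 + Ca + Co + 2 * exp (W * K).
pose Ce := 2 * (Bw * exp ((W + INR M.+1) * K)) + 3 * (Ca * (Cb * Cb)).
have Ca0 : 0 <= Ca by rewrite /Ca; lra.
have Cb1 : 1 <= Cb by rewrite /Cb; lra.
have Ce1 : 0 <= Bw * exp ((W + INR M.+1) * K) by apply: Rmult_le_pos => //; left; apply: exp_pos.
have Ce2 : 0 <= Ca * (Cb * Cb) by apply: Rmult_le_pos => //; nra.
have Ce0 : 0 <= Ce by rewrite /Ce; lra.
have [B [B0 HB]] := @glued_incr_npow r (W + 1) (Ca + Co) Ce 1 ltac:(lra) ltac:(lra) Ce0.
exists (fun k => B * npow k.+2 (-1 - 1)); split.
  apply: (summable_shift (u := fun k => B * npow k.+1 (-1 - 1))).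
  apply: (summable_shift (u := fun k => B * npow k (-1 - 1))).
  by apply: summable_scal => //; exact: npow_summable Rlt_0_1.
move=> k w hw; rewrite /shift_sum; apply: HB; first by rewrite size_shift_nodes.
  have ek : W + 1 - 1 = W by ring.
  have hAW : - A <= W by lra.
  apply: nodes_le_shift_nodes.
  - apply: nodes_le_weaken Ha1 => n; rewrite ek /Ca; apply: Rmult_le_compat => //; try lra; [exact: npow_ge0 | exact: npow_le].
  - apply: nodes_le_weaken Ha2 => n; rewrite ek /Ca; apply: Rmult_le_compat => //; try lra; [exact: npow_ge0 | exact: npow_le].
  - move=> n; have [q1 q2] := Ho w hw n; rewrite ek.
    have q3 : Co * npow n W <= (Ca + Co) * npow n W by apply: Rmult_le_compat_r; [exact: npow_ge0 | lra].
    lra.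
pose a := Ca * npow k.+2 (- A); pose b := Cb * npow k.+2 W.
have nW : 1 <= npow k.+2 W by exact: npow_S_ge1.
have nA : 0 <= npow k.+2 (- A) by exact: npow_ge0.
have nAW : npow k.+2 (- A) <= npow k.+2 W by apply: npow_le; lra.
have a0 : 0 <= a by exact: Rmult_le_pos.
have b1 : 1 <= b by rewrite /b; nra.
have ab : a <= b by rewrite /a /b; apply: Rmult_le_compat => //; rewrite /Cb; lra.
pose e0 := 2 * (Bw * exp ((W + INR M.+1) * K)) * npow k.+2 (W - INR M.+1).
have e00 : 0 <= e0 by apply: Rmult_le_pos; [lra | exact: npow_ge0].
have fin : e0 + 3 * (a * (b * b)) <= Ce * npow k.+2 (- 1 - 1 - INR r * (2 * (W + 1))).
  have p1 : npow k.+2 (W - INR M.+1) <= npow k.+2 (- 1 - 1 - INR r * (2 * (W + 1))) by apply: npow_le; lra.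
  have p2 : npow k.+2 (2 * W - A) <= npow k.+2 (- 1 - 1 - INR r * (2 * (W + 1))) by apply: npow_le; lra.
  have -> : a * (b * b) = Ca * (Cb * Cb) * npow k.+2 (2 * W - A).
    have -> : 2 * W - A = - A + (W + W) by ring.
    by rewrite !npow_plus /a /b; ring.
  have c1 : 0 <= 2 * (Bw * exp ((W + INR M.+1) * K)) by lra.
  have := Rmult_le_compat_l _ _ _ c1 p1; have := Rmult_le_compat_l _ _ _ Ce2 p2.
  by rewrite /e0 /Ce; lra.
move=> i j hi hj; apply: Rle_trans fin.
apply: (@block1_defect _ k.+2 _ _ (size l1) a b e0) => //; rewrite ?size_shift_nodes ?nth_shift_nodes ?hs //.
- lia.
- move=> q hq nq.
  have hla : nodes_le (fun n => Ca * npow n (- A)) (map (nd t) l1 ++ map (nd t) l2).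
    apply/nodes_le_cat; split.
    + by apply: nodes_le_weaken Ha1 => n; apply: Rmult_le_compat_r; [exact: npow_ge0 | rewrite /Ca; lra].
    + by apply: nodes_le_weaken Ha2 => n; apply: Rmult_le_compat_r; [exact: npow_ge0 | rewrite /Ca; lra].
  have [q' hq' ->] : exists2 q', (q' < size (map (nd t) l1 ++ map (nd t) l2))%N &
      nth node0 (shift_nodes t M l1 l2 w) q = nth node0 (map (nd t) l1 ++ map (nd t) l2) q'.
    case: (ltnP q (size l1)) => hl.
      exists q; first by rewrite size_cat !size_map; exact: ltn_addr.
      by rewrite /shift_nodes !nth_cat !size_map hl.
    have alg (x y z : nat) : (z <= x)%N -> x <> z -> (x < z + y.+1)%N -> (x.-1 < z + y)%N by lia.
    have alg2 (x z : nat) : (z <= x)%N -> x <> z -> (z <= x.-1)%N by lia.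
    have alg3 (x z : nat) : (z <= x)%N -> x <> z -> (x - z = (x.-1 - z).+1)%N by lia.
    rewrite -hs in hq.
    exists q.-1; first by rewrite size_cat !size_map; exact: alg.
    rewrite /shift_nodes !nth_cat !size_map.
    have -> : (q < size l1)%N = false by apply/negbTE; rewrite -leqNgt.
    have -> : (q.-1 < size l1)%N = false by apply/negbTE; rewrite -leqNgt; exact: alg2.
    by rewrite (alg3 _ _ hl nq).
  exact: nodes_le_nth hla hq'.
- have [q1 _] := Ho w hw k.+2; apply: Rle_trans q1 _; rewrite /b /Cb; apply: Rmult_le_compat_r; lra.
- have [_ q1] := Ho w hw k.+2; apply: Rle_trans q1 _; rewrite /b /Cb; apply: Rmult_le_compat_r; lra.
- apply: Rle_trans (Cmod_triangle _ _) _; rewrite Cmod_opp.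
  have q1 : Cmod (wpow (lam t) w k.+2) <= exp (W * K) * npow k.+2 W by apply: wpow_end => //; exact: N2.
  have q2 : Cmod (wpow lap w k.+3) <= exp (W * K) * npow k.+2 W by apply: wpow_end => //; exact: unit_step_end (U1 k.+1).
  rewrite [k.+3.-1]/= /b /Cb.
  have : 0 <= (1 + Ca + Co) * npow k.+2 W by apply: Rmult_le_pos; lra.
  lra.
- have [_ q2] := om_node_step M HK hw k; have [q1 _] := om_node_step M HK hw k.+1.
  rewrite /Jn [k.+2.-1]/= [k.+3.-1]/=.
  set o1 := (om_node t M w).1 k.+2 in q1 *; set o2 := (om_node t M w).2 k.+2 in q2 *.
  have -> : (wpow (lam t) w k.+1 - wpow lap w k.+2 - (wpow (lam t) w k.+2 - wpow lap w k.+3) - (o1 + o2) =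
    (wpow lap w k.+3 - wpow lap w k.+2 - o1) + (wpow (lam t) w k.+1 - wpow (lam t) w k.+2 - o2))%C by ring.
  apply: Rle_trans (Cmod_triangle _ _) _.
  have q3 : wprod w M.+1 * (exp ((W + INR M.+1) * K) * npow k.+2 (W - INR M.+1)) <=
     Bw * exp ((W + INR M.+1) * K) * npow k.+2 (W - INR M.+1).
    rewrite Rmult_assoc; apply: Rmult_le_compat_r; last exact: HBw.
    by apply: Rmult_le_pos; [left; apply: exp_pos | exact: npow_ge0].
  by rewrite /e0; lra.
Qed.

(** 3 m + 7 = (m + 1) + 2 (m + 3) is the largest modulus on the circle of [shift_sum_limit]. For
    this W, [shift_order] is the bound on A in [shift_sum_incr]; it serves as cut-off order and as
    lower bound for the other exponents. *)
Definition shift_radius (m : nat) : nat := (3 * m + 7)%N.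
Definition shift_order (r m : nat) : nat := (2 * shift_radius m + 2 + r * (2 * (shift_radius m + 1)))%N.

Lemma INR_shift_order r m : INR (shift_order r m) = 2 * INR (shift_radius m) + 2 + INR r * (2 * (INR (shift_radius m) + 1)).
Proof. by rewrite /shift_order !plus_INR !mult_INR !plus_INR /=; ring. Qed.

(* Circle of radius 2(m+3) about -(m+1): its right arc lies in Re >= 2. *)
Lemma shift_sum_limit r m t F l1 l2 : tdom t -> zetaU_extension r 0 t F -> (size l1 + (size l2).+1)%N = r ->
  List.Forall (fun s => INR (shift_order r m) <= fst s) l1 -> List.Forall (fun s => INR (shift_order r m) <= fst s) l2 ->
  let c := (- RtoC (INR m.+1))%C in
  Ccv (fun k => shift_sum t (shift_order r m) l1 l2 k c)
    (csum (fun l => cbinom (- c) l.+1 * F (l1 ++ (c + RtoC (INR l.+1))%C :: l2))%C (shift_order r m)).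
Proof.
move=> ht HF hs h1 h2 c; set M := shift_order r m in h1 h2 *.
have rp := pos_INR r; have mp := pos_INR m.
have eW : INR (shift_radius m) = 3 * INR m + 7 by rewrite /shift_radius plus_INR mult_INR /=; ring.
have W0 := pos_INR (shift_radius m).
have eM := INR_shift_order r m; rewrite -/M in eM.
have hr : 0 <= INR r * (2 * (INR (shift_radius m) + 1)) by apply: Rmult_le_pos => //; lra.
have [u [Hu Hinc]] := @shift_sum_incr r t M l1 l2 (INR (shift_radius m)) (INR M) ht hs W0 ltac:(lra) ltac:(rewrite S_INR; lra) h1 h2.
pose G w := csum (fun l => cbinom (- w) l.+1 * F (l1 ++ (w + RtoC (INR l.+1))%C :: l2))%C M.
apply: (@vitali_center G (fun k w => shift_sum t M l1 l2 k w) c (2 * (INR m + 3)) u) => //.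
- move=> w; apply: (@Cdiff_csum (fun l w => cbinom (- w) l.+1 * F (l1 ++ (w + RtoC (INR l.+1))%C :: l2))%C) => l _.
  apply: Cdiff_mult.
    apply: (@Cdiff_comp (fun w => cbinom w l.+1) (fun w => - w)%C); first exact: Centire_cbinom.
    by apply: Cdiff_opp; exact: Cdiff_id.
  apply: (@Cdiff_comp (fun w => F (l1 ++ w :: l2)) (fun w => w + RtoC (INR l.+1))%C); first exact: (ext_entire HF hs).
  by apply: Cdiff_plus; [exact: Cdiff_id | exact: Cdiff_const].
- by move=> n; exact: Centire_shift_sum.
- lra.
- move=> n z hz; apply: Hinc.
  have -> : z = (z - c + c)%C by ring.
  apply: Rle_trans (Cmod_triangle _ _) _; rewrite hz /c Cmod_opp Cmod_R Rabs_pos_eq; last exact: pos_INR.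
  by rewrite S_INR eW; lra.
- move=> z _ hz; apply: (shift_sum_arc M ht HF hs _ h1 h2); first lra.
  have e : fst (z - c)%C = fst z + INR m.+1 by rewrite /c /Cminus /Cplus /Copp /RtoC; cbn [fst]; ring.
  by rewrite e S_INR in hz; lra.
Qed.

Lemma wpow_0 la s : wpow la s O = 0.
Proof. by []. Qed.

Lemma cbinom_INR_gt k l : (k < l)%N -> cbinom (RtoC (INR k)) l = 0.
Proof.
elim: l => [//|l IH] h.
have -> : cbinom (RtoC (INR k)) l.+1 = (cbinom (RtoC (INR k)) l * (RtoC (INR k) - RtoC (INR l)) / RtoC (INR l.+1))%C by [].
case: (ltnP k l) => hl; first by rewrite IH // /Cdiv; ring.
by have -> : l = k by [lia]; rewrite /Cdiv; ring.
Qed.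

Lemma cbinom_pascal w l : cbinom (w + 1)%C l.+1 = (cbinom w l.+1 + cbinom w l)%C.
Proof.
elim: l => [|l IH].
  by rewrite /=; field; move=> /RtoC_inj; lra.
have h := @RtoC_INR_neq0 l.+1; have h' := @RtoC_INR_neq0 l.
have e u : cbinom u l.+2 = (cbinom u l.+1 * (u - RtoC (INR l.+1)) / RtoC (INR l.+2))%C by [].
have e1 : cbinom w l.+1 = (cbinom w l * (w - RtoC (INR l)) / RtoC (INR l.+1))%C by [].
rewrite !e IH e1 !(S_INR l.+1) !RtoC_plus; rewrite (S_INR l.+1) RtoC_plus in h; rewrite !(S_INR l) !RtoC_plus.
rewrite !(S_INR l) !RtoC_plus in h h'.
by field; split.
Qed.

Lemma binomial_thm x k : csum (fun l => cbinom (RtoC (INR k)) l * Cpow x (k - l))%C k.+1 = Cpow (x + 1)%C k.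
Proof.
elim: k => [|k IH]; first by rewrite /=; ring.
rewrite csum_S_l (@csum_ext _ (fun l => cbinom (RtoC (INR k)) l.+1 * Cpow x (k - l) + cbinom (RtoC (INR k)) l * Cpow x (k - l))%C); last first.
  by move=> l _; rewrite subSS S_INR RtoC_plus cbinom_pascal; ring.
rewrite csum_plus IH csumS (@cbinom_INR_gt k k.+1) // subnn.
have e : csum (fun l => cbinom (RtoC (INR k)) l * Cpow x (k.+1 - l))%C k.+1 = (x * Cpow (x + 1) k)%C.
  by rewrite -IH -csum_mull; apply: csum_ext => l hl; rewrite subSn //; cbn [Cpow]; ring.
rewrite csum_S_l in e.
rewrite (@csum_ext (fun l => cbinom (RtoC (INR k)) l.+1 * Cpow x (k - l))%C (fun i => cbinom (RtoC (INR k)) i.+1 * Cpow x (k.+1 - i.+1))%C) //.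
cbn [cbinom] in e |- *; rewrite !subn0 in e *; cbn [Cpow] in e |- *.
set S := csum _ k in e *.
have -> : (1 * (x * Cpow x k) + (S + 0 * 1 + Cpow (x + 1) k) = (1 * (x * Cpow x k) + S) + Cpow (x + 1) k)%C by ring.
by rewrite e; ring.
Qed.

Lemma binomial_diff x m : (Cpow (x + 1) m.+1 - Cpow x m.+1)%C =
  csum (fun l => cbinom (RtoC (INR m.+1)) l.+1 * Cpow x (m - l))%C m.+1.
Proof.
rewrite -binomial_thm csum_S_l subn0 (_ : cbinom (RtoC (INR m.+1)) 0 = 1) //.
rewrite (@csum_ext (fun i => cbinom (RtoC (INR m.+1)) i.+1 * Cpow x (m.+1 - i.+1))%C (fun i => cbinom (RtoC (INR m.+1)) i.+1 * Cpow x (m - i))%C) //.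
by ring.
Qed.

Lemma wpow_sub la x s j n : Cexp (la n.+1) = x ->
  wpow la (s - RtoC (INR j)) n.+1 = (wpow la s n.+1 * Cpow x j)%C.
Proof. by move=> <-; rewrite /Cminus wpow_plus cpow_step_wpow. Qed.

Lemma csum_pad (f : nat -> C) k M : (k <= M)%N -> (forall i, (k <= i)%N -> f i = 0) -> csum f M = csum f k.
Proof.
move=> hk h; elim: M hk => [|M IH] hk; first by have -> : k = O by lia.
case: (leqP k M) => hM; last by have -> : k = M.+1 by lia.
by rewrite csumS IH // h //; ring.
Qed.

Section Relation.

Variables (t : C) (m : nat).
Hypothesis ht : tdom t.

Definition gpos (n : nat) : C := Cpow (RtoC (INR n)) m.+1.
Definition gneg (n : nat) : C := Cpow (t - RtoC (INR n))%C m.+1.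

Lemma om_weight la x M n : (m < M)%N -> Cexp (la n.+1) = x ->
  csum (fun l => cbinom (- - RtoC (INR m.+1)) l.+1 * wpow la (- RtoC (INR m.+1) + RtoC (INR l.+1)) n.+1)%C M
  = (Cpow (x + 1) m.+1 - Cpow x m.+1)%C.
Proof.
move=> hM hx; have e : (- - RtoC (INR m.+1) = RtoC (INR m.+1))%C by ring.
rewrite binomial_diff (@csum_pad _ m.+1 M) //; last first.
  by move=> i hi; rewrite e cbinom_INR_gt //; ring.
apply: csum_ext => l hl; rewrite e; congr Cmult; rewrite -hx -cpow_step_wpow; congr wpow.
by rewrite minus_INR; [rewrite !S_INR RtoC_minus !RtoC_plus; ring | apply/leP; lia].
Qed.

Lemma om_node_at M : (m < M)%N -> om_node t M (- RtoC (INR m.+1))%C = om gpos gneg.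
Proof.
move=> hM; rewrite /om_node /om /nd; cbn [fst snd]; congr pair; apply: functional_extensionality => -[|n].
- by rewrite /om_p /= (@csum_ext _ (fun _ => 0 * 0)%C) ?csum_mull; [ring | move=> i _; rewrite /wpow /=; ring].
- rewrite (om_weight hM (Cexp_lap n)) /om_p /gpos (_ : (n.+1 == O) = false) //.
  by rewrite (S_INR n.+1) RtoC_plus.
- by rewrite /om_m /= (@csum_ext _ (fun _ => 0 * 0)%C) ?csum_mull; [ring | move=> i _; rewrite /wpow /=; ring].
- rewrite (om_weight hM (Cexp_lam n ht)) /om_m /gneg (_ : (n.+1 == O) = false) // [n.+1.-1]/=.
  by congr (Cpow _ _ - _)%C; rewrite S_INR RtoC_plus; ring.
Qed.

Lemma Jn_at k : Jn t (- RtoC (INR m.+1)) k.+2 = (gneg k.+2.-1 - gpos k.+2)%C.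
Proof. by rewrite /Jn /gneg /gpos [k.+2.-1]/= !cpow_step_wpow Cexp_lap Cexp_lam. Qed.

(** Upper end in terms of exponents: a factor x^(m+1) at the next variable lowers its exponent by m
    + 1. At the end of the chain g takes the value t^(m+1). *)
Definition rightv (G : seq C -> C) (l1 l2 : seq C) : C :=
  match l2 with
  | [::] => (Cpow t m.+1 * G l1)%C
  | y :: R => G (l1 ++ (y - RtoC (INR m.+1))%C :: R)
  end.

(** Lower end in terms of exponents: (x+1)^(m+1) at the preceding variable is expanded into lowered
    exponents; at the start of the chain g(1) = 1. *)
Definition leftv (G : seq C -> C) (l1 l2 : seq C) : C :=
  match rev l1 with
  | [::] => G l2
  | x :: L => csum (fun l => cbinom (RtoC (INR m.+1)) l * G (rev L ++ (x - RtoC (INR (m.+1 - l)))%C :: l2))%C m.+2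
  end.

Lemma mul_node s : ((fun n => (nd t s).1 n * gpos n, fun n => (nd t s).2 n * gneg n)%C : node)
  = nd t (s - RtoC (INR m.+1)).
Proof.
rewrite /nd; cbn [fst snd]; congr pair; apply: functional_extensionality => -[|n].
- by rewrite /wpow /=; ring.
- by rewrite (wpow_sub s _ (Cexp_lap n)).
- by rewrite /wpow /=; ring.
- by rewrite (wpow_sub s _ (Cexp_lam n ht)).
Qed.

Lemma shifted_node s : shifted gpos gneg (nd t s) =
  (fun n => csum (fun l => cbinom (RtoC (INR m.+1)) l * (nd t (s - RtoC (INR (m.+1 - l)))).1 n)%C m.+2,
   fun n => csum (fun l => cbinom (RtoC (INR m.+1)) l * (nd t (s - RtoC (INR (m.+1 - l)))).2 n)%C m.+2).
Proof.
have Q la x n : Cexp (la n.+1) = x -> (wpow la s n.+1 * Cpow (x + 1) m.+1)%C =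
    csum (fun l => cbinom (RtoC (INR m.+1)) l * wpow la (s - RtoC (INR (m.+1 - l))) n.+1)%C m.+2.
  move=> hx; rewrite -binomial_thm -csum_mull; apply: csum_ext => l _.
  by rewrite (wpow_sub s _ hx); ring.
have Z la : (wpow la s O * 0)%C = csum (fun l => cbinom (RtoC (INR m.+1)) l * wpow la (s - RtoC (INR (m.+1 - l))) O)%C m.+2.
  by rewrite (@csum_ext _ (fun _ => 0 * 0)%C) ?csum_mull; [rewrite wpow_0; ring | move=> i _; rewrite wpow_0; ring].
rewrite /shifted /nd; cbn [fst snd]; congr pair; apply: functional_extensionality => -[|n].
- by rewrite -Z /wpow /=; ring.
- by rewrite -(Q _ _ _ (Cexp_lap n)) /gpos (S_INR n.+1) RtoC_plus.
- by rewrite -Z /wpow /=; ring.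
- rewrite -(Q _ _ _ (Cexp_lam n ht)) /gneg [n.+1.-1]/=; congr (_ * Cpow _ _)%C.
  by rewrite S_INR RtoC_plus; ring.
Qed.

Definition chainsum (N : nat) (s : seq C) : C := zs [::] (map (nd t) s) N.

Lemma Forall_nd_z0 l : List.Forall z0n (map (nd t) l).
Proof. by elim: l => [|s l IH]; [exact: List.Forall_nil | apply: List.Forall_cons => //; exact: nd_z0]. Qed.

Lemma shift_sum_at M l1 l2 k : (m < M)%N -> shift_sum t M l1 l2 k (- RtoC (INR m.+1)) =
  (rightv (chainsum k.+2) l1 l2 - leftv (chainsum k.+2) l1 l2)%C.
Proof.
move=> hM; rewrite shift_sum_zs /shift_nodes om_node_at // Jn_at.
rewrite -[gneg k.+2.-1]/(gneg k.+2.-1) zs_telescope; try exact: Forall_nd_z0; last by [].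
congr Cminus.
  case: l2 => [|y R]; rewrite /rightv /mul_right.
    rewrite [map (nd t) [::]]/=; cbn [fst snd]; rewrite cats0; congr Cmult.
    by rewrite /gneg; congr Cpow; have -> : RtoC (INR 0) = 0 by []; ring.
  cbn [map fst snd]; rewrite Cmult_1_l /chainsum map_cat; cbn [map].
  by congr zs; congr cat; congr cons; exact: mul_node.
case/lastP: l1 => [|l x]; rewrite /leftv.
  rewrite mul_left_nil; cbn [fst snd cat rev map]; rewrite /gpos /chainsum.
  have -> : RtoC (INR 1) = 1 by [].
  have -> : Cpow 1 m.+1 = 1 by elim: (m.+1) => [//|j IH]; cbn [Cpow]; rewrite IH; ring.
  by rewrite /rev /=; ring.
rewrite map_rcons mul_left_rcons rev_rcons revK; cbn [fst snd]; rewrite Cmult_1_l cat_rcons shifted_node.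
rewrite (@zs_csum_node (fun l => cbinom (RtoC (INR m.+1)) l) (fun l => nd t (x - RtoC (INR (m.+1 - l))))).
by apply: csum_ext => i _; rewrite /chainsum map_cat.
Qed.

End Relation.

(** * The relation for the extension *)

(** The variables are released from the half-plane one at a time, from left to right, by the
    identity theorem in one variable. *)
Lemma sep_identity n (f : seq C -> C) A :
  (forall l1 l2, (size l1 + (size l2).+1)%N = n -> Centire (fun w => f (l1 ++ w :: l2))) ->
  (forall l, size l = n -> List.Forall (fun z => A <= fst z) l -> f l = 0) ->
  forall l, size l = n -> f l = 0.
Proof.
move=> He H0 l hl.
suff key : forall l1 l2, size (l1 ++ l2) = n -> List.Forall (fun z => A <= fst z) l2 -> f (l1 ++ l2) = 0.
  by have := key l [::]; rewrite cats0; apply => //; exact: List.Forall_nil.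
elim/last_ind=> [|l1 x IH] l2 hs h2; first exact: H0.
rewrite cat_rcons in hs *; have hs' := hs; rewrite size_cat_cons in hs'.
apply: (@Centire_identity (fun w => f (l1 ++ w :: l2)) A (He _ _ hs')) => z hz.
apply: IH; first by rewrite size_cat_cons.
exact: List.Forall_cons.
Qed.

Definition relsum (F : seq C -> C) (m : nat) (l1 l2 : seq C) : C :=
  csum (fun l => cbinom (RtoC (INR m.+1)) l.+1 * F (l1 ++ (- RtoC (INR (m - l)))%C :: l2))%C m.+1.

Lemma shift_order_ge r m : INR m.+1 + 2 <= INR (shift_order r m).
Proof.
have -> : INR m.+1 + 2 = INR (m.+1 + 2) by rewrite plus_INR.
by apply: le_INR; apply/leP; rewrite /shift_order /shift_radius; lia.
Qed.

(** The corrected sums have two limits: that of [shift_sum_limit] and, since at w = -(m+1) they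
    equal a difference of partial sums of depth r, the one computed termwise. [G] is only asked to
    give limits of convergent sums, so the relation is available before an entire extension in depth
    r. *)
Lemma relation_large r m t F G l1 l2 : tdom t -> zetaU_extension r.+1 0 t F ->
  (forall s, size s = r -> List.Forall (fun z => 1 < fst z) s -> Ccv (fun N => chainsum t N s) (G s)) ->
  (size l1 + size l2)%N = r ->
  List.Forall (fun s => INR (shift_order r.+1 m) <= fst s) l1 -> List.Forall (fun s => INR (shift_order r.+1 m) <= fst s) l2 ->
  relsum F m l1 l2 = (rightv t m G l1 l2 - leftv m G l1 l2)%C.
Proof.
move=> ht HF HG hs h1 h2.
have hM : (m < shift_order r.+1 m)%N by rewrite /shift_order /shift_radius; lia.
have hs' : (size l1 + (size l2).+1)%N = r.+1 by lia.
have lim := shift_sum_limit ht HF hs' h1 h2; rewrite /= in lim.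
have gM := shift_order_ge r.+1 m; have mp := pos_INR m.+1.
set A := INR (shift_order r.+1 m) in h1 h2 gM.
have w1 : List.Forall (fun z => 1 < fst z) l1 by apply: (Forall_lt_of_le (A := A)) => //; lra.
have w2 : List.Forall (fun z => 1 < fst z) l2 by apply: (Forall_lt_of_le (A := A)) => //; lra.
have e0 : csum (fun l => cbinom (- - RtoC (INR m.+1)) l.+1 * F (l1 ++ (- RtoC (INR m.+1) + RtoC (INR l.+1))%C :: l2))%C (shift_order r.+1 m) = relsum F m l1 l2.
  have e : (- - RtoC (INR m.+1) = RtoC (INR m.+1))%C by ring.
  rewrite (@csum_pad _ m.+1) //; last by move=> i hi; rewrite e cbinom_INR_gt //; ring.
  apply: csum_ext => l hl; rewrite e; congr (_ * F (_ ++ _ :: _))%C.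
  rewrite minus_INR; last by apply/leP; lia.
  by rewrite !S_INR RtoC_minus !RtoC_plus; ring.
have {}e0 := e0; cbn [csum] in lim.
apply: (Ccv_unique (x := fun k => (rightv t m (chainsum t k.+2) l1 l2 - leftv m (chainsum t k.+2) l1 l2)%C)).
  by rewrite -e0; apply: Ccv_ext lim => k; rewrite shift_sum_at.
have sh (x : nat -> C) l : Ccv x l -> Ccv (fun k => x k.+2) l.
  by move=> /(Ccv_unshift 2); apply: Ccv_ext => k; rewrite addn2.
apply: Ccv_plus.
  case: l2 h2 w2 hs {hs' lim e0} => [|y R] h2 w2 hs; rewrite /rightv.
    by apply: Ccv_scal; apply: (sh (fun k => chainsum t k l1)); apply: HG => //; rewrite /= addn0 in hs.
  apply: (sh (fun k => chainsum t k _)); apply: HG; first by rewrite size_cat_cons.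
  apply/List.Forall_app; split=> //; inversion h2; inversion w2; apply: List.Forall_cons => //.
  by rewrite /Cminus /Cplus /Copp /RtoC; cbn [fst]; lra.
apply: Ccv_opp; case/lastP: l1 h1 w1 hs {hs' lim e0} => [|L x] h1 w1 hs.
  by rewrite /leftv /rev /=; apply: (sh (fun k => chainsum t k l2)); apply: HG.
rewrite /leftv rev_rcons revK; apply: Ccv_csum => i hi; apply: Ccv_scal.
apply: (sh (fun k => chainsum t k _)).
move: h1 w1; rewrite -cats1 => /List.Forall_app [h1 h1'] /List.Forall_app [w1 _]; inversion h1'.
apply: HG; first by rewrite size_cat_cons; rewrite size_rcons in hs; rewrite addnS -addSn.
apply/List.Forall_app; split=> //; apply: List.Forall_cons => //.
have : INR (m.+1 - i) <= INR m.+1 by apply: le_INR; apply/leP; lia.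
by rewrite /Cminus /Cplus /Copp /RtoC; cbn [fst]; lra.
Qed.

Definition sep_entire (n : nat) (f : seq C -> C) : Prop :=
  forall l1 l2, (size l1 + (size l2).+1)%N = n -> Centire (fun w => f (l1 ++ w :: l2)).

Lemma ext_sep_entire r tp t F : zetaU_extension r tp t F -> sep_entire r F.
Proof. by move=> H l1 l2 hs; exact: (ext_entire H). Qed.

Lemma Centire_shift_arg (f : C -> C) c : Centire f -> Centire (fun w => f (w - c)%C).
Proof.
move=> H w; apply: (@Cdiff_comp f (fun w => w - c)%C); first exact: H.
by apply: Cdiff_minus; [exact: Cdiff_id | exact: Cdiff_const].
Qed.

Lemma relsum_entire_r r m F l1 p1 p2 : sep_entire r.+1 F -> (size l1 + (size p1 + (size p2).+1))%N = r ->
  Centire (fun w => relsum F m l1 (p1 ++ w :: p2)).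
Proof.
move=> H hs w; apply: (@Cdiff_csum (fun l w => _)) => l _; apply: Cdiff_mult; first exact: Cdiff_const.
apply: (@Cdiff_ext (fun w => F ((l1 ++ (- RtoC (INR (m - l)))%C :: p1) ++ w :: p2))).
  by move=> z; rewrite -catA.
by apply: H; rewrite size_cat_cons; lia.
Qed.

Lemma relsum_entire_l r m F p1 p2 l2 : sep_entire r.+1 F -> (size p1 + (size p2).+1 + size l2)%N = r ->
  Centire (fun w => relsum F m (p1 ++ w :: p2) l2).
Proof.
move=> H hs w; apply: (@Cdiff_csum (fun l w => _)) => l _; apply: Cdiff_mult; first exact: Cdiff_const.
apply: (@Cdiff_ext (fun w => F (p1 ++ w :: (p2 ++ (- RtoC (INR (m - l)))%C :: l2)))).
  by move=> z; rewrite -catA.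
by apply: H; rewrite size_cat_cons; lia.
Qed.

Lemma rightv_entire_r r m t G l1 p1 p2 : sep_entire r G -> (size l1 + (size p1 + (size p2).+1))%N = r ->
  Centire (fun w => rightv t m G l1 (p1 ++ w :: p2)).
Proof.
move=> H; case: p1 => [|y p1] hs w; rewrite /rightv /=.
  by apply: (@Centire_shift_arg (fun w => G (l1 ++ w :: p2))); apply: H; rewrite /= in hs.
apply: (@Cdiff_ext (fun w => G ((l1 ++ (y - RtoC (INR m.+1))%C :: p1) ++ w :: p2))).
  by move=> z; rewrite -catA.
by apply: H; rewrite size_cat_cons; rewrite /= in hs; lia.
Qed.

Lemma rightv_entire_l r m t G p1 p2 l2 : sep_entire r G -> (size p1 + (size p2).+1 + size l2)%N = r ->
  Centire (fun w => rightv t m G (p1 ++ w :: p2) l2).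
Proof.
move=> H; case: l2 => [|y R] hs w; rewrite /rightv /=.
  by apply: Cdiff_mult; [exact: Cdiff_const | apply: H; rewrite /= in hs; lia].
apply: (@Cdiff_ext (fun w => G (p1 ++ w :: (p2 ++ (y - RtoC (INR m.+1))%C :: R)))).
  by move=> z; rewrite -catA.
by apply: H; rewrite size_cat_cons; rewrite /= in hs; lia.
Qed.

Lemma leftv_rcons m G l x l2 : leftv m G (rcons l x) l2 =
  csum (fun i => cbinom (RtoC (INR m.+1)) i * G (l ++ (x - RtoC (INR (m.+1 - i)))%C :: l2))%C m.+2.
Proof. by rewrite /leftv rev_rcons revK. Qed.

Lemma leftv_entire_r r m G l1 p1 p2 : sep_entire r G -> (size l1 + (size p1 + (size p2).+1))%N = r ->
  Centire (fun w => leftv m G l1 (p1 ++ w :: p2)).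
Proof.
move=> H; case/lastP: l1 => [|l x] hs w; first by apply: H.
apply: (@Cdiff_ext (fun w => csum (fun i => cbinom (RtoC (INR m.+1)) i *
   G ((l ++ (x - RtoC (INR (m.+1 - i)))%C :: p1) ++ w :: p2))%C m.+2)).
  by move=> z; rewrite leftv_rcons; apply: csum_ext => i _; rewrite -catA.
apply: (@Cdiff_csum (fun l w => _)) => i _; apply: Cdiff_mult; first exact: Cdiff_const.
by apply: H; rewrite size_cat_cons; rewrite size_rcons in hs; lia.
Qed.

Lemma leftv_entire_l r m G p1 p2 l2 : sep_entire r G -> (size p1 + (size p2).+1 + size l2)%N = r ->
  Centire (fun w => leftv m G (p1 ++ w :: p2) l2).
Proof.
move=> H; case/lastP: p2 => [|p2 x] hs w.
  apply: (@Cdiff_ext (fun w => csum (fun i => cbinom (RtoC (INR m.+1)) i *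
     G (p1 ++ (w - RtoC (INR (m.+1 - i)))%C :: l2))%C m.+2)).
    by move=> z; rewrite cats1 leftv_rcons.
  apply: (@Cdiff_csum (fun l w => _)) => i _; apply: Cdiff_mult; first exact: Cdiff_const.
  by apply: (@Centire_shift_arg (fun w => G (p1 ++ w :: l2))); apply: H; rewrite /= in hs; lia.
apply: (@Cdiff_ext (fun w => csum (fun i => cbinom (RtoC (INR m.+1)) i *
   G (p1 ++ w :: (p2 ++ (x - RtoC (INR (m.+1 - i)))%C :: l2)))%C m.+2)).
  move=> z; rewrite -rcons_cons -rcons_cat leftv_rcons; apply: csum_ext => i _; congr (_ * G _)%C.
  by rewrite -catA.
apply: (@Cdiff_csum (fun l w => _)) => i _; apply: Cdiff_mult; first exact: Cdiff_const.
by apply: H; rewrite size_cat_cons; rewrite size_rcons in hs; lia.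
Qed.

(** Both sides are entire in each exponent, so [sep_identity], used once for [l1] and once for [l2],
    removes the size conditions of [relation_large]. *)
Lemma relation_all r m t F G l1 l2 : tdom t -> zetaU_extension r.+1 0 t F -> zetaU_extension r 0 t G ->
  (size l1 + size l2)%N = r ->
  relsum F m l1 l2 = (rightv t m G l1 l2 - leftv m G l1 l2)%C.
Proof.
move=> ht HF HG hs; have EF := ext_sep_entire HF; have EG := ext_sep_entire HG.
have HG' s : size s = r -> List.Forall (fun z => 1 < fst z) s -> Ccv (fun N => chainsum t N s) (G s).
  by move=> h1 h2; exact: (ext_Ccv HG).
pose f a b := (relsum F m a b - (rightv t m G a b - leftv m G a b))%C.
suff h : f l1 l2 = 0.
  by have -> : relsum F m l1 l2 = (f l1 l2 + (rightv t m G l1 l2 - leftv m G l1 l2))%C by [rewrite /f; ring]; rewrite h; ring.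
set A := INR (shift_order r.+1 m).
apply: (@sep_identity (size l1) (fun l => f l l2) A) => // [p1 p2 hp w|l hl h1].
  apply: Cdiff_minus; first by apply: (relsum_entire_l m EF); rewrite hp.
  apply: Cdiff_minus; [apply: (rightv_entire_l m t EG) | apply: (leftv_entire_l m EG)]; by rewrite hp.
apply: (@sep_identity (size l2) (fun l' => f l l') A) => // [p1 p2 hp w|l' hl' h2].
  apply: Cdiff_minus; first by apply: (relsum_entire_r m EF); rewrite hp hl.
  apply: Cdiff_minus; [apply: (rightv_entire_r m t EG) | apply: (leftv_entire_r m EG)]; by rewrite hp hl.
rewrite /f (@relation_large r m t F G l l' ht HF HG') ?hl ?hl' //; ring.
Qed.

(** * Extensions of lower depth *)

Lemma delta_block1 i0 i j : block1 i0 0 i j = delta i j.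
Proof.
rewrite /block1; case: (eqVneq i i0) => [->|//] /=; case: (eqVneq j i0.+1) => [->|//] /=.
by rewrite delta_neq //; lia.
Qed.

Lemma Forall_gt_gap l : List.Forall (fun z : C => 1 < fst z) l ->
  exists g, 0 < g /\ List.Forall (fun z => 1 + g <= fst z) l.
Proof.
elim: l => [|x l IH] H; first by exists 1; split; [lra | exact: List.Forall_nil].
inversion H; have [g [g0 Hg]] := IH H3.
exists (Rmin g (fst x - 1)); split; first by apply: Rmin_glb_lt; lra.
apply: List.Forall_cons; first by have := Rmin_r g (fst x - 1); lra.
by apply: List.Forall_impl Hg => z; have := Rmin_l g (fst x - 1); lra.
Qed.

Lemma npow_le_1 n x : x <= 0 -> npow n.+1 x <= 1.
Proof. by move=> h; rewrite -(npow_0 n); apply: npow_le. Qed.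

(** Plain partial sums are glued by the identity block, seen as a [block1] with entry 0, so
    [block1_defect] applies with e0 = 2 a. The choice kap = g / (4 (r+1)) keeps the growth n^(2 r
    kap) below the gain n^(-g). *)
Lemma zs_incr r g C0 : 0 < g -> 0 <= C0 -> exists u, summable u /\
  forall l k, size l = r -> nodes_le (fun n => C0 * npow n (- (1 + g))) l ->
  Cmod (zs [::] l k.+2 - zs [::] l k.+1)%C <= u k.
Proof.
move=> g0 C00.
have rp := pos_INR r.
set kap := g / (4 * (INR r + 1)).
have kp : 0 < kap by apply: Rdiv_lt_0_compat; lra.
have ke : g = 4 * kap * (INR r + 1) by rewrite /kap; field; lra.
have [B [B0 HB]] := @glued_incr_npow r kap C0 (5 * C0 + 3 * ((1 + C0) * ((1 + C0) * (1 + C0)))) kap kp C00 ltac:(nra).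
exists (fun k => B * npow k.+1 (- 1 - kap)); split.
  by apply: summable_scal => //; apply: (summable_shift (u := fun k => npow k (- 1 - kap))); exact: npow_summable.
move=> l k hr HC.
case: l hr HC => [|x0 l0] hr HC.
  rewrite /=; have -> : (1 * 1 + 0 - (1 * 1 + 0) = 0)%C by ring.
  by rewrite Cmod_0; apply: Rmult_le_pos => //; exact: npow_ge0.
set l := x0 :: l0 in hr HC *.
have Hl : nodes_le (fun n => C0 * npow n (kap - 1)) l.
  apply: nodes_le_weaken HC => n; apply: Rmult_le_compat_l => //; apply: npow_le; rewrite ke; nra.
rewrite -!glued_delta; apply: HB => //.
move=> i j hi hj.
set a := C0 * npow k.+1 (- (1 + g)).
have a0 : 0 <= a by apply: Rmult_le_pos => //; exact: npow_ge0.
have hq q : (q < size l)%N -> Cmod ((nth node0 l q).1 k.+1) <= a /\ Cmod ((nth node0 l q).2 k.+1) <= a.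
  by move=> hq; exact: nodes_le_nth HC hq.
have hs : (0 < size l)%N by [].
have aC : a <= 1 + C0.
  have := @npow_le_1 k (- (1 + g)) ltac:(lra); rewrite /a => q1.
  by have := Rmult_le_compat_l _ _ _ C00 q1; lra.
have := @block1_defect l k.+1 0 0 O a (1 + C0) (2 * a) hs a0 aC ltac:(lra) ltac:(lra) (fun q h _ => hq q h).
have [h1 h2] := hq O hs.
move=> /(_ (Rle_trans _ _ _ h1 aC) (Rle_trans _ _ _ h2 aC)); rewrite Cmod_0 => /(_ ltac:(lra)) H.
have e : delta = block1 0 0.
  by apply: functional_extensionality => x; apply: functional_extensionality => y; rewrite delta_block1.
rewrite e; apply: Rle_trans (H _ i j _ _) _; rewrite ?hr //.
  have -> : (0 - 0 - ((nth node0 l 0).1 k.+1 + (nth node0 l 0).2 k.+1) = - ((nth node0 l 0).1 k.+1 + (nth node0 l 0).2 k.+1))%C by ring.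
  by rewrite Cmod_opp; apply: Rle_trans (Cmod_triangle _ _) _; lra.
have p1 : npow k.+1 (- (1 + g)) <= npow k.+1 (- 1 - kap - INR r * (2 * kap)) by apply: npow_le; rewrite ke; nra.
have p0 := npow_ge0 k.+1 (- 1 - kap - INR r * (2 * kap)).
have -> : 2 * a + 3 * (a * ((1 + C0) * (1 + C0))) = (2 * C0 + 3 * (C0 * ((1 + C0) * (1 + C0)))) * npow k.+1 (- (1 + g)) by rewrite /a; ring.
apply: Rmult_le_compat => //; [nra | exact: npow_ge0 | nra].
Qed.

Lemma conv_limit t s : tdom t -> List.Forall (fun z => 1 < fst z) s ->
  exists v, Ccv (fun N => chainsum t N s) v.
Proof.
move=> ht h; have [K HK] := chain_const_ex ht.
have [g [g0 Hg]] := Forall_gt_gap h; have [C0 [C00 HC]] := nd_le HK Hg.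
have [u [Hu H]] := zs_incr (size (map (nd t) s)) g0 C00.
have [v Hv] := Ccv_summable (x := fun k => chainsum t k.+1 s) Hu (fun k => H _ k erefl HC).
by exists v; apply: (@Ccv_shift _ _ 1); apply: Ccv_ext Hv => n; rewrite addn1.
Qed.

(** A remainder B |h|^2 uniform in n forces the slopes [Ld] to converge, as one small real increment
    shows, and then passes to the limit. *)
Lemma limit_Cdiff (f : nat -> C -> C) (g : C -> C) z (Ld : nat -> C) (B d : R) : 0 < d -> 0 <= B ->
  (forall w, Cmod (w - z)%C < d -> Ccv (fun n => f n w) (g w)) ->
  (forall n h, Cmod h < d -> Cmod (f n (z + h)%C - f n z - Ld n * h)%C <= B * (Cmod h * Cmod h)) ->
  Cdiff g z.
Proof.
move=> dp B0 Hg H.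
have dist h : Cmod h < d -> Cmod (z + h - z)%C < d by have -> : (z + h - z = h)%C by ring.
have dz : Cmod (z - z)%C < d by have -> : (z - z = 0)%C by [ring]; rewrite Cmod_0.
have [l Hl] : exists l, Ccv Ld l.
  apply: Ccv_of_Cauchy => eps He.
  (* Small enough for the remainder B x^2 to be at most eps x / 4, and fixed while n grows. *)
  pose x := Rmin (d / 2) (eps / (4 * (B + 1))).
  have xp : 0 < x by apply: Rmin_glb_lt; [lra | apply: Rdiv_lt_0_compat; lra].
  have xd : x < d by have := Rmin_l (d / 2) (eps / (4 * (B + 1))); rewrite -/x; lra.
  have xe : B * x <= eps / 4.
    have h1 : x <= eps / (4 * (B + 1)) by exact: Rmin_r.
    have e : eps / 4 = (B + 1) * (eps / (4 * (B + 1))) by field; lra.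
    by rewrite e; apply: Rmult_le_compat; lra.
  have mx : Cmod (RtoC x) = x by rewrite Cmod_R Rabs_pos_eq; lra.
  have hx : Cmod (RtoC x) < d by rewrite mx.
  have ep : 0 < eps * x / 8 by have := Rmult_lt_0_compat _ _ He xp; lra.
  have [N1 h1] := Hg _ (dist _ hx) _ ep; have [N2 h2] := Hg _ dz _ ep.
  exists (N1 + N2)%N => n m hn hm.
  have a1 := h1 n ltac:(lia); have a2 := h1 m ltac:(lia); have a3 := h2 n ltac:(lia); have a4 := h2 m ltac:(lia).
  have b1 := H n _ hx; have b2 := H m _ hx; rewrite mx in b1 b2.
  suff : Cmod ((Ld m - Ld n) * RtoC x)%C <= eps * x.
    by rewrite Cmod_mult mx => q; apply: (Rmult_le_reg_r x).
  set y := (z + RtoC x)%C in a1 a2 b1 b2.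
  have -> : ((Ld m - Ld n) * RtoC x = ((f n y - f n z - Ld n * RtoC x) + - (f m y - f m z - Ld m * RtoC x)) +
     (((f m y - g y) + - (f n y - g y)) + ((f n z - g z) + - (f m z - g z))))%C by ring.
  apply: Rle_trans (Cmod_triangle _ _) _.
  apply: Rle_trans (Rplus_le_compat _ _ _ _ (Cmod_triangle _ _) (Cmod_triangle _ _)) _.
  apply: Rle_trans (Rplus_le_compat_l _ _ _ (Rplus_le_compat _ _ _ _ (Cmod_triangle _ _) (Cmod_triangle _ _))) _.
  rewrite !Cmod_opp; have : B * (x * x) <= eps / 4 * x by rewrite -Rmult_assoc; apply: Rmult_le_compat_r; lra.
  lra.
have Hlim h : Cmod h < d -> Cmod (g (z + h)%C - g z - l * h)%C <= B * (Cmod h * Cmod h).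
  move=> hh; apply: Rle_plus_epsilon => e ep.
  have c1 : Ccv (fun n => f n (z + h) - f n z - Ld n * h)%C (g (z + h) - g z - l * h)%C.
    apply: Ccv_plus; last first.
      apply: Ccv_opp; apply: Ccv_mult => //; exact: Ccv_const.
    by apply: Ccv_plus; [exact: Hg (dist _ hh) | apply: Ccv_opp; exact: Hg dz].
  have [N HN] := c1 e ep; have := HN N (leqnn N) => h1.
  have := Cmod_triangle_sub (g (z + h) - g z - l * h)%C (f N (z + h) - f N z - Ld N * h)%C.
  rewrite (Cmod_sub_sym (g (z + h)%C - g z - l * h)%C) => h2.
  have := H N h hh; lra.
exists l => eps He; exists (Rmin d (eps / (B + 1))); split.
  by apply: Rmin_glb_lt => //; apply: Rdiv_lt_0_compat; lra.
move=> h hh; have h1 := Rlt_le_trans _ _ _ hh (Rmin_l _ _); have h2 := Rlt_le_trans _ _ _ hh (Rmin_r _ _).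
apply: Rle_trans (Hlim h h1) _.
have hp := Cmod_ge_0 h.
have : B * Cmod h <= eps.
  have e : eps = (B + 1) * (eps / (B + 1)) by field; lra.
  by rewrite e; apply: Rmult_le_compat; lra.
by nra.
Qed.

Lemma zs_bound m S (l : seq node) N : (forall n, 0 <= m n) -> 1 <= S -> (forall n, rsum m n <= S) ->
  nodes_le m l -> Cmod (zs [::] l N) <= INR (size l).+1 * (S ^ size l * (INR (size l).+1 * (S ^ size l * 1))).
Proof.
move=> m0 S1 HS Hl; rewrite -glued_delta; apply: glue_bound; try lra.
- by apply: pow_le; lra.
- by move=> i hi; apply: (lefts_bound m0).
- by move=> i hi; apply: rights_bound Hl _ _.
- by move=> i j _ _; rewrite /delta; case: (_ == _); rewrite ?Cmod_1 ?Cmod_0; lra.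
Qed.

(** Absorbs the squared logarithms of a second derivative in the exponent into an arbitrarily small
    power of n. *)
Lemma sqr_le_exp d x : 0 < d -> 0 <= x -> x * x <= 4 / (d * d) * exp (d * x).
Proof.
move=> dp x0; have h := exp_ineq1_le (d * x / 2).
have e : exp (d * x) = exp (d * x / 2) * exp (d * x / 2) by rewrite -exp_plus; congr exp; field.
have dx : 0 <= d * x by apply: Rmult_le_pos; lra.
have q : (d * x) * (d * x) <= 4 * exp (d * x) by rewrite e; nra.
have -> : x * x = / (d * d) * ((d * x) * (d * x)) by field; lra.
have -> : 4 / (d * d) * exp (d * x) = / (d * d) * (4 * exp (d * x)) by field; lra.
by apply: Rmult_le_compat_l => //; left; apply: Rinv_0_lt_compat; nra.
Qed.

(* second-order remainder of [w -> x^(-w)], uniformly in the chain element *)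
Lemma wpow_second_order la K z g : 0 <= K -> near_log la K -> 0 < g -> exists B, 0 <= B /\
  forall h n, Cmod h <= g ->
  Cmod (wpow la (z + h) n - wpow la z n + h * (la n * wpow la z n))%C <=
    (Cmod h * Cmod h) * (B * npow n (- fst z + 2 * g)).
Proof.
move=> K0 H gp.
exists (exp (Cmod z * K) * (4 * (4 / (g * g) * exp (2 * g * K)))); split.
  have := exp_pos (Cmod z * K); have := exp_pos (2 * g * K) => e1 e2.
  have q : 0 < 4 / (g * g) by apply: Rdiv_lt_0_compat; nra.
  apply: Rmult_le_pos; first lra.
  by apply: Rmult_le_pos; [lra | apply: Rmult_le_pos; lra].
move=> h [|n] hh.
  rewrite !wpow_0; have -> : (0 - 0 + h * (la O * 0) = 0)%C by ring.
  by rewrite Cmod_0 /npow /= !Rmult_0_r; lra.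
have e : wpow la (z + h)%C n.+1 = (wpow la z n.+1 * Cexp (- (h * la n.+1)))%C.
  by rewrite wpow_plus.
set u := (- (h * la n.+1))%C in e.
have -> : (wpow la (z + h) n.+1 - wpow la z n.+1 + h * (la n.+1 * wpow la z n.+1) = wpow la z n.+1 * (Cexp u - 1 - u))%C.
  by rewrite e /u; ring.
rewrite Cmod_mult.
have q1 := wpow_bound z n.+1 H.
have q2 := Cexp_second_order u.
have mu : Cmod u = Cmod h * Cmod (la n.+1) by rewrite /u Cmod_opp Cmod_mult.
have lnp := ln_INR_ge0 n.
have ml : Cmod (la n.+1) <= ln (INR n.+1) + K.
  have := Cmod_triangle_sub (la n.+1) (RtoC (ln (INR n.+1))); rewrite Cmod_R Rabs_pos_eq //.
  by have := H n; lra.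
have hp := Cmod_ge_0 h; have lp := Cmod_ge_0 (la n.+1).
have q3 : exp (Cmod u) <= exp (g * (ln (INR n.+1) + K)).
  by apply: exp_le_compat; rewrite mu; apply: Rmult_le_compat.
have q4 : Cmod (la n.+1) * Cmod (la n.+1) <= 4 / (g * g) * exp (g * (ln (INR n.+1) + K)).
  apply: Rle_trans (_ : (ln (INR n.+1) + K) * (ln (INR n.+1) + K) <= _); first by nra.
  by apply: sqr_le_exp; lra.
have ee : exp (g * (ln (INR n.+1) + K)) * exp (g * (ln (INR n.+1) + K)) = exp (2 * g * K) * npow n.+1 (2 * g).
  by rewrite npow_S -!exp_plus; congr exp; ring.
have ep := exp_pos (g * (ln (INR n.+1) + K)).
have q5 : Cmod (Cexp u - 1 - u)%C <= (Cmod h * Cmod h) * (4 * (4 / (g * g) * (exp (2 * g * K) * npow n.+1 (2 * g)))).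
  apply: Rle_trans q2 _; rewrite -ee mu.
  have -> : 4 * (Cmod h * Cmod (la n.+1) * (Cmod h * Cmod (la n.+1))) = (Cmod h * Cmod h) * (4 * (Cmod (la n.+1) * Cmod (la n.+1))) by ring.
  rewrite Rmult_assoc; apply: Rmult_le_compat_l; first by nra.
  rewrite Rmult_assoc; apply: Rmult_le_compat_l; first lra.
  rewrite -mu -Rmult_assoc; apply: Rmult_le_compat => //; first by nra.
  by left; apply: exp_pos.
apply: Rle_trans (Rmult_le_compat _ _ _ _ (Cmod_ge_0 _) (Cmod_ge_0 _) q1 q5) _.
by rewrite npow_plus; apply: Req_le; ring.
Qed.

(** By multilinearity the sum at z + h is its value at z, plus h times the sum with the derivative
    node [dn], plus |h|^2 times the sum with the normalised remainder node [rn]. The last one stays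
    bounded because g is a quarter of the gap between 1 and the real parts. *)
Lemma conv_diff t l1 l2 (G : seq C -> C) z : tdom t ->
  (forall s, size s = (size l1 + (size l2).+1)%N -> List.Forall (fun z => 1 < fst z) s ->
     Ccv (fun N => chainsum t N s) (G s)) ->
  List.Forall (fun z => 1 < fst z) l1 -> List.Forall (fun z => 1 < fst z) l2 -> 1 < fst z ->
  Cdiff (fun w => G (l1 ++ w :: l2)) z.
Proof.
move=> ht HG h1 h2 hz; have [K HK] := chain_const_ex ht.
have [K0 [N1 [N2 _]]] := HK.
have h0 : List.Forall (fun z => 1 < fst z) (l1 ++ z :: l2).
  by apply/List.Forall_app; split=> //; apply: List.Forall_cons.
have [g0 [g0p Hg]] := Forall_gt_gap h0.
pose g := g0 / 4.
have gp : 0 < g by rewrite /g; lra.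
have [C0 [C00 HC]] := nd_le HK Hg.
have hz' : 1 + g0 <= fst z by move: Hg => /List.Forall_app [_ q]; inversion q.
have [B1 [b1 HB1]] := wpow_second_order z K0 N1 gp.
have [B2 [b2 HB2]] := wpow_second_order z K0 N2 gp.
pose m n := (C0 + B1 + B2) * npow n (- 1 - g).
have m0 n : 0 <= m n by apply: Rmult_le_pos; [lra | exact: npow_ge0].
have [_ [S HS]] : summable m by apply: summable_scal; [lra | exact: npow_summable].
have S1 : 1 <= 1 + Rabs S by have := Rabs_pos S; lra.
have HS' n : rsum m n <= 1 + Rabs S by apply: Rle_trans (HS n) _; have := Rle_abs S; lra.
have Hm : nodes_le m (map (nd t) l1) /\ nodes_le m (map (nd t) l2).
  have : nodes_le m (map (nd t) (l1 ++ z :: l2)).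
    apply: nodes_le_weaken HC => n; apply: Rmult_le_compat; [lra | exact: npow_ge0 | lra | apply: npow_le; rewrite /g; lra].
  by rewrite map_cat => /nodes_le_cat [q1 q2]; split=> //; inversion q2.
pose dn : node := (fun n => - (lap n * wpow lap z n), fun n => - (lam t n * wpow (lam t) z n))%C.
set r := (size l1 + (size l2).+1)%N.
pose B := INR r.+1 * ((1 + Rabs S) ^ r * (INR r.+1 * ((1 + Rabs S) ^ r * 1))).
have Bp : 0 <= B.
  have := pos_INR r.+1; have : 0 <= (1 + Rabs S) ^ r by [apply: pow_le; lra].
  by move=> p1 p2; rewrite /B; do ! (apply: Rmult_le_pos => //); lra.
apply: (@limit_Cdiff (fun N w => chainsum t N (l1 ++ w :: l2)) _ z
  (fun N => zs [::] (map (nd t) l1 ++ dn :: map (nd t) l2) N) B g gp Bp).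
  move=> w hw; apply: HG; first by rewrite size_cat_cons.
  apply/List.Forall_app; split=> //; apply: List.Forall_cons => //.
  have := fst_ge_Cmod (w - z)%C; have -> : fst (w - z)%C = fst w - fst z by [].
  by rewrite /g in hw; lra.
move=> N h hh.
case: (Req_dec (Cmod h) 0) => h0'.
  have -> : h = 0 by apply: Cmod_eq_0.
  have -> : (z + 0 = z)%C by ring.
  set X := zs _ _ _; have -> : (chainsum t N (l1 ++ z :: l2) - chainsum t N (l1 ++ z :: l2) - X * 0 = 0)%C by ring.
  by rewrite Cmod_0 !Rmult_0_r; lra.
have hp : 0 < Cmod h by have := Cmod_ge_0 h; lra.
pose q := RtoC (Cmod h * Cmod h).
have nq : q <> 0 by move=> /RtoC_inj e; nra.
have mq : Cmod q = Cmod h * Cmod h by rewrite /q Cmod_R Rabs_pos_eq //; nra.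
pose rn : node := (fun n => / q * (wpow lap (z + h) n - wpow lap z n + h * (lap n * wpow lap z n)),
  fun n => / q * (wpow (lam t) (z + h) n - wpow (lam t) z n + h * (lam t n * wpow (lam t) z n)))%C.
pose sn : node := (fun n => h * dn.1 n + wpow lap z n, fun n => h * dn.2 n + wpow (lam t) z n)%C.
have E : (chainsum t N (l1 ++ (z + h)%C :: l2) = q * zs [::] (map (nd t) l1 ++ rn :: map (nd t) l2) N
   + (h * zs [::] (map (nd t) l1 ++ dn :: map (nd t) l2) N + chainsum t N (l1 ++ z :: l2)))%C.
  rewrite /chainsum !map_cat; cbn [map].
  rewrite (@zs_lin (nd t (z + h)) rn sn q); last first.
  - by move=> n; rewrite /rn /sn /nd /dn; cbn [fst snd]; field.
  - by move=> n; rewrite /rn /sn /nd /dn; cbn [fst snd]; field.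
  by congr Cplus; apply: zs_lin.
have e2 (a b x y : C) : (a + (h * b + x) - x - b * h = a)%C by ring.
rewrite E e2 // Cmod_mult mq Rmult_comm; apply: Rmult_le_compat_r; first by nra.
have sr : size (map (nd t) l1 ++ rn :: map (nd t) l2) = r by rewrite size_cat_cons !size_map.
rewrite /B -sr; apply: (@zs_bound m) => //.
apply/nodes_le_cat; split; first exact: Hm.1.
apply: List.Forall_cons; last exact: Hm.2.
move=> n; have hh' : Cmod h <= g by lra.
have mi : Cmod (/ q)%C = / (Cmod h * Cmod h) by rewrite Cmod_inv // mq.
have Q la B' : 0 <= B' -> B' <= C0 + B1 + B2 ->
   Cmod (wpow la (z + h) n - wpow la z n + h * (la n * wpow la z n))%C <= (Cmod h * Cmod h) * (B' * npow n (- fst z + 2 * g)) ->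
   Cmod (/ q * (wpow la (z + h) n - wpow la z n + h * (la n * wpow la z n)))%C <= m n.
  move=> p1 p2 p3; rewrite Cmod_mult mi.
  have ip : 0 < / (Cmod h * Cmod h) by apply: Rinv_0_lt_compat; nra.
  apply: Rle_trans (Rmult_le_compat_l _ _ _ (Rlt_le _ _ ip) p3) _.
  rewrite -Rmult_assoc Rinv_l; last by nra.
  rewrite Rmult_1_l; apply: Rmult_le_compat => //; first exact: npow_ge0.
  by apply: npow_le; rewrite /g; lra.
by split; rewrite /rn; cbn [fst snd]; [apply: (Q _ B1) => //; [lra | exact: HB1] | apply: (Q _ B2) => //; [lra | exact: HB2]].
Qed.

Lemma Centire_chainsum t N l1 l2 : Centire (fun w => chainsum t N (l1 ++ w :: l2)).
Proof.
move=> w; apply: (@Cdiff_ext (fun w => glued (map (fun f => f w)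
   (map (fun s _ => nd t s) l1 ++ nd t :: map (fun s _ => nd t s) l2)) N delta)).
  by move=> z; rewrite /chainsum -glued_delta !map_cat /= -!map_comp.
apply: (Centire_glued (J := fun _ => delta)); last by move=> i j z; exact: Cdiff_const.
apply/List.Forall_app; split; first exact: Forall_map_const.
apply: List.Forall_cons; last exact: Forall_map_const.
by move=> n; split; [exact: (Centire_wpow lap n) | exact: (Centire_wpow (lam t) n)].
Qed.

Lemma chainsum_incr t l1 l2 W g : tdom t -> 0 < g ->
  List.Forall (fun z => 1 + g <= fst z) l1 -> List.Forall (fun z => 1 + g <= fst z) l2 ->
  exists u, summable u /\ forall k w, Cmod w <= W -> 1 + g <= fst w ->
    Cmod (chainsum t k.+2 (l1 ++ w :: l2) - chainsum t k.+1 (l1 ++ w :: l2))%C <= u k.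
Proof.
move=> ht gp h1 h2; have [K HK] := chain_const_ex ht.
have [K0 [N1 [N2 _]]] := HK.
have [C1 [c1 H1]] := nd_le HK h1; have [C2 [c2 H2]] := nd_le HK h2.
have eW := exp_pos (W * K).
pose C0 := C1 + C2 + exp (W * K).
have C00 : 0 <= C0 by rewrite /C0; lra.
have [u [Hu H]] := zs_incr (size l1 + (size l2).+1) gp C00.
exists u; split=> // k w hw hg; apply: H; first by rewrite size_map size_cat_cons.
rewrite map_cat; apply/nodes_le_cat; split.
  by apply: nodes_le_weaken H1 => n; apply: Rmult_le_compat_r; [exact: npow_ge0 | rewrite /C0; lra].
apply: List.Forall_cons; last first.
  by apply: nodes_le_weaken H2 => n; apply: Rmult_le_compat_r; [exact: npow_ge0 | rewrite /C0; lra].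
have Q la : near_log la K -> forall n, Cmod (wpow la w n) <= C0 * npow n (- (1 + g)).
  move=> Hla n; apply: Rle_trans (wpow_bound w n Hla) _.
  have q : exp (Cmod w * K) <= exp (W * K) by apply: exp_le_compat; apply: Rmult_le_compat_r.
  apply: Rmult_le_compat; [left; exact: exp_pos | exact: npow_ge0 | rewrite /C0; lra | apply: npow_le; lra].
by move=> n; split; [exact: (Q _ N1) | exact: (Q _ N2)].
Qed.

(* Each circle with centre c and radius 2(Re c - 1)/3 stays in Re > 1 and reaches
   4/3 as far to the right, so Vitali's step contracts the half-plane towards Re > 1. *)
Lemma half_plane_propagation t l1 l2 (f : C -> C) A : tdom t ->
  List.Forall (fun z => 1 < fst z) l1 -> List.Forall (fun z => 1 < fst z) l2 ->
  Centire f -> (forall w, A <= fst w -> Ccv (fun N => chainsum t N (l1 ++ w :: l2)) (f w)) ->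
  forall w, 1 < fst w -> Ccv (fun N => chainsum t N (l1 ++ w :: l2)) (f w).
Proof.
move=> ht h1 h2 Hf H0.
pose A' := Rmax A 2.
have A2 : 2 <= A' by exact: Rmax_r.
have key n : forall w, 1 + (A' - 1) * (3 / 4) ^ n < fst w -> Ccv (fun N => chainsum t N (l1 ++ w :: l2)) (f w).
  elim: n => [|n IH] c hc; first by apply: H0; rewrite /= Rmult_1_r in hc; have := Rmax_l A 2; rewrite -/A'; lra.
  have p34 : 0 < (3 / 4) ^ n by apply: pow_lt; lra.
  have T0 : 0 < (A' - 1) * (3 / 4) ^ n by apply: Rmult_lt_0_compat; lra.
  have e : (A' - 1) * (3 / 4) ^ n.+1 = 3 / 4 * ((A' - 1) * (3 / 4) ^ n) by rewrite /=; ring.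
  rewrite e in hc.
  pose r := 2 / 3 * (fst c - 1).
  have rp : 0 < r by rewrite /r; lra.
  have [g1 [g1p G1]] := Forall_gt_gap h1; have [g2 [g2p G2]] := Forall_gt_gap h2.
  pose g := Rmin (Rmin g1 g2) ((fst c - 1) / 3).
  have gp : 0 < g by repeat apply: Rmin_glb_lt; lra.
  have l1g : g <= g1 by apply: Rle_trans (Rmin_l _ _) (Rmin_l _ _).
  have l2g : g <= g2 by apply: Rle_trans (Rmin_l _ _) (Rmin_r _ _).
  have l3g : g <= (fst c - 1) / 3 by exact: Rmin_r.
  have H1 : List.Forall (fun z => 1 + g <= fst z) l1 by apply: List.Forall_impl G1 => z; lra.
  have H2 : List.Forall (fun z => 1 + g <= fst z) l2 by apply: List.Forall_impl G2 => z; lra.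
  have [u [Hu Hinc]] := chainsum_incr (Cmod c + r) ht gp H1 H2.
  apply: (@Ccv_shift _ _ 1).
  apply: (Ccv_ext (x := fun k => chainsum t k.+1 (l1 ++ c :: l2))); first by move=> k; rewrite addn1.
  apply: (@vitali_center f (fun k w => chainsum t k.+1 (l1 ++ w :: l2)) c r u) => //.
  - by move=> k; exact: Centire_chainsum.
  - move=> k z hz; apply: Hinc.
      have -> : z = (c + (z - c))%C by ring.
      by apply: Rle_trans (Cmod_triangle _ _) _; rewrite hz; lra.
    have := fst_ge_Cmod (z - c)%C; rewrite hz; have -> : fst (z - c)%C = fst z - fst c by [].
    by rewrite /r; lra.
  - move=> z hz hr.
    have := Ccv_unshift 1 (IH z _); have e' : fst (z - c)%C = fst z - fst c by [].
    move=> /(_ ltac:(rewrite e' /r in hr; lra)).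
    by apply: Ccv_ext => k; rewrite addn1.
move=> w hw.
have [n Hn] : exists n, (A' - 1) * (3 / 4) ^ n < fst w - 1.
  have hl : Rabs (3 / 4) < 1 by rewrite Rabs_pos_eq; lra.
  have ep : 0 < (fst w - 1) / (A' - 1) by apply: Rdiv_lt_0_compat; lra.
  have [n Hn] := pow_lt_1_zero (3 / 4) hl _ ep.
  exists n; have := Hn n (Nat.le_refl n); rewrite Rabs_pos_eq; last by apply: pow_le; lra.
  move=> h; have -> : fst w - 1 = (A' - 1) * ((fst w - 1) / (A' - 1)) by field; lra.
  by apply: Rmult_lt_compat_l; lra.
by apply: (key n); lra.
Qed.

(** A continuation that is known to give the limits for large exponents gives them in the whole
    region demanded by [zetaU_extension]; the exponents are lowered one after the other. *)
Lemma conv_region_propagation q t F A : tdom t -> sep_entire q F ->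
  (forall s, size s = q -> List.Forall (fun z => A <= fst z) s -> Ccv (fun N => chainsum t N s) (F s)) ->
  forall s, size s = q -> List.Forall (fun z => 1 < fst z) s -> Ccv (fun N => chainsum t N s) (F s).
Proof.
move=> ht He H0 s hs h.
pose A' := Rmax A 2.
have A2 : 2 <= A' by exact: Rmax_r.
suff key : forall p1 p2, size (p1 ++ p2) = q -> List.Forall (fun z => 1 < fst z) p1 ->
    List.Forall (fun z => A' <= fst z) p2 -> Ccv (fun N => chainsum t N (p1 ++ p2)) (F (p1 ++ p2)).
  by have := key s [::]; rewrite cats0; apply => //; exact: List.Forall_nil.
elim/last_ind=> [|p1 x IH] p2 hs' h1 h2.
  by apply: H0 => //; apply: List.Forall_impl h2 => z; have := Rmax_l A 2; rewrite -/A'; lra.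
move: h1; rewrite -cats1 => /List.Forall_app [h1 hx].
rewrite cats1 cat_rcons in hs' *; have hs'' := hs'; rewrite size_cat_cons in hs''.
apply: (@half_plane_propagation t p1 p2 (fun w => F (p1 ++ w :: p2)) A' ht h1) => //.
- by apply: Forall_lt_of_le h2.
- exact: He.
- by move=> w hw; apply: IH => //; [rewrite size_cat_cons | apply: List.Forall_cons].
- by inversion hx.
Qed.

Lemma entire_r_sep q F : sep_entire q F -> entire_r q F.
Proof.
move=> H s hs j hj z; apply/Cdiff_ex_derive.
have e w : set_nth (RtoC 0) s j w = take j s ++ w :: drop j.+1 s.
  rewrite -hs in hj; elim: s j hj {hs} => [//|x s IH] [|j] hj; rewrite /= ?drop0 //.
  by rewrite IH.
apply: (@Cdiff_ext (fun w => F (take j s ++ w :: drop j.+1 s))); first by move=> w; rewrite e.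
by apply: H; rewrite size_take size_drop hs hj; lia.
Qed.

(** The case m = 0 of [leftv]: the factor y + 1 gives the exponents y - 1 and y. [G] takes left
    part, distinguished exponent and right part separately, so that [shift_ext] can recurse through
    it. *)
Definition left_terms (G : seq C -> C -> seq C -> C) (l1 : seq C) (x : C) (l2 : seq C) : C :=
  match rev l1 with
  | [::] => G [::] x l2
  | y :: L => (G (rcons (rev L) (y - 1)%C) x l2 + G l1 x l2)%C
  end.

Lemma left_terms_rcons G l y x l2 :
  left_terms G (rcons l y) x l2 = (G (rcons l (y - 1)%C) x l2 + G (rcons l y) x l2)%C.
Proof. by rewrite /left_terms rev_rcons revK. Qed.

Lemma leftv_0 G l1 x l2 : leftv 0 G l1 (x :: l2) = left_terms (fun a b c => G (a ++ b :: c)) l1 x l2.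
Proof.
case/lastP: l1 => [|l y] //; rewrite leftv_rcons left_terms_rcons -!cats1 -!catA !csumS subn0 subnn.
have e1 : (y - RtoC (INR 1) = y - 1)%C by [].
have e0 : (y - RtoC (INR 0) = y)%C by have -> : RtoC (INR 0) = 0 by []; ring.
have b0 : cbinom (RtoC (INR 1)) 0 = 1 by [].
have b1 : cbinom (RtoC (INR 1)) 1 = 1 by rewrite /=; field; move=> /RtoC_inj; lra.
by rewrite e1 e0 b0 b1; cbn [csum cat]; ring.
Qed.

Lemma relsum_0 F l1 l2 : relsum F 0 l1 l2 = F (l1 ++ RtoC 0 :: l2).
Proof.
rewrite /relsum /=; have -> : (1 * (RtoC 1 - RtoC 0) / RtoC 1 = 1)%C by field; move=> /RtoC_inj; lra.
have -> : (- RtoC 0 = 0)%C by ring.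
by ring.
Qed.

(** * Continuation in one exponent *)

Section ExtendOneVariable.

Variables (q j : nat) (A : R) (F H L : seq C -> C).
Hypothesis hj : (j < q)%N.
Hypothesis HF : sep_entire q.+1 F.

Definition tail_gt (j : nat) (l : seq C) : Prop := List.Forall (fun z : C => A < fst z) (drop j l).

(** The first j exponents are arbitrary, the others are confined to Re > A. Passing from j = 0 to j
    = q is the whole continuation. *)
Definition partially_entire (j : nat) (G : seq C -> C) : Prop :=
  forall l1 z l2, size (l1 ++ z :: l2) = q -> tail_gt j (l1 ++ z :: l2) -> Cdiff (fun w => G (l1 ++ w :: l2)) z.

Hypothesis HH : partially_entire j H.
Hypothesis HL : forall l, size l = q -> tail_gt 0 l -> H l = L l.
Hypothesis Hrel : forall (l1 : seq C) (x : C) (l2 : seq C), size l1 = j -> (size l1 + (size l2).+1)%N = q ->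
  List.Forall (fun z : C => A + 1 < fst z) l1 -> A + 1 < fst x -> List.Forall (fun z : C => A < fst z) l2 ->
  L (l1 ++ (x - 1)%C :: l2) = (F (l1 ++ RtoC 0 :: x :: l2) + left_terms (fun a b c => L (a ++ b :: c)) l1 x l2)%C.

(** The relation with an inserted 0 expresses the value at x through values at x + 1, so n uses of
    it reach Re x > A - n. *)
Fixpoint shift_ext (n : nat) (l1 : seq C) (x : C) (l2 : seq C) : C :=
  match n with
  | O => H (l1 ++ x :: l2)
  | S n' => (F (l1 ++ RtoC 0 :: (x + 1)%C :: l2) + left_terms (shift_ext n') l1 (x + 1)%C l2)%C
  end.

Lemma tail_gt_cons (l1 : seq C) (x : C) (l2 : seq C) : size l1 = j -> A < fst x -> List.Forall (fun z : C => A < fst z) l2 ->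
  tail_gt j (l1 ++ x :: l2).
Proof. by move=> hs hx h2; rewrite /tail_gt drop_size_cat //; apply: List.Forall_cons. Qed.

Lemma left_terms_diff1 (G : seq C -> C -> seq C -> C) p1 z p2 x l2 :
  (forall p1 z p2, (size p1 + (size p2).+1)%N = j -> Cdiff (fun w => G (p1 ++ w :: p2) x l2) z) ->
  (size p1 + (size p2).+1)%N = j -> Cdiff (fun w => left_terms G (p1 ++ w :: p2) x l2) z.
Proof.
move=> HG; case/lastP: p2 => [|p2 y] hs.
  apply: (@Cdiff_ext (fun w => G (p1 ++ (w - 1)%C :: [::]) x l2 + G (p1 ++ w :: [::]) x l2)%C).
    by move=> w; rewrite !cats1 left_terms_rcons.
  apply: Cdiff_plus; last exact: HG.
  apply: (@Cdiff_comp (fun w => G (p1 ++ w :: [::]) x l2) (fun w => w - 1)%C); first exact: HG.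
  by apply: Cdiff_minus; [exact: Cdiff_id | exact: Cdiff_const].
apply: (@Cdiff_ext (fun w => G (p1 ++ w :: rcons p2 (y - 1)%C) x l2 + G (p1 ++ w :: rcons p2 y) x l2)%C).
  by move=> w; rewrite -!rcons_cons -!rcons_cat left_terms_rcons.
rewrite size_rcons in hs; by apply: Cdiff_plus; apply: HG; rewrite size_rcons.
Qed.

Lemma left_terms_diff (G : C -> seq C -> C -> seq C -> C) (X : C -> C) (Y : C -> seq C) l1 z :
  (forall l, size l = size l1 -> Cdiff (fun w => G w l (X w) (Y w)) z) ->
  Cdiff (fun w => left_terms (G w) l1 (X w) (Y w)) z.
Proof.
case/lastP: l1 => [|l y] HG; first exact: (HG [::]).
apply: (@Cdiff_ext (fun w => G w (rcons l (y - 1)%C) (X w) (Y w) + G w (rcons l y) (X w) (Y w))%C).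
  by move=> w; rewrite left_terms_rcons.
by apply: Cdiff_plus; apply: HG; rewrite !size_rcons.
Qed.

Lemma left_terms_ext G G' l1 x l2 : (forall l, size l = size l1 -> G l x l2 = G' l x l2) ->
  left_terms G l1 x l2 = left_terms G' l1 x l2.
Proof.
case/lastP: l1 => [|l y] h; first exact: (h [::]).
by rewrite !left_terms_rcons !h // !size_rcons.
Qed.

Lemma shift_ext_diff1 n (p1 : seq C) z (p2 : seq C) (x : C) (l2 : seq C) : (size p1 + (size p2).+1)%N = j -> (j + (size l2).+1)%N = q ->
  A - INR n < fst x -> List.Forall (fun z : C => A < fst z) l2 ->
  Cdiff (fun w => shift_ext n (p1 ++ w :: p2) x l2) z.
Proof.
elim: n p1 z p2 x => [|n IH] p1 z p2 x hp hs hx h2.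
  rewrite /=; apply: (@Cdiff_ext (fun w => H (p1 ++ w :: (p2 ++ x :: l2)))); first by move=> w; rewrite -catA.
  apply: HH; first by rewrite !size_cat /= size_cat /=; lia.
  rewrite -cat_cons catA; apply: tail_gt_cons => //; first by rewrite size_cat_cons.
  by rewrite /= Rminus_0_r in hx.
have hx' : A - INR n < fst (x + 1)%C by rewrite S_INR in hx; have -> : fst (x + 1)%C = fst x + 1 by []; lra.
cbn [shift_ext]; apply: Cdiff_plus.
  apply: (@Cdiff_ext (fun w => F (p1 ++ w :: (p2 ++ RtoC 0 :: (x + 1)%C :: l2)))); first by move=> w; rewrite -catA.
  by apply: HF; rewrite size_cat /=; lia.
by apply: left_terms_diff1 => // r1 y r2 hr; apply: IH.
Qed.

Lemma shift_ext_diff2 n (l1 : seq C) (x : C) (l2 : seq C) : size l1 = j -> (j + (size l2).+1)%N = q ->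
  A - INR n < fst x -> List.Forall (fun z : C => A < fst z) l2 ->
  Cdiff (fun w => shift_ext n l1 w l2) x.
Proof.
move=> hl hs; elim: n l1 x hl => [|n IH] l1 x hl hx h2.
  apply: HH; first by rewrite size_cat_cons hl.
  by apply: tail_gt_cons => //; rewrite /= Rminus_0_r in hx.
have hx' : A - INR n < fst (x + 1)%C by rewrite S_INR in hx; have -> : fst (x + 1)%C = fst x + 1 by []; lra.
have ds (z : C) : Cdiff (fun w => w + 1)%C z by apply: Cdiff_plus; [exact: Cdiff_id | exact: Cdiff_const].
cbn [shift_ext]; apply: Cdiff_plus.
  apply: (@Cdiff_comp (fun w => F (l1 ++ RtoC 0 :: w :: l2)) (fun w => w + 1)%C) => //.
  apply: (@Cdiff_ext (fun w => F ((l1 ++ [:: RtoC 0]) ++ w :: l2))); first by move=> w; rewrite -catA.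
  by apply: HF; rewrite size_cat hl /=; lia.
apply: (@left_terms_diff (fun _ => shift_ext n) (fun w => w + 1)%C (fun _ => l2)) => l hl'.
apply: (@Cdiff_comp (fun w => shift_ext n l w l2) (fun w => w + 1)%C) => //.
by apply: IH => //; rewrite hl'.
Qed.

Lemma shift_ext_diff3 n (l1 : seq C) (x : C) (p1 : seq C) (z : C) (p2 : seq C) : size l1 = j -> (j + (size (p1 ++ z :: p2)).+1)%N = q ->
  A - INR n < fst x -> List.Forall (fun z : C => A < fst z) (p1 ++ z :: p2) ->
  Cdiff (fun w => shift_ext n l1 x (p1 ++ w :: p2)) z.
Proof.
move=> hl hs; elim: n l1 x hl => [|n IH] l1 x hl hx h2.
  apply: (@Cdiff_ext (fun w => H ((l1 ++ x :: p1) ++ w :: p2))); first by move=> w; rewrite -catA.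
  apply: HH; first by rewrite -catA /= size_cat_cons hl.
  by rewrite -catA /=; apply: tail_gt_cons => //; rewrite /= Rminus_0_r in hx.
have hx' : A - INR n < fst (x + 1)%C by rewrite S_INR in hx; have -> : fst (x + 1)%C = fst x + 1 by []; lra.
cbn [shift_ext]; apply: Cdiff_plus.
  apply: (@Cdiff_ext (fun w => F ((l1 ++ RtoC 0 :: (x + 1)%C :: p1) ++ w :: p2))); first by move=> w; rewrite -catA.
  by apply: HF; rewrite size_cat /= hl; rewrite size_cat /= in hs; lia.
apply: (@left_terms_diff (fun _ => shift_ext n) (fun _ => x + 1)%C (fun w => p1 ++ w :: p2)) => l hl'.
by apply: IH => //; rewrite hl'.
Qed.

(** [Hrel] holds for [L] and large [l1]. Both sides are entire in the exponents of [l1] once [L] is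
    replaced by [H], so the identity theorem gives all [l1]. *)
Lemma relation_H (l1 : seq C) (x : C) (l2 : seq C) : size l1 = j -> (j + (size l2).+1)%N = q ->
  A + 1 < fst x -> List.Forall (fun z : C => A < fst z) l2 ->
  H (l1 ++ (x - 1)%C :: l2) = (F (l1 ++ RtoC 0 :: x :: l2) + left_terms (fun a b c => H (a ++ b :: c)) l1 x l2)%C.
Proof.
move=> hl hs hx h2.
have hx1 : A < fst (x - 1)%C by have -> : fst (x - 1)%C = fst x - 1 by []; lra.
pose f l := (H (l ++ (x - 1)%C :: l2) - (F (l ++ RtoC 0 :: x :: l2) + left_terms (fun a b c => H (a ++ b :: c)) l x l2))%C.
suff h : f l1 = 0.
  by have -> : H (l1 ++ (x - 1)%C :: l2) = (f l1 + (F (l1 ++ RtoC 0 :: x :: l2) + left_terms (fun a b c => H (a ++ b :: c)) l1 x l2))%C by [rewrite /f; ring]; rewrite h; ring.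
have dH y p1 z p2 : A < fst y -> (size p1 + (size p2).+1)%N = j -> Cdiff (fun w => H ((p1 ++ w :: p2) ++ y :: l2)) z.
  move=> hy hp; apply: (@Cdiff_ext (fun w => H (p1 ++ w :: (p2 ++ y :: l2)))); first by move=> w; rewrite -catA.
  apply: HH; first by rewrite !size_cat /= size_cat /=; lia.
  by rewrite -cat_cons catA; apply: tail_gt_cons => //; rewrite size_cat_cons.
apply: (@sep_identity j f (A + 3)) => // [p1 p2 hp z|l hl' hA].
  apply: Cdiff_minus; first exact: dH.
  apply: Cdiff_plus.
    apply: (@Cdiff_ext (fun w => F (p1 ++ w :: (p2 ++ RtoC 0 :: x :: l2)))); first by move=> w; rewrite -catA.
    by apply: HF; rewrite size_cat /=; lia.
  by apply: (@left_terms_diff1 (fun a b c => H (a ++ b :: c))) => // r1 y r2 hr; apply: dH => //; lra.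
have wk (B : R) a : B < A + 3 -> List.Forall (fun z : C => A + 3 <= fst z) a -> List.Forall (fun z : C => B < fst z) a.
  by move=> hB; apply: List.Forall_impl => z; lra.
have HLa a y : size a = j -> List.Forall (fun z : C => A < fst z) a -> A < fst y -> H (a ++ y :: l2) = L (a ++ y :: l2).
  move=> ha h1 hy; apply: HL; first by rewrite size_cat_cons ha.
  by rewrite /tail_gt drop0; apply/List.Forall_app; split=> //; apply: List.Forall_cons.
rewrite /f HLa //; last by apply: wk hA; lra.
have hs'' : (size l + (size l2).+1)%N = q by rewrite hl'.
rewrite (Hrel hl' hs'' (wk (A + 1) l ltac:(lra) hA) hx h2).
have -> : left_terms (fun a b c => H (a ++ b :: c)) l x l2 = left_terms (fun a b c => L (a ++ b :: c)) l x l2; last by ring.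
case/lastP: l hl' hA {hs''} => [|l y] hl' hA; first by apply: (HLa [::]) => //; lra.
rewrite !left_terms_rcons; rewrite -cats1 in hA; move: hA => /List.Forall_app [hA1 hA2].
have hy : A + 3 <= fst y by inversion hA2.
congr Cplus; apply: HLa; rewrite ?size_rcons -?cats1; try lra.
- by rewrite -hl' size_rcons.
- apply/List.Forall_app; split; first by apply: wk hA1; lra.
  by apply: List.Forall_cons; [rewrite /Cminus /Cplus /Copp /RtoC; cbn [fst]; lra | exact: List.Forall_nil].
- by rewrite -hl' size_rcons.
- apply/List.Forall_app; split; first by apply: wk hA1; lra.
  by apply: List.Forall_cons; [lra | exact: List.Forall_nil].
Qed.

(** Consistency of the continuation: the value does not depend on how often the relation is used.
    For n = 0 this is [relation_H], and the recursion transports it. *)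
Lemma shift_ext_S n (l1 : seq C) (x : C) (l2 : seq C) : size l1 = j -> (j + (size l2).+1)%N = q ->
  A - INR n < fst x -> List.Forall (fun z : C => A < fst z) l2 ->
  shift_ext n.+1 l1 x l2 = shift_ext n l1 x l2.
Proof.
move=> hl hs; elim: n l1 x hl => [|n IH] l1 x hl hx h2.
  rewrite [INR 0]/= Rminus_0_r in hx.
  have hx' : A + 1 < fst (x + 1)%C by have -> : fst (x + 1)%C = fst x + 1 by []; lra.
  have := relation_H hl hs hx' h2; have -> : (x + 1 - 1 = x)%C by ring.
  by move=> e; rewrite [RHS]/= e; cbn [shift_ext].
have hx' : A - INR n < fst (x + 1)%C by rewrite S_INR in hx; have -> : fst (x + 1)%C = fst x + 1 by []; lra.
have e m : shift_ext m.+1 l1 x l2 = (F (l1 ++ RtoC 0 :: (x + 1)%C :: l2) + left_terms (shift_ext m) l1 (x + 1)%C l2)%C by [].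
rewrite (e n.+1) (e n); congr Cplus; apply: left_terms_ext => l hl'.
by apply: IH => //; rewrite hl'.
Qed.

Lemma shift_ext_stable n n' (l1 : seq C) (x : C) (l2 : seq C) : size l1 = j -> (j + (size l2).+1)%N = q -> 
  A - INR n < fst x -> A - INR n' < fst x -> List.Forall (fun z : C => A < fst z) l2 ->
  shift_ext n l1 x l2 = shift_ext n' l1 x l2.
Proof.
move=> hl hs hn hn' h2.
have key a k : A - INR a < fst x -> shift_ext (a + k) l1 x l2 = shift_ext a l1 x l2.
  move=> ha; elim: k => [|k IH]; first by rewrite addn0.
  rewrite addnS shift_ext_S //; have := pos_INR k; rewrite plus_INR; lra.
by rewrite -(key n n' hn) addnC key.
Qed.

Lemma enough_shifts (x : C) : exists n, A - INR n < fst x.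
Proof.
have [n hn] := INR_archimed 1 (A - fst x) Rlt_0_1; exists n; lra.
Qed.

Definition shifts (x : C) : nat := proj1_sig (constructive_indefinite_description _ (enough_shifts x)).

Lemma shiftsP x : A - INR (shifts x) < fst x.
Proof. exact: (proj2_sig (constructive_indefinite_description _ (enough_shifts x))). Qed.

(** The number of shifts is chosen point by point; near a given point one fixed number serves, by
    [extended_eq], and this is how differentiability is checked. *)
Definition extended (s : seq C) : C :=
  let x := nth (RtoC 0) s j in shift_ext (shifts x) (take j s) x (drop j.+1 s).

Lemma extended_eq n (l1 : seq C) (x : C) (l2 : seq C) : size l1 = j -> (j + (size l2).+1)%N = q ->
  A - INR n < fst x -> List.Forall (fun z : C => A < fst z) l2 ->
  extended (l1 ++ x :: l2) = shift_ext n l1 x l2.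
Proof.
move=> hl hs hx h2; rewrite /extended take_size_cat // -cat_rcons drop_size_cat ?size_rcons ?hl //.
rewrite cat_rcons nth_cat hl ltnn subnn /=.
by apply: shift_ext_stable => //; exact: shiftsP.
Qed.

Lemma extended_diff : partially_entire j.+1 extended.
Proof.
move=> p1 z p2 hs ht; rewrite size_cat_cons in hs.
case: (ltngtP (size p1) j) => hp.
- have [r2 [x [l2 [e1 hr]]]] : exists r2 x l2, p2 = r2 ++ x :: l2 /\ (size p1 + (size r2).+1)%N = j.
    exists (take (j - (size p1).+1) p2), (nth (RtoC 0) p2 (j - (size p1).+1)), (drop (j - (size p1).+1).+1 p2).
    split; last by rewrite size_take; case: ltnP; lia.
    by rewrite -drop_nth ?cat_take_drop //; lia.
  subst p2; have hs2 : (j + (size l2).+1)%N = q by rewrite size_cat_cons in hs; lia.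
  have h2 : List.Forall (fun z : C => A < fst z) l2.
    move: ht; rewrite /tail_gt; have -> : p1 ++ z :: r2 ++ x :: l2 = rcons (p1 ++ z :: r2) x ++ l2 by rewrite cat_rcons -catA.
    by rewrite drop_size_cat // size_rcons size_cat_cons hr.
  have [n hn] := enough_shifts x.
  apply: (@Cdiff_ext (fun w => shift_ext n (p1 ++ w :: r2) x l2)).
    by move=> w; rewrite -(extended_eq (n := n)) ?size_cat_cons // -catA.
  exact: shift_ext_diff1.
- have [l1' [x [r1 [e1 hl]]]] : exists l1' x r1, p1 = l1' ++ x :: r1 /\ size l1' = j.
    exists (take j p1), (nth (RtoC 0) p1 j), (drop j.+1 p1); split; last by rewrite size_take hp.
    by rewrite -drop_nth // cat_take_drop.
  subst p1; have hs2 : (j + (size (r1 ++ z :: p2)).+1)%N = q by move: hs; rewrite !size_cat /=; lia.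
  have h2 : List.Forall (fun z : C => A < fst z) (r1 ++ z :: p2).
    move: ht; rewrite /tail_gt -catA /= -cat_rcons drop_size_cat // size_rcons hl //.
  have [n hn] := enough_shifts x.
  (* The exponents behind position j keep Re > A only near z, hence the comparison on a disc. *)
  apply: (@Cdiff_ext_loc (fun w => shift_ext n l1' x (r1 ++ w :: p2)) _ z (fst z - A)).
  + by move: h2 => /List.Forall_app [_ h2]; inversion h2; lra.
  + move=> w hw; rewrite -catA /= (extended_eq (n := n)) //; first by move: hs2; rewrite !size_cat.
    move: h2 => /List.Forall_app [h2 h3]; apply/List.Forall_app; split=> //.
    inversion h3; apply: List.Forall_cons => //.
    by have := fst_ge_Cmod (w - z)%C; have -> : fst (w - z)%C = fst w - fst z by []; lra.
  + exact: shift_ext_diff3.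
- have hs2 : (j + (size p2).+1)%N = q by rewrite -hp.
  have h2 : List.Forall (fun z : C => A < fst z) p2.
    by move: ht; rewrite /tail_gt -cat_rcons drop_size_cat // size_rcons hp.
  have [n hn] := enough_shifts z.
  apply: (@Cdiff_ext_loc (fun w => shift_ext n p1 w p2) _ z (fst z - (A - INR n))).
  + lra.
  + move=> w hw; rewrite (extended_eq (n := n)) //.
    by have := fst_ge_Cmod (w - z)%C; have -> : fst (w - z)%C = fst w - fst z by []; lra.
  + exact: shift_ext_diff2.
Qed.

Lemma extended_conv l : size l = q -> tail_gt 0 l -> extended l = L l.
Proof.
move=> hl; rewrite /tail_gt drop0 => h; rewrite -(HL hl) /tail_gt ?drop0 //.
have hjl : (j < size l)%N by rewrite hl.
have e : l = take j l ++ nth (RtoC 0) l j :: drop j.+1 l by rewrite -drop_nth // cat_take_drop.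
have hs : size (take j l) = j by rewrite size_take hjl.
have hs2 : (j + (size (drop j.+1 l)).+1)%N = q by rewrite size_drop hl; lia.
move: h; rewrite e => /List.Forall_app [_ h]; inversion h.
by rewrite (extended_eq (n := O)) // [INR 0]/= Rminus_0_r.
Qed.

End ExtendOneVariable.

(** Meaningful where the sums converge; it is the function from which the continuation starts at j =
    0. *)
Definition limit_fun (t : C) (s : seq C) : C :=
  epsilon (inhabits (RtoC 0)) (fun v => Ccv (fun N => chainsum t N s) v).

Lemma limit_funP t s : tdom t -> List.Forall (fun z : C => 1 < fst z) s ->
  Ccv (fun N => chainsum t N s) (limit_fun t s).
Proof. by move=> ht h; apply: epsilon_spec; exact: conv_limit. Qed.

(* Inserting the exponent 0 turns a depth-(q+1) value into a difference of depth-q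
   values, which continues the depth-q series one variable at a time. *)
Lemma ext_lower q t F : tdom t -> zetaU_extension q.+1 0 t F -> exists G, zetaU_extension q 0 t G.
Proof.
move=> ht HF; have EF := ext_sep_entire HF.
set L := limit_fun t.
(* Above A the relation of [relation_large] with m = 0 holds for the limits themselves. *)
set A := INR (shift_order q.+1 0).
have A2 : 2 <= A by have := shift_order_ge q.+1 0; rewrite -/A /=; lra.
have [G [HG1 HG2]] : exists G, partially_entire q A q G /\ forall l, size l = q -> tail_gt A 0 l -> G l = L l.
  (* Induction on the number j of exponents already continued; for j = q the condition on the tail
     is empty. *)
  have key j : (j <= q)%N -> exists G, partially_entire q A j G /\ forall l, size l = q -> tail_gt A 0 l -> G l = L l.
    elim: j => [|j IH] hj.
      exists L; split=> // l1 z l2 hs; rewrite /tail_gt drop0 => /List.Forall_app [h1 h2].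
      have w a : List.Forall (fun z : C => A < fst z) a -> List.Forall (fun z : C => 1 < fst z) a.
        by apply: List.Forall_impl => y; lra.
      inversion h2; apply: (conv_diff ht) => //; try exact: w; last lra.
      by move=> s _ h; exact: limit_funP.
    have [H [HH HL]] := IH (ltnW hj).
    exists (extended j A F H); split.
      apply: (extended_diff hj EF HH HL) => l1 x l2 hl hs h1 hx h2.
      have wk a B : A <= B -> List.Forall (fun z : C => B < fst z) a -> List.Forall (fun z : C => A <= fst z) a.
        by move=> hB; apply: List.Forall_impl => y; lra.
      have := @relation_large q 0 t F L l1 (x :: l2) ht HF (fun s _ h => limit_funP ht h) hs (wk _ _ _ h1).
      move=> /(_ ltac:(lra)) R.
      have h2' : List.Forall (fun z : C => A <= fst z) (x :: l2).
        by apply: List.Forall_cons; [lra | apply: (wk _ A) h2; lra].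
      have := R h2'; rewrite relsum_0 leftv_0 /rightv => ->.
      by have -> : RtoC (INR 1) = 1 by []; ring.
    apply: (extended_conv hj EF HH HL) => l1 x l2 hl hs h1 hx h2.
    have wk a B : A <= B -> List.Forall (fun z : C => B < fst z) a -> List.Forall (fun z : C => A <= fst z) a.
      by move=> hB; apply: List.Forall_impl => y; lra.
    have := @relation_large q 0 t F L l1 (x :: l2) ht HF (fun s _ h => limit_funP ht h) hs (wk _ _ _ h1).
    move=> /(_ ltac:(lra)) R.
    have h2' : List.Forall (fun z : C => A <= fst z) (x :: l2).
      by apply: List.Forall_cons; [lra | apply: (wk _ A) h2; lra].
    have := R h2'; rewrite relsum_0 leftv_0 /rightv => ->.
    by have -> : RtoC (INR 1) = 1 by []; ring.
  exact: key.
have EG : sep_entire q G.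
  move=> l1 l2 hs z; apply: HG1; first by rewrite size_cat_cons.
  by rewrite /tail_gt drop_oversize; [exact: List.Forall_nil | rewrite size_cat_cons hs].
exists G; split; first exact: entire_r_sep.
move=> s [hs hc].
have h : List.Forall (fun z : C => 1 < fst z) s.
  rewrite -hs in hc; elim: s hc {hs} => [|x s IH] hc; first exact: List.Forall_nil.
  by apply: List.Forall_cons; [exact: (hc O) | apply: IH => i hi; exact: (hc i.+1)].
apply/filterlim_Ccv; apply: (Ccv_ext (x := fun N => chainsum t N s)); first by move=> N; rewrite zetaU_trunc_zs.
apply: (conv_region_propagation (A := A + 1) ht EG) => // l hl hA.
rewrite HG2 //; last by rewrite /tail_gt drop0; apply: List.Forall_impl hA => z; lra.
by apply: limit_funP => //; apply: List.Forall_impl hA => z; lra.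
Qed.

(** * Exponents equal to 1 *)

(** The step across infinity changes the logarithm by -pi i in the limit; q ordered variables
    sharing it account for the 1/q!. *)
Definition bc (q : nat) : C := (Cpow (- piI) q / RtoC (INR (fact q)))%C.

(* [c_a(u) = e^(pi i u) sum_m (-pi i)^(m+a) u^m / (m+a)!], cut off at [N] to remain
   elementary; it solves [u c_(a+1) = c_a - e^(pi i u) (-pi i)^a / a!]. *)
Definition cc (N a : nat) (u : C) : C :=
  (Cexp (piI * u) * csum (fun m => bc (m + a) * Cpow u m) N)%C.

Lemma RtoC_fact_neq0 q : RtoC (INR (fact q)) <> 0.
Proof. by move=> /RtoC_inj; exact: INR_fact_neq_0. Qed.

Lemma bc_0 : bc 0 = 1.
Proof. by rewrite /bc /=; field; move=> /RtoC_inj; lra. Qed.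

Lemma cc_rec N a u : (u * cc N a.+1 u)%C = (cc N.+1 a u - Cexp (piI * u) * bc a)%C.
Proof.
rewrite /cc csum_S_l (@csum_ext (fun i => bc (i.+1 + a) * Cpow u i.+1)%C (fun i => u * (bc (i + a.+1) * Cpow u i))%C); last first.
  by move=> i _; rewrite addSnnS; cbn [Cpow]; ring.
by rewrite csum_mull; have -> : Cpow u 0 = 1 by []; rewrite add0n; ring.
Qed.

Lemma cc_succ N a u : cc N.+1 a u = (cc N a u + Cexp (piI * u) * (bc (N + a) * Cpow u N))%C.
Proof. by rewrite /cc csumS; ring. Qed.

Lemma cc_at0 N a : cc N.+1 a 0 = bc a.
Proof.
rewrite /cc csum_S_l (@csum_ext _ (fun _ => 0 * 0)%C); last by move=> i _; cbn [Cpow]; ring.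
have -> : (piI * 0 = 0)%C by ring.
by rewrite Cexp_0 csum_mull add0n; have -> : Cpow 0 0 = 1 by []; ring.
Qed.

(** With pi <= 4 this bounds every |bc q| by 64; only uniformity in q matters. *)
Lemma pow4_fact q : 4 ^ q <= 64 * INR (fact q).
Proof.
case: (ltnP q 3) => h.
  by case: q h => [|[|[|q]]] // _; rewrite /=; lra.
have -> : q = (q - 3 + 3)%N by lia.
elim: (q - 3)%N => [|n IH]; first by rewrite /=; lra.
rewrite addSn fact_simpl mult_INR; have -> : 4 ^ (n + 3).+1 = 4 * 4 ^ (n + 3) by [].
have h4 : 4 <= INR (n + 3).+1.
  by have -> : 4 = INR 4 by [rewrite /=; ring]; apply: le_INR; lia.
have f0 : 0 <= INR (fact (n + 3)) by exact: pos_INR.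
by nra.
Qed.

Lemma Cmod_piI : Cmod piI = PI.
Proof.
have -> : piI = (Ci * RtoC PI)%C by rewrite /piI /Cmult /=; congr pair; ring.
by rewrite Cmod_mult Cmod_R Cmod_Ci Rabs_pos_eq; [ring | have := PI_RGT_0; lra].
Qed.

Lemma bc_le q : Cmod (bc q) <= 64.
Proof.
have fp : 0 < INR (fact q) by exact: INR_fact_lt_0.
rewrite /bc Cmod_div; last exact: RtoC_fact_neq0.
rewrite Cmod_pow Cmod_opp Cmod_piI Cmod_R Rabs_pos_eq; last lra.
apply: (Rmult_le_reg_r (INR (fact q))) => //.
rewrite /Rdiv Rmult_assoc Rinv_l; last lra.
rewrite Rmult_1_r; apply: Rle_trans (pow4_fact q); apply: pow_incr.
by have := PI_4; have := PI_RGT_0; lra.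
Qed.

Lemma geom_le x n : 0 <= x <= / 2 -> rsum (fun m => x ^ m) n <= 2.
Proof.
move=> hx; suff : rsum (fun m => x ^ m) n + 2 * x ^ n <= 2.
  by have : 0 <= x ^ n by [apply: pow_le; lra]; lra.
elim: n => [|n IH]; first by rewrite /=; lra.
have p : 0 <= x ^ n by apply: pow_le; lra.
by cbn [rsum pow]; nra.
Qed.

Lemma Cmod_csum_rsum (f : nat -> C) (g : nat -> R) n : (forall i, Cmod (f i) <= g i) ->
  Cmod (csum f n) <= rsum g n.
Proof.
move=> h; elim: n => [|n IH]; first by rewrite /= Cmod_0; lra.
by cbn [csum rsum]; apply: Rle_trans (Cmod_triangle _ _) _; apply: Rplus_le_compat.
Qed.

Lemma rsum_scal c u n : rsum (fun m => c * u m) n = c * rsum u n.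
Proof. by elim: n => [|n IH]; cbn [rsum]; [ring | rewrite IH; ring]. Qed.

Lemma Cexp_piI_le u : Cmod u <= / 16 -> Cmod (Cexp (piI * u)%C) <= exp 1.
Proof.
move=> h; apply: Rle_trans (Cmod_Cexp_le _) _; apply: exp_le_compat.
by rewrite Cmod_mult Cmod_piI; have := PI_4; have := PI_RGT_0; have := Cmod_ge_0 u; nra.
Qed.

(** The radius 1/16 keeps |pi u| below 1/4, so exponential factors are at most e and cut-off errors
    decay at least like 2^(-n). *)
Lemma cc_le N a u : Cmod u <= / 16 -> Cmod (cc N a u) <= exp 1 * 128.
Proof.
move=> h; have up := Cmod_ge_0 u.
rewrite /cc Cmod_mult; apply: Rmult_le_compat; try exact: Cmod_ge_0; first exact: Cexp_piI_le.
apply: Rle_trans (Cmod_csum_rsum (g := fun m => 64 * Cmod u ^ m) N _) _.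
  move=> i; rewrite Cmod_mult Cmod_pow; apply: Rmult_le_compat_r; last exact: bc_le.
  exact: pow_le.
have hg : rsum (fun m => Cmod u ^ m) N <= 2 by apply: geom_le; split; lra.
by rewrite (rsum_scal 64 (fun m => Cmod u ^ m)); move: hg; set q := rsum _ _; lra.
Qed.

Lemma half_pow_le n : (/ 2) ^ n.+1 <= npow n.+1 (- 1).
Proof.
have e : npow n.+1 (- 1) * INR n.+1 = 1.
  by rewrite -npow_1 -npow_plus Rplus_opp_l npow_0.
have h : INR n.+1 <= 2 ^ n.+1.
  elim: n {e} => [|n IH]; first by rewrite /=; lra.
  by rewrite S_INR; have := INR_S_ge1 n; cbn [pow] in IH |- *; lra.
have ip : 0 < INR n.+1 by have := INR_S_ge1 n; lra.
have p2 : 0 < 2 ^ n.+1 by apply: pow_lt; lra.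
apply: (Rmult_le_reg_r (INR n.+1)) => //; rewrite e pow_inv; apply: (Rmult_le_reg_l (2 ^ n.+1)) => //.
have -> : 2 ^ n.+1 * (/ 2 ^ n.+1 * INR n.+1) = INR n.+1 by field; apply: Rgt_not_eq.
by rewrite Rmult_1_r.
Qed.

Lemma sixteenth_pow_le x n : 0 <= x <= / 16 -> x ^ n.+1 <= npow n.+1 (- 2).
Proof.
move=> hx; apply: Rle_trans (_ : ((/ 2) ^ n.+1) * ((/ 2) ^ n.+1) <= _).
  by rewrite -Rpow_mult_distr; apply: pow_incr; lra.
have -> : npow n.+1 (- 2) = npow n.+1 (- 1) * npow n.+1 (- 1) by rewrite -npow_plus; congr npow; ring.
have p : 0 <= (/ 2) ^ n.+1 by apply: pow_le; lra.
by apply: Rmult_le_compat => //; exact: half_pow_le.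
Qed.

(** c_0(u) is exp(pi i u) times a partial sum of exp(-pi i u), so it differs from 1 by the cut-off
    error only. *)
Lemma cc_0_near1 n u : Cmod u <= / 16 -> Cmod (cc n.+1 0 u - 1)%C <= exp 1 * exp 1 * npow n.+1 (- 1).
Proof.
move=> h; have up := Cmod_ge_0 u; have p1 := PI_4; have p2 := PI_RGT_0.
have -> : cc n.+1 0 u = (Cexp (piI * u) * exp_poly n.+1 (- piI * u))%C.
  rewrite /cc /exp_poly; congr Cmult; apply: csum_ext => i _; rewrite addn0 /bc Cpow_mult_l /Cdiv; ring.
have e1 : (Cexp (piI * u) * Cexp (- piI * u) = 1)%C.
  by rewrite -Cexp_plus; have -> : (piI * u + - piI * u = 0)%C by [ring]; exact: Cexp_0.
have -> : (Cexp (piI * u) * exp_poly n.+1 (- piI * u) - 1 = - (Cexp (piI * u) * (Cexp (- piI * u) - exp_poly n.+1 (- piI * u))))%C.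
  by rewrite -e1; ring.
rewrite Cmod_opp Cmod_mult Rmult_assoc; apply: Rmult_le_compat; try exact: Cmod_ge_0; first exact: Cexp_piI_le.
apply: Rle_trans (Cexp_poly_rem _ _) _; rewrite Rmult_comm.
have mu : Cmod (- piI * u)%C <= / 4 by rewrite Cmod_mult Cmod_opp Cmod_piI; nra.
have mu0 := Cmod_ge_0 (- piI * u)%C.
apply: Rmult_le_compat; first by left; apply: exp_pos.
- by apply: pow_le; lra.
- by apply: exp_le_compat; lra.
- by apply: Rle_trans (half_pow_le n); apply: pow_incr; lra.
Qed.

Lemma npow_m1 n : npow n.+1 (- 1) = / INR n.+1.
Proof.
have h : npow n.+1 (- 1) * INR n.+1 = 1 by rewrite -npow_1 -npow_plus Rplus_opp_l npow_0.
by rewrite -[LHS]Rmult_1_r -(Rinv_r (INR n.+1)); [rewrite -Rmult_assoc h; ring | have := INR_S_ge1 n; lra].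
Qed.

Section SmallT.

Variable t : C.
Hypothesis ht2 : Cmod t <= / 2.

Lemma small_tdom : tdom t.
Proof. by move=> [_ h]; have := fst_le_Cmod t; lra. Qed.

(** log (n - t) - log n, the deviation of the branch after infinity from log n - pi i. *)
Definition theta (n : nat) : C := (lam t n + piI - lap n)%C.

Lemma theta_le n : Cmod (theta n.+1) <= 4 * npow n.+1 (- 1).
Proof.
have hn := INR_S_ge1 n.
have e1 := npow_m1 n.
pose f s := Clog (RtoC (INR n.+1) + RtoC s * (- t))%C.
pose f' s := (- t / (RtoC (INR n.+1) + RtoC s * (- t)))%C.
have -> : theta n.+1 = (f 1 - f 0)%C.
  rewrite /theta /lam /lap -Clog_INR /f.
  have -> : (RtoC (INR n.+1) + RtoC 1 * - t = RtoC (INR n.+1) - t)%C by ring.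
  have -> : (RtoC (INR n.+1) + RtoC 0 * - t = RtoC (INR n.+1))%C by ring.
  by ring.
have -> : 4 * npow n.+1 (- 1) = 2 * (1 * (2 * / INR n.+1)) by rewrite e1; ring.
apply: (@Cmean_value f f') => s hs.
have st : Cmod (RtoC s * (- t))%C <= / 2.
  rewrite Cmod_mult Cmod_opp Cmod_R Rabs_pos_eq; last lra.
  by have := Cmod_ge_0 t; nra.
have fz : INR n.+1 - / 2 <= fst (RtoC (INR n.+1) + RtoC s * (- t))%C.
  have := fst_ge_Cmod (RtoC s * (- t))%C.
  have -> : fst (RtoC (INR n.+1) + RtoC s * (- t))%C = INR n.+1 + fst (RtoC s * (- t))%C by [].
  lra.
have sl : slit (RtoC (INR n.+1) + RtoC s * (- t))%C by apply: slit_pos; lra.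
split.
  apply: (Rder_ext _ _ (Rder_Clog sl (Rder_plus (Rder_const _ s) (Rder_scal_id (- t)%C s)))) => //.
  by rewrite /f' Cplus_0_l.
have mz := fst_le_Cmod (RtoC (INR n.+1) + RtoC s * (- t))%C.
rewrite /f' Cmod_div; last by apply/Cmod_gt_0; lra.
rewrite Cmod_opp; apply: Rmult_le_compat; first exact: Cmod_ge_0.
- by left; apply: Rinv_0_lt_compat; lra.
- lra.
- apply: Rle_trans (Rinv_le_contravar (INR n.+1 / 2) _ _ _) _; try lra.
  have -> : / (INR n.+1 / 2) = 2 * / INR n.+1 by field; lra.
  lra.
Qed.

End SmallT.

(* [sz f b] abstracts "[f] has size at most [b]"; it is used for the supremum norm on a
   set of exponents and for the l^1 norm of power series in [t]. *)
Section Dom.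

Variable sz : (C -> C) -> R -> Prop.
Hypothesis sz_ext : forall f g b, (forall w, f w = g w) -> sz f b -> sz g b.
Hypothesis sz_le : forall f b b', b <= b' -> sz f b -> sz f b'.
Hypothesis sz_const : forall c, sz (fun _ => c) (Cmod c).
Hypothesis sz_plus : forall f g b c, sz f b -> sz g c -> sz (fun w => f w + g w)%C (b + c).
Hypothesis sz_mult : forall f g b c, 0 <= b -> 0 <= c -> sz f b -> sz g c -> sz (fun w => f w * g w)%C (b * c).

Definition dom (f : C -> nat -> C) (x : R) : Prop :=
  exists B, 0 <= B /\ forall n, sz (fun w => f w n.+1) (B * npow n.+1 x).

Lemma dom_ext f g x : (forall w n, f w n.+1 = g w n.+1) -> dom f x -> dom g x.
Proof. by move=> e [B [B0 H]]; exists B; split=> // n; apply: sz_ext (H n) => w. Qed.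

Lemma dom_le f x y : x <= y -> dom f x -> dom f y.
Proof.
move=> h [B [B0 H]]; exists B; split=> // n; apply: sz_le (H n).
by apply: Rmult_le_compat_l => //; exact: npow_le.
Qed.

Lemma dom_seq (c : nat -> C) B x : 0 <= B -> (forall n, Cmod (c n.+1) <= B * npow n.+1 x) -> dom (fun _ => c) x.
Proof. by move=> B0 H; exists B; split=> // n; apply: sz_le (sz_const _). Qed.

Lemma dom_const c : dom (fun _ _ => c) 0.
Proof. by apply: (@dom_seq _ (Cmod c)) => [|n]; [exact: Cmod_ge_0 | rewrite npow_0; lra]. Qed.

Lemma dom_0 x : dom (fun _ _ => RtoC 0) x.
Proof. by apply: (@dom_seq _ 0) => [|n]; [lra | rewrite Cmod_0; lra]. Qed.

Lemma dom_plus f g x : dom f x -> dom g x -> dom (fun w n => f w n + g w n)%C x.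
Proof.
move=> [B [B0 H]] [B' [B'0 H']]; exists (B + B'); split; first lra.
by move=> n; rewrite Rmult_plus_distr_r; apply: sz_plus.
Qed.

Lemma dom_mult f g x y : dom f x -> dom g y -> dom (fun w n => f w n * g w n)%C (x + y).
Proof.
move=> [B [B0 H]] [B' [B'0 H']]; exists (B * B'); split; first exact: Rmult_le_pos.
move=> n; rewrite npow_plus.
have -> : B * B' * (npow n.+1 x * npow n.+1 y) = (B * npow n.+1 x) * (B' * npow n.+1 y) by ring.
by apply: sz_mult => //; apply: Rmult_le_pos => //; exact: npow_ge0.
Qed.

Lemma dom_mult_le f g x y z : x + y <= z -> dom f x -> dom g y -> dom (fun w n => f w n * g w n)%C z.
Proof. by move=> h hf hg; apply: dom_le h (dom_mult hf hg). Qed.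

Lemma dom_scal c f x : dom f x -> dom (fun w n => c * f w n)%C x.
Proof. by move=> h; apply: dom_mult_le (dom_const c) h; lra. Qed.

Lemma dom_opp f x : dom f x -> dom (fun w n => - f w n)%C x.
Proof. by move=> h; apply: dom_ext (dom_scal (- (1))%C h) => w n; ring. Qed.

Lemma dom_minus f g x : dom f x -> dom g x -> dom (fun w n => f w n - g w n)%C x.
Proof. by move=> h1 h2; apply: dom_plus h1 (dom_opp h2). Qed.

Lemma dom_csum (f : nat -> C -> nat -> C) x K : (forall k, (k < K)%N -> dom (f k) x) ->
  dom (fun w n => csum (fun k => f k w n) K) x.
Proof.
elim: K => [|K IH] H; first exact: dom_0.
by apply: dom_plus; [apply: IH => k hk; apply: H; lia | exact: H].
Qed.

Lemma dom_psum f kap : 0 < kap -> (forall w, f w O = RtoC 0) -> dom f (kap - 1) -> dom (fun w n => csum (f w) n) kap.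
Proof.
move=> kp f0 [B [B0 H]]; have [D [D0 HD]] := npow_growth kp.
exists (B * D); split; first by apply: Rmult_le_pos; lra.
move=> n; rewrite Rmult_assoc; apply: (@sz_le _ (B * rsum (fun n => npow n (kap - 1)) n.+1)).
  exact: Rmult_le_compat_l.
elim: n => [|n IH].
  apply: (sz_ext (f := fun _ => 0)) => [w|]; first by cbn [csum]; rewrite f0; ring.
  have := sz_const 0; rewrite Cmod_0; apply: sz_le; cbn [rsum].
  by apply: Rmult_le_pos => //; have := npow_ge0 0 (kap - 1); lra.
cbn [csum rsum] in IH |- *; rewrite [B * _]Rmult_plus_distr_l.
exact: (sz_plus IH (H n)).
Qed.

Lemma dom_nest kap (fam : seq (C -> nat -> C)) : 0 < kap ->
  List.Forall (fun f => (forall w, f w O = RtoC 0) /\ dom f (kap - 1)) fam ->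
  dom (fun w n => nest (map (fun f => f w) fam) n) (INR (size fam) * kap).
Proof.
move=> kp; elim: fam => [|f fam IH] H.
  by apply: dom_le (dom_const 1); rewrite /=; lra.
inversion H; have [f0 hf] := H2; have k0 : 0 <= INR (size fam) * kap by apply: Rmult_le_pos; [exact: pos_INR | lra].
have e : INR (size (f :: fam)) * kap = INR (size fam) * kap + kap by rewrite [size _]/= S_INR; ring.
rewrite e; apply: (@dom_psum (fun w n => f w n * nest (map (fun f => f w) fam) n)%C).
- lra.
- by move=> w; rewrite f0; ring.
- by apply: dom_mult_le hf (IH H3); lra.
Qed.

Definition znode (fam : seq (C -> node)) (w : C) : seq node := map (fun f => f w) fam.

Definition dnode (kap : R) (f : C -> node) : Prop :=
  (forall w, z0n (f w)) /\ dom (fun w n => (f w).1 n) kap /\ dom (fun w n => (f w).2 n) kap.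

(** Exponents add up: nodes of size n^(kap-1) cost at most n^(r kap) on either side of infinity, and
    the block contributes n^x. *)
Lemma dom_glued (fam : seq (C -> node)) (M : C -> nat -> nat -> nat -> C) kap x : 0 < kap ->
  List.Forall (dnode (kap - 1)) fam ->
  (forall i j, (i <= size fam)%N -> (j <= size fam)%N -> dom (fun w n => M w n i j) x) ->
  dom (fun w n => glued (znode fam w) n (M w n)) (INR (size fam) * kap + INR (size fam) * kap + x).
Proof.
move=> kp Hf HM; set r := size fam in HM *.
have sk k : (k <= r)%N -> INR k * kap <= INR r * kap.
  by move=> h; apply: Rmult_le_compat_r; [lra | apply: le_INR; lia].
have HL i : (i <= r)%N -> dom (fun w n => lefts (znode fam w) n i) (INR r * kap).
  move=> hi; apply: (dom_ext (f := fun w n => nest (map (fun f => f w) (map (fun f w => (f w).1) (rev (take i fam)))) n)).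
    by move=> w n; rewrite /lefts /znode -map_take -map_rev -!map_comp.
  have F1 : List.Forall (dnode (kap - 1)) (take i fam).
    by elim: fam i Hf {HM r sk hi} => [|f l IH] [|i] H //=; inversion H; apply: List.Forall_cons => //; apply: IH.
  have F2 : List.Forall (fun f => (forall w, f w O = RtoC 0) /\ dom f (kap - 1)) (map (fun f w => (f w).1) (rev (take i fam))).
    elim: (take i fam) F1 => [|f l IH] H; first exact: List.Forall_nil.
    inversion H; rewrite rev_cons map_rcons -cats1; apply/List.Forall_app; split; first exact: IH.
    by apply: List.Forall_cons; [split; [move=> w; apply H2 | apply H2] | exact: List.Forall_nil].
  apply: dom_le (dom_nest kp F2); apply: sk.
  by rewrite size_map size_rev size_take_min; lia.
have HR i : dom (fun w n => rights (znode fam w) n i) (INR r * kap).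
  apply: (dom_ext (f := fun w n => nest (map (fun f => f w) (map (fun f w => (f w).2) (drop i fam))) n)).
    by move=> w n; rewrite /rights /znode -map_drop -!map_comp.
  have F1 : List.Forall (dnode (kap - 1)) (drop i fam).
    by elim: fam i Hf {HM r sk HL} => [|f l IH] [|i] H //=; inversion H; apply: IH.
  have F2 : List.Forall (fun f => (forall w, f w O = RtoC 0) /\ dom f (kap - 1)) (map (fun f w => (f w).2) (drop i fam)).
    elim: (drop i fam) F1 => [|f l IH] H; first exact: List.Forall_nil.
    inversion H; apply: List.Forall_cons; last exact: IH.
    by split; [move=> w; apply H2 | apply H2].
  apply: dom_le (dom_nest kp F2); apply: sk.
  by rewrite size_map size_drop; exact: leq_subr.
apply: (dom_ext (f := fun w n => csum (fun i => lefts (znode fam w) n i *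
   csum (fun j => rights (znode fam w) n j * M w n i j) r.+1) r.+1)%C).
  by move=> w n; rewrite /glued /glue size_map.
apply: (@dom_csum (fun i w n => lefts (znode fam w) n i *
   csum (fun j => rights (znode fam w) n j * M w n i j) r.+1)%C) => i hi.
rewrite Rplus_assoc; apply: dom_mult; first exact: HL.
apply: (@dom_csum (fun j w n => rights (znode fam w) n j * M w n i j)%C) => j hj.
by apply: dom_mult => //; exact: HM.
Qed.

Lemma dom_glue_incr (fam : seq (C -> node)) (J : C -> nat -> nat -> nat -> C) kap x : 0 < kap ->
  List.Forall (dnode (kap - 1)) fam ->
  (forall i j, (i <= size fam)%N -> (j <= size fam)%N ->
    dom (fun w n => J w n i j - advanced (znode fam w) n (J w n.+1) i j)%C x) ->
  dom (fun w n => glued (znode fam w) n.+1 (J w n.+1) - glued (znode fam w) n (J w n))%C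
    (INR (size fam) * kap + INR (size fam) * kap + x).
Proof.
move=> kp Hf HJ.
have := dom_opp (@dom_glued fam (fun w n i j => J w n i j - advanced (znode fam w) n (J w n.+1) i j)%C kap x kp Hf HJ).
apply: dom_ext => w n; rewrite [glued _ n.+2 _]glued_S /glued -(glue_sub _ _ (J w n.+1)); ring.
Qed.

Definition unitri (J : nat -> nat -> C) : Prop :=
  (forall i, J i i = RtoC 1) /\ (forall i j, (j < i)%N -> J i j = RtoC 0).

Definition nd0 : C -> node := fun _ => node0.

Lemma nth_znode fam w q : (q < size fam)%N -> nth node0 (znode fam w) q = nth nd0 fam q w.
Proof. by move=> h; rewrite /znode (nth_map nd0). Qed.

Lemma advanced_trivial l N J i j : unitri J -> (j <= i)%N -> advanced l N J i j = J i j.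
Proof.
move=> [J1 J0] h; rewrite /advanced /advance.
have e : J i.+1 j = 0 by apply: J0; lia.
rewrite e; case: j h e => [|q] h e.
  by rewrite /opt; case: (_ < _)%N; ring.
by rewrite (J0 i q) ?(J0 i.+1 q) /opt; try lia; case: (_ < _)%N; ring.
Qed.

Lemma advanced_upper l N J i q : (i < size l)%N ->
  advanced l N J i q.+1 = (J i q.+1 + (nth node0 l q).2 N * J i q +
    (nth node0 l i).1 N * (J i.+1 q.+1 + (nth node0 l q).2 N * J i.+1 q))%C.
Proof. by move=> h; rewrite /advanced /advance /opt h. Qed.

(** On and below the diagonal a unitriangular block is unchanged by advancing, so the defect lives
    on the entries (i, q+1) with i <= q. *)
Lemma dom_defect fam (J : C -> nat -> nat -> nat -> C) x : (forall w n, unitri (J w n)) ->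
  (forall i q, (i <= q)%N -> (q < size fam)%N ->
    dom (fun w n => J w n i q.+1 - J w n.+1 i q.+1 - (nth nd0 fam q w).2 n * J w n.+1 i q
       - (nth nd0 fam i w).1 n * J w n.+1 i.+1 q.+1
       - (nth nd0 fam i w).1 n * ((nth nd0 fam q w).2 n * J w n.+1 i.+1 q))%C x) ->
  forall i j, (i <= size fam)%N -> (j <= size fam)%N ->
    dom (fun w n => J w n i j - advanced (znode fam w) n (J w n.+1) i j)%C x.
Proof.
move=> HJ H i j hi hj; case: (leqP j i) => hij.
  apply: dom_ext (dom_0 x) => w n; rewrite advanced_trivial //.
  have [J1 J0] := HJ w n.+1; have [J1' J0'] := HJ w n.+2.
  move: hij; rewrite leq_eqVlt => /orP [/eqP ->|h]; first by rewrite J1 J1'; ring.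
  by rewrite J0 ?J0' //; ring.
case: j hij hj => [//|q] hij hj; apply: dom_ext (H i q _ _); try lia.
have hi2 : (i < size fam)%N by lia.
by move=> w n; rewrite advanced_upper ?nth_znode //; [ring | rewrite /znode size_map].
Qed.

End Dom.

Definition bnd (P : C -> Prop) (f : C -> C) (b : R) : Prop := forall w, P w -> Cmod (f w) <= b.

Section Bnd.
Variable P : C -> Prop.

Lemma bnd_ext f g b : (forall w, f w = g w) -> bnd P f b -> bnd P g b.
Proof. by move=> e H w hw; rewrite -e; exact: H. Qed.

Lemma bnd_le f b b' : b <= b' -> bnd P f b -> bnd P f b'.
Proof. by move=> h H w hw; apply: Rle_trans (H w hw) h. Qed.

Lemma bnd_const c : bnd P (fun _ => c) (Cmod c).
Proof. by move=> w _; lra. Qed.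

Lemma bnd_plus f g b c : bnd P f b -> bnd P g c -> bnd P (fun w => f w + g w)%C (b + c).
Proof.
move=> H1 H2 w hw; apply: Rle_trans (Cmod_triangle _ _) _.
by apply: Rplus_le_compat; [exact: H1 | exact: H2].
Qed.

Lemma bnd_mult f g b c : 0 <= b -> 0 <= c -> bnd P f b -> bnd P g c -> bnd P (fun w => f w * g w)%C (b * c).
Proof.
move=> _ _ H1 H2 w hw; rewrite Cmod_mult.
by apply: Rmult_le_compat; try exact: Cmod_ge_0; [exact: H1 | exact: H2].
Qed.

Definition bdom := dom (bnd P).
Definition bdom_ext := @dom_ext _ bnd_ext.
Definition bdom_le := @dom_le _ bnd_le.
Definition bdom_0 := @dom_0 _ bnd_le bnd_const.
Definition bdom_const := @dom_const _ bnd_le bnd_const.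
Definition bdom_plus := @dom_plus _ bnd_plus.
Definition bdom_mult := @dom_mult _ bnd_mult.
Definition bdom_mult_le := @dom_mult_le _ bnd_le bnd_mult.
Definition bdom_minus := @dom_minus _ bnd_ext bnd_le bnd_const bnd_plus bnd_mult.
Lemma bdom_intro f B x : 0 <= B -> (forall w n, P w -> Cmod (f w n.+1) <= B * npow n.+1 x) -> bdom f x.
Proof. by move=> B0 H; exists B; split=> // n w; exact: H. Qed.

Lemma bdom_summable f kap : 0 < kap -> bdom f (- 1 - kap) ->
  exists u, summable u /\ forall n w, P w -> Cmod (f w n.+1) <= u n.
Proof.
move=> kp [B [B0 H]]; exists (fun n => B * npow n.+1 (- 1 - kap)); split; last by move=> n w; exact: H.
apply: (summable_shift (u := fun n => B * npow n (- 1 - kap))); apply: summable_scal => //.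
exact: npow_summable.
Qed.

End Bnd.

Lemma npow_to_0 x B : 0 < x -> 0 <= B -> forall eps, 0 < eps -> exists N, forall n, (N <= n)%N -> B * npow n.+1 (- x) <= eps.
Proof.
move=> xp B0 eps He.
have [N HN] : exists N, forall n, (N <= n)%N -> exp (ln ((B + 1) / eps) / x) <= INR n.+1.
  have [N HN] := INR_unbounded (exp (ln ((B + 1) / eps) / x)); exists N => n hn.
  by have := le_INR N n.+1 ltac:(lia); lra.
exists N => n hn; have h := HN n hn.
have ip : 0 < INR n.+1 by have := INR_S_ge1 n; lra.
have q : 0 < (B + 1) / eps by apply: Rdiv_lt_0_compat; lra.
have l1 : ln ((B + 1) / eps) / x <= ln (INR n.+1).
  by rewrite -[X in X <= _]ln_exp; apply: ln_le => //; apply: exp_pos.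
have l2 : ln ((B + 1) / eps) <= x * ln (INR n.+1).
  have := Rmult_le_compat_l x _ _ (Rlt_le _ _ xp) l1.
  by have -> : x * (ln ((B + 1) / eps) / x) = ln ((B + 1) / eps) by field; lra.
have e : npow n.+1 (- x) * npow n.+1 x = 1 by rewrite -npow_plus Rplus_opp_l npow_0.
have l3 : (B + 1) / eps <= npow n.+1 x.
  by rewrite npow_S -[X in X <= _]exp_ln //; exact: exp_le_compat.
have l4 : B + 1 <= eps * npow n.+1 x.
  have := Rmult_le_compat_l eps _ _ (Rlt_le _ _ He) l3.
  by have -> : eps * ((B + 1) / eps) = B + 1 by field; lra.
have z := npow_ge0 n.+1 (- x).
have := Rmult_le_compat_r _ _ _ z l4; rewrite Rmult_assoc [npow _ x * _]Rmult_comm e; nra.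
Qed.

(* In [p : seq nat] the entry [a] encodes the exponent [a + 1]. *)
Definition ones (p : seq nat) (i j : nat) : bool := all (fun q => nth 1%N p q == 0%N) (iota i (j - i)).

Lemma ones_nil p i : ones p i i.
Proof. by rewrite /ones subnn. Qed.

Lemma ones_r p i j : (i <= j)%N -> ones p i j.+1 = ones p i j && (nth 1%N p j == 0%N).
Proof.
by move=> h; rewrite /ones subSn // -[(j - i).+1]addn1 iotaD all_cat [iota _ 1]/= [all _ [:: _]]/= andbT subnKC.
Qed.

Lemma ones_l p i j : (i < j)%N -> ones p i j = (nth 1%N p i == 0%N) && ones p i.+1 j.
Proof. by move=> h; rewrite /ones -[(j - i)%N]prednK ?subn_gt0 // subnS. Qed.

Lemma onesP p i j : reflect (forall q, (i <= q < j)%N -> nth 1%N p q = 0%N) (ones p i j).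
Proof.
apply: (iffP allP) => H q.
  by move=> h; apply/eqP; apply: H; rewrite mem_iota; lia.
by rewrite mem_iota => h; apply/eqP; apply: H; lia.
Qed.

(** In the limit only runs of exponents 1 can sit at infinity. The default 1 in [ones] encodes the
    exponent 2, so a run never leaves the list. *)
Definition JP (p : seq nat) (i j : nat) : C := if (i <= j)%N && ones p i j then bc (j - i) else 0.

Lemma JP_unitri p : unitri (JP p).
Proof.
split=> [i|i j h]; rewrite /JP; first by rewrite leqnn ones_nil subnn bc_0.
by rewrite leqNgt h.
Qed.

(* [JW] closes a run of exponents 1 followed by the exponent [w], which contributes
   [N^(1-w) c_a(w-1)]; at [w = 1] it becomes [JP] with one more exponent 1. *)
Definition JW (p : seq nat) (w : C) (n i j : nat) : C :=
  if [&& j == (size p).+1, (i <= size p)%N & ones p i (size p)]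
  then (wpow lap (w - 1) n * cc n ((size p).+1 - i) (w - 1))%C else JP p i j.

Lemma JW_unitri p w n : unitri (JW p w n).
Proof.
have [h1 h2] := JP_unitri p; split=> [i|i j h]; rewrite /JW.
  by have -> : [&& i == (size p).+1, (i <= size p)%N & ones p i (size p)] = false by [apply/negP => /and3P [/eqP -> ]; lia]; exact: h1.
by have -> : [&& j == (size p).+1, (i <= size p)%N & ones p i (size p)] = false by [apply/negP => /and3P [/eqP]; lia]; exact: h2.
Qed.

Lemma JW_at1 p n i j : JW p 1 n.+1 i j = JP (rcons p 0%N) i j.
Proof.
have -> : JW p 1 n.+1 i j = if [&& j == (size p).+1, (i <= size p)%N & ones p i (size p)] then bc ((size p).+1 - i) else JP p i j.
  rewrite /JW; have -> : ((1 - 1 : C)%C = 0) by ring.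
  have -> : wpow lap 0 n.+1 = 1 by rewrite /wpow; have -> : (- (0 * lap n.+1) = 0)%C by [ring]; exact: Cexp_0.
  by rewrite cc_at0 Cmult_1_l.
have onesE q : (q <= size p)%N -> ones (rcons p 0%N) i q = ones p i q.
  move=> hq; apply/onesP/onesP => H k hk; have := H k hk; rewrite nth_rcons;
  by have -> : (k < size p)%N by lia.
case: (eqVneq j (size p).+1) => [->|nj] /=.
  case: (leqP i (size p)) => hi /=; last first.
    by rewrite /JP; case: (leqP i (size p).+1) => //= h; have -> : i = (size p).+1 by [lia]; rewrite !ones_nil.
  rewrite /JP; have -> : (i <= (size p).+1)%N by lia.
  rewrite !ones_r // onesE // nth_rcons ltnn eqxx nth_default // !andbT !andbF /=.
  by case: (ones p i (size p)).
rewrite /JP; case: (leqP i j) => //= hij; case: (ltnP j (size p).+1) => hj; first by rewrite onesE.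
move: hij; rewrite leq_eqVlt => /orP [/eqP <-|hij]; first by rewrite !ones_nil.
have -> : ones p i j = false.
  by apply/negP => /onesP /(_ j.-1) ; rewrite nth_default; lia.
have -> // : ones (rcons p 0%N) i j = false.
by apply/negP => /onesP /(_ j.-1) ; rewrite nth_default ?size_rcons; lia.
Qed.

Lemma JP_rcons_S p x i j : JP (rcons p x.+1) i j = JP p i j.
Proof.
rewrite /JP; have -> // : ones (rcons p x.+1) i j = ones p i j.
rewrite /ones; apply: eq_all => q; rewrite nth_rcons; case: (ltnP q (size p)) => // h.
by rewrite nth_default //; case: (q == size p).
Qed.

Lemma JP_nil i j : JP [::] i j = delta i j.
Proof.
rewrite /JP /delta; case: (eqVneq i j) => [->|n]; first by rewrite leqnn ones_nil subnn bc_0.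
case: (leqP i j) => //= h; have -> // : ones [::] i j = false.
by rewrite ones_l ?nth_nil //; lia.
Qed.

(** * Estimates for an exponent near 1 *)

Definition kc (a : nat) : C := RtoC (INR a.+1).

Lemma one_sub_Cexp_le z : Cmod (1 - Cexp z)%C <= 2 * Cmod z * exp (Cmod z).
Proof.
rewrite Cmod_sub_sym; have := Cexp_poly_rem 1 z; rewrite pow_1.
suff -> : exp_poly 1 z = 1 by [].
by rewrite /exp_poly /=; field; move=> /RtoC_inj; lra.
Qed.

Definition disc (d : R) (w : C) : Prop := Cmod (w - 1)%C <= d.

Section Disc.

Variables (t : C) (d : R).
Hypothesis ht2 : Cmod t <= / 2.
Hypothesis hd : 0 < d <= / 16.

Local Notation D := (bdom (disc d)).

Lemma disc_Cmod w : disc d w -> Cmod w <= 2.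
Proof.
move=> h; have -> : w = (w - 1 + 1)%C by ring.
by apply: Rle_trans (Cmod_triangle _ _) _; rewrite Cmod_1; unfold disc in h; lra.
Qed.

Lemma disc_fst w : disc d w -> 1 - d <= fst w.
Proof.
move=> h; have := fst_ge_Cmod (w - 1)%C; have -> : fst (w - 1)%C = fst w - 1 by rewrite /Cminus /Cplus /Copp /RtoC; cbn [fst]; ring.
by unfold disc in h; lra.
Qed.

Lemma disc_const_power la K s : 0 <= K -> near_log la K -> D (fun _ n => wpow la s n) (- fst s).
Proof.
move=> K0 H; apply: (@bdom_intro _ _ (exp (Cmod s * K))) => [|w n _]; first by left; apply: exp_pos.
exact: wpow_bound.
Qed.

Lemma disc_wpow la K : 0 <= K -> near_log la K -> D (fun w n => wpow la w n) (d - 1).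
Proof.
move=> K0 H; apply: (@bdom_intro _ _ (exp (2 * K))) => [|w n hw]; first by left; apply: exp_pos.
apply: Rle_trans (wpow_bound w n.+1 H) _; apply: Rmult_le_compat.
- by left; apply: exp_pos.
- exact: npow_ge0.
- by apply: exp_le_compat; apply: Rmult_le_compat_r => //; exact: disc_Cmod.
- by apply: npow_le; have := disc_fst hw; lra.
Qed.

Lemma disc_nodes : D (fun w n => wpow lap w n) (d - 1) /\ D (fun w n => wpow (lam t) w n) (d - 1).
Proof.
have [K [K0 [h1 [h2 _]]]] := chain_const_ex (small_tdom ht2).
by split; [exact: disc_wpow h1 | exact: disc_wpow h2].
Qed.

Lemma disc_const_nodes s : D (fun _ n => wpow lap s n) (- fst s) /\ D (fun _ n => wpow (lam t) s n) (- fst s).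
Proof.
have [K [K0 [h1 [h2 _]]]] := chain_const_ex (small_tdom ht2).
by split; [exact: disc_const_power h1 | exact: disc_const_power h2].
Qed.

Lemma disc_u_succ : D (fun w n => wpow lap (w - 1) n.+1) d.
Proof.
apply: (@bdom_intro _ _ (exp (d * 1))) => [|w n hw]; first by left; apply: exp_pos.
by apply: wpow_end hw; [lra | exact: unit_step_end (unit_step_p n)].
Qed.

Lemma disc_cc a : D (fun w n => cc n a (w - 1)) 0.
Proof.
apply: (@bdom_intro _ _ (exp 1 * 128)) => [|w n hw]; first by have := exp_pos 1; lra.
by rewrite npow_0 Rmult_1_r; apply: cc_le; unfold disc in hw; lra.
Qed.

Lemma disc_cc_succ a : D (fun w n => cc n.+1 a (w - 1)) 0.
Proof.
apply: (@bdom_intro _ _ (exp 1 * 128)) => [|w n hw]; first by have := exp_pos 1; lra.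
by rewrite npow_0 Rmult_1_r; apply: cc_le; unfold disc in hw; lra.
Qed.

Lemma disc_cc_diff a : D (fun w n => cc n a (w - 1) - cc n.+1 a (w - 1))%C (- 2).
Proof.
have ep := exp_pos 1.
apply: (@bdom_intro _ _ (exp 1 * 64)) => [|w n hw]; first by lra.
rewrite (cc_succ n.+1); have -> (x y : C) : (x - (x + y) = - y)%C by ring.
have hw' : Cmod (w - 1)%C <= / 16 by unfold disc in hw; lra.
rewrite Cmod_opp Cmod_mult [Cmod (bc _ * _)%C]Cmod_mult Cmod_pow Rmult_assoc; apply: Rmult_le_compat; try exact: Cmod_ge_0.

- by apply: Rmult_le_pos; [exact: Cmod_ge_0 | apply: pow_le; exact: Cmod_ge_0].
- exact: Cexp_piI_le.
- apply: Rmult_le_compat; [exact: Cmod_ge_0 | apply: pow_le; exact: Cmod_ge_0 | exact: bc_le |].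
  by apply: sixteenth_pow_le; split=> //; exact: Cmod_ge_0.
Qed.

Lemma disc_cc0 : D (fun w n => cc n.+1 0 (w - 1) - 1)%C (- 1).
Proof.
have ep := exp_pos 1.
apply: (@bdom_intro _ _ (exp 1 * exp 1)) => [|w n hw]; first by nra.
have h0 := npow_ge0 n.+1 (- 1).
have hw' : Cmod (w - 1)%C <= / 16 by unfold disc in hw; lra.
have h1 := cc_0_near1 n.+1 hw'; apply: Rle_trans h1 _.
apply: Rmult_le_compat_l; first by nra.
rewrite !npow_S; apply: exp_le_compat.
have : ln (INR n.+1) <= ln (INR n.+2) by apply: ln_le; [apply: lt_0_INR; lia | apply: le_INR; lia].
lra.
Qed.

(** [unit_step_taylor] with a single term for the power x^(1-w), whose derivative is -(w-1)
    x^(-w). *)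
Lemma disc_step : D (fun w n => wpow lap (w - 1) n - wpow lap (w - 1) n.+1 - (w - 1) * wpow lap w n)%C (d - 2).
Proof.
have [B [B0 HB]] := wprod_bounded 2 d.
have ep := exp_pos ((d + INR 2) * 1).
apply: (@bdom_intro _ _ (B * exp ((d + INR 2) * 1))) => [|w n hw]; first by nra.
have h := @unit_step_taylor _ _ n 1 1 d Rle_0_1 (unit_step_p n) (w - 1)%C hw.
have -> : (wpow lap (w - 1) n.+1 - wpow lap (w - 1) n.+2 - (w - 1) * wpow lap w n.+1 =
  - ((Cexp (- ((w - 1) * lap n.+2)) - Cexp (- ((w - 1) * lap n.+1))) -
     csum (fun i => cbinom (- (w - 1)) i.+1 * Cexp (- (((w - 1) + RtoC (INR i.+1)) * lap n.+1))) 1))%C.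
  have -> : csum (fun i => cbinom (- (w - 1)) i.+1 * Cexp (- (((w - 1) + RtoC (INR i.+1)) * lap n.+1)))%C 1 =
    (- (w - 1) * Cexp (- (w * lap n.+1)))%C.
    cbn [csum cbinom]; have -> : (w - 1 + RtoC (INR 1) = w)%C by rewrite /=; ring.
    by rewrite [INR 1]/= [INR 0]/=; field; move=> /RtoC_inj; lra.
  by rewrite /wpow; have nz m : (m.+1 == O) = false; [by [] | rewrite !nz; ring].
rewrite Cmod_opp; apply: Rle_trans h _.
rewrite -Rmult_assoc; apply: Rmult_le_compat.
- by apply: Rmult_le_pos; [exact: wprod_ge0 | lra].
- exact: npow_ge0.
- by apply: Rmult_le_compat_r; [lra | exact: HB].
- by apply: npow_le; rewrite /=; lra.
Qed.

Lemma disc_step1 : D (fun w n => wpow lap (w - 1) n - wpow lap (w - 1) n.+1)%C (d - 1).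
Proof.
apply: (@bdom_ext _ (fun w n => (wpow lap (w - 1) n - wpow lap (w - 1) n.+1 - (w - 1) * wpow lap w n) + (w - 1) * wpow lap w n)%C).
  by move=> w n; ring.
apply: bdom_plus; first by apply: bdom_le disc_step; lra.
have [h _] := disc_nodes; apply: (@bdom_mult_le _ _ _ 0 (d - 1)) h; first lra.
apply: (@bdom_intro _ _ d) => [|w n hw]; first lra.
by rewrite npow_0; unfold disc in hw; lra.
Qed.

(** (t - n)^(-s) is - e^(pi i (s-1)) n^(-s) up to the factor e^(-s theta), because exp(pi i) = -1.
    At s = 1 the two weights of a node thus cancel to leading order. *)
Lemma lam_split s n : (wpow (lam t) s n.+1 + wpow lap s n.+1 * Cexp (piI * (s - 1)) =
  wpow lap s n.+1 * (Cexp (piI * (s - 1)) * (1 - Cexp (- (s * theta t n.+1)))))%C.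
Proof.
have -> : wpow (lam t) s n.+1 = (- (wpow lap s n.+1 * Cexp (piI * (s - 1)) * Cexp (- (s * theta t n.+1))))%C; last by ring.
have nz m : (m.+1 == O) = false by [].
rewrite /wpow !nz.
have -> : (- (s * lam t n.+1) = piI + (- (s * lap n.+1) + (piI * (s - 1) + - (s * theta t n.+1))))%C by rewrite /theta; ring.
by rewrite !Cexp_plus Cexp_piI; ring.
Qed.

Lemma theta_factor s n : Cmod s <= 2 -> Cmod (1 - Cexp (- (s * theta t n.+1)))%C <= 16 * exp 8 * npow n.+1 (- 1).
Proof.
move=> hs; have h := theta_le ht2 n; have h0 := Cmod_ge_0 (theta t n.+1); have s0 := Cmod_ge_0 s.
have n1 : npow n.+1 (- 1) <= 1 by rewrite -(npow_0 n); apply: npow_le; lra.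
have m : Cmod (- (s * theta t n.+1))%C <= 8 * npow n.+1 (- 1).
  by rewrite Cmod_opp Cmod_mult; nra.
apply: Rle_trans (one_sub_Cexp_le _) _.
have -> : 16 * exp 8 * npow n.+1 (- 1) = (2 * (8 * npow n.+1 (- 1))) * exp 8 by ring.
have m0 := Cmod_ge_0 (- (s * theta t n.+1))%C.
apply: Rmult_le_compat; [lra | by left; apply: exp_pos | lra | by apply: exp_le_compat; lra].
Qed.

Lemma disc_nu : D (fun w n => wpow (lam t) w n + wpow lap w n * Cexp (piI * (w - 1)))%C (d - 2).
Proof.
apply: (@bdom_ext _ (fun w n => wpow lap w n * (Cexp (piI * (w - 1)) * (1 - Cexp (- (w * theta t n)))))%C).
  by move=> w n; rewrite -lam_split.
have [h _] := disc_nodes; apply: (@bdom_mult_le _ _ _ (d - 1) (-1)) h _; first lra.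
apply: (@bdom_mult_le _ _ _ 0 (-1)); first lra.
  apply: (@bdom_intro _ _ (exp 1)) => [|w n hw]; first by left; apply: exp_pos.
  by rewrite npow_0 Rmult_1_r; apply: Cexp_piI_le; unfold disc in hw; lra.
apply: (@bdom_intro _ _ (16 * exp 8)) => [|w n hw]; first by have := exp_pos 8; lra.
by apply: theta_factor; exact: disc_Cmod.
Qed.

Lemma disc_ones : D (fun _ n => wpow lap (kc 0) n + wpow (lam t) (kc 0) n)%C (- 2).
Proof.
have k1 : kc 0 = 1 by [].
apply: (@bdom_ext _ (fun _ n => wpow lap 1 n * (1 - Cexp (- (1 * theta t n))))%C).
  move=> w n; have := lam_split 1 n; rewrite k1; have -> : (piI * (1 - 1) = 0)%C by ring.
  by rewrite Cexp_0 => e; rewrite Cplus_comm -[X in (_ + X)%C]Cmult_1_r e; ring.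
have [h _] := disc_const_nodes 1; apply: (@bdom_mult_le _ _ _ (- 1) (-1)) h _; first lra.
apply: (@bdom_intro _ _ (16 * exp 8)) => [|w n _]; first by have := exp_pos 8; lra.
by apply: theta_factor; rewrite Cmod_1; lra.
Qed.

End Disc.

Lemma JP_0 p i j : ~~ ones p i j -> JP p i j = 0.
Proof. by move=> /negbTE h; rewrite /JP h andbF. Qed.

Lemma JP_1 p i j : (i <= j)%N -> ones p i j -> JP p i j = bc (j - i).
Proof. by move=> h h'; rewrite /JP h h'. Qed.

Lemma JP_beyond p i j : (i < j)%N -> (size p < j)%N -> JP p i j = 0.
Proof.
move=> h hj; apply: JP_0; apply/negP => /onesP /(_ j.-1).
by rewrite nth_default; lia.
Qed.

Lemma JW_other p w n i j : j <> (size p).+1 -> JW p w n i j = JP p i j.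
Proof. by rewrite /JW => /eqP/negbTE ->. Qed.

Lemma JW_zero p w n i : (i <= size p)%N -> ~~ ones p i (size p) -> JW p w n i (size p).+1 = 0.
Proof. by move=> h h'; rewrite /JW (negbTE h') !andbF JP_beyond //; lia. Qed.

Lemma JW_main p w n i : (i <= size p)%N -> ones p i (size p) ->
  JW p w n i (size p).+1 = (wpow lap (w - 1) n * cc n (size p - i).+1 (w - 1))%C.
Proof. by move=> h h'; rewrite /JW h h' eqxx /= subSn. Qed.

Section LowDefect.

Variable sz : (C -> C) -> R -> Prop.
Hypothesis sz_ext : forall f g b, (forall w, f w = g w) -> sz f b -> sz g b.
Hypothesis sz_le : forall f b b', b <= b' -> sz f b -> sz f b'.
Hypothesis sz_const : forall c, sz (fun _ => c) (Cmod c).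
Hypothesis sz_plus : forall f g b c, sz f b -> sz g c -> sz (fun w => f w + g w)%C (b + c).
Hypothesis sz_mult : forall f g b c, 0 <= b -> 0 <= c -> sz f b -> sz g c -> sz (fun w => f w * g w)%C (b * c).

(** If the whole run i, ..., q consists of exponents 1, both products carry the same value of [bc]
    and the weights 1/n and 1/(t - n) cancel to leading order. Otherwise a nonzero product contains
    the weight of an exponent at least 2. The block does not depend on n; the difference of equal
    terms only matches the shape of [dom_defect]. *)
Lemma dom_low_defect (al nu : nat -> C -> nat -> C) p x i q :
  (forall i q, (i < size p)%N -> (q < size p)%N -> nth 1%N p i = 0%N -> nth 1%N p q = 0%N ->
    dom sz (fun w n => al i w n + nu q w n)%C x) ->
  (forall q, (q < size p)%N -> nth 1%N p q <> 0%N -> dom sz (al q) x /\ dom sz (nu q) x) ->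
  (i <= q)%N -> (q < size p)%N ->
  dom sz (fun w n => JP p i q.+1 - JP p i q.+1 - nu q w n * JP p i q - al i w n * JP p i.+1 q.+1)%C x.
Proof.
move=> hu hs hiq hq.
have sc f c : dom sz f x -> dom sz (fun w n => f w n * c)%C x.
  by move=> h; apply: (dom_ext sz_ext (f := fun w n => c * f w n)%C) (dom_scal sz_le sz_const sz_mult c h) => w n; ring.
have z0 (f : C -> nat -> C) : (forall w n, f w n.+1 = 0) -> dom sz f x.
  by move=> h; apply: (dom_ext sz_ext) (dom_0 sz_le sz_const x) => w n; rewrite h.
have hi : (i < size p)%N by lia.
have hm := @dom_minus sz sz_ext sz_le sz_const sz_plus sz_mult.
case ho : (ones p i q.+1).
  have ho1 : ones p i q by move: ho; rewrite ones_r // => /andP [].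
  have pq : nth 1%N p q = 0%N by move/onesP: ho => /(_ q); apply; lia.
  have pi : nth 1%N p i = 0%N by move/onesP: ho => /(_ i); apply; lia.
  have ho2 : ones p i.+1 q.+1 by move: ho; rewrite ones_l => [/andP [] //|]; lia.
  apply: (dom_ext sz_ext (f := fun w n => (al i w n + nu q w n) * (- bc (q - i)))%C); last by apply: sc; exact: hu.
  by move=> w n; rewrite (JP_1 hiq) // (@JP_1 p i.+1) // (@JP_1 p i q.+1) ?subSS; first ring; lia.
apply: (hm (fun w n => JP p i q.+1 - JP p i q.+1 - nu q w n * JP p i q)%C (fun w n => al i w n * JP p i.+1 q.+1)%C).
  apply: (hm (fun w n => JP p i q.+1 - JP p i q.+1)%C (fun w n => nu q w n * JP p i q)%C).
    by apply: z0 => w n; ring.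
  case: (eqVneq (nth 1%N p q) 0%N) => e.
    apply: z0 => w n; rewrite (@JP_0 p i q); first by ring.
    by apply/negP => h; move: ho; rewrite ones_r ?e ?h //; lia.
  by apply: sc; have [] := hs q hq (elimN eqP e).
case: (eqVneq (nth 1%N p i) 0%N) => e.
  apply: z0 => w n; rewrite (@JP_0 p i.+1); first by ring.
  by apply/negP => h; move: ho; rewrite ones_l ?e ?h //; lia.
by apply: sc; have [] := hs i hi (elimN eqP e).
Qed.

End LowDefect.

Section OnesDefect.

Variables (t : C) (d eta : R) (p : seq nat) (s : seq C).
Hypothesis ht2 : Cmod t <= / 2.
Hypothesis hd : 0 < d <= / 16.
Hypothesis heta : 2 * d <= eta <= / 2.
Hypothesis hs : List.Forall (fun z => 1 + eta <= fst z) s.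

Local Notation D := (bdom (disc d)).

Definition ones_fam : seq (C -> node) :=
  map (fun x _ => nd t x) (map kc p) ++ (nd t : C -> node) :: map (fun x _ => nd t x) s.

Lemma znode_ones_fam w : znode ones_fam w = map (nd t) (map kc p ++ w :: s).
Proof. by rewrite /znode /ones_fam !map_cat /= -!map_comp. Qed.

Lemma size_ones_fam : size ones_fam = (size p + (size s).+1)%N.
Proof. by rewrite size_cat_cons !size_map. Qed.

Lemma nth_ones_fam_lt q : (q < size p)%N -> nth nd0 ones_fam q = (fun _ => nd t (kc (nth 1%N p q))).
Proof.
move=> h; rewrite /ones_fam nth_cat !size_map h.
by rewrite (nth_map (RtoC 0)) ?size_map // (nth_map 1%N).
Qed.

Lemma nth_ones_fam_eq : nth nd0 ones_fam (size p) = (nd t : C -> node).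
Proof. by rewrite /ones_fam nth_cat !size_map ltnn subnn. Qed.

Lemma nth_ones_fam_gt q : (size p < q)%N -> (q < size ones_fam)%N ->
  exists2 z, 1 + eta <= fst z & nth nd0 ones_fam q = (fun _ => nd t z).
Proof.
rewrite size_ones_fam => h hq; rewrite /ones_fam nth_cat !size_map.
have -> : (q < size p)%N = false by lia.
have [k -> hk] : exists2 k, (q - size p = k.+1)%N & (k < size s)%N by exists (q - size p).-1; lia.
rewrite [nth _ (_ :: _) _]/= (nth_map (RtoC 0)) //; exists (nth (RtoC 0) s k) => //.
elim: s k hk hs => [//|z l IH] [|k] hk H; inversion H => //.
exact: IH.
Qed.

Lemma fst_kc a : fst (kc a) = INR a.+1. Proof. by []. Qed.

Lemma ones_fam_big q : (q < size ones_fam)%N ->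
  D (fun w n => (nth nd0 ones_fam q w).1 n) (d - 1) /\ D (fun w n => (nth nd0 ones_fam q w).2 n) (d - 1).
Proof.
move=> hq; case: (ltngtP q (size p)) => h.
- rewrite nth_ones_fam_lt //; have [h1 h2] := disc_const_nodes d ht2 (kc (nth 1%N p q)).
  by split; [apply: bdom_le h1 | apply: bdom_le h2]; rewrite fst_kc; have := INR_S_ge1 (nth 1%N p q); lra.
- have [z hz ->] := nth_ones_fam_gt h hq; have [h1 h2] := disc_const_nodes d ht2 z.
  by split; [apply: bdom_le h1 | apply: bdom_le h2]; lra.
- by rewrite h nth_ones_fam_eq; exact: disc_nodes.
Qed.

Lemma ones_fam_small q : (q < size ones_fam)%N -> q <> size p -> ((q < size p)%N -> nth 1%N p q <> 0%N) ->
  D (fun w n => (nth nd0 ones_fam q w).1 n) (- 1 - eta) /\ D (fun w n => (nth nd0 ones_fam q w).2 n) (- 1 - eta).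
Proof.
move=> hq nq hp; case: (ltngtP q (size p)) => h //.
- rewrite nth_ones_fam_lt //; have [h1 h2] := disc_const_nodes d ht2 (kc (nth 1%N p q)).
  have := hp h; case: (nth 1%N p q) h1 h2 => [//|k] h1 h2 _.
  split; [apply: bdom_le h1 | apply: bdom_le h2]; rewrite fst_kc S_INR; have := INR_S_ge1 k; lra.
- have [z hz ->] := nth_ones_fam_gt h hq; have [h1 h2] := disc_const_nodes d ht2 z.
  by split; [apply: bdom_le h1 | apply: bdom_le h2]; lra.
Qed.

Lemma ones_fam_unit q w : (q < size p)%N -> nth 1%N p q = 0%N -> nth nd0 ones_fam q w = nd t (kc 0).
Proof. by move=> h e; rewrite nth_ones_fam_lt // e. Qed.

Lemma disc_JW i j : D (fun w n => JW p w n.+1 i j) d.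
Proof.
have hc c : D (fun _ _ => c) d by apply: bdom_le (bdom_const (disc d) c); lra.
case h : [&& j == (size p).+1, (i <= size p)%N & ones p i (size p)].
  have /and3P [/eqP -> h1 h2] := h.
  apply: (@bdom_ext _ (fun w n => wpow lap (w - 1) n.+1 * cc n.+1 (size p - i).+1 (w - 1))%C).
    by move=> w n; rewrite JW_main.
  by apply: bdom_mult_le (disc_u_succ d) (disc_cc_succ hd (size p - i).+1); lra.
by apply: bdom_ext (hc (JP p i j)) => w n; rewrite /JW h.
Qed.

(** A weight of exponent at least 1 + eta times a block entry of size n^d. *)
Local Notation x0 := (- 1 - eta + d).

Lemma disc_small_mult f i j : D f (- 1 - eta) -> D (fun w n => f w n * JW p w n.+1 i j)%C x0.
Proof. by move=> h; apply: bdom_mult_le h (disc_JW i j); lra. Qed.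

(** The recurrence for c_a at u = w - 1 turns the increment of n^(1-w) c_(a+1) into the two weights
    of the defect. What remains is the error of differentiating n^(1-w) ([T1]), the moving cut-off
    of c_(a+1) ([T2]), the branch error after infinity ([T3]), and the mismatch in the entry of the
    shorter run ([T4]). *)
Lemma ones_main i : (i <= size p)%N -> ones p i (size p) ->
  D (fun w n => JW p w n i (size p).+1 - JW p w n.+1 i (size p).+1
       - (nth nd0 ones_fam (size p) w).2 n * JW p w n.+1 i (size p)
       - (nth nd0 ones_fam i w).1 n * JW p w n.+1 i.+1 (size p).+1)%C x0.
Proof.
move=> hi ho; set a := (size p - i)%N.
have [hX _] := disc_nodes ht2 hd.
pose T1 w n := ((wpow lap (w - 1) n - wpow lap (w - 1) n.+1 - (w - 1) * wpow lap w n) * cc n a.+1 (w - 1))%C.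
pose T2 w n := (wpow lap (w - 1) n.+1 * (cc n a.+1 (w - 1) - cc n.+1 a.+1 (w - 1)))%C.
pose T3 w n := ((wpow (lam t) w n + wpow lap w n * Cexp (piI * (w - 1))) * bc a)%C.
have H1 : D T1 x0 by apply: bdom_mult_le (disc_step d) (disc_cc hd a.+1); lra.
have H2 : D T2 x0 by apply: bdom_mult_le (disc_u_succ d) (disc_cc_diff hd a.+1); lra.
have H3 : D T3 x0 by apply: bdom_mult_le (disc_nu ht2 hd) (bdom_const (disc d) (bc a)); lra.
have E1 w n : JW p w n i (size p).+1 = (wpow lap (w - 1) n * cc n a.+1 (w - 1))%C by rewrite JW_main.
have E2 w n : JW p w n i (size p) = bc a by rewrite JW_other ?JP_1 //; lia.
have R w n := cc_rec n a (w - 1)%C.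
move: hi; rewrite leq_eqVlt => /orP [/eqP hi|hi].
  have a0 : a = 0%N by rewrite /a hi subnn.
  pose T4 w n := (wpow lap w n * (cc n.+1 0 (w - 1) - 1))%C.
  have H4 : D T4 x0 by apply: bdom_mult_le hX (disc_cc0 hd); lra.
  apply: bdom_ext (bdom_plus (bdom_plus H1 H2) (bdom_minus H4 H3)) => w n.
  rewrite !E1 E2 hi nth_ones_fam_eq; have [-> _] := JW_unitri p w n.+2.
  rewrite /T1 /T2 /T3 /T4 a0 in R *; have := R w n.+1; rewrite /nd; cbn [fst snd].
  move: (cc n.+1 1 _) (cc n.+2 1 _) (cc n.+2 0 _) (bc 0) (Cexp _) (wpow lap w _) (wpow (lam t) w _) => c c' c0 b E X N.
  move=> e; have -> : c0 = ((w - 1) * c + E * b)%C by rewrite e; ring.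
  by ring.
have /andP [/eqP pi ho'] : (nth 1%N p i == 0%N) && ones p i.+1 (size p) by rewrite -ones_l.
pose T4 w n := (wpow lap (kc 0) n * (wpow lap (w - 1) n - wpow lap (w - 1) n.+1) * cc n.+1 a (w - 1))%C.
have H4 : D T4 x0.
  have [h1 _] := disc_const_nodes d ht2 (kc 0); rewrite fst_kc [INR 1]/= in h1.
  have h2 := bdom_mult h1 (disc_step1 ht2 hd); apply: bdom_mult_le h2 (disc_cc_succ hd a); lra.
apply: bdom_ext (bdom_plus (bdom_plus H1 H2) (bdom_minus H4 H3)) => w n.
rewrite !E1 E2 JW_main // nth_ones_fam_eq ones_fam_unit //.
have -> : (size p - i.+1).+1 = a by rewrite /a; lia.
rewrite /T1 /T2 /T3 /T4; have := R w n.+1; rewrite /nd; cbn [fst snd].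
have -> : wpow lap w n.+1 = (wpow lap (kc 0) n.+1 * wpow lap (w - 1) n.+1)%C.
  by rewrite -wpow_plus; congr wpow; rewrite /kc /=; ring.
move: (cc n.+1 a.+1 _) (cc n.+2 a.+1 _) (cc n.+2 a _) (bc a) (Cexp _) (wpow lap (kc 0) _) (wpow lap (w - 1) _) (wpow lap (w - 1) _) (wpow (lam t) w _) => c c' c0 b E X Q Q' N.
move=> e; have -> : c0 = ((w - 1) * c + E * b)%C by rewrite e; ring.
by ring.
Qed.

Lemma disc_zero (f : C -> nat -> C) : (forall w n, f w n.+1 = 0) -> D f x0.
Proof. by move=> h; apply: bdom_ext (bdom_0 _ x0) => w n; rewrite h. Qed.

Lemma ones_defect_low i q : (i <= q)%N -> (q < size p)%N ->
  D (fun w n => JP p i q.+1 - JP p i q.+1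
       - (nth nd0 ones_fam q w).2 n * JP p i q
       - (nth nd0 ones_fam i w).1 n * JP p i.+1 q.+1)%C x0.
Proof.
move=> hiq hq.
have sz k : (k < size p)%N -> (k < size ones_fam)%N by rewrite size_ones_fam; lia.
apply: (dom_low_defect (@bnd_ext _) (@bnd_le _) (@bnd_const _) (@bnd_plus _) (@bnd_mult _)
  (al := fun i w n => (nth nd0 ones_fam i w).1 n) (nu := fun q w n => (nth nd0 ones_fam q w).2 n)) => //.
- move=> i' q' h1 h2 e1 e2; apply: (@bdom_ext _ (fun w n => wpow lap (kc 0) n + wpow (lam t) (kc 0) n)%C).
    by move=> w n; rewrite !ones_fam_unit.
  by apply: bdom_le (disc_ones d ht2); lra.
- move=> q' h1 e1; have [h2 h3] := @ones_fam_small q' (sz _ h1) ltac:(lia) (fun _ => e1).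
  by split; [apply: bdom_le h2 | apply: bdom_le h3]; lra.
Qed.

(** Columns inside p behave as for [JP], columns beyond w involve a weight of an exponent of s or
    vanish, and the column of w is [ones_main] when the run before it consists of exponents 1. The
    product of two weights is small enough in every case. *)
Lemma ones_defect i j : (i <= size ones_fam)%N -> (j <= size ones_fam)%N ->
  D (fun w n => JW p w n i j - advanced (znode ones_fam w) n (JW p w n.+1) i j)%C x0.
Proof.
move: i j; apply: dom_defect; [exact: bnd_ext | exact: bnd_le | exact: bnd_const | exact: JW_unitri |].
move=> i q hiq hq; apply: bdom_minus; last first.
  have [h1 _] := @ones_fam_big i ltac:(lia); have [_ h2] := ones_fam_big hq.
  have h3 := bdom_mult h2 (disc_JW i.+1 q).
  by apply: bdom_mult_le h1 h3; lra.
case: (ltngtP q (size p)) => hqp.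
- apply: bdom_ext (ones_defect_low hiq hqp) => w n.
  by rewrite !JW_other //; lia.
- have [_ h2] := @ones_fam_small q hq ltac:(lia) ltac:(lia).
  apply: bdom_minus; last first.
    move: hiq; rewrite leq_eqVlt => /orP [/eqP e|hiq].
      by rewrite e; have [h _] := @ones_fam_small q hq ltac:(lia) ltac:(lia); exact: (@disc_small_mult _ _ _ h).
    by apply: disc_zero => w n; rewrite JW_other ?JP_beyond; try lia; ring.
  apply: bdom_minus; last exact: (@disc_small_mult _ _ _ h2).
  by apply: disc_zero => w n; rewrite !JW_other ?JP_beyond; try lia; ring.
- subst q; case ho : (ones p i (size p)); first exact: ones_main.
  apply: bdom_minus; last first.
    have hi : (i < size p)%N.
      by rewrite ltn_neqAle hiq andbT; apply/eqP => e; move: ho; rewrite e ones_nil.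
    case: (eqVneq (nth 1%N p i) 0%N) => e.
      apply: disc_zero => w n; rewrite JW_zero //; first by ring.
      by apply/negP => h; move: ho; rewrite ones_l ?e ?h //; lia.
    have [h _] := @ones_fam_small i ltac:(lia) ltac:(lia) (fun _ => elimN eqP e).
    exact: (@disc_small_mult _ _ _ h).
  apply: bdom_minus.
    by apply: disc_zero => w n; rewrite !JW_zero ?ho //; ring.
  by apply: disc_zero => w n; rewrite JW_other ?JP_0 ?ho //; first [ring | lia].
Qed.

End OnesDefect.

Lemma bdom_wpow P la K (f : C -> C) M x : 0 <= K -> near_log la K ->
  (forall w, P w -> Cmod (f w) <= M /\ - fst (f w) <= x) -> bdom P (fun w n => wpow la (f w) n) x.
Proof.
move=> K0 H Hf; apply: (@bdom_intro _ _ (exp (M * K))) => [|w n hw]; first by left; apply: exp_pos.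
have [h1 h2] := Hf w hw; apply: Rle_trans (wpow_bound _ n.+1 H) _; apply: Rmult_le_compat.
- by left; apply: exp_pos.
- exact: npow_ge0.
- by apply: exp_le_compat; apply: Rmult_le_compat_r.
- exact: npow_le.
Qed.

Lemma bdom_to_0 w f x : 0 < x -> bdom (fun z => z = w) f (- x) -> Ccv (fun n => f w n.+1) 0.
Proof.
move=> xp [B [B0 H]]; apply: (Ccv_squeeze (v := fun n => B * npow n.+1 (- x))).
  by move=> n; have -> (z : C) : (z - 0 = z)%C by [ring]; exact: H.
exact: npow_to_0.
Qed.

Lemma dnode_const P t (K : R) z x : 0 <= K -> near_log lap K -> near_log (lam t) K -> - fst z <= x ->
  dnode (bnd P) x (fun _ => nd t z).
Proof.
move=> K0 h1 h2 hz; split; first by move=> w; exact: nd_z0.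
have hf (w : C) : P w -> Cmod z <= Cmod z /\ - fst z <= x by move=> _; split; lra.
by split; [exact: (@bdom_wpow P lap K (fun _ => z) (Cmod z)) | exact: (@bdom_wpow P (lam t) K (fun _ => z) (Cmod z))].
Qed.

Section OnesLimit.

Variables (t : C) (r : nat) (F : seq C -> C).
Hypothesis ht2 : Cmod t <= / 2.
Hypothesis HF : zetaU_extension r 0 t F.

Lemma Centire_JW p n i j : Centire (fun w => JW p w n i j).
Proof.
move=> w; rewrite /JW; case: and3P => _; last exact: Cdiff_const.
have hm (z : C) : Cdiff (fun w => (w - 1)%C) z by apply: Cdiff_minus; [exact: Cdiff_id | exact: Cdiff_const].
apply: Cdiff_mult; first by apply: (@Cdiff_comp (fun w => wpow lap w n) (fun w => w - 1)%C); [exact: Centire_wpow | exact: hm].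
apply: Cdiff_mult.
  apply: (@Cdiff_comp Cexp (fun w => piI * (w - 1))%C); first exact: Centire_Cexp.
  by apply: Cdiff_mult; [exact: Cdiff_const | exact: hm].
apply: (@Cdiff_csum (fun m w => bc (m + ((size p).+1 - i)) * Cpow (w - 1) m)%C) => m _.
apply: Cdiff_mult; first exact: Cdiff_const.
elim: m => [|m IH]; first exact: Cdiff_const.
by apply: Cdiff_mult; [exact: hm | exact: IH].
Qed.

Lemma node_entire_nd : node_entire (nd t).
Proof. by move=> n; split; exact: Centire_wpow. Qed.

Definition ones_E (p : seq nat) (s : seq C) (k : nat) (w : C) : C :=
  glued (map (nd t) (map kc p ++ w :: s)) k.+1 (JW p w k.+1).

Lemma Centire_ones_E p s k : Centire (ones_E p s k).
Proof.
move=> w; apply: (@Cdiff_ext (fun w => glued (map (fun f => f w) (ones_fam t p s)) k.+1 (JW p w k.+1))).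
  by move=> z; rewrite /ones_E -znode_ones_fam.
apply: (Centire_glued (J := fun w => JW p w k.+1)); last by move=> i j; exact: Centire_JW.
apply/List.Forall_app; split; first exact: Forall_map_const.
by apply: List.Forall_cons; [exact: node_entire_nd | exact: Forall_map_const].
Qed.

(** With r the length of the index, 2 (r+1) d <= eta is exactly what makes r d + r d + (-1 - eta +
    d) at most -1 - d. *)
Lemma ones_E_incr p s d eta : 0 < d <= / 16 -> 2 * d <= eta <= / 2 ->
  2 * (INR (size p + (size s).+1) + 1) * d <= eta -> List.Forall (fun z => 1 + eta <= fst z) s ->
  exists u, summable u /\ forall k w, disc d w -> Cmod (ones_E p s k.+1 w - ones_E p s k w)%C <= u k.
Proof.
move=> hd heta hr hs; have hx := @ones_defect t d eta p s ht2 hd heta hs.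
have hn : List.Forall (dnode (bnd (disc d)) (d - 1)) (ones_fam t p s).
  apply/List.Forall_forall => f /(@List.In_nth _ _ _ nd0) [q [hq <-]].
  have e : List.nth q (ones_fam t p s) nd0 = nth nd0 (ones_fam t p s) q.
    by elim: (ones_fam t p s) q {hq} => [|x l IH] [|q] //=.
  have hq' : (q < size (ones_fam t p s))%N by apply/ltP.
  rewrite e; split; last exact: (ones_fam_big ht2 hd heta hs hq').
  case: (ltngtP q (size p)) => h w.
  - by rewrite nth_ones_fam_lt //; exact: nd_z0.
  - by have [z _ ->] := nth_ones_fam_gt hs h hq'; exact: nd_z0.
  - by rewrite h nth_ones_fam_eq; exact: nd_z0.
have h := dom_glue_incr (@bnd_ext _) (@bnd_le _) (@bnd_const _) (@bnd_plus _) (@bnd_mult _) hd.1 hn hx.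
have [|u [Hu H]] := @bdom_summable (disc d) (fun w n => glued (znode (ones_fam t p s) w) n.+1 (JW p w n.+1) - glued (znode (ones_fam t p s) w) n (JW p w n))%C d hd.1.
  by apply: bdom_le h; rewrite size_ones_fam; move: hr; set q := INR _ => hr; lra.
by exists u; split=> // k w hw; have := H k w hw; rewrite znode_ones_fam.
Qed.

(** With x = Re w - 1 > 0, the closing entries are O(n^(-x)), while the nested sums grow by at most
    n^(2 r kap), which kap keeps below n^(x/2). In the limit the block [JP p] is left. *)
Lemma ones_E_arc p s w : (size p + (size s).+1)%N = r -> 1 < fst w -> Cmod (w - 1)%C <= / 16 -> List.Forall (fun z => 1 < fst z) s ->
  Ccv (fun N => glued (map (nd t) (map kc p ++ w :: s)) N (JP p)) (F (map kc p ++ w :: s)) ->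
  Ccv (fun k => ones_E p s k w) (F (map kc p ++ w :: s)).
Proof.
move=> hsz hw hw1 hs H; pose x := fst w - 1; have xp : 0 < x by rewrite /x; lra.
pose P z := z = w.
have rp := pos_INR r.
pose kap := x / (4 * (INR r + 1)).
have kp : 0 < kap by apply: Rdiv_lt_0_compat; lra.
have kr : 4 * INR r * kap + 4 * kap = x by rewrite /kap; field; lra.
have [K [K0 [h1 [h2 _]]]] := chain_const_ex (small_tdom ht2).
have hn : List.Forall (dnode (bnd P) (kap - 1)) (ones_fam t p s).
  apply/List.Forall_app; split.
    elim: (p) => [|a p' IH]; first exact: List.Forall_nil.
    apply: List.Forall_cons => //; apply: dnode_const h1 h2 _ => //.
    by rewrite fst_kc; have := INR_S_ge1 a; lra.
  apply: List.Forall_cons; last first.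
    elim: s hs {hsz H} => [|a s' IH] hs; first exact: List.Forall_nil.
    inversion hs; apply: List.Forall_cons; last exact: IH.
    by apply: dnode_const h1 h2 _ => //; lra.
  have hf (z : C) : P z -> Cmod z <= Cmod w /\ - fst z <= kap - 1 by move=> ->; split; lra.
  split; first by move=> z; exact: nd_z0.
  by split; [exact: (@bdom_wpow P lap K (fun z => z) (Cmod w)) | exact: (@bdom_wpow P (lam t) K (fun z => z) (Cmod w))].
have hM i j : (i <= size (ones_fam t p s))%N -> (j <= size (ones_fam t p s))%N ->
    bdom P (fun z n => JW p z n i j - JP p i j)%C (- x).
  move=> _ _; case e : [&& j == (size p).+1, (i <= size p)%N & ones p i (size p)]; last first.
    by apply: bdom_ext (bdom_0 P (- x)) => z n; rewrite /JW e; ring.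
  have /and3P [/eqP -> e1 e2] := e.
  apply: (@bdom_ext P (fun z n => wpow lap (z - 1) n * cc n (size p - i).+1 (z - 1))%C).
    by move=> z n; rewrite JW_main // JP_beyond; [ring | lia | lia].
  apply: (@bdom_mult_le P _ _ (- x) 0); first lra.
    apply: (@bdom_wpow P lap 0 (fun z => z - 1)%C (Cmod (w - 1)%C)); [lra | exact: near_log_lap |].
    by move=> z ->; split; [lra | rewrite /x /Cminus /Cplus /Copp /RtoC; cbn [fst]; lra].
  have HB n : Cmod (cc n (size p - i).+1 (w - 1)) <= exp 1 * 128 by exact: cc_le.
  set B := exp 1 * 128 in HB.
  have B0 : 0 <= B by have := HB O; have := Cmod_ge_0 (cc 0 (size p - i).+1 (w - 1)); lra.
  by apply: (@bdom_intro P _ B) => // z n ->; rewrite npow_0 Rmult_1_r.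
have h := @dom_glued _ (@bnd_ext P) (@bnd_le P) (@bnd_const P) (@bnd_plus P) (@bnd_mult P) (ones_fam t p s)
  (fun z n i j => JW p z n i j - JP p i j)%C kap (- x) kp hn hM.
have h0 : Ccv (fun n => glued (znode (ones_fam t p s) w) n.+1 (fun i j => JW p w n.+1 i j - JP p i j)%C) 0.
  apply: (@bdom_to_0 w (fun z n => glued (znode (ones_fam t p s) z) n (fun i j => JW p z n i j - JP p i j)%C) (x / 2)); first lra.
  by apply: bdom_le h; rewrite size_ones_fam hsz; clear - kr kp xp; lra.
rewrite -[F _]Cplus_0_l.
apply: (Ccv_ext (x := fun k => (glued (znode (ones_fam t p s) w) k.+1 (fun i j => JW p w k.+1 i j - JP p i j)%C +
   glued (map (nd t) (map kc p ++ w :: s)) k.+1 (JP p))%C)).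
  move=> k; rewrite /ones_E znode_ones_fam /glued -(glue_sub _ _ (JW p w k.+1)).
  have alg (a b : C) : (a - b + b = a)%C by ring.
  exact: alg.
apply: Ccv_plus h0 _; apply: (Ccv_ext (x := fun k => glued (map (nd t) (map kc p ++ w :: s)) (k + 1) (JP p))).
  by move=> k; rewrite addn1.
exact: (Ccv_unshift (x := fun k => glued (map (nd t) (map kc p ++ w :: s)) k (JP p))).
Qed.

(* A run of [a] exponents 1 leaves the limit of its iterated sum across infinity, [(-pi i)^a / a!]. *)
Lemma ones_limit p s : (size p + size s)%N = r -> List.Forall (fun z => 1 < fst z) s ->
  Ccv (fun N => glued (map (nd t) (map kc p ++ s)) N (JP p)) (F (map kc p ++ s)).
Proof.
elim/last_ind: p s => [|p x IH] s hsz hs.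
  apply: (Ccv_ext (x := fun N => zs [::] (map (nd t) s) N)); last exact: (ext_Ccv HF).
  by move=> N; rewrite -glued_delta; apply: glue_ext => i j _ _; rewrite JP_nil.
rewrite map_rcons cat_rcons.
have hsz' : (size p + (size s).+1)%N = r by rewrite -hsz size_rcons; lia.
(* An exponent at least 2 can simply join [s]; only the exponent 1 needs the passage through a
   variable w. *)
case: x hsz => [|x] _; last first.
  apply: (Ccv_ext (x := fun N => glued (map (nd t) (map kc p ++ kc x.+1 :: s)) N (JP p))).
    by move=> N; apply: glue_ext => i j _ _; rewrite JP_rcons_S.
  apply: IH => //; apply: List.Forall_cons => //.
  by rewrite fst_kc S_INR; have := INR_S_ge1 x; lra.
have [eta0 [e0 he0]] := Forall_gt_gap hs.
pose eta := Rmin eta0 (/ 2).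
have ep : 0 < eta by apply: Rmin_glb_lt; lra.
have hs' : List.Forall (fun z => 1 + eta <= fst z) s.
  by apply: List.Forall_impl he0 => z; have := Rmin_l eta0 (/ 2); rewrite -/eta; lra.
have eh : eta <= / 2 by exact: Rmin_r.
have rp := pos_INR r.
(* The two parts of 2 r d + 16 d = eta serve the increment estimate and the radius bound d <=
   1/16. *)
pose d := eta / (2 * INR r + 16).
have dp : 0 < d by apply: Rdiv_lt_0_compat; lra.
have de : 2 * (INR r * d) + 16 * d = eta by rewrite /d; field; lra.
have rd : 0 <= INR r * d by apply: Rmult_le_pos; lra.
have hd : 0 < d <= / 16 by lra.
have [u [Hu Hinc]] := @ones_E_incr p s d eta hd ltac:(lra) ltac:(rewrite hsz'; lra) hs'.
(* On the right arc Re z > 1, so the induction hypothesis applies with z moved into [s]; the centre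
   is the exponent 1. *)
have main : Ccv (fun k => ones_E p s k 1) (F (map kc p ++ RtoC 1 :: s)).
  apply: (@vitali_center (fun w => F (map kc p ++ w :: s)) (ones_E p s) 1 d u) => //.
  - by apply: (ext_entire HF); rewrite size_map.
  - by move=> n; exact: Centire_ones_E.
  - by move=> n z hz; apply: Hinc; rewrite /disc hz; lra.
  - move=> z hz0 hz; have hz' : 1 < fst z.
      by move: hz; rewrite /Cminus /Cplus /Copp /RtoC; cbn [fst]; lra.
    by apply: ones_E_arc => //; [rewrite hz0; lra | apply: IH => //; apply: List.Forall_cons].
apply: (@Ccv_shift _ _ 1); apply: (Ccv_ext (x := fun k => ones_E p s k 1)) main => k.
by rewrite addn1 /ones_E; apply: glue_ext => i j _ _; rewrite JW_at1.
Qed.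

End OnesLimit.

(** * Power series in [t] *)

Definition tser (c : nat -> C) (t : C) (L : nat) : C := csum (fun l => c l * Cpow t l)%C L.

(** The l^1 norm of the coefficients at radius 1/2, safely inside the disc |t| < 1 on which all
    weights 1/(n - t) are analytic. It is submultiplicative and complete in the sense of [psb_mult]
    and [psb_lim]. *)
Definition psb (f : C -> C) (b : R) : Prop :=
  exists c, (forall L, rsum (fun l => Cmod (c l) * (/ 2) ^ l) L <= b) /\
    forall t, Cmod t <= / 2 -> Ccv (tser c t) (f t).

Lemma psb_ext_small f g b : (forall t, Cmod t <= / 2 -> f t = g t) -> psb f b -> psb g b.
Proof. by move=> e [c [h H]]; exists c; split=> // t ht; rewrite -e //; exact: H. Qed.

Lemma psb_ext f g b : (forall t, f t = g t) -> psb f b -> psb g b.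
Proof. by move=> e; apply: psb_ext_small => t _. Qed.

Lemma psb_le f b b' : b <= b' -> psb f b -> psb f b'.
Proof. by move=> h [c [hc H]]; exists c; split=> // L; apply: Rle_trans (hc L) h. Qed.

Lemma csum_first (c : nat -> C) L : (forall l, c l.+1 = RtoC 0) -> csum c L.+1 = c O.
Proof.
move=> h; rewrite csum_S_l (@csum_ext _ (fun _ => 0 * 0)%C) ?csum_mull; first by ring.
by move=> i _; rewrite h; ring.
Qed.

Lemma Ccv_S x l : Ccv (fun n => x n.+1) l -> Ccv x l.
Proof. by move=> H; apply: (@Ccv_shift x l 1); apply: Ccv_ext H => n; rewrite addn1. Qed.

Lemma psb_const c : psb (fun _ => c) (Cmod c).
Proof.
exists (fun l => if l == O then c else RtoC 0); split.
  have h L : rsum (fun l => Cmod (if l == O then c else 0) * (/ 2) ^ l) L.+1 = Cmod c.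
    by elim: L => [|L IH]; cbn [rsum] in *; [rewrite /=; ring | rewrite IH /= Cmod_0; ring].
  by case=> [|L]; [cbn [rsum]; exact: Cmod_ge_0 | rewrite h; lra].
move=> t _; apply: Ccv_S; apply: (Ccv_ext (x := fun _ => c)); last exact: Ccv_const.
by move=> n; rewrite /tser csum_first => [|l] /=; ring.
Qed.

Lemma rsum_plus u v n : rsum (fun k => u k + v k) n = rsum u n + rsum v n.
Proof. by elim: n => [|n IH]; cbn [rsum]; [ring | rewrite IH; ring]. Qed.

Lemma rsum_le u v n : (forall k, (k < n)%N -> u k <= v k) -> rsum u n <= rsum v n.
Proof.
elim: n => [|n IH] H; first by cbn [rsum]; lra.
by cbn [rsum]; apply: Rplus_le_compat; [apply: IH => k hk; apply: H; lia | apply: H].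
Qed.

Lemma psb_plus f g b c : psb f b -> psb g c -> psb (fun t => f t + g t)%C (b + c).
Proof.
move=> [x [hx Hx]] [y [hy Hy]]; exists (fun l => x l + y l)%C; split.
  move=> L; apply: Rle_trans (Rplus_le_compat _ _ _ _ (hx L) (hy L)); rewrite -rsum_plus.
  apply: rsum_le => l _; rewrite -Rmult_plus_distr_r; apply: Rmult_le_compat_r; first by apply: pow_le; lra.
  exact: Cmod_triangle.
move=> t ht; apply: Ccv_ext (Ccv_plus (Hx t ht) (Hy t ht)) => L.
by rewrite /tser -csum_plus; apply: csum_ext => l _; ring.
Qed.

Definition cauchy (a b : nat -> C) (l : nat) : C := csum (fun i => a i * b (l - i)%N)%C l.+1.

Lemma csum_cauchy a b K : csum (cauchy a b) K = csum (fun i => a i * csum b (K - i))%C K.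
Proof.
elim: K => [//|K IH]; rewrite csumS IH [in RHS]csumS /cauchy csumS subnn subSnn.
have -> : csum (fun i => a i * csum b (K.+1 - i))%C K = (csum (fun i => a i * csum b (K - i)) K + csum (fun i => a i * b (K - i)%N) K)%C.
  by rewrite -csum_plus; apply: csum_ext => i hi; rewrite subSn ?csumS; [ring | lia].
by cbn [csum]; ring.
Qed.

Lemma rsum_cauchy (a b : nat -> R) K : rsum (fun l => rsum (fun i => a i * b (l - i)%N) l.+1) K =
  rsum (fun i => a i * rsum b (K - i)) K.
Proof.
elim: K => [//|K IH]; cbn [rsum] in *; rewrite IH subnn subSnn.
have -> : rsum (fun i => a i * rsum b (K.+1 - i)) K = rsum (fun i => a i * rsum b (K - i)) K + rsum (fun i => a i * b (K - i)%N) K.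
  rewrite -rsum_plus; have e i : (i < K)%N -> a i * rsum b (K.+1 - i) = a i * rsum b (K - i) + a i * b (K - i)%N.
    by move=> hi; rewrite subSn; [cbn [rsum]; ring | lia].
  apply: Rle_antisym; apply: rsum_le => i hi; rewrite e //; lra.
by cbn [rsum]; ring.
Qed.

(* Mertens: A_K B - sum_(l<K) (a*b)_l = sum_(i<K) a_i (B - B_(K-i)). *)
Lemma Ccv_cauchy a b A B : summable (fun i => Cmod (a i)) -> Ccv (csum a) A -> Ccv (csum b) B ->
  Ccv (csum (cauchy a b)) (A * B)%C.
Proof.
move=> Ha HA HB; have [a0 [S HS]] := Ha.
have [M HM] := Ccv_bounded HB.
pose D := M + Cmod B.
have D0 : 0 <= D by have := HM O; have := Cmod_ge_0 (csum b 0); have := Cmod_ge_0 B; rewrite /D; lra.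
have HD m : Cmod (B - csum b m)%C <= D.
  by apply: Rle_trans (Cmod_triangle _ _) _; rewrite Cmod_opp; have := HM m; rewrite /D; lra.
have S0 : 0 <= S by have := HS O; cbn [rsum].
have H0 : Ccv (fun K => csum (fun i => a i * (B - csum b (K - i))) K)%C 0.
  move=> eps He; pose e1 := eps / (2 * (S + 1)); pose e2 := eps / (2 * (D + 1)).
  have e1p : 0 < e1 by apply: Rdiv_lt_0_compat; lra.
  have e2p : 0 < e2 by apply: Rdiv_lt_0_compat; lra.
  have [N1 h1] := HB e1 e1p; have [N2 h2] := summable_Cauchy Ha e2p.
  exists (N1 + N2)%N => K hK; have -> (z : C) : (z - 0 = z)%C by ring.
  have bound L : (L <= K)%N -> Cmod (csum (fun i => a i * (B - csum b (K - i)))%C L) <=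
      e1 * rsum (fun i => Cmod (a i)) (minn L (K - N1)) + D * (rsum (fun i => Cmod (a i)) L - rsum (fun i => Cmod (a i)) (minn L (K - N1))).
    elim: L => [|L IH] hL.
      by rewrite min0n; cbn [csum rsum]; rewrite Cmod_0; lra.
    rewrite csumS; apply: Rle_trans (Cmod_triangle _ _) _; have := IH ltac:(lia).
    rewrite Cmod_mult; have ap := Cmod_ge_0 (a L); case: (ltnP L (K - N1)) => hLN.
      have -> : minn L.+1 (K - N1) = L.+1 by lia.
      cbn [rsum]; have := h1 (K - L)%N ltac:(lia); rewrite Cmod_sub_sym => q; nra.
    have -> : minn L.+1 (K - N1) = (K - N1)%N by lia.
    by cbn [rsum]; have := HD (K - L)%N; nra.
  apply: Rle_trans (bound K (leqnn K)) _.
  have -> : minn K (K - N1) = (K - N1)%N by lia.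
  have q1 := HS (K - N1)%N; have q2 := h2 (K - N1)%N K ltac:(lia) ltac:(lia).
  have q3 : e1 * rsum (fun i => Cmod (a i)) (K - N1) <= e1 * S by apply: Rmult_le_compat_l; lra.
  have q4 : D * (rsum (fun i => Cmod (a i)) K - rsum (fun i => Cmod (a i)) (K - N1)) <= D * e2 by apply: Rmult_le_compat_l; lra.
  have q5 : e1 * S <= eps / 2.
    have -> : eps / 2 = e1 * (S + 1) by rewrite /e1; field; lra.
    by nra.
  have q6 : D * e2 <= eps / 2.
    have -> : eps / 2 = (D + 1) * e2 by rewrite /e2; field; lra.
    by nra.
  lra.
have HAB := Ccv_plus (Ccv_scal B HA) (Ccv_opp H0).
have -> : (A * B = B * A + - 0)%C by ring.
apply: Ccv_ext HAB => K; rewrite csum_cauchy.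
have -> : csum (fun i => a i * (B - csum b (K - i)))%C K = (B * csum a K - csum (fun i => a i * csum b (K - i)) K)%C; last by ring.
have -> : (B * csum a K - csum (fun i => a i * csum b (K - i)) K = csum (fun i => B * a i) K + csum (fun i => (- (1)) * (a i * csum b (K - i))) K)%C.
  by rewrite !csum_mull; ring.
by rewrite -csum_plus; apply: csum_ext => i _; ring.
Qed.

Lemma tser_terms_summable c b t : (forall L, rsum (fun l => Cmod (c l) * (/ 2) ^ l) L <= b) -> Cmod t <= / 2 ->
  summable (fun l => Cmod (c l * Cpow t l)%C).
Proof.
move=> h ht; split=> [n|]; first exact: Cmod_ge_0.
exists b => n; apply: Rle_trans (h n); apply: rsum_le => l _.
rewrite Cmod_mult Cmod_pow; apply: Rmult_le_compat_l; first exact: Cmod_ge_0.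
by apply: pow_incr; split=> //; exact: Cmod_ge_0.
Qed.

Lemma Cpow_sub_mult (t : C) i l : (i <= l)%N -> (Cpow t i * Cpow t (l - i) = Cpow t l)%C.
Proof. by move=> h; rewrite -Cpow_add_r; congr Cpow; lia. Qed.

Lemma psb_mult f g b c : 0 <= b -> 0 <= c -> psb f b -> psb g c -> psb (fun t => f t * g t)%C (b * c).
Proof.
move=> b0 c0 [x [hx Hx]] [y [hy Hy]]; exists (cauchy x y); split.
  move=> L; apply: (Rle_trans _ (rsum (fun l => rsum (fun i => (Cmod (x i) * (/ 2) ^ i) * (Cmod (y (l - i)%N) * (/ 2) ^ (l - i))) l.+1) L)).
    apply: rsum_le => l _; apply: (Rle_trans _ (rsum (fun i => Cmod (x i) * Cmod (y (l - i)%N)) l.+1 * (/ 2) ^ l)).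
      apply: Rmult_le_compat_r; first by apply: pow_le; lra.
      by apply: Cmod_csum_rsum => i; rewrite Cmod_mult; lra.
    rewrite Rmult_comm -rsum_scal; apply: rsum_le => i hi; apply: Req_le.
    have -> : (/ 2) ^ l = (/ 2) ^ i * (/ 2) ^ (l - i).
      by rewrite -pow_add; congr pow; lia.
    by ring.
  rewrite (rsum_cauchy (fun i => Cmod (x i) * (/ 2) ^ i) (fun i => Cmod (y i) * (/ 2) ^ i)).
  apply: (Rle_trans _ (rsum (fun i => c * (Cmod (x i) * (/ 2) ^ i)) L)).
    apply: rsum_le => i _; rewrite Rmult_comm; apply: Rmult_le_compat_r => //.
    by apply: Rmult_le_pos; [exact: Cmod_ge_0 | apply: pow_le; lra].
  by rewrite (rsum_scal c (fun i => Cmod (x i) * (/ 2) ^ i)) Rmult_comm; apply: Rmult_le_compat_r.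
move=> t ht; have h := Ccv_cauchy (tser_terms_summable hx ht) (Hx t ht) (Hy t ht).
apply: Ccv_ext h => L; apply: csum_ext => l _; rewrite /cauchy Cmult_comm -csum_mull.
apply: csum_ext => i hi; rewrite -(@Cpow_sub_mult t i l); [ring | lia].
Qed.

Lemma psb_t : psb (fun t => t) (/ 2).
Proof.
exists (fun l => if l == 1%N then RtoC 1 else RtoC 0); split.
  have h L : rsum (fun l => Cmod (if l == 1%N then RtoC 1 else 0) * (/ 2) ^ l) L.+2 = / 2.
    elim: L => [|L IH]; first by rewrite /= Cmod_0 Cmod_1; lra.
    by cbn [rsum] in *; rewrite IH /= Cmod_0; ring.
  by case=> [|[|L]]; [cbn [rsum]; lra | rewrite /= Cmod_0; lra | rewrite h; lra].
move=> t _; apply: Ccv_S; apply: Ccv_S; apply: (Ccv_ext (x := fun _ => t)); last exact: Ccv_const.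
move=> n; rewrite /tser csum_S_l (@csum_first (fun i => _)) => [|l] /=; ring.
Qed.

Lemma Cmod_INR_sub t n : Cmod t <= / 2 -> / 2 * INR n.+1 <= Cmod (RtoC (INR n.+1) - t)%C.
Proof.
move=> ht; have := Cmod_triangle (RtoC (INR n.+1) - t)%C t; have -> : (RtoC (INR n.+1) - t + t = RtoC (INR n.+1))%C by ring.
rewrite Cmod_R Rabs_pos_eq; last exact: pos_INR.
by have := INR_S_ge1 n; lra.
Qed.

(** The geometric series in t / N; as N >= 1, its norm is at most (1/N) times the sum of the
    2^(-l). *)
Lemma psb_inv n : psb (fun t => / (RtoC (INR n.+1) - t))%C (2 * npow n.+1 (- 1)).
Proof.
have hn := INR_S_ge1 n; set N := INR n.+1 in hn *.
have e1 : npow n.+1 (- 1) = / N := npow_m1 n.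
have iN : 0 < / N by apply: Rinv_0_lt_compat; lra.
have i1 : / N <= 1 by rewrite -Rinv_1; apply: Rinv_le_contravar; lra.
exists (fun l => RtoC (/ N ^ l.+1)); split.
  move=> L; rewrite e1; apply: (Rle_trans _ (/ N * rsum (fun m => (/ 2) ^ m) L)).
    rewrite -rsum_scal; apply: rsum_le => l _; rewrite -pow_inv Cmod_R Rabs_pos_eq; last by apply: pow_le; lra.
    cbn [pow]; rewrite Rmult_assoc; apply: Rmult_le_compat_l; first lra.
    rewrite -[X in _ <= X]Rmult_1_l; apply: Rmult_le_compat_r; first by apply: pow_le; lra.
    by rewrite -(pow1 l); apply: pow_incr; lra.
  by have := @geom_le (/ 2) L ltac:(split; lra); set q := rsum _ _ => h; nra.
move=> t ht; have m := Cmod_INR_sub n ht; rewrite -/N in m.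
have nz : (RtoC N - t)%C <> 0 by apply/Cmod_gt_0; lra.
have Nz : RtoC N <> 0 by move=> /RtoC_inj; lra.
apply: (Ccv_squeeze (v := fun L => 2 * (/ 2) ^ L)).
  move=> L; have -> : (tser (fun l => RtoC (/ N ^ l.+1)) t L - / (RtoC N - t) = - (Cpow (t / RtoC N) L / (RtoC N - t)))%C.
    elim: L => [|L IH]; first by rewrite /tser /=; field.
    have -> : tser (fun l => RtoC (/ N ^ l.+1)) t L.+1 = (tser (fun l => RtoC (/ N ^ l.+1)) t L + RtoC (/ N ^ L.+1) * Cpow t L)%C by [].
    have -> : (tser (fun l => RtoC (/ N ^ l.+1)) t L + RtoC (/ N ^ L.+1) * Cpow t L - / (RtoC N - t) =
      (tser (fun l => RtoC (/ N ^ l.+1)) t L - / (RtoC N - t)) + RtoC (/ N ^ L.+1) * Cpow t L)%C by ring.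
    have -> : RtoC (/ N ^ L.+1) = (Cpow (/ RtoC N) L * / RtoC N)%C.
      by rewrite -pow_inv RtoC_pow RtoC_inv; [cbn [Cpow]; ring | lra].
    by rewrite IH /Cdiv Cpow_mult_l; cbn [Cpow]; rewrite Cpow_mult_l; field.
  rewrite Cmod_opp Cmod_div // Cmod_pow Cmod_div // Cmod_R Rabs_pos_eq; last lra.
  rewrite /Rdiv Rmult_comm; apply: Rmult_le_compat.
  - by left; apply: Rinv_0_lt_compat; lra.
  - by apply: pow_le; apply: Rmult_le_pos; [exact: Cmod_ge_0 | lra].
  - rewrite -[X in _ <= X]Rinv_inv; apply: Rinv_le_contravar; lra.
  - apply: pow_incr; have := Cmod_ge_0 t; split; nra.
move=> eps He; have [K HK] := pow_lt_1_zero (/ 2) ltac:(rewrite Rabs_pos_eq; lra) (eps / 2) ltac:(lra).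
by exists K => L hL; have := HK L ltac:(lia); have := Rle_abs ((/ 2) ^ L); lra.
Qed.

Lemma tser_minus c d t L : (tser c t L - tser d t L)%C = tser (fun l => c l - d l)%C t L.
Proof.
have -> : (tser c t L - tser d t L = tser c t L + (- (1)) * tser d t L)%C by ring.
by rewrite /tser -csum_mull -csum_plus; apply: csum_ext => l _; ring.
Qed.

(** The coefficients of [f k] converge one by one, and tails of the summable increments bound the
    norm of the error uniformly in the number of coefficients, so the limit in k and the sum over l
    may be exchanged. *)
Lemma psb_lim (f : nat -> C -> C) (g : C -> C) B u : psb (f O) B ->
  (forall k, psb (fun t => f k.+1 t - f k t)%C (u k)) -> summable u ->
  (forall t, Cmod t <= / 2 -> Ccv (fun k => f k t) (g t)) ->
  exists c, forall t, Cmod t <= / 2 -> Ccv (tser c t) (g t).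
Proof.
move=> [c0 [_ H0]] Hd Hu Hg; have [u0 _] := Hu.
pose d k := proj1_sig (constructive_indefinite_description _ (Hd k)).
have hd k : (forall L, rsum (fun l => Cmod (d k l) * (/ 2) ^ l) L <= u k) /\
    forall t, Cmod t <= / 2 -> Ccv (tser (d k) t) (f k.+1 t - f k t)%C.
  exact: proj2_sig (constructive_indefinite_description _ (Hd k)).
pose CK K l := (c0 l + csum (fun k => d k l) K)%C.
have HCK K t : Cmod t <= / 2 -> Ccv (tser (CK K) t) (f K t).
  move=> ht; elim: K => [|K IH].
    by apply: Ccv_ext (H0 t ht) => L; apply: csum_ext => l _; rewrite /CK; cbn [csum]; ring.
  have -> : f K.+1 t = (f K t + (f K.+1 t - f K t))%C by ring.
  apply: Ccv_ext (Ccv_plus IH ((hd K).2 t ht)) => L.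
  by rewrite /tser -csum_plus; apply: csum_ext => l _; rewrite /CK csumS; ring.
pose nrm (e : nat -> C) L := rsum (fun l => Cmod (e l) * (/ 2) ^ l) L.
have nrm_tri e e' L : nrm (fun l => e l + e' l)%C L <= nrm e L + nrm e' L.
  rewrite /nrm -rsum_plus; apply: rsum_le => l _; rewrite -Rmult_plus_distr_r.
  by apply: Rmult_le_compat_r; [apply: pow_le; lra | exact: Cmod_triangle].
have hdiff K j L : nrm (fun l => CK (j + K)%N l - CK K l)%C L <= rsum u (j + K) - rsum u K.
  elim: j => [|j IH].
    rewrite add0n Rminus_diag /nrm; elim: L => [|L IH]; first by cbn [rsum]; lra.
    by cbn [rsum]; have -> : (CK K L - CK K L = 0)%C by [ring]; rewrite Cmod_0; lra.
  have e : nrm (fun l => CK (j.+1 + K)%N l - CK K l)%C L = nrm (fun l => (CK (j + K)%N l - CK K l) + d (j + K)%N l)%C L.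
    by rewrite /nrm; congr rsum; apply: functional_extensionality => l; rewrite addSn /CK csumS; congr (Cmod _ * _); ring.
  rewrite e; apply: Rle_trans (nrm_tri _ _ _) _; rewrite addSn; cbn [rsum].
  by have := (hd (j + K)%N).1 L; rewrite -/(nrm _ _); lra.
have [Ci HCi] : exists Ci : nat -> C, forall l, Ccv (fun K => CK K l) (Ci l).
  (* The norm controls the coefficient of order l only up to a factor 2^l, hence the tolerance eps /
     2^l. *)
  have ex l : exists z, Ccv (fun K => CK K l) z.
    have p2 : 0 < (/ 2) ^ l by apply: pow_lt; lra.
    apply: Ccv_of_Cauchy => eps He; have [N HN] := summable_Cauchy Hu (Rmult_lt_0_compat _ _ He p2).
    exists N => n m hn hm.
    have q1 : forall K j, (N <= K)%N -> Cmod (CK (j + K)%N l - CK K l)%C <= eps.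
      move=> K j hK; apply: (Rmult_le_reg_r ((/ 2) ^ l)) => //.
      apply: Rle_trans (HN K (j + K)%N hK ltac:(lia)); apply: Rle_trans (hdiff K j l.+1).
      rewrite /nrm; cbn [rsum]; have : 0 <= rsum (fun l => Cmod (CK (j + K)%N l - CK K l)%C * (/ 2) ^ l) l; last by lra.
      apply: rsum_ge0 => k; apply: Rmult_le_pos; [exact: Cmod_ge_0 | apply: pow_le; lra].
    case: (leqP n m) => h.
      by have := q1 n (m - n)%N hn; rewrite subnK // Cmod_sub_sym.
    have := q1 m (n - m)%N hm; rewrite subnK ?(ltnW h) // => q.
    by rewrite Cmod_sub_sym.
  exists (fun l => proj1_sig (constructive_indefinite_description _ (ex l))) => l.
  exact: proj2_sig (constructive_indefinite_description _ (ex l)).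
have hinf L eps : 0 < eps -> exists N, forall K, (N <= K)%N -> nrm (fun l => Ci l - CK K l)%C L <= eps.
  elim: L eps => [|L IH] eps He; first by exists O => K _; rewrite /nrm; cbn [rsum]; lra.
  have p2 : 0 < (/ 2) ^ L by apply: pow_lt; lra.
  have p1 : (/ 2) ^ L <= 1 by rewrite -(pow1 L); apply: pow_incr; lra.
  have [N1 h1] := IH (eps / 2) ltac:(lra); have [N2 h2] := HCi L (eps / 2) ltac:(lra).
  exists (N1 + N2)%N => K hK; have q1 := h1 K ltac:(lia); have q2 := h2 K ltac:(lia).
  rewrite /nrm in q1 *; cbn [rsum]; rewrite Cmod_sub_sym in q2; have := Cmod_ge_0 (Ci L - CK K L)%C; nra.
have htail eps : 0 < eps -> exists K, forall K', (K <= K')%N -> forall L, nrm (fun l => Ci l - CK K' l)%C L <= eps.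
  move=> He; have [N HN] := summable_Cauchy Hu (ltac:(lra) : 0 < eps / 2).
  exists N => K hK L; have [N2 h2] := hinf L (eps / 2) ltac:(lra).
  have q1 := h2 (N2 + K)%N ltac:(lia); have q2 := hdiff K N2 L; have q3 := HN K (N2 + K)%N hK ltac:(lia).
  have e : nrm (fun l => Ci l - CK K l)%C L = nrm (fun l => (Ci l - CK (N2 + K)%N l) + (CK (N2 + K)%N l - CK K l))%C L.
    by rewrite /nrm; congr rsum; apply: functional_extensionality => l; congr (Cmod _ * _); ring.
  by rewrite e; apply: Rle_trans (nrm_tri _ _ _) _; lra.
exists Ci => t ht eps He.
have [K1 h1] := htail (eps / 3) ltac:(lra); have [K2 h2] := Hg t ht (eps / 3) ltac:(lra).
pose K := (K1 + K2)%N; have [L0 h3] := HCK K t ht (eps / 3) ltac:(lra).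
exists L0 => L hL.
have -> : (tser Ci t L - g t = (tser Ci t L - tser (CK K) t L) + ((tser (CK K) t L - f K t) + (f K t - g t)))%C by ring.
apply: Rle_trans (Cmod_triangle _ _) _.
have q1 := Cmod_triangle (tser (CK K) t L - f K t)%C (f K t - g t)%C.
have q2 := h2 K ltac:(rewrite /K; lia); have q3 := h3 L hL.
suff : Cmod (tser Ci t L - tser (CK K) t L)%C <= eps / 3 by lra.
apply: Rle_trans (h1 K ltac:(rewrite /K; lia) L); rewrite tser_minus /nrm; apply: Cmod_csum_rsum => l.
rewrite Cmod_mult Cmod_pow; apply: Rmult_le_compat_l; first exact: Cmod_ge_0.
by apply: pow_incr; split=> //; exact: Cmod_ge_0.
Qed.

Definition pdom := dom psb.

Lemma pdom_ext f g x : (forall t n, Cmod t <= / 2 -> f t n.+1 = g t n.+1) -> pdom f x -> pdom g x.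
Proof. by move=> e [B [B0 H]]; exists B; split=> // n; apply: psb_ext_small (H n) => t ht; exact: e. Qed.

Lemma pdom_inv : pdom (fun t n => / (RtoC (INR n) - t))%C (- 1).
Proof. by exists 2; split; [lra | move=> n; exact: psb_inv]. Qed.

Lemma lap_kc a n : wpow lap (kc a) n.+1 = Cpow (/ RtoC (INR n.+1))%C a.+1.
Proof.
have e : Cexp (- lap n.+1)%C = (/ RtoC (INR n.+1))%C.
  have nz : RtoC (INR n.+1) <> 0 by exact: RtoC_INR_neq0.
  have := Cexp_neg (lap n.+1); rewrite Cexp_lap => h.
  by rewrite -[LHS]Cmult_1_r -(Cinv_r (RtoC (INR n.+1))) // Cmult_assoc h; ring.
rewrite -e /wpow; have -> : (n.+1 == O) = false by [].
rewrite /kc; elim: a => [|a IH].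
  by have -> : (- (RtoC (INR 1) * lap n.+1) = - lap n.+1)%C by [rewrite /=; ring]; cbn [Cpow]; ring.
have -> : (- (RtoC (INR a.+2) * lap n.+1) = - lap n.+1 + - (RtoC (INR a.+1) * lap n.+1))%C.
  by rewrite (S_INR a.+1) RtoC_plus; ring.
by rewrite Cexp_plus IH.
Qed.

(** At integer exponents the choice of branch disappears and the weight is a rational function of t,
    with an explicit power series. *)
Lemma lam_kc t a n : Cmod t <= / 2 -> wpow (lam t) (kc a) n.+1 = Cpow (- (/ (RtoC (INR n.+1) - t)))%C a.+1.
Proof.
move=> ht.
have nz : (RtoC (INR n.+1) - t)%C <> 0.
  by apply/Cmod_gt_0; have := Cmod_INR_sub n ht; have := INR_S_ge1 n; lra.
have e : Cexp (- lam t n.+1)%C = (- (/ (RtoC (INR n.+1) - t)))%C.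
  have h := Cexp_neg (lam t n.+1); rewrite (Cexp_lam n (small_tdom ht)) in h.
  have -> : (- (/ (RtoC (INR n.+1) - t)) = - (/ (RtoC (INR n.+1) - t)) * (Cexp (- lam t n.+1) * (t - RtoC (INR n.+1))))%C by rewrite h; ring.
  by field.
rewrite -e /wpow; have -> : (n.+1 == O) = false by [].
rewrite /kc; elim: a => [|a IH].
  by have -> : (- (RtoC (INR 1) * lam t n.+1) = - lam t n.+1)%C by [rewrite /=; ring]; cbn [Cpow]; ring.
have -> : (- (RtoC (INR a.+2) * lam t n.+1) = - lam t n.+1 + - (RtoC (INR a.+1) * lam t n.+1))%C.
  by rewrite (S_INR a.+1) RtoC_plus; ring.
by rewrite Cexp_plus IH.
Qed.

Definition pdom_scal := @dom_scal _ psb_le psb_const psb_mult.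
Definition pdom_mult := @dom_mult _ psb_mult.
Definition pdom_le := @dom_le _ psb_le.

Lemma pdom_nodes a : pdom (fun _ n => wpow lap (kc a) n) (- INR a.+1) /\ pdom (fun t n => wpow (lam t) (kc a) n) (- INR a.+1).
Proof.
have n1 : pdom (fun t n => - (/ (RtoC (INR n) - t)))%C (- 1).
  by apply: (dom_opp psb_ext psb_le psb_const psb_mult); exact: pdom_inv.
split.
  apply: (dom_seq psb_le psb_const (B := 1)) => [|n]; first lra.
  have := wpow_bound (kc a) n.+1 near_log_lap; rewrite Rmult_0_r exp_0 Rmult_1_l => h.
  exact: h.
apply: (pdom_ext (f := fun t n => Cpow (- (/ (RtoC (INR n) - t)))%C a.+1)) => [t n ht|]; first by rewrite lam_kc.
elim: a => [|a IH].
  by apply: (dom_ext psb_ext) n1 => t n; cbn [Cpow]; ring.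
have -> : - INR a.+2 = - (1) + - INR a.+1 by rewrite (S_INR a.+1); ring.
exact: pdom_mult n1 IH.
Qed.

(** The cancellation is exact here: 1/n + 1/(t - n) = - t / (n (n - t)). *)
Lemma pdom_ones : pdom (fun t n => wpow lap (kc 0) n + wpow (lam t) (kc 0) n)%C (- 2).
Proof.
have h0 := psb_t; have [h1 _] := pdom_nodes 0; rewrite [INR 1]/= in h1.
have h2 : pdom (fun t _ => t) 0 by exists (/ 2); split; [lra | move=> n; rewrite npow_0; apply: psb_le psb_t; lra].
have h := pdom_scal (- (1))%C (pdom_mult h2 (pdom_mult h1 pdom_inv)).
apply: pdom_ext (pdom_le _ h); last lra.
move=> t n ht; rewrite lap_kc lam_kc //; cbn [Cpow].
have nz : (RtoC (INR n.+1) - t)%C <> 0.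
  by apply/Cmod_gt_0; have := Cmod_INR_sub n ht; have := INR_S_ge1 n; lra.
by have nz2 := @RtoC_INR_neq0 n; field.
Qed.

(** * Taylor expansion at positive indices *)

Definition kc_fam (p : seq nat) : seq (C -> node) := map (fun a t => nd t (kc a)) p.

Lemma znode_kc_fam p t : znode (kc_fam p) t = map (nd t) (map kc p).
Proof. by rewrite /znode /kc_fam -!map_comp. Qed.

Lemma nth_kc_fam p q : (q < size p)%N -> nth nd0 (kc_fam p) q = (fun t => nd t (kc (nth 1%N p q))).
Proof. by move=> h; rewrite /kc_fam (nth_map 1%N). Qed.

Lemma kc_fam_defect p i j : (i <= size (kc_fam p))%N -> (j <= size (kc_fam p))%N ->
  pdom (fun t n => JP p i j - advanced (znode (kc_fam p) t) n (JP p) i j)%C (- 2).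
Proof.
have hnode q : (q < size p)%N -> pdom (fun t n => (nth nd0 (kc_fam p) q t).1 n) (- 1) /\ pdom (fun t n => (nth nd0 (kc_fam p) q t).2 n) (- 1).
  move=> hq; rewrite nth_kc_fam //; have [h1 h2] := pdom_nodes (nth 1%N p q).
  by split; [apply: pdom_le h1 | apply: pdom_le h2]; have := INR_S_ge1 (nth 1%N p q); lra.
apply: (dom_defect psb_ext psb_le psb_const (J := fun _ _ => JP p)) => [w n|]; first exact: JP_unitri.
rewrite size_map => {}i q hiq hq.
have hc c : pdom (fun _ _ => c) 0 by exact: (dom_const psb_le psb_const).
apply: (dom_minus psb_ext psb_le psb_const psb_plus psb_mult); last first.
  have [h1 _] := hnode i ltac:(lia); have [_ h2] := hnode q hq.
  by apply: pdom_le (pdom_mult h1 (pdom_mult h2 (hc (JP p i.+1 q)))); lra.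
apply: (dom_low_defect psb_ext psb_le psb_const psb_plus psb_mult
  (al := fun i w n => (nth nd0 (kc_fam p) i w).1 n) (nu := fun q w n => (nth nd0 (kc_fam p) q w).2 n)) => //.
- move=> i' q' h1 h2 e1 e2; apply: (dom_ext psb_ext) pdom_ones => w n.
  by rewrite !nth_kc_fam // e1 e2.
- move=> q' h e; rewrite nth_kc_fam //; have [h1 h2] := pdom_nodes (nth 1%N p q').
  case: (nth 1%N p q') e h1 h2 => [//|k] _ h1 h2; have k1 := INR_S_ge1 k.
  by split; [apply: pdom_le h1 | apply: pdom_le h2]; rewrite (S_INR k.+1); lra.
Qed.

(** The sums of [ones_limit] are power series in t for each n. With kap = 1 / (4 (r+1)) their
    increments have norm O(n^(-3/2)), so [psb_lim] expands the limit. *)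
Lemma positive_taylor p (G : C -> seq C -> C) :
  (forall t, tdom t -> zetaU_extension (size p) 0 t (G t)) ->
  exists c, forall t, Cmod t <= / 2 -> Ccv (tser c t) (G t (map kc p)).
Proof.
move=> HG; set r := size p in HG; have rp := pos_INR r.
pose kap := / (4 * (INR r + 1)).
have kp : 0 < kap by apply: Rinv_0_lt_compat; lra.
have kr : 4 * INR r * kap + 4 * kap = 1 by rewrite /kap; field; lra.
have rk : 0 <= INR r * kap by apply: Rmult_le_pos; lra.
have hsz : size (kc_fam p) = r by rewrite size_map.
have hn : List.Forall (dnode psb (kap - 1)) (kc_fam p).
  rewrite /kc_fam; elim: (p) => [|a p' IH]; first exact: List.Forall_nil.
  apply: List.Forall_cons => //; split; first by move=> w; exact: nd_z0.
  have [h1 h2] := pdom_nodes a; have := INR_S_ge1 a => a1.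
  by split; [apply: pdom_le h1 | apply: pdom_le h2]; lra.
pose E t n := glued (znode (kc_fam p) t) n (JP p).
have hE : pdom E (INR r * kap + INR r * kap + 0).
  rewrite -hsz; apply: (@dom_glued _ psb_ext psb_le psb_const psb_plus psb_mult (kc_fam p) (fun _ _ => JP p)) => //.
  by move=> i j _ _; exact: (dom_const psb_le psb_const).
have hinc : pdom (fun t n => E t n.+1 - E t n)%C (- 1 - / 2).
  have h := @dom_glue_incr _ psb_ext psb_le psb_const psb_plus psb_mult (kc_fam p) (fun _ _ => JP p) kap (- 2) kp hn (@kc_fam_defect p).
  by apply: pdom_le h; rewrite hsz; lra.
have [B [B0 HB]] := hE; have [B' [B'0 HB']] := hinc.
apply: (@psb_lim (fun k t => E t k.+1) (fun t => G t (map kc p)) _ (fun k => B' * npow k.+1 (- 1 - / 2)) (HB O)).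
- by move=> k; exact: HB'.
- apply: (summable_shift (u := fun k => B' * npow k (- 1 - / 2))); apply: summable_scal => //.
  by apply: npow_summable; lra.
- move=> t ht; have h := @ones_limit t r (G t) ht (HG t (small_tdom ht)) p [::].
  have := h ltac:(by rewrite addn0) (List.Forall_nil _); rewrite cats0 => {}h.
  apply: (Ccv_ext (x := fun k => glued (map (nd t) (map kc p)) (k + 1) (JP p))).
    by move=> k; rewrite /E znode_kc_fam addn1.
  exact: (Ccv_unshift (x := fun N => glued (map (nd t) (map kc p)) N (JP p))).
Qed.

Import GRing.Theory Num.Theory.

(** * The relation for truncated sums *)

Section RationalRelation.
Local Open Scope ring_scope.

(** The variables beyond a given position, with the inner sum kept as a function of its bound, so
    that the telescoping takes place inside [f]. *)
Fixpoint outer (A : seq int) (f : nat -> rat) (N : nat) : rat :=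
  match A with
  | [::] => f N
  | z :: A' => \sum_(1 <= n < N) ((n%:R : rat) ^ (- z)) * outer A' f n
  end.

Lemma trunc_rev_cat A B N : trunc_rev (A ++ B) N = outer A (trunc_rev B) N.
Proof. by elim: A N => [//|z A IH] N /=; apply: eq_bigr => n _; rewrite IH. Qed.

Lemma outer_ext A f g N : (forall n, (0 < n)%N -> f n = g n) -> (0 < N)%N -> outer A f N = outer A g N.
Proof.
move=> h; elim: A N => [|z A IH] N hN /=; first exact: h.
by rewrite !big_nat; apply: eq_bigr => n /andP [hn _]; rewrite IH.
Qed.

Lemma outer_lin A c f g N : outer A (fun n => c * f n + g n) N = c * outer A f N + outer A g N.
Proof.
elim: A N => [//|z A IH] N /=.
rewrite big_distrr -big_split; apply: eq_bigr => n _ /=.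
by rewrite IH mulrDr mulrCA.
Qed.

Lemma outer_0 A N : outer A (fun _ => 0) N = 0.
Proof. by elim: A N => [//|z A IH] N /=; rewrite big1 // => n _; rewrite IH mulr0. Qed.

Lemma outer_sum A (c : nat -> rat) (f : nat -> nat -> rat) M N :
  outer A (fun n => \sum_(i < M) c i * f i n) N = \sum_(i < M) c i * outer A (f i) N.
Proof.
elim: M => [|M IH].
  by rewrite big_ord0 -[RHS](outer_0 A N); congr outer; apply: functional_extensionality => n; rewrite big_ord0.
rewrite big_ord_recr /= addrC -IH -outer_lin; congr outer; apply: functional_extensionality => n.
by rewrite big_ord_recr /= addrC.
Qed.

Lemma outer_sub A f g N : outer A (fun n => f n - g n) N = outer A f N - outer A g N.
Proof.
rewrite addrC -[- outer A g N]mulN1r -outer_lin; congr outer.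
by apply: functional_extensionality => n; rewrite mulN1r addrC.
Qed.

Lemma trunc_rev_S k B N : (0 < N)%N ->
  trunc_rev (k :: B) N.+1 = trunc_rev (k :: B) N + (N%:R : rat) ^ (- k) * trunc_rev B N.
Proof. by move=> h; rewrite /= big_nat_recr. Qed.

Lemma trunc_rev_1 k B : trunc_rev (k :: B) 1 = 0.
Proof. by rewrite /= big_geq. Qed.

Definition left_rev (m : nat) (B : seq int) (N : nat) : rat :=
  match B with
  | [::] => 1
  | x :: B' => \sum_(i < m.+2) 'C(m.+1, i)%:R * trunc_rev ((x - (m.+1 - i)%:Z) :: B') N
  end.

Lemma binom_succ_pow (x : rat) m : (x + 1) ^+ m.+1 = \sum_(i < m.+2) 'C(m.+1, i)%:R * x ^+ (m.+1 - i).
Proof. by rewrite exprDn; apply: eq_bigr => i _; rewrite expr1n mulr1 -mulr_natl. Qed.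

Lemma binom_diff_pow (x : rat) m : (x + 1) ^+ m.+1 - x ^+ m.+1 =
  \sum_(l < m.+1) 'C(m.+1, l.+1)%:R * x ^+ (m - l).
Proof.
rewrite binom_succ_pow big_ord_recl bin0 mul1r subn0 addrC addKr.
by apply: eq_bigr => i _; rewrite lift0 subSS.
Qed.

(** Both sides vanish at N = 1 and have equal increments, by the binomial expansions of (N+1)^(m+1)
    - N^(m+1) and of the factor (N+1)^(m+1) in [left_rev]. *)
Lemma telescope_rev m B N : (0 < N)%N ->
  \sum_(l < m.+1) 'C(m.+1, l.+1)%:R * trunc_rev ((- (m - l)%:Z) :: B) N =
    (N%:R) ^+ m.+1 * trunc_rev B N - left_rev m B N.
Proof.
case: N => [//|N] _; elim: N => [|N IH].
  rewrite big1 => [|l _]; last by rewrite trunc_rev_1 mulr0.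
  rewrite expr1n mul1r; case: B => [|x B]; first by rewrite /= subrr.
  rewrite trunc_rev_1 /left_rev big1 => [|i _]; last by rewrite trunc_rev_1 mulr0.
  by rewrite subrr.
have -> : \sum_(l < m.+1) 'C(m.+1, l.+1)%:R * trunc_rev ((- (m - l)%:Z) :: B) N.+2 =
   \sum_(l < m.+1) 'C(m.+1, l.+1)%:R * trunc_rev ((- (m - l)%:Z) :: B) N.+1 +
   ((N.+2%:R) ^+ m.+1 - (N.+1%:R) ^+ m.+1) * trunc_rev B N.+1.
  rewrite -[N.+2%:R]natr1 binom_diff_pow big_distrl -big_split; apply: eq_bigr => l _.
  by rewrite trunc_rev_S // opprK -exprnP mulrDr mulrA.
rewrite {}IH; case: B => [|x B] /=.
  by rewrite !mulr1 addrC addrA -[_ - _ + _]addrA addNr addr0.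
have -> : \sum_(i < m.+2) 'C(m.+1, i)%:R * \sum_(1 <= n < N.+2) (n%:R : rat) ^ (- (x - (m.+1 - i)%:Z)) * trunc_rev B n =
  \sum_(i < m.+2) 'C(m.+1, i)%:R * \sum_(1 <= n < N.+1) (n%:R : rat) ^ (- (x - (m.+1 - i)%:Z)) * trunc_rev B n +
   (N.+2%:R) ^+ m.+1 * ((N.+1%:R : rat) ^ (- x) * trunc_rev B N.+1).
  rewrite -[N.+2%:R]natr1 binom_succ_pow big_distrl -big_split; apply: eq_bigr => i _ /=.
  rewrite big_nat_recr //= mulrDr -mulrA; congr (_ + _ * _).
  by rewrite opprB expfzDr ?pnatr_eq0 // -mulrA.
rewrite (big_nat_recr N.+1) //=.
have alg (a b c d e : rat) : a * c - d + (b - a) * c = b * (c + e) - (d + b * e).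
  by rewrite mulrBl mulrDr opprD [RHS]addrACA subrr addr0 [LHS]addrC addrA -[_ - _ + _]addrA addNr addr0.
exact: alg.
Qed.

End RationalRelation.

(** * Rational numbers as complex numbers *)

Lemma int2Z_of_int z : int2Z z = ssrZ.Z_of_int z. Proof. by case: z => n; rewrite /int2Z /ssrZ.Z_of_int; lia. Qed.

Lemma int2Z_mul a b : int2Z (a * b)%R = Z.mul (int2Z a) (int2Z b).
Proof. by rewrite !int2Z_of_int; lia. Qed.

Lemma int2Z_add a b : int2Z (a + b)%R = Z.add (int2Z a) (int2Z b).
Proof. by rewrite !int2Z_of_int; lia. Qed.

Lemma int2Z_opp a : int2Z (- a)%R = Z.opp (int2Z a).
Proof. by rewrite !int2Z_of_int; lia. Qed.

Lemma int2Z_neq0 a : (a != 0)%R -> int2Z a <> Z0.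
Proof. by rewrite int2Z_of_int => /eqP h h'; apply: h; lia. Qed.

(** Allows fractions that are not in lowest terms, as they arise from sums and products of reduced
    ones. *)
Lemma Q2R_frac (n d : int) : (d != 0)%R -> Defs.Q2R (n%:~R / d%:~R)%R = IZR (int2Z n) / IZR (int2Z d).
Proof.
move=> hd; set x : rat := (n%:~R / d%:~R)%R.
have hx : (numq x * d = n * denq x)%R.
  apply: (@intr_inj rat); rewrite !rmorphM /=; apply/eqP.
  by rewrite -eqr_div ?intr_eq0 ?denq_neq0 // divq_num_den.
have e : IZR (int2Z (numq x)) * IZR (int2Z d) = IZR (int2Z n) * IZR (int2Z (denq x)).
  by rewrite -!mult_IZR -!int2Z_mul hx.
have d0 : IZR (int2Z d) <> 0 by apply: not_0_IZR; exact: int2Z_neq0.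
have x0 : IZR (int2Z (denq x)) <> 0 by apply: not_0_IZR; apply: int2Z_neq0; exact: denq_neq0.
by rewrite /Defs.Q2R; apply: (Rmult_eq_reg_r (IZR (int2Z (denq x)) * IZR (int2Z d))); [field_simplify; lra | exact: Rmult_integral_contrapositive_currified].
Qed.

Lemma Q2R_add a b : Defs.Q2R (a + b)%R = Defs.Q2R a + Defs.Q2R b.
Proof.
have da := denq_neq0 a; have db := denq_neq0 b.
rewrite -{1}[a]divq_num_den -{1}[b]divq_num_den addf_div ?intr_eq0 // -!rmorphM -rmorphD Q2R_frac ?mulf_neq0 //.
rewrite int2Z_add !int2Z_mul plus_IZR !mult_IZR /Defs.Q2R -/(denq a) -/(denq b); field.
by split; apply: not_0_IZR; exact: int2Z_neq0.
Qed.

Lemma Q2R_mul a b : Defs.Q2R (a * b)%R = Defs.Q2R a * Defs.Q2R b.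
Proof.
have da := denq_neq0 a; have db := denq_neq0 b.
rewrite -{1}[a]divq_num_den -{1}[b]divq_num_den mulf_div -!rmorphM Q2R_frac ?mulf_neq0 //.
rewrite !int2Z_mul !mult_IZR /Defs.Q2R -/(denq a) -/(denq b) -/(numq a) -/(numq b); field.
by split; apply: not_0_IZR; exact: int2Z_neq0.
Qed.

Lemma Q2R_nat n : Defs.Q2R (n%:R)%R = INR n.
Proof.
have -> : (n%:R = (n%:Z)%:~R / 1%:~R :> rat)%R by rewrite divr1 -pmulrn.
by rewrite Q2R_frac //= INR_IZR_INZ /Rdiv Rinv_1 Rmult_1_r.
Qed.

Lemma Q2C_add a b : Q2C (a + b)%R = (Q2C a + Q2C b)%C.
Proof. by rewrite /Q2C Q2R_add RtoC_plus. Qed.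

Lemma Q2C_mul a b : Q2C (a * b)%R = (Q2C a * Q2C b)%C.
Proof. by rewrite /Q2C Q2R_mul RtoC_mult. Qed.

Lemma Q2C_nat n : Q2C (n%:R)%R = RtoC (INR n).
Proof. by rewrite /Q2C Q2R_nat. Qed.

Lemma Q2C_0 : Q2C 0%R = 0.
Proof. exact: (Q2C_nat 0). Qed.

Lemma Q2C_1 : Q2C 1%R = 1.
Proof. exact: (Q2C_nat 1). Qed.

Lemma Q2C_opp a : Q2C (- a)%R = (- Q2C a)%C.
Proof.
have h : (Q2C (- a)%R + Q2C a = 0)%C by rewrite -Q2C_add addNr Q2C_0.
by have -> : (Q2C (- a)%R = (Q2C (- a)%R + Q2C a) - Q2C a)%C by [ring]; rewrite h; ring.
Qed.

Lemma Q2C_inv_nat n : (Q2C (n.+1%:R^-1)%R * RtoC (INR n.+1))%C = 1.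
Proof. by rewrite -Q2C_nat -Q2C_mul mulVf ?Q2C_1 // pnatr_eq0. Qed.

Lemma int2C_sub_nat y n : int2C (y - n%:Z)%R = (int2C y - RtoC (INR n))%C.
Proof. by rewrite /int2C int2Z_add int2Z_opp plus_IZR opp_IZR /= -INR_IZR_INZ RtoC_plus RtoC_opp. Qed.

Lemma int2C_opp_nat n : int2C (- n%:Z)%R = (- RtoC (INR n))%C.
Proof. by rewrite /int2C int2Z_opp opp_IZR /= -INR_IZR_INZ RtoC_opp. Qed.

Lemma cbinom_bin n l : cbinom (RtoC (INR n)) l = RtoC (INR 'C(n, l)).
Proof.
elim: n l => [|n IH] [|l]; rewrite ?bin0 //; first by rewrite cbinom_INR_gt.
by rewrite S_INR RtoC_plus cbinom_pascal !IH binS plus_INR RtoC_plus.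
Qed.

(* A triple [(q, e, k)] stands for [q p^e zeta_p(k)], or for [q t^e zeta_U(k; 0, t)]. *)
Definition term := (rat * nat * seq int)%type.

(** The relation solved for its term l = 0, whose coefficient is the binomial m + 1: the lower
    powers, the upper end and the lower end of the telescoped sum, all divided by m + 1. *)
Definition red (m : nat) (k1 k2 : seq int) : seq term :=
  let c : rat := (m.+1%:R^-1)%R in
  [seq (- ('C(m.+1, l.+2)%:R * c), 0%N, k1 ++ (- (m - l.+1)%:Z) :: k2)%R | l <- iota 0 m]
  ++ match k2 with
     | [::] => [:: (c, m.+1, k1)]
     | y :: k' => [:: (c, 0%N, k1 ++ (y - m.+1%:Z) :: k')%R]
     end
  ++ match rev k1 with
     | [::] => [:: (- c, 0%N, k2)%R]
     | x :: k' => [seq (- ('C(m.+1, i)%:R * c), 0%N, rev k' ++ (x - (m.+1 - i)%:Z) :: k2)%R | i <- iota 0 m.+2]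
     end.

Definition evQ (L : seq term) (N : nat) : rat :=
  (\sum_(T <- L) T.1.1 * N%:R ^+ T.1.2 * zeta_trunc T.2 N)%R.

Section RedRational.
Local Open Scope ring_scope.

Lemma big_iota n (f : nat -> rat) : \sum_(i <- iota 0 n) f i = \sum_(i < n) f i.
Proof. by rewrite -[n in iota 0 n]subn0 -/(index_iota 0 n) big_mkord. Qed.

Lemma zeta_trunc_cat k1 x k2 N : zeta_trunc (k1 ++ x :: k2) N = outer (rev k2) (trunc_rev (x :: rev k1)) N.
Proof. by rewrite /zeta_trunc rev_cat rev_cons cat_rcons trunc_rev_cat. Qed.

Lemma outer_rcons A z f N : outer (rcons A z) f N = outer A (fun n => \sum_(1 <= k < n) ((k%:R : rat) ^ (- z)) * f k) N.
Proof. by elim: A N => [//|y A IH] N /=; apply: eq_bigr => n _; rewrite IH. Qed.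

Lemma zeta_relation m k1 k2 N : (0 < N)%N ->
  \sum_(l < m.+1) 'C(m.+1, l.+1)%:R * zeta_trunc (k1 ++ (- (m - l)%:Z) :: k2) N =
  match k2 with
  | [::] => N%:R ^+ m.+1 * zeta_trunc k1 N
  | y :: k' => zeta_trunc (k1 ++ (y - m.+1%:Z) :: k') N
  end -
  match rev k1 with
  | [::] => zeta_trunc k2 N
  | x :: k' => \sum_(i < m.+2) 'C(m.+1, i)%:R * zeta_trunc (rev k' ++ (x - (m.+1 - i)%:Z) :: k2) N
  end.
Proof.
move=> hN.
have -> : \sum_(l < m.+1) 'C(m.+1, l.+1)%:R * zeta_trunc (k1 ++ (- (m - l)%:Z) :: k2) N =
    outer (rev k2) (fun n => n%:R ^+ m.+1 * trunc_rev (rev k1) n - left_rev m (rev k1) n) N.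
  under eq_bigr do rewrite zeta_trunc_cat.
  rewrite -(outer_sum (rev k2) (fun l => 'C(m.+1, l.+1)%:R) (fun l => trunc_rev ((- (m - l)%:Z) :: rev k1)) m.+1 N).
  by apply: outer_ext hN => n hn; exact: telescope_rev.
rewrite outer_sub; congr (_ - _).
  case: k2 => [//|y k2]; rewrite zeta_trunc_cat rev_cons outer_rcons; apply: outer_ext hN => n hn /=.
  rewrite !big_nat; apply: eq_bigr => k /andP [hk _].
  by rewrite opprB addrC expfzDr ?pnatr_eq0 -?lt0n // -mulrA.
case: (rev k1) => [|x k'] /=.
  by rewrite /zeta_trunc -[in RHS](cats0 (rev k2)) trunc_rev_cat.
rewrite (outer_sum (rev k2) (fun i => 'C(m.+1, i)%:R) (fun i => trunc_rev ((x - (m.+1 - i)%:Z) :: k')) m.+2 N).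
by apply: eq_bigr => i _; rewrite zeta_trunc_cat revK.
Qed.

Lemma red_rational m k1 k2 N : (0 < N)%N ->
  zeta_trunc (k1 ++ (- m%:Z) :: k2) N = evQ (red m k1 k2) N.
Proof.
move=> hN; have := zeta_relation m k1 k2 hN; set Rt := match k2 with [::] => _ | _ => _ end; set Lt := match rev k1 with [::] => _ | _ => _ end.
rewrite big_ord_recl bin1 subn0 => h.
have m0 : (m.+1%:R : rat) != 0 by rewrite pnatr_eq0.
have -> : zeta_trunc (k1 ++ (- m%:Z) :: k2) N =
   (- (\sum_(i < m) 'C(m.+1, (lift ord0 i).+1)%:R * zeta_trunc (k1 ++ (- (m - lift ord0 i)%:Z) :: k2) N) + (Rt - Lt)) * m.+1%:R^-1.
  by rewrite -h addrCA addNr addr0 mulrAC mulfV // mul1r.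
rewrite /evQ /red !big_cat !mulrDl; congr (_ + (_ + _)).
- rewrite big_map (big_iota m (fun l => _)) /= mulNr big_distrl /= -sumrN; apply: eq_bigr => i _.
  by rewrite /bump leq0n add1n expr0 mulr1 mulNr -mulrA [zeta_trunc _ _ * _]mulrC mulrA.
- rewrite /Rt; case: (k2) => [|y k']; rewrite big_seq1 /= ?expr0 ?mulr1 mulrC //.
  by rewrite mulrA.
- rewrite /Lt; case: (rev k1) => [|x k']; first by rewrite big_seq1 /= expr0 mulr1 mulrC mulrN mulNr.
  rewrite big_map (big_iota m.+2 (fun l => _)) mulNr big_distrl /= -sumrN; apply: eq_bigr => i _.
  by rewrite expr0 mulr1 mulNr -mulrA [zeta_trunc _ _ * _]mulrC mulrA.
Qed.

End RedRational.

Definition evC (t : C) (Z : seq int -> C) (L : seq term) : C :=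
  foldr (fun (T : term) acc => Q2C T.1.1 * (Cpow t T.1.2 * Z T.2) + acc)%C (RtoC 0) L.

Lemma evC_cat t Z L1 L2 : evC t Z (L1 ++ L2) = (evC t Z L1 + evC t Z L2)%C.
Proof. by elim: L1 => [|T L IH] /=; [ring | rewrite IH; ring]. Qed.

Lemma evC_iota t Z (q : nat -> rat) (k : nat -> seq int) n :
  evC t Z [seq (q i, 0%N, k i) | i <- iota 0 n] = csum (fun i => Q2C (q i) * Z (k i))%C n.
Proof.
elim: n => [//|n IH]; rewrite -addn1 iotaD map_cat evC_cat IH addn1 csumS /=.
by rewrite add0n; ring.
Qed.

(** [F] serves depth r + 1 and [G] depth r, the only depths that occur in [red]. *)
Definition two_level (r : nat) (F G : seq C -> C) (k : seq int) : C :=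
  if size k == r.+1 then F (map int2C k) else G (map int2C k).

Lemma two_level_top r F G k : size k = r.+1 -> two_level r F G k = F (map int2C k).
Proof. by rewrite /two_level => ->; rewrite eqxx. Qed.

Lemma two_level_low r F G k : size k = r -> two_level r F G k = G (map int2C k).
Proof. by rewrite /two_level => ->; have -> : (r == r.+1) = false by apply/eqP; lia. Qed.

(** The computation of [red_rational] with [relation_all] as its input; one list of terms thus
    describes both sides. *)
Lemma red_complex r m t F G k1 k2 : tdom t -> zetaU_extension r.+1 0 t F -> zetaU_extension r 0 t G ->
  (size k1 + size k2)%N = r ->
  F (map int2C (k1 ++ (- m%:Z)%R :: k2)) = evC t (two_level r F G) (red m k1 k2).
Proof.
move=> ht HF HG hs.
have hs1 : (size (map int2C k1) + size (map int2C k2))%N = r by rewrite !size_map.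
have := relation_all m ht HF HG hs1.
rewrite /relsum csum_S_l subn0 cbinom_bin bin1.
set S := csum _ m; set A := rightv _ _ _ _ _; set B := leftv _ _ _ _ => h.
set c := Q2C (m.+1%:R^-1)%R; have hc : (c * RtoC (INR m.+1))%C = 1 by exact: Q2C_inv_nat.
have -> : F (map int2C (k1 ++ (- m%:Z)%R :: k2)) = (- c * S + (c * A + - c * B))%C.
  rewrite map_cat map_cons int2C_opp_nat; set X := F _ in h *.
  have -> : X = (c * (RtoC (INR m.+1) * X + S) - c * S)%C.
    by have -> : (c * (RtoC (INR m.+1) * X + S) - c * S = (c * RtoC (INR m.+1)) * X)%C by [ring]; rewrite hc; ring.
  by rewrite h; ring.
rewrite /red !evC_cat; congr (_ + (_ + _))%C.
- rewrite (evC_iota t _ (fun l => - ('C(m.+1, l.+2)%:R * m.+1%:R^-1))%R (fun l => k1 ++ (- (m - l.+1)%:Z)%R :: k2)).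
  rewrite /S -csum_mull; apply: csum_ext => l _; rewrite two_level_top ?size_cat_cons; last by rewrite addnS hs.
  by rewrite map_cat map_cons int2C_opp_nat Q2C_opp Q2C_mul Q2C_nat cbinom_bin -/c; ring.
- rewrite /A; case: (k2) hs => [|y k'] hs; rewrite /evC; cbn [rightv map foldr fst snd]; rewrite -/c.
    rewrite two_level_low -?hs ?addn0 //. by cbn [Cpow]; ring.
  rewrite two_level_low; last by rewrite size_cat_cons; exact: hs.
  by rewrite map_cat map_cons int2C_sub_nat; ring.
- rewrite /B /leftv -map_rev.
  have e : size (rev k1) = size k1 by rewrite size_rev.
  case: (rev k1) e => [|x k'] e; last rewrite [map int2C (x :: k')]map_cons.
    by rewrite /= Q2C_opp -/c two_level_low; [cbn [Cpow]; ring | rewrite -hs -e].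
  rewrite (evC_iota t _ (fun i => - ('C(m.+1, i)%:R * m.+1%:R^-1))%R (fun i => rev k' ++ (x - (m.+1 - i)%:Z)%R :: k2)).
  rewrite -csum_mull; apply: csum_ext => i _.
  rewrite two_level_low ?size_cat_cons; last by rewrite size_rev -hs -e /= addnS.
  by rewrite map_cat map_cons int2C_sub_nat map_rev Q2C_opp Q2C_mul Q2C_nat cbinom_bin -/c; ring.
Qed.

Lemma red_terms m k1 k2 T : T \in red m k1 k2 ->
  (exists2 m', (m' < m)%N & T.2 = k1 ++ (- m'%:Z)%R :: k2) \/ size T.2 = (size k1 + size k2)%N.
Proof.
rewrite /red !mem_cat => /orP [/mapP [l]|/orP []].
- by rewrite mem_iota => h ->; left; exists (m - l.+1)%N => //; lia.
- case: k2 => [|y k']; rewrite inE => /eqP -> /=; right; first by rewrite addn0.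
  by rewrite size_cat_cons.
- have e : size (rev k1) = size k1 by rewrite size_rev.
  case: (rev k1) e => [|x k'] e.
    by rewrite inE => /eqP -> /=; right; rewrite -e.
  by move=> /mapP [i _ ->] /=; right; rewrite size_cat_cons size_rev -e /= addnS.
Qed.

(** Entries created at lower depth may be very negative, which is harmless because depth is compared
    first; at equal depth only the treated entry changes, and it moves towards 0. *)
Lemma index_ind (P : seq int -> Prop) : (forall k, positive_index k -> P k) ->
  (forall k1 m k2, (forall T, T \in red m k1 k2 -> P T.2) -> P (k1 ++ (- m%:Z)%R :: k2)) -> forall k, P k.
Proof.
move=> Hp Hs k; move: {2}(size k) (erefl (size k)) => n; elim: n k => [|n IH] k hk.
  by case: k hk => // _; apply: Hp.
case hpos : (positive_index k); first exact: Hp.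
have [x xk hx] : exists2 x, x \in k & ~~ (0 < x)%R by apply/allPn; rewrite -/(positive_index k) hpos.
have [m hm] : exists m : nat, x = (- m%:Z)%R by exists `|x|%N; lia.
case/splitPr: xk hk hpos => k1 k2; rewrite size_cat_cons addnS => -[hk] _; rewrite {}hm {x hx}.
elim/ltn_ind: m => m IHm; apply: Hs => T /red_terms [[m' hm' ->]|hT]; first exact: IHm.
by apply: IH; rewrite hT.
Qed.

(** * The finite model *)

Section PIntegral.
Local Open Scope ring_scope.
Variable p : nat.
Hypothesis pp : prime p.

(** [pval_ge] refers to the reduced fraction; coprimality of [numq] and [denq] transfers the
    divisibilities from an arbitrary one. *)
Lemma pval_frac n (a b : int) : b != 0 -> (p ^ n %| `|a|)%N -> ~~ (p %| `|b|)%N ->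
  pval_ge p n (a%:~R / b%:~R).
Proof.
move=> b0 ha hb; set x : rat := a%:~R / b%:~R.
have hx : numq x * b = a * denq x.
  apply: (@intr_inj rat); rewrite !rmorphM /=; apply/eqP.
  by rewrite -eqr_div ?intr_eq0 ?denq_neq0 // divq_num_den.
have hN : (`|numq x| * `|b| = `|a| * `|denq x|)%N by rewrite -!abszM hx.
have cop := coprime_num_den x; rewrite /pval_ge; apply/andP; split.
  have c : coprime (p ^ n) `|b| by rewrite coprimeXl // prime_coprime.
  by rewrite -(Gauss_dvdl _ c) hN dvdn_mulr.
have d : (`|denq x| %| `|b|)%N.
  by rewrite -(Gauss_dvdr (m := `|denq x|%N) (n := `|numq x|%N)) ?hN ?dvdn_mull // coprime_sym.
by apply: contra hb => h; exact: dvdn_trans d.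
Qed.

Lemma pval_exists n x : pval_ge p n x -> exists a b : int,
  [/\ b != 0, (p ^ n %| `|a|)%N, ~~ (p %| `|b|)%N & x = a%:~R / b%:~R].
Proof.
by move=> /andP [h1 h2]; exists (numq x), (denq x); split; rewrite ?denq_neq0 ?divq_num_den.
Qed.

Lemma pval_add n x y : pval_ge p n x -> pval_ge p n y -> pval_ge p n (x + y).
Proof.
move=> /pval_exists [a [b [b0 ha hb ->]]] /pval_exists [c [d [d0 hc hd ->]]].
rewrite addf_div ?intr_eq0 // -!rmorphM -rmorphD; apply: pval_frac; first exact: mulf_neq0.
- have h1 : ((p ^ n)%N%:Z %| a * d)%Z by rewrite dvdzE abszM; apply: dvdn_mulr.
  have h2 : ((p ^ n)%N%:Z %| c * b)%Z by rewrite dvdzE abszM; apply: dvdn_mulr.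
  by have := rpredD h1 h2.
- by rewrite abszM Euclid_dvdM // negb_or hb.
Qed.

Lemma pval_mul n k x y : pval_ge p n x -> pval_ge p k y -> pval_ge p (n + k) (x * y).
Proof.
move=> /pval_exists [a [b [b0 ha hb ->]]] /pval_exists [c [d [d0 hc hd ->]]].
rewrite mulf_div -!rmorphM; apply: pval_frac; first exact: mulf_neq0.
- by rewrite abszM expnD dvdn_mul.
- by rewrite abszM Euclid_dvdM // negb_or hb.
Qed.

Lemma pval_int n (a : int) : (p ^ n %| `|a|)%N -> pval_ge p n a%:~R.
Proof.
move=> h; have -> : (a%:~R : rat) = a%:~R / 1%:~R by rewrite divr1.
by apply: pval_frac => //=; rewrite dvdn1 neq_ltn prime_gt1 // orbT.
Qed.

Lemma pval_0 n : pval_ge p n 0.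
Proof. by have := @pval_int n 0 (dvdn0 _). Qed.

Lemma pval_1 : pval_ge p 0 1.
Proof. by have := @pval_int 0 1 (dvd1n _). Qed.

Lemma pval_opp n x : pval_ge p n x -> pval_ge p n (- x).
Proof. by rewrite /pval_ge numqN denqN abszN. Qed.

Lemma pval_le n k x : (k <= n)%N -> pval_ge p n x -> pval_ge p k x.
Proof. by move=> h /andP [h1 h2]; rewrite /pval_ge h2 andbT; apply: dvdn_trans h1; exact: dvdn_exp2l. Qed.

Lemma pval_mulr n x y : pval_ge p n x -> pval_ge p 0 y -> pval_ge p n (x * y).
Proof. by move=> h1 h2; have := pval_mul h1 h2; rewrite addn0. Qed.

Lemma pval_pow e : pval_ge p e (p%:R ^+ e).
Proof. by have := @pval_int e (p ^ e)%N (dvdnn _); rewrite -pmulrn natrX. Qed.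

(** n is a unit modulo p, so the exponent may have either sign; this is why zeta_p is p-integral at
    all integer indices. *)
Lemma pval_nat_pow (n : nat) (z : int) : (0 < n < p)%N -> pval_ge p 0 ((n%:R : rat) ^ z).
Proof.
move=> /andP [n0 np].
have hn : pval_ge p 0 (n%:R : rat) by have := @pval_int 0 n (dvd1n _).
have hi : pval_ge p 0 (n%:R^-1 : rat).
  have -> : (n%:R^-1 : rat) = 1%:~R / n%:~R by rewrite div1r.
  apply: pval_frac; rewrite ?dvd1n //; first by lia.
  by rewrite absz_nat gtnNdvd.
have hx (x : rat) e : pval_ge p 0 x -> pval_ge p 0 (x ^+ e).
  by move=> h; elim: e => [|e IH]; [exact: pval_1 | rewrite exprS; exact: pval_mulr].
case: z => e; first exact: hx.
by rewrite NegzE -exprnN -exprVn; exact: hx.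
Qed.

Lemma pval_sum m n (f : nat -> rat) : (forall i, (m <= i < n)%N -> pval_ge p 0 (f i)) ->
  pval_ge p 0 (\sum_(m <= i < n) f i).
Proof.
move=> h; rewrite big_nat; elim/big_ind: _ => //; first exact: pval_0.
by move=> x y; exact: pval_add.
Qed.

Lemma trunc_rev_integral rk N : (N <= p)%N -> pval_ge p 0 (trunc_rev rk N).
Proof.
elim: rk N => [|k rk IH] N hN; first exact: pval_1.
apply: pval_sum => n /andP [h1 h2]; apply: pval_mulr.
  by apply: pval_nat_pow; rewrite h1; exact: leq_trans hN.
by apply: IH; apply: ltnW; exact: leq_trans hN.
Qed.

Lemma zeta_p_integral k : pval_ge p 0 (zeta_p k p).
Proof. exact: trunc_rev_integral. Qed.

Lemma pval_const (q : rat) : (`|denq q| < p)%N -> pval_ge p 0 q.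
Proof.
move=> h; rewrite /pval_ge expn0 dvd1n gtnNdvd //.
by rewrite absz_gt0 denq_neq0.
Qed.

End PIntegral.

Section Congruences.
Local Open Scope ring_scope.

Lemma admissible_zeta k : admissible (zetaA k).
Proof. by exists 0%N => p pp _; exact: zeta_p_integral. Qed.

Lemma admissible_const q : admissible (fun _ => q).
Proof. by exists `|denq q|.+1 => p pp h; exact: pval_const. Qed.

Lemma admissible_pow e : admissible (fun p => p%:R ^+ e).
Proof. by exists 0%N => p pp _; apply: pval_le (pval_pow pp e). Qed.

Lemma admissible_add a b : admissible a -> admissible b -> admissible (Defs.addA a b).
Proof.
move=> [N1 h1] [N2 h2]; exists (N1 + N2)%N => p pp h.
by apply: pval_add => //; [apply: h1 | apply: h2] => //; apply: leq_trans h; rewrite ?leq_addr ?leq_addl.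
Qed.

Lemma admissible_mul a b : admissible a -> admissible b -> admissible (Defs.mulA a b).
Proof.
move=> [N1 h1] [N2 h2]; exists (N1 + N2)%N => p pp h.
by apply: pval_mulr => //; [apply: h1 | apply: h2] => //; apply: leq_trans h; rewrite ?leq_addr ?leq_addl.
Qed.

Lemma eqAn_ext n a b : (forall p, (0 < p)%N -> a p = b p) -> eqAn n a b.
Proof. by move=> h; exists 0%N => p pp _; rewrite h ?prime_gt0 // subrr; exact: pval_0. Qed.

Lemma eqAn_refl n a : eqAn n a a.
Proof. exact: eqAn_ext. Qed.

Lemma eqAn_mul n a b a' b' : admissible a -> admissible b' -> eqAn n a a' -> eqAn n b b' ->
  eqAn n (Defs.mulA a b) (Defs.mulA a' b').
Proof.
move=> [N1 h1] [N2 h2] [N3 h3] [N4 h4]; exists (N1 + (N2 + (N3 + N4)))%N => p pp h.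
have le1 : (N1 <= p)%N by lia.
have le2 : (N2 <= p)%N by lia.
have le3 : (N3 <= p)%N by lia.
have le4 : (N4 <= p)%N by lia.
have -> : Defs.mulA a b p - Defs.mulA a' b' p = (b p - b' p) * a p + (a p - a' p) * b' p.
  by rewrite /Defs.mulA mulrBl mulrBl [b p * _]mulrC [b' p * a p]mulrC addrA subrK.
by apply: pval_add => //; apply: pval_mulr => //; [exact: h4 | exact: h1 | exact: h3 | exact: h2].
Qed.

Lemma isAh_seq (a : nat -> rat) : admissible a -> isAh (fun _ => a).
Proof. by move=> h; split=> n //; exact: eqAn_refl. Qed.

Lemma isAh_add x y : isAh x -> isAh y -> isAh (addAh x y).
Proof.
move=> [h1 h2] [h3 h4]; split=> n; first exact: admissible_add.
have [N1 q1] := h2 n; have [N2 q2] := h4 n; exists (N1 + N2)%N => p pp h.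
have -> : addAh x y n.+1 p - addAh x y n p = (x n.+1 p - x n p) + (y n.+1 p - y n p).
  by rewrite /addAh opprD addrACA.
by apply: pval_add => //; [apply: q1 | apply: q2] => //; lia.
Qed.

Lemma isAh_mul x y : isAh x -> isAh y -> isAh (mulAh x y).
Proof.
move=> [h1 h2] [h3 h4]; split=> n; first exact: admissible_mul.
by apply: (@eqAn_mul n (x n.+1) (y n.+1) (x n) (y n)).
Qed.

Lemma ZAh0_isAh x : ZAh0 x -> isAh x.
Proof.
elim=> [k _||q|y z _ hy _ hz|y z _ hy _ hz|//].
- exact: isAh_seq (admissible_zeta k).
- by apply: isAh_seq; have := admissible_pow 1; congr admissible; apply: functional_extensionality => p; rewrite expr1.
- exact: isAh_seq (admissible_const q).
- exact: isAh_add.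
- exact: isAh_mul.
Qed.

Lemma ZAh0_ZAh x : ZAh0 x -> ZAh x.
Proof.
move=> h; split; first exact: ZAh0_isAh.
exists (fun _ => x); split=> // m; exists 0%N => i _; exists (constAh 0).
split; first exact: isAh_seq (admissible_const 0).
by move=> n; apply: eqAn_ext => p _; rewrite /subAh /mulAh /constAh subrr mulr0.
Qed.

End Congruences.

(** * Arithmetic modulo pi i Z[pi i] *)

Lemma Zpi_0 : Zpi 0.
Proof. by rewrite -Q2C_0; exact: Zpi_const. Qed.

Lemma Zpi_opp z : Zpi z -> Zpi (- z)%C.
Proof.
move=> h; have -> : (- z = Q2C (- 1)%R * z)%C by rewrite Q2C_opp Q2C_1; ring.
by apply: Zpi_mul h; exact: Zpi_const.
Qed.

Lemma piZpi_0 : in_piZpi 0.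
Proof. by exists 0; split; [exact: Zpi_0 | ring]. Qed.

Lemma piZpi_add z w : in_piZpi z -> in_piZpi w -> in_piZpi (z + w)%C.
Proof. by move=> [a [ha ->]] [b [hb ->]]; exists (a + b)%C; split; [exact: Zpi_add | ring]. Qed.

Lemma piZpi_mul z w : Zpi z -> in_piZpi w -> in_piZpi (z * w)%C.
Proof. by move=> hz [b [hb ->]]; exists (z * b)%C; split; [exact: Zpi_mul | ring]. Qed.

Lemma eqZbar_refl z : eqZbar z z.
Proof. by rewrite /eqZbar; have -> : (z - z = 0)%C by [ring]; exact: piZpi_0. Qed.

Lemma eqZbar_sym z w : eqZbar z w -> eqZbar w z.
Proof.
move=> [a [ha e]]; exists (- a)%C; split; first exact: Zpi_opp.
by have -> : (w - z = - (z - w))%C by [ring]; rewrite e; ring.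
Qed.

Lemma eqZbar_trans z w v : eqZbar z w -> eqZbar w v -> eqZbar z v.
Proof.
move=> h1 h2; rewrite /eqZbar; have -> : (z - v = (z - w) + (w - v))%C by ring.
exact: piZpi_add.
Qed.

Lemma eqZbar_add z w z' w' : eqZbar z z' -> eqZbar w w' -> eqZbar (z + w) (z' + w').
Proof.
move=> h1 h2; rewrite /eqZbar; have -> : (z + w - (z' + w') = (z - z') + (w - w'))%C by ring.
exact: piZpi_add.
Qed.

Lemma Zpi_eqZbar z w : Zpi z -> eqZbar z w -> Zpi w.
Proof.
move=> hz [a [ha e]]; have -> : w = (z + - (piI * a))%C by rewrite -e; ring.
by apply: Zpi_add hz _; apply: Zpi_opp; apply: Zpi_mul ha; exact: Zpi_pii.
Qed.

Lemma eqZbar_mul z w z' w' : Zpi z -> Zpi w -> eqZbar z z' -> eqZbar w w' -> eqZbar (z * w) (z' * w').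
Proof.
move=> hz hw h1 h2; rewrite /eqZbar; have -> : (z * w - z' * w' = z * (w - w') + w' * (z - z'))%C by ring.
by apply: piZpi_add; apply: piZpi_mul => //; exact: Zpi_eqZbar h2.
Qed.

Lemma evQ_cons T L : evQ (T :: L) = Defs.addA (Defs.mulA (Defs.mulA (constA T.1.1) (fun p => p%:R ^+ T.1.2)%R) (zetaA T.2)) (evQ L).
Proof. by apply: functional_extensionality => p; rewrite /evQ big_cons. Qed.

Section FiniteModel.

Variable phi : (nat -> rat) -> C.
Hypothesis iso : QalgIso_A phi.

Lemma phi_Zpi a : ZA a -> Zpi (phi a). Proof. by case: iso => h _; exact: h. Qed.

Lemma phi_eq a b : ZA a -> ZA b -> eqA a b <-> eqZbar (phi a) (phi b).
Proof. by case: iso => _ [h _]; exact: h. Qed.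

Lemma phi_add a b : ZA a -> ZA b -> eqZbar (phi (Defs.addA a b)) (phi a + phi b).
Proof. by case: iso => _ [_ [_ [h _]]]; exact: h. Qed.

Lemma phi_mul a b : ZA a -> ZA b -> eqZbar (phi (Defs.mulA a b)) (phi a * phi b).
Proof. by case: iso => _ [_ [_ [_ [h _]]]]; exact: h. Qed.

Lemma phi_const q : eqZbar (phi (constA q)) (Q2C q).
Proof. by case: iso => _ [_ [_ [_ [_ h]]]]; exact: h. Qed.

Lemma phi_add_eq a b z w : ZA a -> ZA b -> eqZbar (phi a) z -> eqZbar (phi b) w ->
  eqZbar (phi (Defs.addA a b)) (z + w).
Proof. by move=> ha hb h1 h2; apply: eqZbar_trans (phi_add ha hb) _; exact: eqZbar_add. Qed.

Lemma phi_mul_eq a b z w : ZA a -> ZA b -> eqZbar (phi a) z -> eqZbar (phi b) w ->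
  eqZbar (phi (Defs.mulA a b)) (z * w).
Proof.
move=> ha hb h1 h2; apply: eqZbar_trans (phi_mul ha hb) _.
by apply: eqZbar_mul => //; exact: phi_Zpi.
Qed.

(** p vanishes modulo p, which corresponds to t = 0; the case e = 0 gives 1 on both sides and covers
    the terms without a power. *)
Lemma phi_pow e : ZA (fun p => p%:R ^+ e)%R /\ eqZbar (phi (fun p => p%:R ^+ e)%R) (Cpow 0 e).
Proof.
case: e => [|e].
  have -> : (fun p : nat => p%:R ^+ 0 : rat)%R = constA 1%R by apply: functional_extensionality => p; rewrite expr0.
  by split; [exact: ZA_const | have := phi_const 1%R; rewrite Q2C_1].
have h : eqA (constA 0%R) (fun p => p%:R ^+ e.+1)%R.
  exists 0%N => p pp _; rewrite /constA sub0r; apply: pval_opp.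
  by apply: (@pval_le p e.+1) => //; exact: pval_pow.
have hz : ZA (fun p => p%:R ^+ e.+1)%R by apply: ZA_eq (ZA_const 0%R) _ h; exact: admissible_pow.
split=> //; apply: eqZbar_trans (eqZbar_sym (proj1 (phi_eq (ZA_const 0%R) hz) h)) _.
have -> : Cpow 0 e.+1 = Q2C 0%R by rewrite Q2C_0 /=; ring.
exact: phi_const.
Qed.

Lemma phi_evQ (Z : seq int -> C) L :
  (forall T : term, T \in L -> ZA (zetaA T.2) /\ eqZbar (phi (zetaA T.2)) (Z T.2)) ->
  ZA (evQ L) /\ eqZbar (phi (evQ L)) (evC 0 Z L).
Proof.
elim: L => [|T L IH] H.
  have -> : evQ [::] = constA 0%R by apply: functional_extensionality => p; rewrite /evQ big_nil.
  by split; [exact: ZA_const | have := phi_const 0%R; rewrite Q2C_0].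
have [h1 h2] := IH (fun T' h => H T' (mem_behead (s := T :: L) h)).
have [h3 h4] := H T (mem_head _ _); have [h5 h6] := phi_pow T.1.2.
have h7 := ZA_mul (ZA_const T.1.1) h5; rewrite evQ_cons; split.
  by apply: ZA_add h1; exact: ZA_mul.
have -> : evC 0 Z (T :: L) = (Q2C T.1.1 * Cpow 0 T.1.2 * Z T.2 + evC 0 Z L)%C.
  have alg (x y z w : C) : (x * (y * z) + w = x * y * z + w)%C by ring.
  exact: alg.
apply: phi_add_eq => //; first exact: ZA_mul.
apply: phi_mul_eq => //; apply: phi_mul_eq => //; [exact: ZA_const | exact: phi_const].
Qed.

Hypothesis pos : forall k v, positive_index k -> zetaU00_is k v -> eqZbar (phi (zetaA k)) v.

(** Membership follows from [red] alone. For the value, [zetaU00_is] supplies an extension in the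
    depth of the index and [ext_lower] one in the depth below; these two witness the values of all
    terms of [red], as the induction hypothesis requires. *)
Lemma finite_all_indices k : ZA (zetaA k) /\ forall v, zetaU00_is k v -> eqZbar (phi (zetaA k)) v.
Proof.
elim/index_ind: k => [k hk|k1 m k2 IH]; first by split; [exact: ZA_gen | move=> v; exact: pos].
have hL : eqA (evQ (red m k1 k2)) (zetaA (k1 ++ (- m%:Z)%R :: k2)).
  by apply: eqAn_ext => p hp; rewrite /zetaA /zeta_p red_rational.
(* Only membership is extracted here, so the values of [phi] themselves can be inserted. *)
have [hZ _] := @phi_evQ (fun k => phi (zetaA k)) _ (fun T h => conj (IH T h).1 (eqZbar_refl _)).
have hk : ZA (zetaA (k1 ++ (- m%:Z)%R :: k2)) by apply: ZA_eq hZ _ hL; exact: admissible_zeta.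
split=> // v [F [HF <-]].
rewrite size_cat_cons addnS in HF; have [G HG] := ext_lower tdom_0 HF.
rewrite (red_complex m tdom_0 HF HG erefl).
apply: eqZbar_trans (eqZbar_sym (proj1 (phi_eq hZ hk) hL)) _.
apply: (proj2 (phi_evQ _)) => T hT; have [h1 h2] := IH T hT; split=> //; apply: h2.
have [hs|hs] : size T.2 = (size k1 + size k2).+1 \/ size T.2 = (size k1 + size k2)%N.
- by case: (red_terms hT) => [[m' _ ->]|]; [left; rewrite size_cat_cons addnS | right].
- by exists F; rewrite hs two_level_top.
- by exists G; rewrite hs two_level_low.
Qed.

Lemma finite_linear_relations n (a : nat -> rat) (ks : nat -> seq int) (v : nat -> C) :
  (forall i, (i < n)%N -> zetaU00_is (ks i) (v i)) ->
  (eqA (fun p => (\sum_(i < n) a i * zeta_p (ks i) p)%R) (constA 0%R)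
   <-> eqZbar (csum (fun i => Cmult (Q2C (a i)) (v i)) n) (RtoC 0)).
Proof.
move=> hv.
have [h1 h2] : ZA (fun p => (\sum_(i < n) a i * zeta_p (ks i) p)%R) /\
    eqZbar (phi (fun p => (\sum_(i < n) a i * zeta_p (ks i) p)%R)) (csum (fun i => Cmult (Q2C (a i)) (v i)) n).
  elim: n hv => [|n IH] hv.
    have -> : (fun p => \sum_(i < 0) a i * zeta_p (ks i) p)%R = constA 0%R.
      by apply: functional_extensionality => p; rewrite big_ord0.
    by split; [exact: ZA_const | have := phi_const 0%R; rewrite Q2C_0].
  have -> : (fun p => \sum_(i < n.+1) a i * zeta_p (ks i) p)%R =
      Defs.addA (fun p => \sum_(i < n) a i * zeta_p (ks i) p)%R (Defs.mulA (constA (a n)) (zetaA (ks n))).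
    by apply: functional_extensionality => p; rewrite big_ord_recr.
  have [h1 h2] := IH (fun i hi => hv i (ltnW hi)); have [h3 h4] := finite_all_indices (ks n).
  have h5 := ZA_mul (ZA_const (a n)) h3; split; first exact: ZA_add.
  apply: phi_add_eq => //; apply: phi_mul_eq => //; [exact: ZA_const | exact: phi_const |].
  by apply: h4; exact: hv.
have h0 := phi_const 0%R; rewrite Q2C_0 in h0.
split=> [/(phi_eq h1 (ZA_const _)) h|h].
  by apply: eqZbar_trans (eqZbar_sym h2) (eqZbar_trans h h0).
by apply/(phi_eq h1 (ZA_const _)); apply: eqZbar_trans h2 (eqZbar_trans h (eqZbar_sym h0)).
Qed.

End FiniteModel.

(** * The complete model *)

Definition tseries (g : C -> C) (c : nat -> C) : Prop :=
  exists rho, 0 < rho /\ forall t, Cmod t < rho -> Ccv (tser c t) (g t).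

Lemma Cpown_Cpow z n : Cpown z n = Cpow z n.
Proof. by elim: n => [//|n IH]; cbn [Cpown Cpow]; rewrite IH; ring. Qed.

Lemma sum_n_csum (a : nat -> C) n : sum_n a n = csum a n.+1.
Proof.
elim: n => [|n IH]; first by rewrite sum_O /=; ring.
by rewrite sum_Sn IH [in RHS]csumS.
Qed.

Lemma is_series_tser c t l : is_series (fun n => Cmult (c n) (Cpown t n)) l <-> Ccv (tser c t) l.
Proof.
have e n : sum_n (fun n => Cmult (c n) (Cpown t n)) n = tser c t n.+1.
  by rewrite sum_n_csum; apply: csum_ext => i _; rewrite Cpown_Cpow.
rewrite /is_series (filterlim_Ccv (sum_n (fun n => Cmult (c n) (Cpown t n))) l); split=> H.
  by apply: Ccv_S; apply: Ccv_ext H => n; exact: e.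
by apply: (Ccv_ext (x := fun n => tser c t (n + 1))) => [n|]; [rewrite e addn1 | exact: Ccv_unshift].
Qed.

Lemma tseries_ext f g c : (forall t, Cmod t <= / 2 -> f t = g t) -> tseries f c -> tseries g c.
Proof.
move=> e [r [rp H]]; exists (Rmin r (/ 2)); split; first by apply: Rmin_glb_lt; lra.
move=> t ht; have := Rmin_l r (/ 2); have := Rmin_r r (/ 2) => h1 h2.
by rewrite -e; [apply: H; lra | lra].
Qed.

Lemma tseries_0 : tseries (fun _ => 0) (fun _ => 0).
Proof.
exists 1; split; first lra; move=> t _; apply: (Ccv_ext (x := fun _ => RtoC 0)); last exact: Ccv_const.
move=> L; rewrite /tser (@csum_ext _ (fun _ => 0 * 0)%C) ?csum_mull; first by ring.
by move=> i _; ring.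
Qed.

Lemma tseries_add f g c d : tseries f c -> tseries g d -> tseries (fun t => f t + g t)%C (fun n => c n + d n)%C.
Proof.
move=> [r [rp H]] [r' [rp' H']]; exists (Rmin r r'); split; first by apply: Rmin_glb_lt.
move=> t ht; have := Rmin_l r r'; have := Rmin_r r r' => h1 h2.
apply: Ccv_ext (Ccv_plus (H t ltac:(lra)) (H' t ltac:(lra))) => L.
by rewrite /tser -csum_plus; apply: csum_ext => i _; ring.
Qed.

Lemma tseries_scal a f c : tseries f c -> tseries (fun t => a * f t)%C (fun n => a * c n)%C.
Proof.
move=> [r [rp H]]; exists r; split=> // t ht; apply: Ccv_ext (Ccv_scal a (H t ht)) => L.
by rewrite /tser -csum_mull; apply: csum_ext => i _; ring.
Qed.

Definition shiftPS (c : PS) : PS := fun n => match n with O => RtoC 0 | S n' => c n' end.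

Lemma tseries_shift f c : tseries f c -> tseries (fun t => t * f t)%C (shiftPS c).
Proof.
move=> [r [rp H]]; exists r; split=> // t ht; apply: Ccv_S; apply: Ccv_ext (Ccv_scal t (H t ht)) => L.
rewrite /tser csum_S_l -csum_mull [shiftPS c O]/=.
rewrite (@csum_ext (fun i => shiftPS c i.+1 * Cpow t i.+1)%C (fun i => t * (c i * Cpow t i))%C); first by ring.
by move=> i _; cbn [shiftPS Cpow]; ring.
Qed.

Lemma tseries_shifts e f c : tseries f c -> tseries (fun t => Cpow t e * f t)%C (iter e shiftPS c).
Proof.
move=> h; elim: e => [|e IH]; first by apply: tseries_ext h => t _ /=; ring.
by apply: tseries_ext (tseries_shift IH) => t _; cbn [Cpow]; ring.
Qed.

Lemma Ccv_cmod_le x l b : Ccv x l -> (forall n, Cmod (x n) <= b) -> Cmod l <= b.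
Proof.
move=> H h; apply: Rle_plus_epsilon => eps He; have [N HN] := H eps He.
have := Cmod_triangle (x N) (l - x N)%C; have -> : (x N + (l - x N) = l)%C by ring.
by have := HN N (leqnn N); rewrite Cmod_sub_sym; have := h N; lra.
Qed.

(** At one radius r the terms are bounded by 2 B. If the coefficients below n vanish, the terms
    beyond n at radius r x are at most 4 B x x^n in total, so |c n| r^n <= 4 B x for every x in (0,
    1/2]. *)
Lemma tseries_zero_unique c : tseries (fun _ => 0) c -> forall n, c n = 0.
Proof.
move=> [r0 [rp0 H0]].
pose r := r0 / 2; have rp : 0 < r by rewrite /r; lra.
have Cr : Cmod (RtoC r) = r by rewrite Cmod_R Rabs_pos_eq; lra.
have [B HB] := Ccv_bounded (H0 (RtoC r) ltac:(rewrite Cr /r; lra)).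
have B0 : 0 <= B by have := HB O; have := Cmod_ge_0 (tser c r 0); lra.
have hterm l : Cmod (c l) * r ^ l <= 2 * B.
  have e : (c l * Cpow (RtoC r) l = tser c (RtoC r) l.+1 - tser c (RtoC r) l)%C by rewrite /tser csumS; ring.
  rewrite -{1}Cr -Cmod_pow -Cmod_mult e; apply: Rle_trans (Cmod_triangle _ _) _; rewrite Cmod_opp.
  by have := HB l; have := HB l.+1; lra.
move=> n; elim/ltn_ind: n => n IH.
have rn : 0 < r ^ n by apply: pow_lt.
suff small x : 0 < x <= / 2 -> Cmod (c n) * r ^ n <= 4 * B * x.
  apply: Cmod_eq_0; apply: Rle_antisym; last exact: Cmod_ge_0.
  have h : Cmod (c n) * r ^ n <= 0.
    apply: Rle_plus_epsilon => eps He; rewrite Rplus_0_l.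
    pose x := Rmin (/ 2) (eps / (4 * B + 1)).
    have ep : 0 < eps / (4 * B + 1) by apply: Rdiv_lt_0_compat; lra.
    have xp : 0 < x by apply: Rmin_glb_lt; lra.
    have x1 : x <= / 2 by exact: Rmin_l.
    have x2 : x <= eps / (4 * B + 1) by exact: Rmin_r.
    apply: Rle_trans (small x (conj xp x1)) _.
    have : (4 * B + 1) * x <= (4 * B + 1) * (eps / (4 * B + 1)) by apply: Rmult_le_compat_l; lra.
    have -> : (4 * B + 1) * (eps / (4 * B + 1)) = eps by field; lra.
    lra.
  have := Cmod_ge_0 (c n); nra.
move=> hx; pose t := RtoC (r * x).
have ht : Cmod t < r0 by rewrite /t Cmod_R Rabs_pos_eq /r; nra.
have xn : 0 < x ^ n by apply: pow_lt; lra.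
have e L : tser c t (L.+1 + n) = (c n * Cpow t n + csum (fun i => c (i.+1 + n)%N * Cpow t (i.+1 + n)) L)%C.
  elim: L => [|L IHL].
    rewrite add1n /tser csumS (@csum_ext _ (fun _ => 0 * 0)%C) ?csum_mull; first by cbn [csum]; ring.
    by move=> i hi; rewrite IH //; ring.
  by rewrite addSn {1}/tser csumS -/(tser c t (L.+1 + n)) IHL csumS; ring.
have h0 : Ccv (fun L => csum (fun i => c (i.+1 + n)%N * Cpow t (i.+1 + n))%C L) (- (c n * Cpow t n))%C.
  have h := Ccv_plus (@Ccv_unshift _ _ n.+1 (H0 t ht)) (Ccv_const (- (c n * Cpow t n))%C).
  have -> : (- (c n * Cpow t n) = 0 + - (c n * Cpow t n))%C by ring.
  by apply: Ccv_ext h => L; rewrite addnS -addSn e; ring.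
have hb : Cmod (- (c n * Cpow t n))%C <= 4 * B * x * x ^ n.
  apply: Ccv_cmod_le h0 _ => L.
  apply: (Rle_trans _ (rsum (fun i => (2 * B * x ^ n * x) * x ^ i) L)).
    apply: Cmod_csum_rsum => i; rewrite Cmod_mult Cmod_pow /t Cmod_R Rabs_pos_eq; last by nra.
    rewrite Rpow_mult_distr -Rmult_assoc.
    have -> : 2 * B * x ^ n * x * x ^ i = 2 * B * x ^ (i.+1 + n) by rewrite pow_add; cbn [pow]; ring.
    apply: Rmult_le_compat_r; [apply: pow_le; lra | exact: hterm].
  rewrite (rsum_scal (2 * B * x ^ n * x) (fun m => x ^ m)); have hg : rsum (fun m => x ^ m) L <= 2 by apply: geom_le; split; lra.
  have q0 : 0 <= 2 * B * x ^ n * x by repeat apply: Rmult_le_pos; lra.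
  by move: hg; set q := rsum _ _ => hg; nra.
move: hb; rewrite Cmod_opp Cmod_mult Cmod_pow /t Cmod_R Rabs_pos_eq; last by nra.
rewrite Rpow_mult_distr -Rmult_assoc => hb.
exact: (Rmult_le_reg_r (x ^ n)).
Qed.

Lemma tseries_unique f c d : tseries f c -> tseries f d -> forall n, c n = d n.
Proof.
move=> h1 h2 n; have h : tseries (fun _ => 0) (fun n => c n + (- (1)) * d n)%C.
  by apply: tseries_ext (tseries_add h1 (tseries_scal (- (1))%C h2)) => t _; ring.
by have := tseries_zero_unique h n => e; have -> : c n = (c n + (- (1)) * d n + d n)%C by [ring]; rewrite e; ring.
Qed.

(** One extension for each t; how the values depend on t is expressed by [tseries]. *)
Definition family (r : nat) (G : C -> seq C -> C) : Prop := forall t, tdom t -> zetaU_extension r 0 t (G t).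

Lemma family_lower r F : family r.+1 F -> exists G, family r G.
Proof.
move=> HF; have ex t : exists G, tdom t -> zetaU_extension r 0 t G.
  by case: (classic (tdom t)) => [ht|nt]; [have [G HG] := ext_lower ht (HF t ht); exists G | exists (fun _ => RtoC 0)].
exists (fun t => proj1_sig (constructive_indefinite_description _ (ex t))) => t.
exact: proj2_sig (constructive_indefinite_description _ (ex t)).
Qed.

Lemma taylor_tseries k c : zetaU0t_taylor k c <->
  exists G, family (size k) G /\ tseries (fun t => G t (map int2C k)) c.
Proof.
split=> -[G [HG [rho [hr H]]]]; exists G; split=> //; exists rho; split=> // t ht.
  by apply/is_series_tser; exact: H.
by apply/is_series_tser; exact: H.
Qed.

Lemma positive_kc k : positive_index k -> exists p, size p = size k /\ map int2C k = map kc p.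
Proof.
elim: k => [|x k IH] /=; first by exists [::].
move=> /andP [hx /IH [p [<- ->]]]; exists (`|x|.-1 :: p); split=> //=; congr cons.
case: x hx => [[|n]|n] // _.
by rewrite /int2C /kc INR_IZR_INZ.
Qed.

Lemma positive_tseries k G : positive_index k -> family (size k) G -> exists c, tseries (fun t => G t (map int2C k)) c.
Proof.
move=> /positive_kc [p [hs ->]]; rewrite -hs => HG.
have [c Hc] := positive_taylor HG; exists c, (/ 2); split; first lra.
by move=> t ht; apply: Hc; lra.
Qed.

Lemma eqPS_refl c : eqPS c c.
Proof. by move=> n; exact: eqZbar_refl. Qed.

Lemma eqPS_sym c d : eqPS c d -> eqPS d c.
Proof. by move=> h n; apply: eqZbar_sym. Qed.

Lemma eqPS_trans c d e : eqPS c d -> eqPS d e -> eqPS c e.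
Proof. by move=> h h' n; exact: eqZbar_trans (h n) (h' n). Qed.

Lemma eqPS_add c d c' d' : eqPS c c' -> eqPS d d' -> eqPS (addPS c d) (addPS c' d').
Proof. by move=> h h' n; exact: eqZbar_add. Qed.

Lemma eqZbar_csum f g n : (forall i, (i < n)%N -> eqZbar (f i) (g i)) -> eqZbar (csum f n) (csum g n).
Proof.
elim: n => [|n IH] h; first exact: eqZbar_refl.
by rewrite !csumS; apply: eqZbar_add; [apply: IH => i hi; apply: h; exact: ltnW | exact: h].
Qed.

Lemma eqPS_mul c d c' d' : isPS c -> isPS d -> eqPS c c' -> eqPS d d' -> eqPS (mulPS c d) (mulPS c' d').
Proof.
by move=> hc hd h h' n; apply: eqZbar_csum => i _; apply: eqZbar_mul; [exact: hc | exact: hd | exact: h | exact: h'].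
Qed.

Lemma mulPS_const q d n : mulPS (constPS q) d n = (Q2C q * d n)%C.
Proof.
rewrite /mulPS csum_first => [|l]; first by rewrite /constPS eqxx subn0.
by rewrite /constPS /=; ring.
Qed.

Lemma mulPS_t d : mulPS tPS d = shiftPS d.
Proof.
apply: functional_extensionality => -[|n]; rewrite /mulPS csum_S_l /tPS.
  have alg (x : C) : (RtoC 0 * x + RtoC 0 = RtoC 0)%C by ring.
  exact: alg.
rewrite csum_first => [|l].
  have alg (x y : C) : (RtoC 0 * x + RtoC 1 * y = y)%C by ring.
  by rewrite [shiftPS d n.+1]/= subSS !subn0; exact: alg.
by rewrite /=; ring.
Qed.

Definition evAh (L : seq term) : Ahat := fun _ => evQ L.

Lemma evAh_cons T L : evAh (T :: L) = addAh (mulAh (constAh T.1.1) (iter T.1.2 (mulAh pAh) (zetaAh T.2))) (evAh L).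
Proof.
apply: functional_extensionality => m; apply: functional_extensionality => p.
rewrite /evAh evQ_cons /Defs.addA /Defs.mulA /addAh /mulAh /constA /constAh; congr (_ + _)%R.
rewrite -mulrA; congr (_ * _)%R; elim: T.1.2 => [|e IH]; first by rewrite expr0 mul1r.
by rewrite iterS exprS -mulrA IH.
Qed.

Section CompleteModel.

Variable psi : Ahat -> PS.
Hypothesis iso : topQalgIso_Ah psi.
Hypothesis psi_p : eqPS (psi pAh) tPS.

Lemma psi_isPS x : ZAh0 x -> isPS (psi x).
Proof. by move=> /ZAh0_ZAh h; case: iso => H _; exact: H. Qed.

Lemma psi_eq x y : ZAh0 x -> ZAh0 y -> eqAh x y <-> eqPS (psi x) (psi y).
Proof. by move=> /ZAh0_ZAh h /ZAh0_ZAh h'; case: iso => _ [H _]; exact: H. Qed.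

Lemma psi_const q : eqPS (psi (constAh q)) (constPS q).
Proof. by case: iso => _ [_ [_ [_ [_ [H _]]]]]; exact: H. Qed.

Lemma psi_add_eq x y c d : ZAh0 x -> ZAh0 y -> eqPS (psi x) c -> eqPS (psi y) d ->
  eqPS (psi (addAh x y)) (addPS c d).
Proof.
move=> hx hy h1 h2; apply: (@eqPS_trans _ (addPS (psi x) (psi y))); last exact: eqPS_add.
by case: iso => _ [_ [_ [H _]]]; apply: H; exact: ZAh0_ZAh.
Qed.

Lemma psi_mul_eq x y c d : ZAh0 x -> ZAh0 y -> eqPS (psi x) c -> eqPS (psi y) d ->
  eqPS (psi (mulAh x y)) (mulPS c d).
Proof.
move=> hx hy h1 h2; apply: (@eqPS_trans _ (mulPS (psi x) (psi y))).
  by case: iso => _ [_ [_ [_ [H _]]]]; apply: H; exact: ZAh0_ZAh.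
by apply: eqPS_mul => //; exact: psi_isPS.
Qed.

Lemma psi_const_mul q x c : ZAh0 x -> eqPS (psi x) c ->
  eqPS (psi (mulAh (constAh q) x)) (fun n => Q2C q * c n)%C.
Proof.
move=> hx h; have -> : (fun n => Q2C q * c n)%C = mulPS (constPS q) c.
  by apply: functional_extensionality => n; rewrite mulPS_const.
by apply: psi_mul_eq => //; [exact: ZAh0_const | exact: psi_const].
Qed.

Lemma psi_p_iter e x c : ZAh0 x -> eqPS (psi x) c ->
  ZAh0 (iter e (mulAh pAh) x) /\ eqPS (psi (iter e (mulAh pAh) x)) (iter e shiftPS c).
Proof.
move=> hx h; elim: e => [//|e [IH1 IH2]]; rewrite !iterS -mulPS_t.
by split; [apply: ZAh0_mul => //; exact: ZAh0_p | apply: psi_mul_eq => //; exact: ZAh0_p].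
Qed.

Lemma psi_0 : eqPS (psi (constAh 0%R)) (fun _ => RtoC 0).
Proof.
have := psi_const 0%R; have -> : constPS 0%R = (fun _ => RtoC 0) :> PS; last by [].
by apply: functional_extensionality => n; rewrite /constPS Q2C_0; case: (_ == _).
Qed.

Lemma evAh_nil : evAh [::] = constAh 0%R.
Proof.
apply: functional_extensionality => m; apply: functional_extensionality => p.
by rewrite /evAh /evQ big_nil.
Qed.

Lemma psi_evAh (Z : C -> seq int -> C) L :
  (forall T : term, T \in L -> ZAh0 (zetaAh T.2) /\
     exists c, tseries (fun t => Z t T.2) c /\ eqPS (psi (zetaAh T.2)) c) ->
  ZAh0 (evAh L) /\ exists c, tseries (fun t => evC t (Z t) L) c /\ eqPS (psi (evAh L)) c.
Proof.
elim: L => [|T L IH] H.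
  rewrite evAh_nil; split; first exact: ZAh0_const.
  by exists (fun _ => RtoC 0); split; [exact: tseries_0 | exact: psi_0].
have [h1 [d [h2 h3]]] := IH (fun T' h => H T' (mem_behead (s := T :: L) h)).
have [h4 [c [h5 h6]]] := H T (mem_head _ _); have [h7 h8] := psi_p_iter T.1.2 h4 h6.
have h9 := ZAh0_mul (ZAh0_const T.1.1) h7; rewrite evAh_cons; split; first exact: ZAh0_add.
exists (addPS (fun n => Q2C T.1.1 * iter T.1.2 shiftPS c n)%C d); split.
  exact: tseries_add (tseries_scal (Q2C T.1.1) (tseries_shifts T.1.2 h5)) h2.
by apply: psi_add_eq => //; exact: psi_const_mul.
Qed.

Hypothesis pos : forall k c, positive_index k -> zetaU0t_taylor k c -> eqPS (psi (zetaAh k)) c.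

(** The terms of [red] come with extensions but without expansions in t, so the existence of an
    expansion is part of the induction; it starts at positive indices with [positive_tseries]. *)
Lemma complete_all_families k : ZAh0 (zetaAh k) /\ forall G, family (size k) G ->
  exists c, tseries (fun t => G t (map int2C k)) c /\ eqPS (psi (zetaAh k)) c.
Proof.
elim/index_ind: k => [k hk|k1 m k2 IH].
  split; first exact: ZAh0_gen.
  move=> G HG; have [c hc] := positive_tseries hk HG; exists c; split=> //.
  by apply: pos => //; apply/taylor_tseries; exists G.
have hL : eqAh (evAh (red m k1 k2)) (zetaAh (k1 ++ (- m%:Z)%R :: k2)).
  by move=> n; apply: eqAn_ext => p hp; rewrite /zetaAh /evAh /zeta_p red_rational.
have step r F G : (size k1 + size k2)%N = r -> family r.+1 F -> family r G ->
    ZAh0 (evAh (red m k1 k2)) /\ exists c,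
      tseries (fun t => evC t (two_level r (F t) (G t)) (red m k1 k2)) c /\ eqPS (psi (evAh (red m k1 k2))) c.
  move=> hr HF HG; apply: psi_evAh => T hT; have [h1 h2] := IH T hT; split=> //.
  have [hs|hs] : size T.2 = r.+1 \/ size T.2 = r.
  - by case: (red_terms hT) => [[m' _ ->]|->]; [left; rewrite size_cat_cons addnS hr | right].
  - have [|c [q1 q2]] := h2 F; first by rewrite hs.
    by exists c; split=> //; apply: tseries_ext q1 => t _; rewrite two_level_top.
  - have [|c [q1 q2]] := h2 G; first by rewrite hs.
    by exists c; split=> //; apply: tseries_ext q1 => t _; rewrite two_level_low.
(* Membership must hold even when no family of extensions is at hand, so it is proved apart from
   [step]. *)
have hZ : ZAh0 (evAh (red m k1 k2)).
  elim: (red m k1 k2) IH => [|T L IHL] H; first by rewrite evAh_nil; exact: ZAh0_const.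
  rewrite evAh_cons; apply: ZAh0_add; last by apply: IHL => T' hT'; apply: H; rewrite inE hT' orbT.
  apply: ZAh0_mul; first exact: ZAh0_const.
  by have [h _] := psi_p_iter T.1.2 (H T (mem_head _ _)).1 (eqPS_refl _).
have hk : ZAh0 (zetaAh (k1 ++ (- m%:Z)%R :: k2)).
  by apply: ZAh0_eq hZ _ hL; exact: isAh_seq (admissible_zeta _).
split=> // F; rewrite size_cat_cons addnS => HF; have [G HG] := family_lower HF.
have [_ [c [q1 q2]]] := step _ F G erefl HF HG; exists c; split.
  (* Comparing on |t| <= 1/2 is enough for an expansion at 0 and keeps t off [1, oo). *)
  by apply: tseries_ext q1 => t ht; have tt := small_tdom ht; rewrite (red_complex m tt (HF t tt) (HG t tt) erefl).
by apply: eqPS_trans (eqPS_sym (proj1 (psi_eq hZ hk) hL)) q2.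
Qed.

(** The given series and the one found by induction expand the same function, so they have equal
    coefficients. *)
Lemma complete_all_indices k : ZAh0 (zetaAh k) /\ forall c, zetaU0t_taylor k c -> eqPS (psi (zetaAh k)) c.
Proof.
have [h1 h2] := complete_all_families k; split=> // c /taylor_tseries [G [HG hc]].
have [d [q1 q2]] := h2 G HG; have -> // : c = d.
by apply: functional_extensionality => n; exact: tseries_unique hc q1 n.
Qed.

Lemma complete_linear_relations n (a : nat -> rat) (ks : nat -> seq int) (c : nat -> PS) :
  (forall i, (i < n)%N -> zetaU0t_taylor (ks i) (c i)) ->
  (eqAh (fun m p => (\sum_(i < n) a i * zeta_p (ks i) p)%R) (constAh 0%R)
   <-> eqPS (fun j => csum (fun i => Cmult (Q2C (a i)) (c i j)) n) (fun _ => RtoC 0)).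
Proof.
move=> hv.
have [h1 h2] : ZAh0 (fun m p => (\sum_(i < n) a i * zeta_p (ks i) p)%R) /\
    eqPS (psi (fun m p => (\sum_(i < n) a i * zeta_p (ks i) p)%R)) (fun j => csum (fun i => Cmult (Q2C (a i)) (c i j)) n).
  elim: n hv => [|n IH] hv.
    have -> : (fun (m p : nat) => \sum_(i < 0) a i * zeta_p (ks i) p)%R = constAh 0%R.
      by apply: functional_extensionality => m; apply: functional_extensionality => p; rewrite big_ord0.
    by split; [exact: ZAh0_const | exact: psi_0].
  have -> : (fun (m p : nat) => \sum_(i < n.+1) a i * zeta_p (ks i) p)%R =
      addAh (fun (m p : nat) => \sum_(i < n) a i * zeta_p (ks i) p)%R (mulAh (constAh (a n)) (zetaAh (ks n))).
    by apply: functional_extensionality => m; apply: functional_extensionality => p; rewrite big_ord_recr.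
  have [h1 h2] := IH (fun i hi => hv i (ltnW hi)); have [h3 h4] := complete_all_indices (ks n).
  have h5 := ZAh0_mul (ZAh0_const (a n)) h3; split; first exact: ZAh0_add.
  apply: (psi_add_eq h1 h5 h2); apply: psi_const_mul => //.
  by apply: h4; exact: hv.
have h0 := ZAh0_const 0%R.
split=> [/(psi_eq h1 h0) h|h].
  by apply: eqPS_trans (eqPS_sym h2) (eqPS_trans h psi_0).
by apply/(psi_eq h1 h0); apply: eqPS_trans h2 (eqPS_trans h (eqPS_sym psi_0)).
Qed.

End CompleteModel.

Local Close Scope R_scope.

Theorem theorem4p4 :
  (* (i) *)
  (forall phi : (nat -> rat) -> C,
     QalgIso_A phi ->
     (forall k v, positive_index k -> zetaU00_is k v -> eqZbar (phi (zetaA k)) v) ->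
     (forall k : seq int,
        ZA (zetaA k) /\
        forall v, zetaU00_is k v -> eqZbar (phi (zetaA k)) v) /\
     (* same Q-linear relations *)
     (forall (n : nat) (a : nat -> rat) (ks : nat -> seq int) (v : nat -> C),
        (forall i, (i < n)%N -> zetaU00_is (ks i) (v i)) ->
        (eqA (fun p => (\sum_(i < n) a i * zeta_p (ks i) p)%R) (constA 0%R)
         <-> eqZbar (csum (fun i => Cmult (Q2C (a i)) (v i)) n) (RtoC 0)))) /\
  (* (ii) *)
  (forall psi : Ahat -> PS,
     topQalgIso_Ah psi ->
     eqPS (psi pAh) tPS ->
     (forall k c, positive_index k -> zetaU0t_taylor k c -> eqPS (psi (zetaAh k)) c) ->
     (forall k : seq int,
        ZAh (zetaAh k) /\
        forall c, zetaU0t_taylor k c -> eqPS (psi (zetaAh k)) c) /\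
     (forall (n : nat) (a : nat -> rat) (ks : nat -> seq int) (c : nat -> PS),
        (forall i, (i < n)%N -> zetaU0t_taylor (ks i) (c i)) ->
        (eqAh (fun m p => (\sum_(i < n) a i * zeta_p (ks i) p)%R) (constAh 0%R)
         <-> eqPS (fun j => csum (fun i => Cmult (Q2C (a i)) (c i j)) n) (fun _ => RtoC 0)))).
Proof.
split=> [phi iso pos|psi iso psi_p pos]; split.
- by move=> k; exact: finite_all_indices iso pos k.
- by move=> n a ks v; exact: finite_linear_relations iso pos n a ks v.
- move=> k; have [h1 h2] := complete_all_indices iso psi_p pos k.
  by split=> //; exact: ZAh0_ZAh.
- by move=> n a ks c; exact: complete_linear_relations iso psi_p pos n a ks c.
Qed.
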